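(* Let $W$ be a finite irreducible Coxeter group of rank $n$ with Coxeter number $h$ and exponents $e_1,\dots,e_n$. For any Coxeter element $c$ of $W$, the number of $c$-sortable elements of $W$ equals the $W$-Catalan number $\operatorname{Cat}(W)=\prod_{i=1}^n\frac{e_i+h+1}{e_i+1}$.
   Context: A Coxeter element $c$ is an element with a reduced word that is a permutation of the simple generators $S$. Fix a reduced word $a_1\cdots a_n$ for $c$ and form $c^\infty=a_1\cdots a_n|a_1\cdots a_n|\cdots$. The $c$-sorting word of $w$ is the lexicographically first (in positions of $c^\infty$) subword of $c^\infty$ which is a reduced word for $w$; $w$ is $c$-sortable if the sequence of sets of letters between consecutive dividers is weakly decreasing under inclusion. *)

(* Defs.v *)
From HB Require Import structures.
From mathcomp Require Import all_boot all_order all_fingroup all_algebra all_field.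
From mathcomp Require Import boolp.

Set Implicit Arguments.
Unset Strict Implicit.
Unset Printing Implicit Defensive.

Import Order.Theory GRing.Theory Num.Theory.

Section CoxeterSystem.

Variables (gT : finGroupType) (S : {set gT}).
Implicit Types (w c : gT) (a b : seq gT).

Local Open Scope group_scope.

(* The finite group is the whole type gT. As in Bourbaki, the entry m(s, t) of
   the Coxeter matrix is the order of s * t, and the group is presented by the
   generators S and the relations (s * t) ^+ m(s, t) = 1 (for s = t, where
   m(s, t) is the order of s ^+ 2 = 1, this is s ^+ 2 = 1). The target H ranges
   over all groups, finite or not. *)
Record coxeter_system : Prop := CoxeterSystem {
  coxeter_involution : {in S, forall s, #[s] = 2};
  coxeter_generate : <<S>> = [set: gT];
  coxeter_present : forall (H : groupType) (f : gT -> H),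
    {in S &, forall s t, (f s * f t) ^+ #[s * t] = 1} ->
    exists phi : gT -> H,
      {morph phi : x y / x * y} /\ {in S, forall s, phi s = f s}
}.

Definition coxeter_graph : rel gT :=
  fun s t => [&& s \in S, t \in S & 2 < #[s * t]].

Definition coxeter_irreducible : Prop :=
  S != set0 /\ {in S &, forall s t, connect coxeter_graph s t}.

Definition word_for a w : Prop :=
  {subset a <= S} /\ \prod_(s <- a) s = w.

Definition reduced_word a w : Prop :=
  word_for a w /\ forall b, word_for b w -> size a <= size b.

Definition coxeter_word a c : Prop := reduced_word a c /\ perm_eq a (enum S).

Definition coxeter_element c : Prop := exists a, coxeter_word a c.

(* All Coxeter elements of a finite Coxeter group are conjugate, so the choice
   of one in the definitions of the Coxeter number and of the exponents is
   immaterial. *)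
Definition is_coxeter_number (h : nat) : Prop :=
  exists2 c, coxeter_element c & #[c] = h.

Section Exponents.
Local Open Scope ring_scope.

(* m.-root (-1) is exp(i pi / m), so this is B(s, t) = - cos(pi / m(s, t)). *)
Definition coxeter_form (s t : gT) : algC :=
  - 'Re (#[(s * t)%g].-root (-1)).

(* Matrix, acting on columns in the basis of simple roots alpha_t (t in S), of
   the reflection alpha_t |-> alpha_t - 2 B(s, t) alpha_s. *)
Definition reflection_mx (s : gT) : 'M[algC]_#|S| :=
  \matrix_(i, j) ((i == j)%:R
    - 2 * coxeter_form s (enum_val j) * (enum_val i == s)%:R).

Definition geometric_mx a : 'M[algC]_#|S| :=
  \big[mulmx/1%:M]_(s <- a) reflection_mx s.

Definition zeta (h : nat) : algC := (h.-root (-1)) ^+ 2.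

(* The eigenvalues of a Coxeter element in the geometric representation, with
   multiplicity, are the exp(2 i pi e_i / h) with 0 <= e_i < h. *)
Definition is_exponents (h n : nat) (e : 'I_n -> nat) : Prop :=
  (forall i, (e i < h)%N) /\
  exists c a, coxeter_word a c /\
    char_poly (geometric_mx a) = \prod_(i < n) ('X - (zeta h ^+ e i)%:P).

End Exponents.

(* The letter of c^infty in position k, for c^infty = a|a|a|... ; the divider
   blocks are the sets of positions k with a given k %/ size a. *)
Definition cinf_letter a (k : nat) : gT := nth 1 a (k %% size a).

Definition reduced_subword a w (p : seq nat) : Prop :=
  sorted ltn p /\ reduced_word (map (cinf_letter a) p) w.

(* Subwords of c^infty are given by their increasing sequences of positions,
   which are compared lexicographically. *)
Definition sorting_word a w (p : seq nat) : Prop :=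
  reduced_subword a w p /\
  forall q : seq nat, reduced_subword a w q ->
    ((p : seqlexi nat) <= (q : seqlexi nat))%O.

Definition block a (p : seq nat) (k : nat) : {set gT} :=
  [set s in [seq cinf_letter a i | i <- p & i %/ size a == k]].

Definition sortable a w : Prop :=
  exists2 p, sorting_word a w p & forall k, block a p k.+1 \subset block a p k.

Definition sortable_set a : {set gT} := [set w | `[< sortable a w >]].

End CoxeterSystem.

Definition W_catalan (h n : nat) (e : 'I_n -> nat) : rat :=
  (\prod_(i < n) ((e i + h + 1)%N%:R / (e i + 1)%N%:R))%R.

(* Main.v *)
(* Fix a Coxeter word a of c and a reduced word r of the longest element w_0
   whose root sequence is compatible with the Reading-Speyer form omega_c.
   Reading's recursion (delete or take the first letter of the Coxeter word)
   shows that the c-sortable elements are counted by the reduced subwords of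
   a ++ r that spell w_0. Let N(J) be this count for the parabolic subgroup W_J.
   Rotating a letter from the front to the back of a ++ r and counting the
   letters that a subword omits gives, when J is connected with c_J of order h,
     2 |J| N(J) = (h + 2) sum_(q in J) N(J - q),
   and N is multiplicative over commuting unions. The form of a finite group is
   positive definite, so its diagram is one of A, B, D, E, F, H, I_2, and the
   recurrence is solved for each type with the convolution of Catalan numbers.
   If U is the unitriangular half of the Cartan matrix C = U + U^T, ordered
   along a, then c acts as - U^-1 U^T and its characteristic polynomial
   det (X U + U^T) is expanded along the leaves of the diagram; it determines
   both the order h and the exponents, hence the Catalan product. *)

From HB Require Import structures.
Require Import Defs.
From mathcomp Require Import all_boot all_order all_fingroup all_algebra all_solvable all_field.
From mathcomp Require Import boolp.
From mathcomp Require Import zify ring lra.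

Set Implicit Arguments.
Unset Strict Implicit.
Unset Printing Implicit Defensive.

Import Order.Theory GRing.Theory Num.Theory.

Local Open Scope group_scope.

(** * Geometric representation and Tits' theorem *)

(** The recurrence is a double count. A reduced subword of a ++ r for w_0 uses as many positions as
    r has letters, so it omits |J| of them; the subwords omitting a given position, which rotations
    bring into the Coxeter word as a letter q, are counted by N(J - q). A letter s that leaves the
    front returns at the back as w_0 s w_0, since w_0 permutes J by conjugation. The factor h has
    its own argument: in r followed by its image under this conjugation, each letter of a connected
    J occurs exactly h times. The recurrence needs the order of c_J for every connected J and every
    ordering of its letters. The diagram being a forest, the expansion of det (X U + U^T) meets only
    products X A(s,t)^2 of opposite entries, from which the ordering has disappeared; so all Coxeter
    elements of J are treated at once. The geometry lives over the real algebraic numbers, the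
    eigenvalues in algC. The number 2 cos (pi / m) is handled algebraically: Chebyshev values at it
    stand for sin (k pi / m) / sin (pi / m). *)

Section Chebyshev.
Variable R : comRingType.
Local Open Scope ring_scope.

(** The Chebyshev polynomial U_(k-1) at x / 2: for x = 2 cos t its value is sin (k t) / sin t. *)
Definition cheb (x : R) (k : nat) : R :=
  (iter k (fun p => (p.2, x * p.2 - p.1)) (0, 1)).1.

Lemma cheb0 x : cheb x 0 = 0. Proof. by []. Qed.
Lemma cheb1 x : cheb x 1 = 1. Proof. by []. Qed.
Lemma chebSS x k : cheb x k.+2 = x * cheb x k.+1 - cheb x k.
Proof. by []. Qed.
End Chebyshev.

Section Simple.
Variables (gT : finGroupType) (S : {set gT}) (R : realFieldType) (ck : nat -> R).
Local Open Scope ring_scope.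

(** The simple root of s. Coordinates range over all of [gT], so that the root spaces of all
    parabolic subgroups sit in one space, cut out by conditions on the support. *)
Definition al (s : gT) : {ffun gT -> R} := [ffun t => (t == s)%:R].

Definition cartan (s t : gT) : R := if s == t then 2 else - ck #[(s * t)%g].

Definition pairing (s : gT) (v : {ffun gT -> R}) : R :=
  \sum_(t in S) cartan s t * v t.

Definition scv (k : R) (v : {ffun gT -> R}) : {ffun gT -> R} :=
  [ffun t => k * v t].

Definition refl (s : gT) (v : {ffun gT -> R}) : {ffun gT -> R} :=
  [ffun t => v t - pairing s v * (t == s)%:R].

End Simple.
Arguments al {gT R} s.
Arguments scv {gT R} k v.

(* [ck m] plays the role of 2 cos(pi / m): it is the largest root of the
   Chebyshev polynomial [cheb _ m], and only the two properties [ck_pos] and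
   [ck_root] of it are ever used. *)
Record coxrep (gT : finGroupType) (S : {set gT}) (R : realFieldType) := CoxRep {
  ck : nat -> R;
  act : gT -> {ffun gT -> R} -> {ffun gT -> R};
  sgn : gT -> bool;
  S_inv : {in S, forall s, s * s = 1};
  S_neq1 : {in S, forall s, s != 1};
  S_gen : <<S>> = [set: gT];
  ck_pos : forall m k, 0 < k < m -> (0 < cheb (ck m) k)%R;
  ck_root : forall m, 1 < m -> (cheb (ck m) m = 0)%R;
  act1 : forall v, act 1 v = v;
  actM : forall x y v, act (x * y) v = act x (act y v);
  act_gen : {in S, forall s v, act s v = refl S ck s v};
  sgnM : forall x y, sgn (x * y) = sgn x (+) sgn y;
  sgn_gen : {in S, forall s, sgn s}
}.

Section Length.
Variables (gT : finGroupType) (S : {set gT}) (R : realFieldType).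
Variable X : coxrep S R.
Implicit Types (s t q w x y : gT) (a b r : seq gT) (u v : {ffun gT -> R}).

Definition wprod a : gT := \prod_(s <- a) s.

Lemma wprod_nil : wprod [::] = 1. Proof. by rewrite /wprod big_nil. Qed.
Lemma wprod_cons s a : wprod (s :: a) = s * wprod a.
Proof. by rewrite /wprod big_cons. Qed.
Lemma wprod_cat a b : wprod (a ++ b) = wprod a * wprod b.
Proof. by rewrite /wprod big_cat. Qed.
Lemma wprod_rcons a s : wprod (rcons a s) = wprod a * s.
Proof. by rewrite -cats1 wprod_cat wprod_cons wprod_nil mulg1. Qed.

Lemma invS s : s \in S -> s^-1 = s.
Proof. by move=> sS; apply/(mulgI s); rewrite mulgV (S_inv X). Qed.

Lemma mulSS s x : s \in S -> s * (s * x) = x.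
Proof. by move=> sS; rewrite mulgA (S_inv X) ?mul1g. Qed.

Lemma mulSSr s x : s \in S -> x * s * s = x.
Proof. by move=> sS; rewrite -mulgA (S_inv X) ?mulg1. Qed.

Lemma wprod_rev a : all [in S] a -> wprod (rev a) = (wprod a)^-1.
Proof.
elim: a => [|s a IH] /=; first by rewrite /wprod !big_nil invg1.
case/andP=> sS aS; rewrite rev_cons wprod_rcons IH // wprod_cons invMg.
by congr (_ * _); rewrite invS.
Qed.

Lemma word_exists w : exists2 a, all [in S] a & wprod a = w.
Proof.
have: w \in <<S>> by rewrite (S_gen X) inE.
case/gen_prodgP=> n [c cS ->].
exists [seq c i | i <- index_enum 'I_n].
  by apply/allP=> _ /mapP[i _ ->]; apply: cS.
by rewrite /wprod big_map.
Qed.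

Definition word_of_size w k :=
  [exists a : k.-tuple gT, all [in S] a && (wprod a == w)].

Lemma word_of_size_ex w : exists k, word_of_size w k.
Proof.
have [a aS aw] := word_exists w; exists (size a).
by apply/existsP; exists (in_tuple a); rewrite aS aw eqxx.
Qed.

Definition len w := ex_minn (word_of_size_ex w).

Definition red a : bool := all [in S] a && (size a == len (wprod a)).

Lemma len_word a : all [in S] a -> len (wprod a) <= size a.
Proof.
move=> aS; rewrite /len; case: ex_minnP => k _; apply.
by apply/existsP; exists (in_tuple a); rewrite aS eqxx.
Qed.

Lemma red_exists w : exists2 a, red a & wprod a = w.
Proof.
have: word_of_size w (len w) by rewrite /len; case: ex_minnP.
case/existsP=> a /andP[aS /eqP aw]; exists a => //.
by rewrite /red aS aw size_tuple eqxx.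
Qed.

Lemma red_all a : red a -> all [in S] a. Proof. by case/andP. Qed.
Lemma red_size a : red a -> size a = len (wprod a). Proof. by case/andP=> _ /eqP. Qed.

Lemma len1 : len 1 = 0.
Proof. by apply/eqP; rewrite -leqn0 -wprod_nil len_word. Qed.

Lemma len_eq0 w : (len w == 0) = (w == 1).
Proof.
apply/idP/eqP => [/eqP lw|->]; last by rewrite len1.
have [a ra aw] := red_exists w; move: (red_size ra); rewrite aw lw.
by move/size0nil=> a0; rewrite -aw a0 wprod_nil.
Qed.

Lemma lenM x y : len (x * y) <= len x + len y.
Proof.
have [a ra <-] := red_exists x; have [b rb <-] := red_exists y.
rewrite -(red_size ra) -(red_size rb) -wprod_cat -size_cat len_word //.
by rewrite all_cat !red_all.
Qed.

Lemma lenV x : len x^-1 = len x.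
Proof.
wlog suff le : x / len x^-1 <= len x.
  by apply/eqP; rewrite eqn_leq le -{1}(invgK x) le.
have [a ra <-] := red_exists x.
by rewrite -wprod_rev ?red_all // -(red_size ra) -size_rev len_word ?all_rev ?red_all.
Qed.

Lemma sgn1 : sgn X 1 = false.
Proof. by have := sgnM X 1 1; rewrite mulg1; case: (sgn X 1). Qed.

Lemma sgn_word a : all [in S] a -> sgn X (wprod a) = odd (size a).
Proof.
elim: a => [_|s a IH /= /andP[sS aS]]; first by rewrite wprod_nil sgn1.
by rewrite wprod_cons (sgnM X) IH // (sgn_gen X).
Qed.

Lemma sgn_len w : sgn X w = odd (len w).
Proof.
by have [a ra <-] := red_exists w; rewrite sgn_word ?red_all // (red_size ra).
Qed.

Lemma len_gen s : s \in S -> len s = 1%N.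
Proof.
move=> sS; have := @len_word [:: s]; rewrite /= sS wprod_cons wprod_nil mulg1.
move/(_ isT); case E: (len s) => [|[|//]] // _.
by move/eqP: E; rewrite len_eq0 (negbTE (S_neq1 X sS)).
Qed.

(** One generator changes the length by at most 1, and the sign character forbids equality. *)
Lemma len_mulr w s : s \in S ->
  (len (w * s) == (len w).+1) || (len w == (len (w * s)).+1).
Proof.
move=> sS; have := lenM w s; have := lenM (w * s) s.
rewrite mulSSr // !(len_gen sS).
have : odd (len (w * s)) = ~~ odd (len w).
  by rewrite -!sgn_len (sgnM X) (sgn_gen X sS) addbT.
case: (ltngtP (len (w * s)) (len w)) => [||->]; [lia | lia | by case: odd].
Qed.

Lemma len_mull w s : s \in S ->
  (len (s * w) == (len w).+1) || (len w == (len (s * w)).+1).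
Proof.
move=> sS; have := len_mulr w^-1 sS.
by rewrite -(lenV (w^-1 * s)) invMg invgK (invS sS) lenV.
Qed.

Lemma len_ltr w s : s \in S -> (len w < len (w * s)) = ~~ (len (w * s) < len w).
Proof. by move=> sS; have := len_mulr w sS; lia. Qed.

Lemma len_ltl w s : s \in S -> (len w < len (s * w)) = ~~ (len (s * w) < len w).
Proof. by move=> sS; have := len_mull w sS; lia. Qed.

Lemma red_catl a b : red (a ++ b) -> red a.
Proof.
case/andP; rewrite all_cat => /andP[aS bS] /eqP sz; rewrite /red aS eqn_leq.
rewrite len_word // andbT; have := lenM (wprod a) (wprod b).
by rewrite -wprod_cat -sz size_cat; have := len_word bS; lia.
Qed.

Lemma red_catr a b : red (a ++ b) -> red b.
Proof.
case/andP; rewrite all_cat => /andP[aS bS] /eqP sz; rewrite /red bS eqn_leq.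
rewrite len_word // andbT; have := lenM (wprod a) (wprod b).
by rewrite -wprod_cat -sz size_cat; have := len_word aS; lia.
Qed.

Lemma red_cons s a : red (s :: a) = [&& s \in S, red a & len (wprod a) < len (s * wprod a)].
Proof.
apply/idP/idP => [r|/and3P[sS ra lt]].
  have ra : red a by apply: (@red_catr [:: s]).
  move/andP: r => /= [/andP[sS _] /eqP]; rewrite sS ra wprod_cons /= => <-.
  by rewrite (red_size ra).
rewrite /red /= sS red_all // wprod_cons (red_size ra).
by have := len_mull (wprod a) sS; move: lt; lia.
Qed.

Lemma red_rcons s a : red (rcons a s) = [&& s \in S, red a & len (wprod a) < len (wprod a * s)].
Proof.
apply/idP/idP => [r|/and3P[sS ra lt]].
  have ra : red a by apply: (@red_catl a [:: s]); rewrite cats1.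
  move/andP: r => [] /=; rewrite all_rcons => /andP[sS _] /eqP.
  by rewrite sS ra wprod_rcons size_rcons /= => <-; rewrite (red_size ra).
rewrite /red all_rcons sS red_all // wprod_rcons size_rcons (red_size ra).
by have := len_mulr (wprod a) sS; move: lt; lia.
Qed.

Lemma red_nil : red [::]. Proof. by rewrite /red wprod_nil len1. Qed.

Lemma red_of_size a : all [in S] a -> size a <= len (wprod a) -> red a.
Proof. by move=> aS sz; rewrite /red aS eqn_leq sz len_word. Qed.

End Length.

Section Action.
Variables (gT : finGroupType) (S : {set gT}) (R : realFieldType).
Variable X : coxrep S R.
Implicit Types (s t q w x y : gT) (a b r : seq gT) (u v : {ffun gT -> R}).
Local Open Scope ring_scope.
Notation act := (act X).
Notation A := (cartan (ck X)).
Notation pair := (pairing S (ck X)).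
Notation len := (len X).

Lemma cartanC s t : s \in S -> t \in S -> A s t = A t s.
Proof.
move=> sS tS; rewrite /cartan eq_sym; case: eqP => // _; congr (- ck X _).
by rewrite -[RHS]orderV invMg !(invS X).
Qed.

Lemma cartan_ss s : A s s = 2. Proof. by rewrite /cartan eqxx. Qed.

Lemma pairing_al s t : t \in S -> pair s (al t) = A s t.
Proof.
move=> tS; rewrite /pairing (bigD1 t) //= ffunE eqxx mulr1 big1 ?addr0 //.
by move=> i /andP[_ /negbTE ne]; rewrite ffunE ne mulr0.
Qed.

Lemma pairingD s u v : pair s (u + v) = pair s u + pair s v.
Proof. by rewrite /pairing -big_split; apply: eq_bigr => t _; rewrite ffunE mulrDr. Qed.

Lemma pairingZ s k v : pair s (scv k v) = k * pair s v.
Proof. by rewrite /pairing mulr_sumr; apply: eq_bigr => t _; rewrite ffunE; ring. Qed.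

Lemma word_ind (P : gT -> Prop) :
  P 1%g -> (forall s w, s \in S -> P w -> P (s * w)%g) -> forall w, P w.
Proof.
move=> P1 PM w; have [a + <-] := word_exists X w; elim: a => [_|s a IH /=].
  by rewrite wprod_nil.
by case/andP=> sS aS; rewrite wprod_cons; apply: PM => //; apply: IH.
Qed.

Lemma actD w u v : act w (u + v) = act w u + act w v.
Proof.
elim/word_ind: w u v => [|s w sS IH] u v; first by rewrite !act1.
rewrite !actM IH !(act_gen X sS); apply/ffunP=> t; rewrite !ffunE pairingD; ring.
Qed.

Lemma actZ w k v : act w (scv k v) = scv k (act w v).
Proof.
elim/word_ind: w v => [|s w sS IH] v; first by rewrite !act1.
rewrite !actM IH !(act_gen X sS); apply/ffunP=> t; rewrite !ffunE pairingZ; ring.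
Qed.

Lemma scvN1 v : scv (-1) v = - v.
Proof. by apply/ffunP=> t; rewrite !ffunE mulN1r. Qed.

Lemma actN w v : act w (- v) = - act w v.
Proof. by rewrite -scvN1 actZ scvN1. Qed.

Lemma actK w : cancel (act w) (act w^-1).
Proof. by move=> v; rewrite -actM mulVg act1. Qed.

Lemma actKV w : cancel (act w^-1) (act w).
Proof. by move=> v; rewrite -actM mulgV act1. Qed.

Lemma act_inj w : injective (act w). Proof. exact: can_inj (actK w). Qed.

Lemma act0 w : act w 0 = 0.
Proof. by have := actD w 0 0; rewrite addr0 => /(congr1 (fun z => z - act w 0)); rewrite subrr addrK. Qed.

Lemma actE s v t : s \in S -> act s v t = v t - pair s v * (t == s)%:R.
Proof. by move=> sS; rewrite (act_gen X sS) ffunE. Qed.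

Lemma act_al s : s \in S -> act s (al s) = - al s.
Proof.
by move=> sS; apply/ffunP=> t; rewrite actE // pairing_al // cartan_ss !ffunE; ring.
Qed.

Definition pos v : bool := [forall t, 0 <= v t].
Definition neg v : bool := [forall t, v t <= 0].

Lemma posP v : reflect (forall t, 0 <= v t) (pos v).
Proof. exact: forallP. Qed.
Lemma negvP v : reflect (forall t, v t <= 0) (neg v).
Proof. exact: forallP. Qed.

Lemma posN v : pos (- v) = neg v.
Proof. by apply/forallP/forallP => H t; have := H t; rewrite ffunE; lra. Qed.

Lemma negN v : neg (- v) = pos v.
Proof. by rewrite -posN opprK. Qed.

Lemma pos_neg0 v : pos v -> neg v -> v = 0.
Proof.
move=> /posP p /negvP n; apply/ffunP=> t; rewrite ffunE; apply/eqP.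
by rewrite eq_le p n.
Qed.

Lemma al_neq0 s : (al s : {ffun gT -> R}) != 0.
Proof. by apply/eqP=> /(congr1 (fun f : {ffun gT -> R} => f s)) /eqP; rewrite !ffunE eqxx oner_eq0. Qed.

Lemma pos_al s : pos (al s).
Proof. by apply/posP=> t; rewrite ffunE ler0n. Qed.

Lemma posD u v : pos u -> pos v -> pos (u + v).
Proof. by move=> /posP pu /posP pv; apply/posP=> t; rewrite ffunE addr_ge0. Qed.

Lemma posZ k v : 0 <= k -> pos v -> pos (scv k v).
Proof. by move=> k0 /posP pv; apply/posP=> t; rewrite ffunE mulr_ge0. Qed.

Definition root v : Prop := exists w s, s \in S /\ v = act w (al s).

Lemma root_act w v : root v -> root (act w v).
Proof. by move=> [x [s [sS ->]]]; exists (w * x)%g, s; rewrite actM. Qed.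

Lemma root_al s : s \in S -> root (al s).
Proof. by move=> sS; exists 1%g, s; rewrite act1. Qed.

Lemma root_neq0 v : root v -> v != 0.
Proof.
move=> [x [s [sS ->]]]; apply/eqP=> /(congr1 (act x^-1)); rewrite actK act0.
by apply/eqP/al_neq0.
Qed.

Section Dihedral.
Variables s t : gT.
Hypotheses (sS : s \in S) (tS : t \in S) (neq : s != t).

Let m := #[(s * t)%g].

Definition letter k := if odd k then s else t.

(** The alternating product of k letters that begins with t. *)
Fixpoint altr k : gT := if k is j.+1 then (altr j * letter j)%g else 1%g.

Lemma order_gt1 : (1 < m)%N.
Proof.
rewrite /m ltn_neqAle order_gt0 andbT eq_sym order_eq1; apply: contra neq.
by move=> /eqP st1; rewrite -(mulSSr X s tS) st1 mul1g.
Qed.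

Lemma letterS k : letter k \in S. Proof. by rewrite /letter; case: odd. Qed.

Lemma altrE k : altr k = ((t * s) ^+ k./2 * (if odd k then t else 1))%g.
Proof.
elim: k => [|k IH]; first by rewrite mulg1.
rewrite /= IH /letter uphalf_half; case: (odd k) => /=.
  by rewrite mulg1 add1n expgSr !mulgA.
by rewrite mulg1 add0n.
Qed.

(** Each reflection replaces one coordinate p by x q - p, with q the other one and x = [ck X m];
    this is the Chebyshev recursion. *)
Lemma act_altr k : act (altr k)^-1 (al s) =
  scv (cheb (ck X m) k.+1) (al (letter k.+1)) + scv (cheb (ck X m) k) (al (letter k)).
Proof.
have Ast : A s t = - ck X m by rewrite /cartan (negbTE neq).
have Ats : A t s = - ck X m by rewrite cartanC.
elim: k => [|k IH].
  by rewrite /= invg1 act1 cheb0 cheb1; apply/ffunP=> q; rewrite !ffunE; ring.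
rewrite /= invMg actM IH actD !actZ (invS X (letterS k)) chebSS /letter /= negbK.
apply/ffunP=> q; rewrite !ffunE; case: (odd k) => /=;
  rewrite !actE // !pairing_al // cartan_ss ?Ast ?Ats !ffunE; ring.
Qed.

(** The braid relation: [altr m] also equals the alternating product of m letters that begins with
    s, and this s cancels. *)
Lemma altr_order : (s * altr m)%g = altr m.-1.
Proof.
have sd i : (s * (t * s) ^+ i = (s * t) ^+ i * s)%g.
  elim: i => [|i IH]; first by rewrite !expg0 mulg1 mul1g.
  by rewrite !expgSr mulgA IH !mulgA.
have dd i j : (i + j = m)%N -> ((s * t) ^+ i = (t * s) ^+ j)%g.
  move=> ij; have <- : ((s * t)^-1 = t * s)%g by rewrite invMg !(invS X).
  apply/(mulIg ((s * t) ^+ j)%g); rewrite -expgD ij expg_order expgVn.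
  by rewrite mulVg.
have m1 := order_gt1; have := odd_double_half m; set i := m./2.
case om: (odd m) => /= mi.
  rewrite [altr m]altrE om -/i mulgA sd -mulgA -expgSr (dd _ i); last by lia.
  rewrite -mi add1n /= altrE doubleK odd_double mulg1 //.
have i0 : (0 < i)%N by lia.
rewrite [altr m]altrE om -/i mulg1 sd (dd _ i); last by lia.
have -> : m.-1 = i.-1.*2.+1 by lia.
rewrite altrE /= odd_double uphalf_double -{1}(prednK i0) expgSr -!mulgA.
by rewrite (S_inv X) ?mulg1.
Qed.

Lemma len_altr k : (len (altr k) <= k)%N.
Proof.
elim: k => [|k IH] /=; first by rewrite len1.
by apply: leq_trans (lenM X _ _) _; rewrite (len_gen X (letterS k)) addn1.
Qed.

(** The elements w * [altr k] get shorter up to some k, where both s and t are ascents. There the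
    induction hypothesis makes the images of both simple roots positive, and w sends alpha_s to a
    combination of them whose Chebyshev coefficients are nonnegative as k < m. *)
Lemma dihedral_step w : (len w < len (w * s))%N -> (len (w * t) < len w)%N ->
    (forall (v : gT) q, (len v < len w)%N -> q \in S -> (len v < len (v * q))%N ->
       pos (act v (al q))) ->
  pos (act w (al s)).
Proof.
move=> ws wt IH; pose v k := (w * altr k)%g.
have vS k : v k.+1 = (v k * letter k)%g by rewrite /v /= mulgA.
have ex : exists k, (len (v k) < len (v k.+1))%N.
  suff /existsP[k kP] : [exists k : 'I_(len w).+1, len (v k) < len (v k.+1)]%N.
    by exists k.
  apply: contraT; rewrite negb_exists => /forallP nex.
  have lt k : (k <= (len w).+1)%N -> (len (v k) + k <= len w)%N.
    elim: k => [|k IHk kl]; first by rewrite /v /= mulg1 addn0.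
    have := nex (Ordinal kl); rewrite -leqNgt /= => h.
    by have := len_mulr X (v k) (letterS k); rewrite -vS; have := IHk (ltnW kl); lia.
  by have := lt (len w).+1 (leqnn _); lia.
have {ex} [k kP kmin] := ex_minnP ex.
have lv j : (j <= k)%N -> (len (v j) + j = len w)%N.
  elim: j => [_|j IHj jk]; first by rewrite /v /= mulg1 addn0.
  have := len_mulr X (v j) (letterS j); rewrite -vS.
  have := IHj (ltnW jk); case: (ltnP (len (v j)) (len (v j.+1))) => h.
    by have := kmin j h; lia.
  by lia.
have k0 : (0 < k)%N.
  case: k kP {kmin lv} => //; rewrite vS /v /= mulg1 /letter /=; lia.
(* Otherwise the braid relation writes w * s as [v m], of length len w - m, times m - 1 letters,
   although s is an ascent of w. *)
have km : (k < m)%N.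
  rewrite ltnNge; apply/negP => mk.
  have ew : (w * s = v m * (altr m.-1)^-1)%g.
    by rewrite -altr_order invMg (invS X sS) /v mulgA mulgK.
  have := lenM X (v m) (altr m.-1)^-1; rewrite -ew lenV.
  have := len_altr m.-1; have := lv m mk; have := order_gt1; lia.
have vk : (len (v k) < len w)%N by have := lv k (leqnn k); lia.
have p1 : pos (act (v k) (al (letter k))).
  by apply: IH; rewrite ?letterS -?vS.
have p2 : pos (act (v k) (al (letter k.+1))).
  have e : letter k.+1 = letter k.-1 by rewrite -{1}(prednK k0) /letter /= negbK.
  have e2 : (v k * letter k.-1 = v k.-1)%g.
    by rewrite -{1}(prednK k0) vS (mulSSr X) ?letterS.
  apply: IH; rewrite ?letterS // e e2.
  by have := lv k (leqnn k); have := lv k.-1 (leq_pred k); lia.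
have -> : act w (al s) = act (v k) (act (altr k)^-1 (al s)).
  by rewrite -actM /v mulgK.
rewrite act_altr actD !actZ; apply: posD; apply: posZ => //.
  have [->|?] := eqVneq k.+1 m; first by rewrite ck_root ?order_gt1.
  by rewrite ltW // ck_pos //; lia.
by rewrite ltW // ck_pos //; lia.
Qed.

End Dihedral.

(* Tits: split off the longest alternating tail of w in the letters s and t. *)
Theorem tits_pos w s : s \in S -> (len w < len (w * s))%N -> pos (act w (al s)).
Proof.
have [n] := ubnP (len w); elim: n w s => // n IH w s ln sS lt.
have [a ra aw] := red_exists X w.
case/lastP: a => [|a t] in ra aw.
  by rewrite -aw wprod_nil act1 pos_al.
move: ra; rewrite red_rcons => /and3P[tS ra].
have wt : (w * t)%g = wprod a by rewrite -aw wprod_rcons (mulSSr X).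
rewrite -wprod_rcons aw -wt => lt2.
have ne : s != t by apply: contraTneq lt => ->; rewrite -leqNgt ltnW.
apply: dihedral_step lt lt2 _ => // v q lv qS; apply: IH => //; lia.
Qed.

Theorem tits_neg w s : s \in S -> (len (w * s) < len w)%N -> neg (act w (al s)).
Proof.
move=> sS lt; rewrite -posN -actN -act_al // -actM tits_pos //.
by rewrite (mulSSr X).
Qed.

Lemma tits w s : s \in S -> (len (w * s) < len w)%N = neg (act w (al s)).
Proof.
move=> sS; case: (ltnP (len (w * s)) (len w)) => h; first by rewrite tits_neg.
have: (len w < len (w * s))%N by have := len_mulr X w sS; lia.
move/(tits_pos sS)=> p; apply/esym/negbTE/negP=> n.
by have := root_neq0 (root_act w (root_al sS)); rewrite (pos_neg0 p n) eqxx.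
Qed.

Lemma root_sign v : root v -> neg v = ~~ pos v.
Proof.
move=> rv; have [w [s [sS ev]]] := rv.
have h : pos v || neg v.
  rewrite ev; case: (boolP (len (w * s) < len w)%N) => [/(tits_neg sS)->|].
    by rewrite orbT.
  by rewrite -len_ltr // => /(tits_pos sS)->.
case: (boolP (pos v)) h => [p _|_ /= ->//]; apply/negbTE/negP=> n.
by have := root_neq0 rv; rewrite (pos_neg0 p n) eqxx.
Qed.

Lemma titsl w s : s \in S -> (len (s * w) < len w)%N = neg (act w^-1 (al s)).
Proof. by move=> sS; rewrite -tits // -(lenV X (s * w)) invMg (invS X sS) lenV. Qed.

(** A nontrivial w makes the simple root of the last letter of a reduced word negative. *)
Lemma act_faithful w : (forall s, s \in S -> act w (al s) = al s) -> w = 1%g.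
Proof.
move=> H; have [a ra aw] := red_exists X w.
case/lastP: a => [|a t] in ra aw; first by rewrite -aw wprod_nil.
move: ra; rewrite red_rcons => /and3P[tS _].
have -> : wprod a = (w * t)%g by rewrite -aw wprod_rcons (mulSSr X).
rewrite (mulSSr X) // tits // H // => /(pos_neg0 (pos_al t))/eqP.
by rewrite (negbTE (al_neq0 t)).
Qed.

End Action.

(** * Roots and parabolic subgroups *)

Section Roots.
Variables (gT : finGroupType) (S : {set gT}) (R : realFieldType).
Variable X : coxrep S R.
Implicit Types (s t q w x y : gT) (a b r : seq gT) (u v : {ffun gT -> R}).
Local Open Scope ring_scope.
Notation act := (act X).
Notation A := (cartan (ck X)).
Notation pair := (pairing S (ck X)).
Notation len := (len X).
Notation red := (red X).
Notation root := (root X).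

Definition bil u v : R := \sum_(s in S) u s * pair s v.

Lemma bilDl u u' v : bil (u + u') v = bil u v + bil u' v.
Proof. by rewrite /bil -big_split; apply: eq_bigr => s _; rewrite ffunE mulrDl. Qed.

Lemma bilZl k u v : bil (scv k u) v = k * bil u v.
Proof. by rewrite /bil mulr_sumr; apply: eq_bigr => s _; rewrite ffunE mulrA. Qed.

Lemma bilC u v : bil u v = bil v u.
Proof.
rewrite /bil /pairing; under eq_bigr do rewrite mulr_sumr.
rewrite exchange_big; apply: eq_bigr => s sS; rewrite mulr_sumr.
by apply: eq_bigr => t tS; rewrite (cartanC X tS sS); ring.
Qed.

Lemma bilDr u v v' : bil u (v + v') = bil u v + bil u v'.
Proof. by rewrite !(bilC u) bilDl. Qed.

Lemma bilZr k u v : bil u (scv k v) = k * bil u v.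
Proof. by rewrite !(bilC u) bilZl. Qed.

Lemma bil_al s v : s \in S -> bil (al s) v = pair s v.
Proof.
move=> sS; rewrite /bil (bigD1 s) //= ffunE eqxx mul1r big1 ?addr0 //.
by move=> i /andP[_ /negbTE ne]; rewrite ffunE ne mul0r.
Qed.

Lemma act_refl s v : s \in S -> act s v = v + scv (- bil (al s) v) (al s).
Proof.
by move=> sS; apply/ffunP=> t; rewrite actE // bil_al // !ffunE; ring.
Qed.

Lemma bil_act w u v : bil (act w u) (act w v) = bil u v.
Proof.
elim/(word_ind X): w u v => [|s w sS IH] u v; first by rewrite !act1.
rewrite !actM !(act_refl _ sS) -[RHS]IH.
set u' := act w u; set v' := act w v.
rewrite bilDl !bilDr !bilZl !bilZr (bilC u' (al s)) [bil (al s) (al s)]bil_al //.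
by rewrite pairing_al // cartan_ss; ring.
Qed.

Lemma root_norm v : root v -> bil v v = 2.
Proof.
by move=> [w [s [sS ->]]]; rewrite bil_act bil_al // pairing_al // cartan_ss.
Qed.

(** The reflection s changes only the coordinate at s. If it made v negative, the other coordinates
    of v would vanish, and norm 2 would leave only alpha_s. *)
Lemma pos_act s v : s \in S -> root v -> pos v -> v != al s -> pos (act s v).
Proof.
move=> sS rv pv ne; apply: contraT; rewrite -(root_sign (root_act s rv)) => n.
have v0 t : t != s -> v t = 0.
  move=> ts; apply/eqP; rewrite eq_le (posP _ pv) andbT.
  by have := negvP _ n t; rewrite actE // (negbTE ts) mulr0 subr0.
have ev : v = scv (v s) (al s).
  apply/ffunP=> t; rewrite !ffunE; have [->|ts] := eqVneq t s.
    by rewrite mulr1.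
  by rewrite mulr0 v0.
have := root_norm rv; rewrite ev bilZl bilC bilZl bil_al // pairing_al // cartan_ss.
move=> h; have v0s : 0 <= v s by apply/posP.
have v1 : v s = 1.
  have : (v s - 1) * (v s + 1) = 0 by lra.
  move/eqP; rewrite mulf_eq0 => /orP[]/eqP; lra.
case/eqP: ne; rewrite ev v1; apply/ffunP=> t; rewrite !ffunE; ring.
Qed.

Lemma act_conj w q v : q \in S ->
  act (w * q * w^-1) v = v + scv (- bil (act w (al q)) v) (act w (al q)).
Proof.
move=> qS; rewrite !actM (act_refl _ qS) actD actZ actKV -[v in RHS](actKV X w).
by rewrite bil_act actKV.
Qed.

Lemma conj_eq w q w' q' : q \in S -> q' \in S ->
  act w (al q) = act w' (al q') -> (w * q * w^-1 = w' * q' * w'^-1)%g.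
Proof.
move=> qS qS' e; apply/eqP; rewrite eq_mulgV1; apply/eqP/(@act_faithful _ _ _ X).
move=> s sS; rewrite actM act_conj // e -act_conj //.
by rewrite actKV.
Qed.

Lemma conj_al w q s : q \in S -> s \in S ->
  act w (al q) = al s -> (w * q * w^-1 = s)%g.
Proof.
move=> qS sS e; rewrite (@conj_eq w q 1 s) ?act1 //.
by rewrite mul1g invg1 mulg1.
Qed.

(** A reflection determines its root up to sign: the image of alpha_q spans the (-1)-eigenline of j,
    and both roots have norm 2. *)
Lemma conj_al_pm m q j : q \in S -> j \in S -> (m * q * m^-1)%g = j ->
  act m (al q) = al j \/ act m (al q) = - al j.
Proof.
move=> qS jS ej.
have e : act m (- al q) = act j (act m (al q)).
  by rewrite -(act_al X qS) -!actM -ej mulgKV.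
pose v := act m (al q); have rv : root v by apply/root_act/root_al.
have : act j v = - v by rewrite -e actN.
rewrite (act_refl _ jS) => h.
have ev t : v t = (bil (al j) v / 2) * al j t.
  have := congr1 (fun f : {ffun gT -> R} => f t) h; rewrite !ffunE; lra.
set k := bil (al j) v / 2 in ev.
have k1 : k = 1 \/ k = -1.
  have := root_norm rv.
  have -> : v = scv k (al j) by apply/ffunP=> t; rewrite ev !ffunE.
  rewrite bilZl bilC bilZl bil_al // pairing_al // cartan_ss => hh.
  have : (k - 1) * (k + 1) = 0 by lra.
  move/eqP; rewrite mulf_eq0 => /orP[]/eqP; [left|right]; lra.
case: k1 => k1; [left|right]; apply/ffunP=> t; rewrite ev k1 ?mul1r // !ffunE; ring.
Qed.

Fixpoint roots r : seq {ffun gT -> R} :=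
  if r is s :: r' then al s :: map (act s) (roots r') else [::].

Lemma size_roots r : size (roots r) = size r.
Proof. by elim: r => //= s r IH; rewrite size_map IH. Qed.

Lemma roots_cat a b : roots (a ++ b) = roots a ++ map (act (wprod a)) (roots b).
Proof.
elim: a => [|s a IH] /=.
  by rewrite wprod_nil -[LHS]map_id; apply: eq_map => v; rewrite act1.
rewrite IH map_cat -map_comp wprod_cons; congr (_ :: _ ++ _).
by apply: eq_map => v; rewrite /= actM.
Qed.

Lemma roots_rcons r s : roots (rcons r s) = rcons (roots r) (act (wprod r) (al s)).
Proof. by rewrite -!cats1 roots_cat. Qed.

Lemma rootsP r v : v \in roots r ->
  exists r1 q r2, r = r1 ++ q :: r2 /\ v = act (wprod r1) (al q).
Proof.
elim: r v => //= s r IH v; rewrite inE => /predU1P[->|].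
  by exists [::], s, r; rewrite wprod_nil act1.
case/mapP=> u /IH[r1 [q [r2 [-> ->]]]] ->.
by exists (s :: r1), q, r2; rewrite wprod_cons actM.
Qed.

Lemma roots_root r v : all [in S] r -> v \in roots r -> root v.
Proof.
move=> rS /rootsP[r1 [q [r2 [er ->]]]]; exists (wprod r1), q; split => //.
by move: rS; rewrite er all_cat => /andP[_ /andP[]].
Qed.

Definition inv x v : bool := pos v && neg (act x^-1 v).

(** By induction on the word: s permutes the positive roots other than alpha_s, so the inversions of
    the tail are carried over, and alpha_s is a new one because s is an ascent of the tail. *)
Lemma red_roots r v : red r -> root v -> (v \in roots r) = inv (wprod r) v.
Proof.
elim: r v => [|s r IH] v rr rv.
  by rewrite /inv wprod_nil invg1 act1 (root_sign rv); case: (pos v).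
move: rr; rewrite red_cons => /and3P[sS rr lt].
rewrite /= inE wprod_cons /inv invMg (invS X sS) actM.
have px : pos (act (wprod r)^-1 (al s)).
  rewrite -[pos _]negbK -(root_sign (root_act _ (root_al X sS))).
  by rewrite -titsl // -leqNgt ltnW.
have [->|ne] := eqVneq v (al s).
  by rewrite pos_al act_al // actN negN px.
rewrite /= -[X in X \in map _ _](actK X s v) (invS X sS) mem_map; last exact: act_inj.
rewrite IH ?root_act //; last by apply: root_act.
rewrite /inv.
(* The other root whose sign s changes; both sides are false for it. *)
have [ev|ne'] := eqVneq v (- al s).
  rewrite ev actN act_al // opprK posN; apply/idP/idP.
    case/andP=> _ n; have := root_neq0 (root_act (wprod r)^-1 (root_al X sS)).
    by rewrite (pos_neg0 px n) eqxx.
  case/andP=> n _; have := al_neq0 R s; by rewrite (pos_neg0 (pos_al R s) n) eqxx.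
congr (_ && _); apply/idP/idP => [p|p]; last exact: pos_act.
rewrite -[v](actK X s) (invS X sS) pos_act ?root_act //; last first.
  by apply: contra ne' => /eqP e; rewrite -[v](actK X s) e (invS X sS) act_al.
exact: root_act.
Qed.

Lemma red_roots_pos r v : red r -> v \in roots r -> pos v.
Proof.
move=> rr vr; have := vr; rewrite red_roots //; first by case/andP.
exact: roots_root (red_all rr) vr.
Qed.

Lemma red_roots_uniq r : red r -> uniq (roots r).
Proof.
elim: r => [|s r IH] //; rewrite red_cons => /and3P[sS rr _].
rewrite /= map_inj_uniq ?IH ?andbT //; last exact: act_inj.
apply/negP=> /mapP[v vr e]; have pv := red_roots_pos rr vr.
have ev : v = - al s by rewrite -[v](actK X s) -e (invS X sS) act_al.
have := al_neq0 R s; rewrite (pos_neg0 (pos_al R s)) ?eqxx //.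
by rewrite -posN -ev.
Qed.

(** alpha_s is an inversion, hence occurs in the root sequence, and the letter q at that place is
    the one to delete. The equation for its root is kept because it later identifies q when s
    commutes with [r1]. *)
Lemma exchange r s : red r -> s \in S -> (len (s * wprod r) < len (wprod r))%N ->
  exists r1 q r2, [/\ r = r1 ++ q :: r2, act (wprod r1) (al q) = al s
                    & (s * wprod r = wprod (r1 ++ r2))%g].
Proof.
move=> rr sS lt; have: al s \in roots r.
  by rewrite red_roots // /inv ?pos_al -?titsl //; apply: root_al.
case/rootsP=> r1 [q [r2 [er e]]]; exists r1, q, r2; split=> //.
have qS : q \in S.
  by move: (red_all rr); rewrite er all_cat => /andP[_ /andP[]].
rewrite -(conj_al qS sS (esym e)) er !wprod_cat wprod_cons.
by rewrite -!mulgA mulKg (mulSS X).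
Qed.

Lemma order2_comm s t : s \in S -> t \in S -> (#[s * t]%g == 2)%N = (s != t) && (s * t == t * s)%g.
Proof.
move=> sS tS; apply/eqP/andP => [o2|[ne /eqP st]].
  split; first by apply: contra_eqN o2 => /eqP->; rewrite (S_inv X) // order1.
  have := expg_order (s * t)%g; rewrite o2 expgS expg1 => e; apply/eqP.
  apply: (mulIg (s * t)%g); rewrite e -mulgA (mulSS X) //.
  by rewrite (S_inv X).
have: (#[s * t]%g %| 2)%N.
  by rewrite order_dvdn expgS expg1 {2}st mulgA (mulSSr X) // (S_inv X).
have /primeP[_ H] : prime 2 by [].
move/H=> /orP[|/eqP//]; rewrite order_eq1 => /eqP e; case/eqP: ne.
by rewrite -(mulSSr X s tS) e mul1g.
Qed.

Lemma cartan_eq0 s t : s \in S -> t \in S -> (A s t == 0) = (s != t) && (s * t == t * s)%g.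
Proof.
move=> sS tS; rewrite -order2_comm //; have [->|ne] := eqVneq s t.
  by rewrite cartan_ss (S_inv X) // order1 pnatr_eq0.
have m1 := order_gt1 X tS ne; rewrite /cartan (negbTE ne) oppr_eq0.
apply/eqP/eqP => [c0|->]; last first.
  by have := @ck_root _ _ _ X 2 isT; rewrite chebSS cheb0 cheb1 mulr1 subr0.
apply/eqP; rewrite eqn_leq m1 andbT leqNgt; apply/negP=> m2.
have := @ck_pos _ _ _ X #[(s * t)%g] 2 m2.
by rewrite chebSS cheb0 cheb1 mulr1 subr0 c0 ltxx.
Qed.

Lemma cartan_le0 s t : s \in S -> t \in S -> s != t -> A s t <= 0.
Proof.
move=> sS tS ne; have m1 := order_gt1 X tS ne.
have [/eqP o2|o2] := boolP (#[s * t]%g == 2)%N.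
  by rewrite le_eqVlt cartan_eq0 // -order2_comm // o2 eqxx.
rewrite /cartan (negbTE ne) oppr_le0 ltW //.
have := @ck_pos _ _ _ X #[(s * t)%g] 2; rewrite chebSS cheb0 cheb1 mulr1 subr0.
by apply; rewrite /= ltn_neqAle eq_sym (negbTE o2) /=.
Qed.

End Roots.

(** * Parabolic subgroups and minimal coset representatives *)

Section Parabolic.
Variables (gT : finGroupType) (S : {set gT}) (R : realFieldType).
Variable X : coxrep S R.
Implicit Types (s t q w x y g m : gT) (a b r : seq gT) (u v : {ffun gT -> R}).
Implicit Types (J K : {set gT}).
Local Open Scope ring_scope.
Notation act := (act X).
Notation pair := (pairing S (ck X)).
Notation len := (len X).
Notation red := (red X).
Notation root := (root X).

Definition supp J v : bool := [forall t, (t \notin J) ==> (v t == 0)].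

Lemma suppP J v : reflect (forall t, t \notin J -> v t = 0) (supp J v).
Proof.
apply: (iffP forallP) => H t; first by move=> tJ; apply/eqP; apply: (implyP (H t)).
by apply/implyP=> /H->.
Qed.

Lemma supp_al J s : supp J (al s) = (s \in J).
Proof.
apply/suppP/idP => [H|sJ t tJ]; last first.
  by rewrite ffunE; case: eqP tJ sJ => // -> /negbTE->.
apply: contraT => /H/eqP; rewrite ffunE eqxx oner_eq0 //.
Qed.

Lemma supp_sub J K v : J \subset K -> supp J v -> supp K v.
Proof.
by move=> /subsetP JK /suppP H; apply/suppP=> t tK; apply: H; apply: contra tK => /JK.
Qed.

Lemma gen_word J x : J \subset S ->
  reflect (exists2 a, all [in J] a & wprod a = x) (x \in <<J>>).
Proof.
move=> JS; apply: (iffP idP) => [/gen_prodgP[n [c cJ ->]]|[a aJ <-]].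
  exists [seq c i | i <- index_enum 'I_n]; last by rewrite /wprod big_map.
  by apply/allP=> _ /mapP[i _ ->]; apply: cJ.
elim: a aJ => [|s a IH] /=; first by rewrite wprod_nil group1.
by case/andP=> sJ aJ; rewrite wprod_cons groupM ?IH // mem_gen.
Qed.

Lemma all_sub J a : J \subset S -> all [in J] a -> all [in S] a.
Proof. by move=> /subsetP JS; apply: sub_all => s; apply: JS. Qed.

Section J.
Variable J : {set gT}.
Hypothesis JS : J \subset S.

Let JSP s : s \in J -> s \in S. Proof. exact: subsetP. Qed.

Lemma act_out g v t : g \in <<J>> -> t \notin J -> act g v t = v t.
Proof.
move=> /(gen_word _ JS)[a aJ <-] tJ; elim: a aJ v => [_|s a IH /= /andP[sJ aJ]] v.
  by rewrite wprod_nil act1.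
rewrite wprod_cons actM actE ?JSP // IH //.
by rewrite (_ : (t == s) = false) ?mulr0 ?subr0 //; apply: contraNF tJ => /eqP->.
Qed.

Lemma supp_act g v : g \in <<J>> -> supp J (act g v) = supp J v.
Proof.
by move=> gJ; apply/suppP/suppP => H t tJ; have := H t tJ; rewrite act_out.
Qed.

(** A first letter s outside J would be a descent, so the inverse of the product would make alpha_s
    negative; but an element of W_J leaves its coordinate at s equal to 1. *)
Lemma red_gen r : red r -> wprod r \in <<J>> -> all [in J] r.
Proof.
elim: r => // s r IH; rewrite red_cons => /and3P[sS rr lt]; rewrite wprod_cons => gJ.
suff sJ : s \in J by rewrite /= sJ IH //; rewrite -(groupMl _ (mem_gen sJ)).
apply: contraT => sJ.
have: (len (s * (s * wprod r)) < len (s * wprod r))%N by rewrite (mulSS X).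
by rewrite titsl // => /negvP/(_ s); rewrite act_out ?groupV // ffunE eqxx ler10.
Qed.

Lemma red_ex_gen g : g \in <<J>> -> exists2 r, red r && all [in J] r & wprod r = g.
Proof.
by move=> gJ; have [r rr e] := red_exists X g; exists r; rewrite // rr red_gen ?e.
Qed.

Lemma gen_pos g : g \in <<J>> -> (forall j, j \in J -> pos (act g (al j))) -> g = 1%g.
Proof.
move=> gJ H; have [r /andP[+ +] e] := red_ex_gen gJ.
case/lastP: r e => [|r t] e; first by rewrite -e wprod_nil.
rewrite red_rcons all_rcons => /and3P[tS rr lt] /andP[tJ rJ].
have : (len (g * t) < len g)%N.
  by rewrite -e wprod_rcons (mulSSr X).
rewrite tits // => n; have := root_neq0 (root_act g (root_al X tS)).
by rewrite (pos_neg0 (H t tJ) n) eqxx.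
Qed.

(** The minimal representatives of the cosets W_J m. *)
Definition jmin m : bool := [forall j in J, pos (act m^-1 (al j))].

Lemma jminP m : reflect (forall j, j \in J -> pos (act m^-1 (al j))) (jmin m).
Proof. exact: forall_inP. Qed.

Lemma jmin1 : jmin 1%g.
Proof. by apply/jminP=> j _; rewrite invg1 act1 pos_al. Qed.

(** Builds v from multiples of simple roots. Keeping k equal to a coordinate of v lets sign
    hypotheses on v reach each summand. *)
Lemma vec_ind (P : {ffun gT -> R} -> Prop) v : supp J v ->
  P 0 -> (forall k j u, j \in J -> k = v j -> P u -> P (u + scv k (al j))) -> P v.
Proof.
move=> sv P0 PD; have -> : v = \sum_(j <- enum J) scv (v j) (al j).
  apply/ffunP=> t; rewrite sum_ffunE; case: (boolP (t \in J)) => tJ.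
    rewrite (big_rem t) ?mem_enum //= !ffunE eqxx mulr1 big_seq big1 ?addr0 //.
    move=> i; rewrite mem_rem_uniq ?enum_uniq // inE => /andP[ne _].
    by rewrite !ffunE eq_sym (negbTE ne) mulr0.
  rewrite (suppP _ _ sv) // big_seq big1 // => i; rewrite mem_enum => iJ.
  rewrite !ffunE; case: eqP => [e|]; last by rewrite mulr0.
  by rewrite e iJ in tJ.
have : all [in J] (enum J) by apply/allP=> j; rewrite mem_enum.
elim: (enum J) => [|j l IH] /=; first by rewrite big_nil.
by case/andP=> jJ lJ; rewrite big_cons addrC; apply: PD => //; apply: IH.
Qed.

Lemma jmin_pos m v : jmin m -> supp J v -> pos v -> pos (act m^-1 v).
Proof.
move=> /jminP mm sv pv; apply: (@vec_ind (fun u => pos (act m^-1 u)) _ sv).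
  by rewrite act0; apply/posP=> t; rewrite ffunE.
move=> k j u jJ -> pu; rewrite actD actZ posD ?posZ ?mm //; exact/posP.
Qed.

Lemma jmin_sign m v : jmin m -> root v -> supp J v -> neg (act m^-1 v) = neg v.
Proof.
move=> mm rv sv; rewrite (root_sign rv) (root_sign (root_act _ rv)).
apply/idP/idP; apply: contra; first exact: jmin_pos.
move=> p; apply: contraT; rewrite -(root_sign rv) -posN => n.
have := jmin_pos mm _ n; rewrite actN.
have -> : supp J (- v) by apply/suppP=> t tJ; rewrite ffunE (suppP _ _ sv) ?oppr0.
move/(_ isT); rewrite posN => n'.
by have := root_neq0 (root_act m^-1 rv); rewrite (pos_neg0 p n') eqxx.
Qed.

(** The inverse of m keeps the signs of the roots of J, so a letter of J that is an ascent on the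
    left of g stays one on the left of g * m. *)
Lemma lenJ g m : g \in <<J>> -> jmin m -> len (g * m) = (len g + len m)%N.
Proof.
move=> gJ mm; have [r /andP[rr rJ] <-] := red_ex_gen gJ.
elim: r rr rJ {gJ} => [|s r IH]; first by rewrite wprod_nil mul1g len1.
rewrite red_cons => /and3P[sS rr lt] /= /andP[sJ rJ].
have gJ : wprod r \in <<J>> by apply/(gen_word _ JS); exists r.
rewrite wprod_cons -mulgA.
have : (len (wprod r * m) < len (s * (wprod r * m)))%N.
  rewrite len_ltl // titsl // invMg actM jmin_sign //.
  - by rewrite -titsl // -leqNgt ltnW.
  - exact/root_act/root_al.
  - by rewrite supp_act ?groupV // supp_al.
have [/eqP->|/eqP->] := orP (len_mull X (wprod r * m)%g sS); last by rewrite ltnNge leqnSn.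
have [/eqP->|/eqP e] := orP (len_mull X (wprod r) sS); first by rewrite (IH rr rJ).
by rewrite e ltnNge leqnSn in lt.
Qed.

(** The reflection q makes no positive root negative except alpha_q, and if alpha_q were the image
    of alpha_j, then m q m^-1 would be j. *)
Lemma jmin_step m q : q \in S -> jmin m -> (m * q * m^-1)%g \notin J -> jmin (m * q).
Proof.
move=> qS mm nJ; apply/jminP=> j jJ; rewrite invMg (invS X qS) actM.
apply: pos_act => //; [exact/root_act/root_al/JSP | exact: (jminP _ mm) |].
apply: contra nJ => /eqP e; suff -> : (m * q * m^-1)%g = j by [].
by apply: (@conj_al _ _ _ X) => //; rewrite ?JSP // -e actKV.
Qed.

Lemma jmin_al m q : q \in S -> jmin m -> (m * q * m^-1)%g \in J ->
  act m (al q) = al (m * q * m^-1)%g.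
Proof.
set j := (m * q * m^-1)%g => qS mm jJ.
case: (conj_al_pm X qS (JSP jJ) erefl) => // ev.
have := jminP _ mm j jJ; rewrite -[al j]opprK -ev actN actK posN => n.
by have := al_neq0 R q; rewrite (pos_neg0 (pos_al R q) n) eqxx.
Qed.

End J.
End Parabolic.

(** * Reduced subwords *)

Section Subwords.
Variables (gT : finGroupType) (S : {set gT}) (R : realFieldType).
Variable X : coxrep S R.
Implicit Types (s t q w x y z g m : gT) (a b r p Q P : seq gT) (v : {ffun gT -> R}).
Implicit Types (J K : {set gT}).
Notation act := (act X).
Notation len := (len X).
Notation red := (red X).
Notation root := (root X).

(* The number of sets of positions of Q that spell a reduced word of x. *)
Fixpoint nred Q x : nat :=
  if Q is s :: Q' then nred Q' x + (if len (s * x) < len x then nred Q' (s * x) else 0)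
  else (x == 1).

Lemma nred_congr P Q Q' x : (forall y, nred Q y = nred Q' y) ->
  nred (P ++ Q) x = nred (P ++ Q') x.
Proof. by move=> e; elim: P x => //= s P IH x; rewrite !IH. Qed.

(** Both sides say that s and t together shorten x by 2. *)
Lemma len_square s t x : s \in S -> t \in S ->
  (len (s * x) < len x) && (len (s * x * t) < len (s * x)) =
  (len (x * t) < len x) && (len (s * (x * t)) < len (x * t)).
Proof.
move=> sS tS; rewrite -!mulgA.
have := len_mull X x sS; have := len_mulr X x tS; have := len_mulr X (s * x) tS.
have := len_mull X (x * t) sS; rewrite -!mulgA.
move: (len (s * (x * t))) (len (x * t)) (len (s * x)) (len x) => n1 n2 n3 n4; lia.
Qed.

(** [nred] peels from the left; peeling from the right gives the same count because the two descent
    conditions commute by [len_square]. This is what permits rotation. *)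
Lemma nred_rcons Q s x : all [in S] (rcons Q s) ->
  nred (rcons Q s) x = nred Q x + (if len (x * s) < len x then nred Q (x * s) else 0).
Proof.
elim: Q x => [|q Q IH] x /=.
  rewrite andbT => sS; congr (_ + _).
  have [->|ne] := eqVneq x s.
    by rewrite !(S_inv X sS) len1 (len_gen X sS) eqxx.
  have -> : (s * x == 1) = false.
    apply: contra_neqF ne => /eqP e; apply: (mulgI s).
    by rewrite e (S_inv X sS).
  have -> : (x * s == 1) = false.
    apply: contra_neqF ne => /eqP e; apply: (mulIg s).
    by rewrite e (S_inv X sS).
  by rewrite !if_same.
case/andP=> qS Qs; have sS : s \in S by move: Qs; rewrite all_rcons => /andP[].
rewrite !IH //; have := len_square x qS sS; rewrite -!mulgA.
set b1 := len (q * x) < len x; set b2 := len (x * s) < len x.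
set b3 := len (q * (x * s)) < len (q * x); set b4 := len (q * (x * s)) < len (x * s).
move: (nred Q (q * (x * s))) (nred Q (q * x)) (nred Q (x * s)) (nred Q x).
by case: b1; case: b2; case: b3; case: b4 => //= n1 n2 n3 n4 _; lia.
Qed.

Lemma nred_swap s t Q x : s \in S -> t \in S -> s * t = t * s ->
  nred (s :: t :: Q) x = nred (t :: s :: Q) x.
Proof.
move=> sS tS st /=; rewrite !mulgA -st.
have := len_mull X x sS; have := len_mull X x tS; have := len_mull X (t * x) sS.
have := len_mull X (s * x) tS; rewrite !mulgA -st.
move: (nred Q (s * t * x)) (nred Q (t * x)) (nred Q (s * x)) (nred Q x).
move: (len (s * t * x)) (len (t * x)) (len (s * x)) (len x) => n1 n2 n3 n4 N1 N2 N3 N4.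
by case: (ltnP n3 n4) => h1; case: (ltnP n2 n4) => h2; case: (ltnP n1 n3) => h3;
  case: (ltnP n1 n2) => h4; lia.
Qed.

Lemma nred_move s p Q x : s \in S -> all [in S] p -> {in p, forall q, s * q = q * s} ->
  nred (p ++ s :: Q) x = nred (s :: p ++ Q) x.
Proof.
move=> sS; elim: p x => [|q p IH] x //= /andP[qS pS] cp.
have cp' : {in p, forall q, s * q = q * s} by move=> z zp; apply: cp; rewrite inE zp orbT.
rewrite -[RHS]/(nred (s :: q :: (p ++ Q)) x) (nred_swap _ _ sS qS); last first.
  by apply: cp; rewrite inE eqxx.
by rewrite !IH.
Qed.

(** Counts the pairs of a reduced subword and a position of Q: each subword uses len x positions and
    omits the others. *)
Lemma nred_del Q x : all [in S] Q -> (size Q * nred Q x =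
  len x * nred Q x + \sum_(i < size Q) nred (take i Q ++ drop i.+1 Q) x)%N.
Proof.
elim: Q x => [|s Q IH] x /=.
  by rewrite big_ord0 mul0n addn0; have [->|//] := eqVneq x 1; rewrite ?len1 ?muln0.
case/andP=> sS QS; rewrite big_ord_recl /= drop0.
have -> : (\sum_(i < size Q) nred (take (bump 0 i) (s :: Q) ++ drop (bump 0 i) Q) x =
  \sum_(i < size Q) nred (take i Q ++ drop i.+1 Q) x +
  (if len (s * x)%g < len x then
     \sum_(i < size Q) nred (take i Q ++ drop i.+1 Q) (s * x)%g else 0))%N.
  under eq_bigr do rewrite /bump /= add1n /=.
  rewrite big_split /=; congr (_ + _); case: ifP => // _; exact: big1.
have := IH x QS; have := IH (s * x) QS; have := len_mull X x sS.
move: (\sum_(i < _) _)%N (\sum_(i < _) _)%N => T1 T2.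
move: (len (s * x)) (len x) (nred Q x) (nred Q (s * x)) (size Q) => l1 l2 N1 N2 n.
case: ifP => lt /orP[]/eqP e; try lia; nia.
Qed.

(** W_K fixes the simple roots of J, so its elements are minimal in their cosets W_J y and lengths
    add; each descent condition on x * y then concerns one factor only. *)
Lemma nred_prod J K Q x y : J \subset S -> K \subset S -> [disjoint J & K] ->
    {in J & K, forall s t, s * t = t * s} ->
    all [in J :|: K] Q -> x \in <<J>> -> y \in <<K>> ->
  nred Q (x * y) = (nred [seq s <- Q | s \in J] x * nred [seq s <- Q | s \in K] y)%N.
Proof.
move=> JS KS dJK cJK.
have KJ s : s \in K -> (s \in J) = false by apply: (disjointFl dJK).
have JK s : s \in J -> (s \in K) = false by apply: (disjointFr dJK).
have cGK g t : g \in <<J>> -> t \in K -> t * g = g * t.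
  move=> gJ tK; apply/esym; move: gJ => /(gen_word _ JS)[a + <-].
  elim: a => [_|s a IH /= /andP[sJ aJ]]; first by rewrite wprod_nil mulg1 mul1g.
  by rewrite wprod_cons mulgA -(cJK s t sJ tK) -!mulgA IH.
have jm u : u \in <<K>> -> jmin X J u.
    move=> uK; apply/jminP=> j jJ; apply/posP=> q.
    have [qK|qK] := boolP (q \in K); last by rewrite (act_out X KS) ?groupV // (posP _ (pos_al _ j)).
    suff -> : act u^-1 (al j) = al j by rewrite (posP _ (pos_al _ j)).
    apply/eqP; move: (groupVr uK) => /(gen_word _ KS)[a + <-].
    elim: a => [_|s a IH /= /andP[sK aK]]; first by rewrite wprod_nil act1.
    rewrite wprod_cons actM (eqP (IH aK)).
    apply/eqP/ffunP=> i; rewrite (actE X _ _ (subsetP KS _ sK)) (pairing_al _ _ (subsetP JS _ jJ)).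
    have -> : cartan (ck X) s j = 0%R.
      apply/eqP; rewrite (cartan_eq0 X (subsetP KS _ sK) (subsetP JS _ jJ)).
      rewrite (cJK j s) // eqxx andbT; apply: contraTneq sK => ->.
      by rewrite (JK _ jJ).
    by rewrite mul0r subr0.
have lenD g t z : g \in <<J>> -> t \in K -> z \in <<K>> ->
    len (t * (g * z)) < len (g * z) = (len (t * z) < len z).
  move=> gJ tK zK; have tzK : t * z \in <<K>> by rewrite groupM // mem_gen.
  by rewrite mulgA (cGK g t gJ tK) -mulgA (lenJ JS gJ (jm _ tzK)) (lenJ JS gJ (jm _ zK)) ltn_add2l.
have lenD' g s z : g \in <<J>> -> s \in J -> z \in <<K>> ->
    len (s * (g * z)) < len (g * z) = (len (s * g) < len g).
  move=> gJ sJ zK; have sgJ : s * g \in <<J>> by rewrite groupM // mem_gen.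
  by rewrite mulgA (lenJ JS sgJ (jm _ zK)) (lenJ JS gJ (jm _ zK)) ltn_add2r.
elim: Q x y => [|s Q IH] x y /=.
  move=> _ xJ yK; case: (eqVneq x 1) => [->|x1]; first by rewrite mul1g; case: eqP.
  rewrite mul0n; case: eqP => // xy; case/eqP: x1; apply: (gen_pos JS (X := X)) => // j jJ.
  have -> : x = y^-1 by apply: (mulIg y); rewrite xy mulVg.
  exact: (jminP _ _ _ (jm _ yK)).
case/andP; rewrite inE => /orP[sJ|sK] QJK xJ yK.
  rewrite sJ (JK _ sJ) /= IH // lenD' // mulnDl; congr (_ + _)%N.
  case: ifP => _; last by rewrite mul0n.
  by rewrite mulgA IH // groupM // mem_gen.
rewrite sK (KJ _ sK) /= IH // lenD // mulnDr; congr (_ + _)%N.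
case: ifP => _; last by rewrite muln0.
by rewrite mulgA (cGK x s xJ sK) -mulgA IH // groupM // mem_gen.
Qed.

End Subwords.

(** * Bruhat order and restriction of words to a parabolic subgroup *)

Section Bruhat.
Variables (gT : finGroupType) (S : {set gT}) (R : realFieldType).
Variable X : coxrep S R.
Implicit Types (s t q w x y z g m u b : gT) (a r p Q P : seq gT) (v : {ffun gT -> R}).
Implicit Types (J K : {set gT}).
Notation act := (act X).
Notation len := (len X).
Notation red := (red X).
Notation root := (root X).
Notation nred := (nred X).

(** The root is an inversion of u, hence occurs in the root sequence of a reduced word; multiplying
    by its reflection deletes that letter. *)
Lemma refl_len_lt w s u : s \in S -> pos (act w (al s)) ->
  neg (act u^-1 (act w (al s))) -> len (w * s * w^-1 * u) < len u.
Proof.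
move=> sS pb nb; have [r rr er] := red_exists X u.
have: act w (al s) \in roots X r.
  by rewrite red_roots ?er /inv ?pb //; apply/root_act/root_al.
case/rootsP=> r1 [q [r2 [e1 e2]]].
have /andP[r1S /andP[qS r2S]] : all [in S] r1 && all [in S] (q :: r2).
  by rewrite -all_cat -e1 (red_all rr).
rewrite (conj_eq sS qS e2) -[X in _ < len X]er -(red_size rr) -er e1 !wprod_cat wprod_cons.
rewrite -!mulgA mulKg (mulSS X) // -wprod_cat size_cat /= addnS ltnS -size_cat.
by apply: len_word; rewrite all_cat r1S.
Qed.

Lemma conjS_involutive w s : s \in S -> (w * s * w^-1) * (w * s * w^-1) = 1.
Proof. by move=> sS; rewrite -!mulgA mulKg (mulSS X) // mulgV. Qed.

Lemma refl_len_gt w s u : s \in S -> pos (act w (al s)) ->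
  pos (act u^-1 (act w (al s))) -> len u < len (w * s * w^-1 * u).
Proof.
move=> sS pb pn; set t := w * s * w^-1.
have tt : t * t = 1 by apply: conjS_involutive.
have := @refl_len_lt w s (t * u) sS pb; rewrite -/t mulgA tt mul1g; apply.
rewrite invMg actM -[X in act X (act w _)]/(t^-1).
have -> : t^-1 = t by apply: (mulgI t); rewrite mulgV tt.
have -> : act t (act w (al s)) = (- act w (al s))%R.
  by rewrite -actM /t mulgKV actM act_al // actN.
by rewrite actN negN.
Qed.

Definition bstep : rel gT := fun u z =>
  (len u < len z) && [exists w, [exists s in S, z == w * s * w^-1 * u]].

Definition bruhat := connect bstep.

Lemma bstepP u z : reflect
  (exists w s, [/\ s \in S, z = w * s * w^-1 * u, pos (act w (al s))
     & pos (act u^-1 (act w (al s)))]) (bstep u z).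
Proof.
apply: (iffP andP) => [[lt /existsP[w /exists_inP[s sS /eqP e]]]|[w [s [sS e pb pn]]]].
  have H w' : pos (act w' (al s)) -> w * s * w^-1 = w' * s * w'^-1 ->
      exists w s, [/\ s \in S, z = w * s * w^-1 * u, pos (act w (al s))
        & pos (act u^-1 (act w (al s)))].
    move=> pw ew; exists w', s; split; rewrite ?e ?ew //.
    apply: contraT; rewrite -(root_sign (root_act u^-1 (root_act w' (root_al X sS)))).
    by move/(refl_len_lt sS pw); rewrite -ew -e; move: lt; rewrite ltnNge => /negbTE h /ltnW; rewrite h.
  case: (boolP (pos (act w (al s)))) => [|np]; first by move=> ?; apply: (H w).
  (* Replacing w by w s changes the sign of the root and keeps the reflection. *)
  apply: (H (w * s)).
    by rewrite actM act_al // actN posN (root_sign (root_act w (root_al X sS))).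
  by rewrite invMg (invS X sS) !mulgA (mulSSr X).
split; first by rewrite e refl_len_gt.
by apply/existsP; exists w; apply/exists_inP; exists s => //; rewrite e.
Qed.

Lemma bruhat_len u z : bruhat u z -> len u <= len z.
Proof.
case/connectP=> p + ->; elim: p u => //= y p IH u /andP[/andP[/ltnW lt _]] /IH.
exact: leq_trans.
Qed.

(** Right multiplication by s keeps the sign conditions of [bstepP], unless the root pulled back by
    u is alpha_s; the step is then right multiplication by s. *)
Lemma bstep_mulr u z s : s \in S -> bstep u z -> z = u * s \/ bstep (u * s) (z * s).
Proof.
move=> sS /bstepP[w [q [qS e pb pn]]].
have [eb|ne] := eqVneq (act u^-1 (act w (al q))) (al s).
  left; rewrite e; have -> : w * q * w^-1 = u * s * u^-1; last by rewrite mulgKV.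
  by apply: (@conj_eq _ _ _ X); rewrite // -eb actKV.
right; apply/bstepP; exists w, q; split=> //; first by rewrite e !mulgA.
by rewrite invMg (invS X sS) actM pos_act //; do 2 apply: root_act; apply: root_al.
Qed.

Lemma bruhat_mulr u z s : s \in S -> bruhat u z ->
  bruhat u (z * s) \/ bruhat (u * s) (z * s).
Proof.
move=> sS /connectP[p + ->]; elim/last_ind: p => [_|p y IH] /=.
  by right; apply: connect0.
rewrite rcons_path last_rcons => /andP[pth st].
have {}IH := IH pth; case: (bstep_mulr sS st) => [->|st'].
  by left; rewrite (mulSSr X) //; apply/connectP; exists p.
by case: IH => h; [left|right]; apply: connect_trans h (connect1 st').
Qed.

Lemma bruhat_mulr_lt u z s : s \in S -> len (u * s) < len u -> bruhat u z ->
  bruhat (u * s) (z * s).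
Proof.
move=> sS lt uz; case: (bruhat_mulr sS uz) => // h.
apply: connect_trans h; apply: connect1; rewrite /bstep lt /=.
apply/existsP; exists u; apply/exists_inP; exists s => //.
by rewrite mulgA mulgKV (mulSSr X).
Qed.

Lemma bruhat_mulr_le u s : s \in S -> len (u * s) < len u -> bruhat (u * s) u.
Proof.
move=> sS lt; apply: connect1; rewrite /bstep lt /=.
apply/existsP; exists u; apply/exists_inP; exists s => //.
by rewrite mulgA mulgKV (mulSSr X).
Qed.

Lemma bstepV u z : bstep u z -> bstep u^-1 z^-1.
Proof.
case/andP=> lt /existsP[w /exists_inP[s sS /eqP e]]; rewrite /bstep !lenV lt /=.
apply/existsP; exists (u^-1 * w); apply/exists_inP; exists s => //; apply/eqP.
by rewrite e !invMg !invgK (invS X sS) -!mulgA mulgV mulg1.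
Qed.

Lemma bruhatV u z : bruhat u z -> bruhat u^-1 z^-1.
Proof.
case/connectP=> p + ->; elim: p u => [|y p IH] u /=; first by move=> _; apply: connect0.
by case/andP=> st /IH; apply: connect_trans; apply/connect1/bstepV.
Qed.

Lemma bruhat_mull u z s : s \in S -> bruhat u z ->
  bruhat u (s * z) \/ bruhat (s * u) (s * z).
Proof.
move=> sS /bruhatV/(bruhat_mulr sS)[]/bruhatV; rewrite !(invMg, invgK, invS X sS);
  by [left | right].
Qed.

(** Removing a letter of g from the upper element costs at most one letter of J on the left of u. *)
Lemma bruhat_coset J g m u : J \subset S -> g \in <<J>> -> bruhat u (g * m) ->
  exists2 g', g' \in <<J>> & bruhat (g' * u) m.
Proof.
move=> JS /(gen_word _ JS)[a + <-]; elim: a u => [|s a IH] u /=.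
  by rewrite wprod_nil mul1g => _ h; exists 1; rewrite ?group1 ?mul1g.
case/andP=> sJ aJ; rewrite wprod_cons -mulgA => h.
case: (bruhat_mull (subsetP JS _ sJ) h); rewrite (mulSS X) ?(subsetP JS _ sJ) //.
  exact: IH.
case/(IH _ aJ)=> g' gJ h'; exists (g' * s); rewrite -?mulgA //.
by rewrite groupM // mem_gen.
Qed.

(** By [bruhat_coset] some g' m' lies below m, and g' only adds length to the minimal m'. *)
Lemma bruhat_jmin J g m m' : J \subset S -> g \in <<J>> -> jmin X J m' ->
  bruhat m' (g * m) -> len m' <= len m.
Proof.
move=> JS gJ mm /(bruhat_coset JS gJ)[g' gJ' /bruhat_len]; apply: leq_trans.
by rewrite (lenJ JS) // leq_addl.
Qed.

(** Subwords that need not be reduced: deleting a letter from a reduced subword leaves one of these,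
    which is all that the exchange arguments provide. *)
Fixpoint in_sub Q y : bool :=
  if Q is s :: Q' then in_sub Q' y || in_sub Q' (s * y) else y == 1.

Lemma in_sub_rcons Q s y : s \in S ->
  in_sub (rcons Q s) y = in_sub Q y || in_sub Q (y * s).
Proof.
move=> sS; elim: Q y => [|q Q IH] y /=.
  congr (_ || _); rewrite -[s * y == 1](inj_eq (mulgI s)) (mulSS X) // mulg1.
  by rewrite -[RHS](inj_eq (mulIg s)) (mulSSr X) // mul1g.
by rewrite !IH mulgA orbACA.
Qed.

Lemma nred_in_sub Q y : 0 < nred Q y -> in_sub Q y.
Proof.
elim: Q y => [|s Q IH] y /=; first by case: (y == 1).
case: ifP => _; last by rewrite addn0 => /IH->.
by rewrite addn_gt0 => /orP[]/IH->; rewrite ?orbT.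
Qed.

(** Strong exchange inside Q: z inverts the root, so multiplying z by the reflection deletes one
    letter of the reduced subword. *)
Lemma nred_in_sub_refl Q z w s : all [in S] Q -> s \in S -> 0 < nred Q z ->
  pos (act w (al s)) -> neg (act z^-1 (act w (al s))) -> in_sub Q (w * s * w^-1 * z).
Proof.
move=> + sS; elim: Q z w => [|t Q IH] z w /=.
  case: eqP => // -> _ _ pb; rewrite invg1 act1 => nb.
  by have := root_neq0 (root_act w (root_al X sS)); rewrite (pos_neg0 pb nb) eqxx.
case/andP=> tS QS; rewrite addn_gt0 => /orP[h pb nb|]; first by rewrite IH.
case: ifP => // lt h pb nb; apply/orP.
have [eb|ne] := eqVneq (act w (al s)) (al t).
  by left; rewrite (conj_al sS tS eb) nred_in_sub.
right; have := IH (t * z) (t * w) QS h.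
rewrite !invMg (invS X tS) !mulgA (mulSSr X) // !actM.
have -> : act t (act t (act w (al s))) = act w (al s).
  by rewrite -!actM (S_inv X) // mul1g.
rewrite -!mulgA; apply => //; apply: pos_act => //.
by apply: root_act; apply: root_al.
Qed.

(* Peeling the letters of r off the right end of z keeps z above the
   corresponding prefix of m * wprod r. *)
Lemma bruhat_peel r m z y : all [in S] r -> len (m * wprod r) = len m + size r ->
  bruhat (m * wprod r) z -> in_sub r y -> bruhat m (z * y^-1).
Proof.
elim/last_ind: r z y => [|r q IH] z y.
  by rewrite wprod_nil mulg1 => _ _ h /eqP ->; rewrite invg1 mulg1.
rewrite all_rcons wprod_rcons size_rcons mulgA => /andP[qS rS] ln bz.
have ln' : len (m * wprod r) = len m + size r.
  apply/eqP; rewrite eqn_leq; apply/andP; split.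
    by apply: leq_trans (lenM X _ _) _; rewrite leq_add2l len_word.
  by have := lenM X (m * wprod r) q; rewrite ln (len_gen X qS) addn1 addnS ltnS.
have lt : len (m * wprod r * q * q) < len (m * wprod r * q).
  by rewrite (mulSSr X) // ln ln' addnS.
rewrite in_sub_rcons // => /orP[h|h].
  apply: IH => //; apply: connect_trans bz.
  by have := bruhat_mulr_le qS lt; rewrite (mulSSr X).
have -> : z * y^-1 = z * q * (y * q)^-1 by rewrite invMg (invS X qS) mulgA (mulSSr X).
by apply: IH => //; have := bruhat_mulr_lt qS lt bz; rewrite (mulSSr X).
Qed.

Section Restriction.
Variable J : {set gT}.
Hypothesis JS : J \subset S.

(* m runs through the minimal representatives of the cosets W_J b, for b the
   prefixes of the word; a letter that does not change the coset acts on it as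
   the letter m q m^-1 of J. *)
Fixpoint restr m r : seq gT :=
  if r is q :: r' then
    if m * q * m^-1 \in J then m * q * m^-1 :: restr m r' else restr (m * q) r'
  else [::].

Fixpoint rcoset m r : gT :=
  if r is q :: r' then
    if m * q * m^-1 \in J then rcoset m r' else rcoset (m * q) r'
  else m.

Lemma restr_prod m r : m * wprod r = wprod (restr m r) * rcoset m r.
Proof.
elim: r m => [|q r IH] m /=; first by rewrite wprod_nil mul1g mulg1.
rewrite wprod_cons mulgA; case: ifP => _; last exact: IH.
by rewrite wprod_cons -[RHS]mulgA -IH !mulgA mulgKV.
Qed.

Lemma restr_all m r : all [in J] (restr m r).
Proof. by elim: r m => //= q r IH m; case: ifP => h /=; rewrite ?h IH. Qed.

Lemma rcoset_jmin m r : all [in S] r -> jmin X J m -> jmin X J (rcoset m r).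
Proof.
elim: r m => //= q r IH m /andP[qS rS] mm; case: ifP => h; first exact: IH.
by apply: IH => //; apply: jmin_step; rewrite ?h.
Qed.

Lemma restr_len m r : all [in S] r -> len (rcoset m r) + size (restr m r) <= len m + size r.
Proof.
elim: r m => //= q r IH m /andP[qS rS]; case: ifP => _ /=.
  by rewrite !addnS ltnS IH.
apply: leq_trans (IH _ rS) _; rewrite addnS -addSn leq_add2r.
by apply: leq_trans (lenM X _ _) _; rewrite (len_gen X qS) addn1.
Qed.

(** Each letter of r either enters the restriction or changes the coset, lengthening its
    representative by at most 1. As the two final lengths add up to that of r, no slack is left. *)
Lemma restr_red r : red r -> red (restr 1 r).
Proof.
move=> rr; have rS := red_all rr.
apply: red_of_size; first exact: all_sub (restr_all _ _).
have := restr_len 1 rS; rewrite len1 (red_size rr) -[wprod r]mul1g restr_prod.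
rewrite (lenJ JS) ?rcoset_jmin ?jmin1 //; first by rewrite add0n addnC leq_add2r.
by apply/(gen_word _ JS); exists (restr 1 r); rewrite ?restr_all.
Qed.

(** The letter m q m^-1 of the restriction has the root m alpha_q, so the restriction keeps part of
    the root sequence, in order. Compatibility is thereby inherited. *)
Lemma restr_roots m r : all [in S] r -> jmin X J m ->
  subseq (roots X (restr m r)) (map (act m) (roots X r)).
Proof.
elim: r m => //= q r IH m /andP[qS rS] mm; case: ifP => h /=.
  rewrite (jmin_al JS qS mm h) eqxx -map_comp.
  have -> : [seq (act m \o act q) i | i <- roots X r] =
      map (act (m * q * m^-1)) (map (act m) (roots X r)).
    by rewrite -map_comp; apply: eq_map => v /=; rewrite -!actM mulgKV.
  by apply: map_subseq; apply: IH.
apply: subseq_trans (subseq_cons _ _); rewrite -map_comp.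
have -> : [seq (act m \o act q) i | i <- roots X r] = map (act (m * q)) (roots X r).
  by apply: eq_map => v /=; rewrite actM.
by apply: IH => //; apply: jmin_step; rewrite ?h.
Qed.

(** A reduced subword for this element must take every letter that changes the coset: after skipping
    one, the coset of [rcoset m r] is out of reach in the Bruhat order. The letters that keep the
    coset are free and form the restriction. *)
Lemma nred_restr m r g : all [in S] r -> jmin X J m ->
    len (m * wprod r) = len m + size r -> g \in <<J>> ->
  nred r (m^-1 * g * rcoset m r) = nred (restr m r) g.
Proof.
elim: r m g => [|q r IH] m g /=.
  move=> _ _ _ _; rewrite -(inj_eq (mulgI m)) -(inj_eq (mulIg m^-1)).
  by rewrite !mulgA mulgV mul1g mulgK mulg1 mulgV.
case/andP=> qS rS mm; rewrite wprod_cons mulgA => ln gJ.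
case: ifP => h /=.
  set j := m * q * m^-1 in h *; have jS := subsetP JS _ h.
  have ln' : len (m * wprod r) = len m + size r.
    apply/eqP; rewrite eqn_leq; apply/andP; split.
      by apply: leq_trans (lenM X _ _) _; rewrite leq_add2l len_word.
    have := lenM X j (m * wprod r); rewrite (len_gen X jS) add1n.
    by rewrite {1}/j -!mulgA mulKg mulgA ln addnS ltnS.
  have jgJ : j * g \in <<J>> by rewrite groupM // mem_gen.
  rewrite IH //; congr (_ + _).
  have -> : q * (m^-1 * g * rcoset m r) = m^-1 * (j * g) * rcoset m r.
    by rewrite /j !mulgA mulVg mul1g.
  rewrite IH //; congr (if _ then _ else _).
  have -> : m^-1 * (j * g) * rcoset m r = q * (m^-1 * g * rcoset m r).
    by rewrite /j !mulgA mulVg mul1g.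
  rewrite !titsl // !invMg invgK !actM (jmin_al JS qS mm h) -/j.
  have rg : root (act g^-1 (al j)) by apply: root_act; apply: root_al.
  have sg : supp J (act g^-1 (al j)) by rewrite (supp_act X JS) ?groupV // supp_al.
  by rewrite (jmin_sign (rcoset_jmin rS mm) rg sg).
set m' := m * q in ln *; have mm' : jmin X J m' by apply: jmin_step; rewrite ?h.
have lm' : len m' = (len m).+1.
  have /orP[/eqP//|/eqP e] := len_mulr X m qS.
  have := lenM X m' (wprod r); rewrite ln; have := len_word X rS.
  by move: e; rewrite -/m'; move: (len m') (len m) (len (wprod r)) => a b d; lia.
have ln' : len (m' * wprod r) = len m' + size r by rewrite ln lm' addnS.
(* Skipping q is impossible: peeling such a subword off m' * wprod r would put m' below an element
   of W_J m, although m' is longer than m. *)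
have nosub y : y = m^-1 * g * rcoset m' r -> ~~ in_sub r y.
  move=> ey; apply/negP=> h'.
  have := bruhat_peel rS ln' (connect0 _ _) h'.
  rewrite restr_prod ey !invMg invgK -!mulgA mulKVg mulgA => bm.
  have gJ' : wprod (restr m' r) * g^-1 \in <<J>>.
    rewrite groupM ?groupV //.
    by apply/(gen_word _ JS); exists (restr m' r); rewrite ?restr_all.
  by have := bruhat_jmin JS gJ' mm' bm; rewrite lm' ltnn.
have e : q * (m^-1 * g * rcoset m' r) = m'^-1 * g * rcoset m' r.
  by rewrite /m' invMg (invS X qS) !mulgA.
rewrite (_ : nred r (m^-1 * g * rcoset m' r) = 0); last first.
  by apply/eqP; apply: contraNT (nosub _ erefl); rewrite -lt0n; apply: nred_in_sub.
rewrite add0n e IH //; case: ifP => // /negbT nlt.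
(* Here q is an ascent of q * z, hence a descent of z. A reduced subword for z would by strong
   exchange give a subword for q * z, which [nosub] excludes. *)
apply/esym/eqP; rewrite -(IH _ _ rS mm' ln' gJ); apply: contraNT (nosub _ erefl).
rewrite -lt0n => hz; set z := m'^-1 * _ * _ in hz e nlt *.
have ez : m^-1 * g * rcoset m' r = q * z by rewrite -e (mulSS X).
rewrite ez in nlt *.
have := @nred_in_sub_refl r z 1 q rS qS hz; rewrite mul1g invg1 mulg1 act1 pos_al.
rewrite -titsl //; apply=> //; move: nlt; rewrite -?ez ?e.
by have := len_mull X z qS; rewrite -ez; move: (len z) (len (m^-1 * g * rcoset m' r)) => a b; lia.
Qed.

Lemma nred_cat_restr p r g : all [in J] p -> red r -> g \in <<J>> ->
  nred (p ++ r) (g * rcoset 1 r) = nred (p ++ restr 1 r) g.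
Proof.
move=> + rr; have rS := red_all rr; elim: p g => [|s p IH] g /=.
  move=> _ gJ; rewrite -nred_restr ?jmin1 ?invg1 ?mul1g //.
  by rewrite len1 -(red_size rr).
case/andP=> sJ pJ gJ; have sgJ : s * g \in <<J>> by rewrite groupM // mem_gen.
have mm : jmin X J (rcoset 1 r) by apply: rcoset_jmin; rewrite ?jmin1.
rewrite IH // mulgA IH // (lenJ JS sgJ mm) (lenJ JS gJ mm) ltn_add2r //.
Qed.

End Restriction.
End Bruhat.

(** * Longest elements and compatible words *)

Section Longest.
Variables (gT : finGroupType) (S : {set gT}) (R : realFieldType).
Variable X : coxrep S R.
Implicit Types (s t q w x y z g m u b : gT) (a r p Q P : seq gT) (v : {ffun gT -> R}).
Implicit Types (J K : {set gT}).
Notation act := (act X).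
Notation len := (len X).
Notation red := (red X).
Notation root := (root X).
Notation nred := (nred X).

Definition longest J w : bool :=
  (w \in <<J>>) && [forall j in J, neg (act w^-1 (al j))].

Section J.
Variable J : {set gT}.
Hypothesis JS : J \subset S.
Let JSP s : s \in J -> s \in S. Proof. exact: subsetP. Qed.

Lemma longest_neg w v : longest J w -> supp J v -> pos v -> neg (act w^-1 v).
Proof.
case/andP=> _ /forall_inP nw sv pv; rewrite -posN.
refine (vec_ind (P := fun u : {ffun gT -> R} => is_true (pos (- act w^-1 u)%R)) sv _ _).
  by rewrite act0 oppr0; apply/posP=> t; rewrite ffunE.
move=> k j u jJ -> pu; rewrite actD actZ opprD posD //.
have -> : (- scv (v j) (act w^-1 (al j)))%R = scv (v j) (- act w^-1 (al j))%R.
  by apply/ffunP=> t; rewrite !ffunE mulrN.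
by apply: posZ; [apply/posP | rewrite posN nw].
Qed.

Lemma suppN v : supp J v -> supp J (- v)%R.
Proof. by move/suppP=> sv; apply/suppP=> t /sv; rewrite ffunE => ->; rewrite oppr0. Qed.

(** For w of maximal length in W_J each letter of J is a descent on both sides, so w * w keeps the
    simple roots of J positive and is trivial. *)
Lemma longest_ex2 : exists w, [/\ longest J w, longest J w^-1 & w * w = 1].
Proof.
have ex : 1 \in <<J>> by rewrite group1.
case: (@arg_maxnP _ 1 (fun x => x \in <<J>>) len ex) => w wJ mw.
have lw : longest J w.
  rewrite /longest wJ; apply/forall_inP=> j jJ; rewrite -titsl ?JSP //.
  have := mw (j * w) (groupM (mem_gen jJ) wJ).
  have := len_mull X w (JSP jJ); move: (len w) (len (j * w)) => a b; lia.
have lw' : longest J w^-1.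
  rewrite /longest groupV wJ; apply/forall_inP=> j jJ; rewrite -titsl ?JSP //.
  have := mw (w * j) (groupM wJ (mem_gen jJ)).
  rewrite /= -(lenV X (w * j)) invMg (invS X (JSP jJ)) -(lenV X w).
  have := len_mull X w^-1 (JSP jJ); move: (len w^-1) (len (j * w^-1)) => a b; lia.
exists w; split=> //; apply: (gen_pos JS (X := X)); first by rewrite groupM.
move=> j jJ; rewrite actM -negN -actN -{1}(invgK w); apply: longest_neg => //.
  by apply: suppN; rewrite (supp_act X JS) // supp_al.
rewrite posN; case/andP: lw' => _ /forall_inP/(_ j jJ); by rewrite invgK.
Qed.

Lemma longest_uniq w w' : longest J w -> longest J w' -> w = w'.
Proof.
have [w0 [l0 l0' w00]] := longest_ex2.
suff H x : longest J x -> x = w0 by move=> /H-> /H->.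
move=> lx; apply/esym/eqP; rewrite eq_mulVg1 -eq_invg1 invMg invgK; apply/eqP.
have xJ : x \in <<J>> by case/andP: lx.
have w0J : w0 \in <<J>> by case/andP: l0.
apply: (gen_pos JS (X := X)); first by rewrite groupM ?groupV.
move=> j jJ; rewrite actM -negN -actN; apply: longest_neg => //.
  by apply: suppN; rewrite (supp_act X JS) // supp_al.
by rewrite posN; case/andP: l0' => _ /forall_inP/(_ j jJ); rewrite invgK.
Qed.

Lemma longest_ex : exists w, longest J w.
Proof. by have [w [? _ _]] := longest_ex2; exists w. Qed.

Section W.
Variable w : gT.
Hypothesis lw : longest J w.

Lemma longest_inv : w * w = 1.
Proof. by have [w0 [l0 _ w00]] := longest_ex2; rewrite (longest_uniq lw l0). Qed.

Lemma longestV : w^-1 = w.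
Proof. by apply: (mulgI w); rewrite mulgV longest_inv. Qed.

Lemma longest_gen : w \in <<J>>. Proof. by case/andP: lw. Qed.

(** Each letter that lengthens u on the left shortens u * w, since w turns positive roots of J into
    negative ones. *)
Lemma longest_len u : u \in <<J>> -> len (u * w) + len u = len w.
Proof.
move=> uJ; have [r /andP[rr rJ] <-] := red_ex_gen X JS uJ.
elim: r rr rJ {uJ} => [|s r IH]; first by rewrite wprod_nil mul1g len1 addn0.
rewrite red_cons => /and3P[sS rr lt] /= /andP[sJ rJ].
have gJ : wprod r \in <<J>> by apply/(gen_word _ JS); exists r.
rewrite wprod_cons -mulgA -(IH rr rJ).
have lt2 : len (s * (wprod r * w)) < len (wprod r * w).
  rewrite titsl // invMg actM; apply: longest_neg => //.
    by rewrite (supp_act X JS) ?groupV // supp_al.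
  rewrite -[pos _]negbK -(root_sign (root_act _ (root_al X sS))) -titsl //.
  by rewrite -leqNgt ltnW.
have := len_mull X (wprod r * w) sS; have := len_mull X (wprod r) sS.
move: lt lt2; move: (len (s * wprod r)) (len (wprod r)) (len (s * (wprod r * w))).
by move: (len (wprod r * w)) => a b c d; lia.
Qed.

(** As w is its own inverse, this is conjugation by w: the opposition automorphism of the diagram of
    J. *)
Definition psi s := w * s * w.

Lemma psiJ s : s \in J -> psi s \in J.
Proof.
move=> sJ; have sG := mem_gen sJ; have wG := longest_gen.
have l1 : len (psi s) = 1%N.
  have := longest_len sG; have := longest_len (groupM wG sG).
  rewrite -(lenV X (w * s)) invMg longestV (invS X (JSP sJ)) (len_gen X (JSP sJ)) -/(psi s).
  by move: (len (s * w)) (len w) (len (psi s)) => a b c; lia.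
have [r /andP[rr rJ] e] := red_ex_gen X JS (groupM (groupM wG sG) wG).
have := red_size rr; rewrite e -/(psi s) l1.
case: r rJ e {rr} => [|j [|? ?]] //=; rewrite andbT wprod_cons wprod_nil mulg1.
by move=> jJ ej _; rewrite /psi -ej.
Qed.

Lemma act_psi s : s \in J -> act w (al (psi s)) = (- al s)%R.
Proof.
move=> sJ; have pJ := psiJ sJ.
have e : w * psi s * w^-1 = s by rewrite /psi longestV !mulgA longest_inv mul1g -mulgA longest_inv mulg1.
case: (conj_al_pm X (JSP pJ) (JSP sJ) e) => // e'.
have := longest_neg lw; rewrite longestV => /(_ (al (psi s))).
rewrite supp_al pJ pos_al e' => /(_ isT isT) n.
by have := al_neq0 R s; rewrite (pos_neg0 (pos_al R s) n) eqxx.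
Qed.

(** Peeling s off the left of w and [psi s] off its right leaves the same element, since s * w = w *
    psi s. *)
Lemma nred_rotate s Q : all [in S] Q -> s \in J ->
  nred (s :: Q) w = nred (rcons Q (psi s)) w.
Proof.
move=> QS sJ; have pJ := psiJ sJ.
rewrite nred_rcons ?all_rcons ?QS ?JSP //=; congr (_ + _).
have -> : w * psi s = s * w by rewrite /psi !mulgA longest_inv mul1g.
by [].
Qed.

Lemma wprod_psi r : wprod (map psi r) = w * wprod r * w.
Proof.
elim: r => [|s r IH] /=; first by rewrite wprod_nil mulg1 longest_inv.
by rewrite !wprod_cons IH /psi !mulgA -(mulgA (w * s)) longest_inv mulg1.
Qed.

End W.
End J.

Lemma longest_restr J K r : J \subset K -> K \subset S -> red r ->
  longest K (wprod r) -> longest J (wprod (restr J 1 r)).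
Proof.
move=> JK KS rr /andP[_ /forall_inP nw]; have JS := subset_trans JK KS.
have gJ : wprod (restr J 1 r) \in <<J>>.
  by apply/(gen_word _ JS); exists (restr J 1 r); rewrite ?restr_all.
rewrite /longest gJ; apply/forall_inP=> j jJ; have jS := subsetP JS _ jJ.
have rc : jmin X J (rcoset J 1 r).
  by apply: (rcoset_jmin JS (red_all rr)); apply: jmin1.
have rg : root (act (wprod (restr J 1 r))^-1 (al j)) by apply: root_act; apply: root_al.
have sg : supp J (act (wprod (restr J 1 r))^-1 (al j)).
  by rewrite (supp_act X JS) ?groupV // supp_al.
have := nw j (subsetP JK _ jJ).
by rewrite -[wprod r]mul1g (restr_prod J) invMg actM (jmin_sign rc rg sg).
Qed.

End Longest.

(** * The Reading-Speyer form and compatible words *)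

Section Omega.
Variables (gT : finGroupType) (S : {set gT}) (R : realFieldType).
Variable X : coxrep S R.
Implicit Types (s t q w x y z g m b : gT) (a r p Q P : seq gT) (u v : {ffun gT -> R}).
Implicit Types (J K : {set gT}).
Local Open Scope ring_scope.
Notation act := (act X).
Notation len := (len X).
Notation red := (red X).
Notation root := (root X).
Notation nred := (nred X).
Notation A := (cartan (ck X)).
Notation pair := (pairing S (ck X)).
Notation roots := (roots X).

Definition psum t p v : R := \sum_(q <- p) A t q * v q.

(* The skew-symmetric form omega_c of Reading and Speyer, for c = wprod a. *)
Fixpoint om a u v : R :=
  if a is t :: p then v t * psum t p u - u t * psum t p v + om p u v else 0.

Lemma psum_cons t q p v : psum t (q :: p) v = A t q * v q + psum t p v.
Proof. by rewrite /psum big_cons. Qed.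

Lemma psum_cat t p p' v : psum t (p ++ p') v = psum t p v + psum t p' v.
Proof. by rewrite /psum big_cat. Qed.

Lemma psum_rcons t q p v : psum t (rcons p q) v = psum t p v + A t q * v q.
Proof. by rewrite -cats1 psum_cat psum_cons /psum big_nil addr0. Qed.

Lemma psum_eq t p u v : {in p, u =1 v} -> psum t p u = psum t p v.
Proof. by move=> e; rewrite /psum; apply: eq_big_seq => q /e->. Qed.

Lemma psum0 t p v : {in p, forall q, v q = 0} -> psum t p v = 0.
Proof. by move=> e; rewrite /psum big_seq big1 // => q /e->; rewrite mulr0. Qed.

Lemma om_eq a u u' v v' : {in a, u =1 u'} -> {in a, v =1 v'} -> om a u v = om a u' v'.
Proof.
elim: a => //= t p IH eu ev.
have eu' : {in p, u =1 u'} by move=> q qp; apply: eu; rewrite inE qp orbT.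
have ev' : {in p, v =1 v'} by move=> q qp; apply: ev; rewrite inE qp orbT.
by rewrite (psum_eq _ eu') (psum_eq _ ev') IH // eu ?ev ?mem_head.
Qed.

Lemma omC a u v : om a u v = - om a v u.
Proof. by elim: a => [|t p IH] /=; rewrite ?oppr0 // IH; ring. Qed.

Lemma om0 a u v : {in a, forall q, v q = 0} -> om a u v = 0.
Proof.
elim: a => //= t p IH e.
have e' : {in p, forall q, v q = 0} by move=> q qp; apply: e; rewrite inE qp orbT.
by rewrite (IH e') (psum0 _ e') (e t (mem_head _ _)); ring.
Qed.

Lemma om_rcons p t u v : all [in S] (rcons p t) ->
  om (rcons p t) u v = om p u v + (u t * psum t p v - v t * psum t p u).
Proof.
rewrite all_rcons => /andP[tS]; elim: p => [_|q p IH /= /andP[qS pS]] /=.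
  by rewrite /psum !big_nil; ring.
by rewrite IH // !psum_rcons !psum_cons (cartanC X tS qS); ring.
Qed.

Lemma om_move p t p' u v : all [in S] p -> t \in S -> {in p, forall q, A t q = 0} ->
  om (p ++ t :: p') u v = om (t :: p ++ p') u v.
Proof.
move=> + tS; elim: p => [//|q p IH] /= /andP[qS pS] A0.
rewrite IH //=; last by move=> z zp; apply: A0; rewrite inE zp orbT.
have Aq : A t q = 0 by apply: A0; rewrite mem_head.
by rewrite !(psum_cat, psum_cons) (cartanC X qS tS) Aq; ring.
Qed.

Lemma om_del p q p' u v : u q = 0 -> v q = 0 -> om (p ++ q :: p') u v = om (p ++ p') u v.
Proof.
move=> uq vq; elim: p => [|t p IH] /=; first by rewrite uq vq; ring.
by rewrite IH !psum_cat !psum_cons uq vq; ring.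
Qed.

Definition ltr a : {set gT} := [set q in a].

Lemma pair_supp a s v : uniq a -> all [in S] a -> supp (ltr a) v ->
  pair s v = psum s a v.
Proof.
move=> ua aS /suppP sv; rewrite /pairing /psum (big_uniq _ ua) /=.
rewrite (bigID [in a]) /= [X in _ + X]big1 ?addr0 => [|q /andP[_ qa]].
  by apply: eq_bigl => q; case: (boolP (q \in a)) => [/(allP aS)->|]; rewrite ?andbF.
by rewrite sv ?mulr0 // inE.
Qed.

(** Only the terms in the coordinate at t differ between the two forms, and the reflection t changes
    this coordinate by exactly the pairing that compensates. *)
Lemma om_rot t p u v : uniq (t :: p) -> all [in S] (t :: p) ->
  supp (ltr (t :: p)) u -> supp (ltr (t :: p)) v ->
  om (rcons p t) (act t u) (act t v) = om (t :: p) u v.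
Proof.
move=> ua aS su sv; have /= /andP[tp _] := ua; have /= /andP[tS pS] := aS.
have out (z : {ffun gT -> R}) : {in p, act t z =1 z}.
  move=> q qp; rewrite actE // (_ : (q == t) = false) ?mulr0 ?subr0 //.
  by apply: contraNF tp => /eqP <-.
rewrite om_rcons ?all_rcons ?tS // (om_eq (out u) (out v)) !(psum_eq _ (out _)).
rewrite !actE // eqxx !mulr1 !(pair_supp _ ua aS) // !psum_cons cartan_ss /=; ring.
Qed.

Lemma al_out t p : t \notin p -> {in p, forall q, (al t : {ffun gT -> R}) q = 0}.
Proof. by move=> tp q qp; rewrite ffunE; case: eqP => // e; rewrite -e qp in tp. Qed.

Lemma al_id t : (al t : {ffun gT -> R}) t = 1.
Proof. by rewrite ffunE eqxx. Qed.

Lemma om_init t p v : t \notin p -> om (t :: p) (al t) v = - psum t p v.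
Proof.
by move=> tp; rewrite /= (psum0 _ (al_out tp)) al_id omC (om0 _ (al_out tp)); ring.
Qed.

Lemma om_fin t p u : all [in S] (rcons p t) -> t \notin p ->
  om (rcons p t) u (al t) = - psum t p u.
Proof.
by move=> aS tp; rewrite om_rcons // (psum0 _ (al_out tp)) al_id (om0 _ (al_out tp)); ring.
Qed.

Lemma psum_le0 t p v : t \in S -> all [in S] p -> t \notin p -> pos v -> psum t p v <= 0.
Proof.
move=> tS pS tp /posP pv; rewrite /psum big_seq; apply: sumr_le0 => q qp.
apply: mulr_le0_ge0 => //; apply: (cartan_le0 X) => //; first exact: (allP pS).
by apply: contraNneq tp => ->.
Qed.

(** The form is here a sum of nonpositive terms A t q v_q, so it vanishes and the pairing equals 2
    v_t. As t v is still positive, - v_t is nonnegative too, hence v_t = 0. *)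
Lemma om_init_orth t p v : uniq (t :: p) -> all [in S] (t :: p) -> root v -> pos v ->
  supp (ltr (t :: p)) v -> v != al t -> 0 <= om (t :: p) v (al t) -> pair t v = 0.
Proof.
move=> ua aS rv pv sv ne; have /= /andP[tp up] := ua; have /= /andP[tS pS] := aS.
rewrite -/(om (t :: p) v (al t)) omC om_init // opprK => h.
have p0 : psum t p v = 0 by have := psum_le0 tS pS tp pv; lra.
rewrite (pair_supp _ ua aS sv) psum_cons p0 cartan_ss addr0.
have := posP _ (pos_act tS rv pv ne) t.
rewrite actE // (pair_supp _ ua aS sv) psum_cons p0 cartan_ss eqxx mulr1 addr0.
have := posP _ pv t; lra.
Qed.

(** The sign pattern that Reading and Speyer associate with sorting words of sortable elements. It
    is a condition on the root sequence, so it passes to subsequences. *)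
Definition compat a r : bool := pairwise (fun u v => 0 <= om a u v) (roots r).

Lemma om_alal p t p' q : uniq (p ++ t :: p') -> all [in S] (p ++ t :: p') -> q \in p ->
  om (p ++ t :: p') (al t) (al q) = A t q.
Proof.
elim: p => //= z p IH /andP[zn un] /andP[zS aS].
have tS : t \in S by move: aS; rewrite all_cat => /andP[_ /andP[]].
have zt : z != t by apply: contraNneq zn => ->; rewrite mem_cat mem_head orbT.
rewrite !(ffunE, mem_cat) inE (negbTE zt) mul0r subr0.
have [eq _|ne /= qp] := eqVneq q z; last by rewrite mul0r add0r IH.
rewrite eq /= mul1r om0 ?addr0; last exact: al_out.
rewrite psum_cat psum_cons ffunE eqxx mulr1.
have tp : t \notin p.
  by move: un; rewrite cat_uniq => /and3P[_ /norP[]].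
have tp' : t \notin p'.
  by move: un; rewrite cat_uniq => /and3P[_ _ /andP[]].
by rewrite !(psum0 _ (al_out _)) // add0r addr0 cartanC.
Qed.

Lemma supp_root a t u : ltr a \subset S -> t \in a -> supp (ltr a) u -> supp (ltr a) (act t u).
Proof. by move=> aS ta su; rewrite (supp_act X aS) // mem_gen // inE. Qed.

(** The first root is the simple root of the first letter z, so z fixes alpha_t; removing z
    therefore keeps the orthogonality. *)
Lemma orth_word t r : t \in S -> all [in S] r -> {in roots r, forall v, pair t v = 0} ->
  act (wprod r) (al t) = al t /\ {in r, forall q, (t * q)%g = (q * t)%g /\ t != q}.
Proof.
move=> tS; elim: r => [|z r IH] /=; first by rewrite wprod_nil act1.
case/andP=> zS rS orth.
have Atz : A t z = 0 by rewrite -(pairing_al X) ?orth ?mem_head.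
have fz : act z (al t) = al t.
  apply/ffunP=> q; rewrite actE // pairing_al // cartanC // Atz; ring.
have [|e c] := IH rS.
  move=> v vr; rewrite -(bil_al X) // -(bil_act X z) fz bil_al // orth //.
  by rewrite inE map_f ?orbT.
split; first by rewrite wprod_cons actM e.
move=> q; rewrite inE => /predU1P[->|]; last exact: c.
by move/eqP: Atz; rewrite cartan_eq0 // => /andP[-> /eqP].
Qed.

Lemma pairwise_impl (T : eqType) (e e' : rel T) (l : seq T) :
  {in l &, forall x y : T, e x y -> e' x y} -> pairwise e l -> pairwise e' l.
Proof.
elim: l => //= z l IH H /andP[h1 h2]; apply/andP; split.
  apply/allP=> y yl; apply: H; rewrite ?mem_head ?inE ?yl ?orbT //; exact: (allP h1).
by apply: IH h2 => x y xl yl; apply: H; rewrite inE ?xl ?yl orbT.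
Qed.

Lemma compat_eq a a' r : {in roots r &, forall u v, om a u v = om a' u v} ->
  compat a r = compat a' r.
Proof.
rewrite /compat; elim: (roots r) => //= z l IH e.
rewrite IH; last by move=> u v ul vl; apply: e; rewrite inE ?ul ?vl orbT.
congr (_ && _); apply: eq_in_all => v vl; rewrite e ?mem_head //.
by rewrite inE vl orbT.
Qed.

Lemma ltr_sub a : all [in S] a -> ltr a \subset S.
Proof. by move=> aS; apply/subsetP=> q; rewrite inE => /(allP aS). Qed.

Lemma roots_supp J r v : J \subset S -> all [in J] r -> v \in roots r -> supp J v.
Proof.
move=> JS rJ /rootsP[r1 [z [r2 [e1 ->]]]].
move: rJ; rewrite e1 all_cat => /andP[r1J /andP[zJ _]].
by rewrite (supp_act X JS) ?supp_al //; apply/(gen_word _ JS); exists r1.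
Qed.

Lemma red_roots_inv r v : red r -> v \in roots r -> inv X (wprod r) v.
Proof. by move=> rr vr; rewrite -red_roots //; apply: roots_root (red_all rr) vr. Qed.

Lemma compat_exists a x : uniq a -> all [in S] a -> x \in <<ltr a>> ->
  (forall u v, root u -> root v -> supp (ltr a) u -> supp (ltr a) v ->
     inv X x u -> pos v -> ~~ inv X x v -> 0 <= om a u v) ->
  exists r, [/\ red r, wprod r = x & compat a r].
Proof.
have [n] := ubnP (size a + len x)%N; elim: n a x => // n IH [|t p] x ln ua aS xJ C.
  exists [::]; split; rewrite ?red_nil // wprod_nil.
  by move: xJ; rewrite (_ : ltr [::] = set0) ?gen0 ?inE => [/eqP//|]; apply/setP=> z; rewrite !inE.
have /= /andP[tp up] := ua; have /= /andP[tS pS] := aS.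
have JS := ltr_sub aS; have pS' := ltr_sub pS.
have eJ : ltr (rcons p t) = ltr (t :: p) by apply/setP=> q; rewrite !inE mem_rcons inE.
have pJ : ltr p \subset ltr (t :: p) by apply/subsetP=> q; rewrite !inE => ->; rewrite orbT.
have tJ : t \in ltr (t :: p) by rewrite !inE eqxx.
have rt := root_al X tS.
have st : supp (ltr (t :: p)) (al t : {ffun gT -> R}) by rewrite supp_al.
case: (boolP (inv X x (al t))) => it; last first.
  have px : x \in <<ltr p>>.
    have [r /andP[rr rJ] er] := red_ex_gen X JS xJ.
    have orth : {in roots r, forall v, pair t v = 0}.
      move=> v vr; have rv := roots_root (red_all rr) vr.
      have iv : inv X x v by rewrite -er red_roots_inv.
      have pv : pos v by case/andP: iv.
      have sv := roots_supp JS rJ vr.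
      apply: (om_init_orth ua aS rv pv sv); last exact: (C _ _ rv rt sv st iv (pos_al R t) it).
      by apply: contraNneq it => <-.
    have [_ c] := orth_word tS (red_all rr) orth.
    apply/(gen_word _ pS'); exists r => //; apply/allP=> q qr; rewrite inE.
    have := allP rJ q qr; rewrite !inE => /predU1P[eqt|//].
    by have [_] := c q qr; rewrite eqt eqxx.
  have om_p u v : supp (ltr p) u -> supp (ltr p) v -> om (t :: p) u v = om p u v.
    have tn : t \notin ltr p by rewrite inE.
    by move=> /suppP/(_ t tn) ut /suppP/(_ t tn) vt; rewrite (om_del [::] p ut vt).
  have [|u v ru rv su sv iu pv iv|r [rr er cr]] := IH p x _ up pS px.
  - by move: ln; rewrite /= addSn ltnS.
  - by rewrite -om_p //; apply: C => //; apply: supp_sub pJ _.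
  exists r; split=> //; rewrite (@compat_eq _ p) // => u v ur vr.
  have rp : all [in ltr p] r by apply: (red_gen pS' rr); rewrite er.
  by rewrite om_p // (roots_supp pS' rp).
have lt : (len (t * x) < len x)%N by rewrite titsl //; case/andP: it.
have apS : all [in S] (rcons p t) by rewrite all_rcons tS.
have uap : uniq (rcons p t) by rewrite rcons_uniq tp.
have txJ : (t * x)%g \in <<ltr (rcons p t)>> by rewrite eJ groupM // mem_gen.
have tin : t \in t :: p by rewrite mem_head.
have ts u : act t (act t u) = u by rewrite -actM (S_inv X) // act1.
have om_t u v : supp (ltr (t :: p)) u -> supp (ltr (t :: p)) v ->
    om (rcons p t) u v = om (t :: p) (act t u) (act t v).
  by move=> su sv; have := om_rot ua aS (supp_root JS tin su) (supp_root JS tin sv); rewrite !ts.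
have itx u : inv X (t * x)%g u = pos u && neg (act x^-1 (act t u)).
  by rewrite /inv invMg (invS X tS) actM.
have [|u v ru rv|r [rr er cr]] := IH (rcons p t) (t * x)%g _ uap apS txJ.
- by rewrite size_rcons -ltnS; apply: leq_trans ln; rewrite /= ltnS ltn_add2l.
- rewrite eJ => su sv iu pv iv.
  have pu : pos u by move: iu; rewrite itx => /andP[].
  have [->|ne] := eqVneq v (al t).
    by rewrite om_fin // oppr_ge0 psum_le0.
  have tv : pos (act t v) by apply: pos_act.
  have utn : u != al t.
    apply: contraTneq iu => ->; rewrite itx pos_al act_al // actN negN /=.
    case/andP: it => _ n'; apply/negP=> p'.
    by have := root_neq0 (root_act x^-1 rt); rewrite (pos_neg0 p' n') eqxx.
  rewrite om_t //; apply: C; rewrite ?supp_root //; try exact: root_act.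
  + by move: iu; rewrite itx /inv => /andP[_ ->]; rewrite pos_act.
  + by move: iv; rewrite itx /inv pv tv.
have etx : (t * wprod r = x)%g by rewrite er (mulSS X).
have rJ : all [in ltr (t :: p)] r by apply: (red_gen JS rr); rewrite er -eJ.
exists (t :: r); split; first by rewrite red_cons tS rr etx er.
  by rewrite wprod_cons.
have rtr : red (t :: r) by rewrite red_cons tS rr etx er.
rewrite /compat [roots (t :: r)]/= pairwise_cons pairwise_map; apply/andP; split.
  apply/allP=> v vr; rewrite om_init // oppr_ge0 psum_le0 //.
  by apply: (red_roots_pos rtr); rewrite /= inE vr orbT.
apply: pairwise_impl cr => u v ur vr; rewrite om_t //; exact: (roots_supp JS rJ).
Qed.

End Omega.

(** * The recurrence *)

Section Recurrence.
Variables (gT : finGroupType) (S : {set gT}) (R : realFieldType).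
Variable X : coxrep S R.
Implicit Types (s t q w x y z g m b : gT) (a r p Q P ts : seq gT) (u v : {ffun gT -> R}).
Implicit Types (J K : {set gT}).
Notation act := (act X).
Notation len := (len X).
Notation red := (red X).
Notation root := (root X).
Notation nred := (nred X).
Notation A := (cartan (ck X)).
Notation pair := (pairing S (ck X)).
Notation roots := (roots X).
Notation om := (om X).
Notation compat := (compat X).

Record okst J w a r : Prop := Okst {
  ok_uniq : uniq a; ok_ltr : ltr a = J; ok_red : red r;
  ok_prod : wprod r = w; ok_compat : compat a r }.

(* [n] is the number of c-sortable elements of W_J, counted as the reduced
   subwords of [a ++ r] that spell the longest element (see [cnt_nred]). *)
Definition Nval J n : Prop :=
  forall w a r, longest X J w -> okst J w a r -> nred (a ++ r) w = n.

Lemma rem_index t a : t \in a ->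
  a = take (index t a) a ++ t :: drop (index t a).+1 a /\
  rem t a = take (index t a) a ++ drop (index t a).+1 a.
Proof.
move=> ta; split; last by rewrite remE.
by rewrite -{1}(cat_take_drop (index t a) a) (drop_nth t) ?index_mem // nth_index.
Qed.

Section J.
Variables (J : {set gT}) (w : gT).
Hypothesis JS : J \subset S.
Hypothesis lw : longest X J w.
Let JSP s : s \in J -> s \in S. Proof. exact: subsetP. Qed.
Notation psi := (psi w).

Lemma ltr_mem a q : ltr a = J -> (q \in a) = (q \in J).
Proof. by move=> <-; rewrite inE. Qed.

Lemma ltr_all a : ltr a = J -> all [in S] a.
Proof. by move=> e; apply/allP=> q; rewrite (ltr_mem _ e); apply: JSP. Qed.

Lemma okst_all a r : okst J w a r -> all [in J] r.
Proof. by case=> _ _ rr e _; apply: (red_gen JS rr); rewrite e (longest_gen lw). Qed.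

Lemma rot_uniq a t : t \in a -> uniq a -> uniq (rcons (rem t a) t).
Proof. by move=> ta ua; rewrite rcons_uniq mem_rem_uniq // !inE eqxx rem_uniq. Qed.

Lemma rot_ltr a t : t \in a -> ltr (rcons (rem t a) t) = ltr a.
Proof.
by move=> ta; apply/setP=> q; rewrite !inE mem_rcons -(perm_mem (perm_to_rem ta)).
Qed.

(** For q before t in a, alpha_q comes after alpha_t in the root sequence, as w inverts every simple
    root of J. So om alpha_t alpha_q = A t q is nonnegative, and being nonpositive it is 0. *)
Lemma okst_init a t r : okst J w a (t :: r) ->
  t \in a /\ {in take (index t a) a, forall q, t * q = q * t /\ t != q}.
Proof.
move=> ok; have /= /andP[tJ rJ] := okst_all ok; case: ok => ua ea rr er cr.
have ta : t \in a by rewrite (ltr_mem _ ea).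
split=> // q qp; have [e1 e2] := rem_index ta.
have qa : q \in a by rewrite e1 mem_cat qp.
have qJ : q \in J by rewrite -(ltr_mem _ ea).
have tq : t != q.
  apply: contraTneq qp => <-; move: ua; rewrite {1}e1 cat_uniq => /and3P[_ /norP[]] //.
split=> //; have : al q \in roots (t :: r).
  rewrite (red_roots rr) ?er; last exact/root_al/JSP.
  by rewrite /inv pos_al; case/andP: lw => _ /forall_inP ->.
rewrite /= inE => /predU1P[/(congr1 (fun f : {ffun gT -> R} => f q))/eqP|qr].
  by rewrite !ffunE eqxx [q == t]eq_sym (negbTE tq) oner_eq0.
have := cr; rewrite /compat /= => /andP[/allP/(_ _ qr) + _].
rewrite {1}e1 om_alal ?(JSP tJ) //; rewrite -?e1 ?(ltr_all ea) // => h.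
have := cartan_le0 X (JSP tJ) (JSP qJ) tq => h'.
have : A t q == 0%R by rewrite eq_le h h'.
by rewrite (cartan_eq0 X (JSP tJ) (JSP qJ)) => /andP[_ /eqP].
Qed.

Lemma init_om a t u v : ltr a = J -> t \in a ->
  {in take (index t a) a, forall q, t * q = q * t /\ t != q} ->
  om a u v = om (t :: rem t a) u v.
Proof.
move=> ea ta c; have [e1 e2] := rem_index ta.
have aS := ltr_all ea; have tS := allP aS _ ta.
have pS : all [in S] (take (index t a) a).
  by apply/allP=> q /mem_take; apply: (allP aS).
rewrite {1}e1 e2 om_move // => q qp; apply/eqP.
by rewrite (cartan_eq0 X tS (allP pS _ qp)); have [-> ->] := c q qp; rewrite eqxx.
Qed.

Lemma init_wprod a t : t \in a ->
  {in take (index t a) a, forall q, t * q = q * t /\ t != q} ->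
  wprod a = t * wprod (rem t a).
Proof.
move=> ta c; have [e1 e2] := rem_index ta.
rewrite {1}e1 e2; elim: (take _ _) c => [|q p IH] c /=; first by rewrite wprod_cons.
rewrite !wprod_cons IH; last by move=> z zp; apply: c; rewrite inE zp orbT.
by rewrite !mulgA; congr (_ * _); have [] := c q (mem_head _ _).
Qed.

Lemma init_nred a t Q : ltr a = J -> t \in a -> all [in S] Q ->
  {in take (index t a) a, forall q, t * q = q * t /\ t != q} ->
  nred (a ++ Q) w = nred (rem t a ++ rcons Q (psi t)) w.
Proof.
move=> ea ta QS c; have [e1 e2] := rem_index ta.
have aS := ltr_all ea; have tS := allP aS _ ta.
have pS : all [in S] (take (index t a) a).
  by apply/allP=> q /mem_take; apply: (allP aS).
have p'S : all [in S] (drop (index t a).+1 a).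
  by apply/allP=> q /mem_drop; apply: (allP aS).
rewrite {1}e1 -catA cat_cons nred_move //; last by move=> q /c[].
rewrite (nred_rotate JS lw) ?all_cat ?pS ?p'S //; last by rewrite -(ltr_mem _ ea).
by rewrite e2 -catA !rcons_cat.
Qed.

(** The root sequence loses alpha_t in front, is reflected by t, and gains alpha_t at the end, where
    it is compatible because t is now the last letter of the Coxeter word. *)
Lemma okst_rot a t r : okst J w a (t :: r) ->
  okst J w (rcons (rem t a) t) (rcons r (psi t)).
Proof.
move=> ok; have [ta c] := okst_init ok.
have /= /andP[tJ rJ] := okst_all ok; have [ua ea rr er cr] := ok.
have tS := JSP tJ; have pJ := psiJ JS lw tJ.
have er' : wprod r = t * w by rewrite -er wprod_cons (mulSS X).
have erc : wprod (rcons r (psi t)) = w.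
  by rewrite wprod_rcons er' /psi !mulgA -(mulgA t w w) (longest_inv JS lw) mulg1 (S_inv X) // mul1g.
have rr' : red (rcons r (psi t)).
  apply: red_of_size; first by rewrite all_rcons JSP //= (all_sub JS).
  by rewrite erc size_rcons -er -(red_size rr).
have rtr : roots (rcons r (psi t)) = rcons (roots r) (al t).
  rewrite roots_rcons er' actM (act_psi JS lw) // actN act_al // opprK //.
split=> //; [exact: rot_uniq | by rewrite rot_ltr |].
have aS := ltr_all ea.
have uap := rot_uniq ta ua.
have tr : t \notin rem t a by rewrite mem_rem_uniq // !inE eqxx.
have rS : all [in S] (t :: rem t a).
  by rewrite /= tS; apply/allP=> q /mem_rem; apply: (allP aS).
have ur : uniq (t :: rem t a) by rewrite /= tr rem_uniq.
have eltr : ltr (t :: rem t a) = J.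
  by rewrite -ea; apply/setP=> q; rewrite [LHS]inE [RHS]inE (perm_mem (perm_to_rem ta)).
rewrite /compat rtr -[rcons (roots r) _]cats1 pairwise_cat /= andbT; apply/andP; split.
  rewrite allrel1r; apply/allP=> u ur'; rewrite om_fin ?all_rcons //.
  rewrite oppr_ge0 (psum_le0 X tS) //; first by case/andP: rS.
  by apply: (red_roots_pos rr'); rewrite rtr mem_rcons inE ur' orbT.
have srr : {in roots r, forall u, supp J u} by move=> u; apply: roots_supp.
move: cr; rewrite /compat /= pairwise_map => /andP[_].
elim: (roots r) srr => //= z l IH sl /andP[h1 h2]; apply/andP; split; last first.
  by apply: IH => // u ul; apply: sl; rewrite inE ul orbT.
apply/allP=> u ul; have := allP h1 u ul; rewrite /= (init_om _ _ ea ta c).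
have sz : supp J z by apply: sl; rewrite mem_head.
have su : supp J u by apply: sl; rewrite inE ul orbT.
have st (x : {ffun gT -> R}) : supp J x -> supp J (act t x).
  by move=> sx; rewrite (supp_act X JS) // mem_gen.
have := @om_rot _ _ _ X t (rem t a) (act t z) (act t u) ur rS.
by rewrite eltr !st // => /(_ isT isT) <-; rewrite -!(actM X t t) (S_inv X) // !act1.
Qed.

(** Without q the Coxeter word lies in the smaller parabolic subgroup, and r restricts to a
    compatible reduced word of the longest element there. *)
Lemma val_a a r q n : okst J w a r -> q \in J -> Nval (J :\ q) n ->
  nred (rem q a ++ r) w = n.
Proof.
move=> ok qJ val; have [ua ea rr er cr] := ok.
have qa : q \in a by rewrite (ltr_mem _ ea).
set K := J :\ q; have KJ : K \subset J by rewrite subsetDl.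
have KS := subset_trans KJ JS.
have lrem : ltr (rem q a) = K.
  by apply/setP=> z; rewrite inE mem_rem_uniq // !inE (ltr_mem _ ea).
have rK : all [in K] (rem q a) by apply/allP=> z; rewrite -lrem inE.
set g := wprod (restr K 1 r).
have ew : w = g * rcoset K 1 r by rewrite -restr_prod mul1g.
have lg : longest X K g by apply: (longest_restr KJ JS rr); rewrite er.
rewrite {1}ew (nred_cat_restr KS rK rr (longest_gen lg)).
apply: val lg _; split=> //; [exact: rem_uniq | exact: restr_red |].
have sub : subseq (roots (restr K 1 r)) (roots r).
  have := restr_roots KS (red_all rr) (jmin1 X K).
  by rewrite (_ : map _ _ = roots r) // -[RHS]map_id; apply: eq_map => v; rewrite act1.
have [e1 e2] := rem_index qa.
rewrite (@compat_eq _ _ _ X _ a); last first.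
  move=> u v uK vK; have qn : q \notin K by rewrite !inE eqxx.
  have H (x : {ffun gT -> R}) : x \in roots (restr K 1 r) -> x q = 0%R.
    by move=> xr; apply/(suppP _ _ (roots_supp KS (restr_all K 1 r) xr)).
  have := @om_del _ _ _ X (take (index q a) a) q (drop (index q a).+1 a) u v (H _ uK) (H _ vK).
  by rewrite e2 -e1 => ->.
exact: subseq_pairwise sub cr.
Qed.

Variable G : gT -> nat.
Hypothesis GP : forall q, q \in J -> Nval (J :\ q) (G q).

(** After i + 1 rotations the letter at place i of r is the last letter of the Coxeter word, where
    [val_a] applies. *)
Lemma val_r i a r : okst J w a r -> i < size r ->
  nred (a ++ take i r ++ drop i.+1 r) w = G (nth 1 r i).
Proof.
elim: i a r => [|i IH] a [|t r] //= ok ir.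
  rewrite drop0; have [ta c] := okst_init ok; have [ua ea rr er cr] := ok.
  have /= /andP[tJ rJ] := okst_all ok.
  rewrite (init_nred ea ta _ c) ?(all_sub JS rJ) //.
  have := val_a (okst_rot ok) tJ (GP tJ).
  rewrite (_ : rem t (rcons _ _) = rem t a) //.
  have tr : t \notin rem t a by rewrite mem_rem_uniq // !inE eqxx.
  rewrite remE -cats1 index_cat (negbTE tr) /= eqxx addn0 take_size_cat //.
  by rewrite drop_oversize ?cats0 // size_cat addn1.
have [ta c] := okst_init ok; have [ua ea rr er cr] := ok.
have /= /andP[tJ rJ] := okst_all ok; have rS := all_sub JS rJ.
rewrite (init_nred ea ta _ c); last first.
  rewrite /= JSP //=; apply/allP=> q; rewrite mem_cat => /orP[/mem_take|/mem_drop];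
  exact: (allP rS).
have := IH _ _ (okst_rot ok); rewrite size_rcons ltnS nth_rcons ltnS in ir *.
rewrite ir => <-; last exact: ltnW.
rewrite cat_rcons -[rcons r (psi t)]cats1 takel_cat ?(ltnW ir) // drop_cat.
case: (ltngtP i.+1 (size r)) ir => // [_ _|ei _].
  by rewrite -[rcons (t :: _) _]cats1 /= -catA.
by rewrite ei drop_size cats0 subnn drop0 -cats1.
Qed.

(** Omitting the final [psi t] of the rotated word and omitting t from a before the rotation leave
    the same word. *)
Lemma G_psi_head a t r : okst J w a (t :: r) -> G (psi t) = G t.
Proof.
move=> ok; have /= /andP[tJ rJ] := okst_all ok.
have := @val_r (size r) _ _ (okst_rot ok); rewrite size_rcons ltnSn nth_rcons ltnn eqxx.
move=> <- //; rewrite -(val_a ok tJ (GP tJ)) cat_rcons.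
by rewrite -cats1 take_size_cat // drop_oversize ?cats0 // size_cat addn1.
Qed.

(** Source firing: each letter of ts is initial up to commutation in the current Coxeter word, and
    then moves to its end. *)
Fixpoint valid a ts : bool :=
  if ts is t :: ts' then
    [&& t \in a, all (fun q => (t * q == q * t) && (t != q)) (take (index t a) a)
      & valid (rcons (rem t a) t) ts']
  else true.

Fixpoint fire a ts := if ts is t :: ts' then fire (rcons (rem t a) t) ts' else a.

Lemma valid_cat a ts ts' : valid a (ts ++ ts') = valid a ts && valid (fire a ts) ts'.
Proof. by elim: ts a => //= t ts IH a; rewrite IH !andbA. Qed.

Lemma okst_fire a r r' : okst J w a (r ++ r') ->
  valid a r /\ okst J w (fire a r) (r' ++ map psi r).
Proof.
elim: r a r' => [|t r IH] a r' /= ok; first by rewrite cats0.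
have [ta c] := okst_init ok; have := okst_rot ok; rewrite rcons_cat => /IH[v o].
split; last by rewrite -cat_rcons.
by rewrite ta v andbT; apply/allP=> q /c[-> ->]; rewrite eqxx.
Qed.

Lemma G_psi a r : okst J w a r -> {in r, forall t, G (psi t) = G t}.
Proof.
move=> ok t tr; case/splitPr: r / tr ok => r1 r2 /okst_fire[_].
rewrite cat_cons; exact: G_psi_head.
Qed.

(** Reduced words of w have size r letters, so a subword of a ++ r omits size a positions; [val_a]
    and [val_r] evaluate each omission. *)
Lemma val_sum a r : okst J w a r ->
  (size a * nred (a ++ r) w = \sum_(q <- a) G q + \sum_(q <- r) G q)%N.
Proof.
move=> ok; have [ua ea rr er cr] := ok; have aS := ltr_all ea.
have := @nred_del _ _ _ X (a ++ r) w; rewrite all_cat aS (red_all rr) => /(_ isT).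
have lenw : len w = size r by rewrite -er (red_size rr).
rewrite size_cat lenw mulnDl addnC => /addnI.
rewrite -(big_mkord xpredT (fun i => nred (take i (a ++ r) ++ drop i.+1 (a ++ r)) w)).
rewrite (@big_cat_nat _ _ _ (size a)) ?leq_addr //= => ->; congr (_ + _)%N.
  rewrite [RHS](big_nth 1) !big_nat; apply: eq_bigr => i /= ia.
  rewrite takel_cat ?(ltnW ia) // drop_cat.
  have -> : take i a ++ (if i.+1 < size a then drop i.+1 a ++ r else drop (i.+1 - size a) r)
     = rem (nth 1 a i) a ++ r.
    rewrite remE index_uniq // -catA; congr (_ ++ _).
    case: (ltngtP i.+1 (size a)) ia => // ei _.
    by rewrite ei subnn drop0 drop_oversize.
  by apply: val_a => //; rewrite -?(ltr_mem _ ea) ?mem_nth //; apply: GP; rewrite -(ltr_mem _ ea) mem_nth.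
rewrite -{1}[size a]add0n big_addn addnC addnK [RHS](big_nth 1) !big_nat.
apply: eq_bigr => i /= ir; rewrite -(val_r ok ir) take_cat drop_cat.
by rewrite ltnNge leq_addl /= addnK -addSn ltnNge leq_addl /= addnK catA.
Qed.

Section CoxeterNumber.
Hypothesis conJ : {in J &, forall s t,
  connect (fun s t => [&& s \in J, t \in J & s * t != t * s]) s t}.
Hypothesis pd : forall v, supp S v -> (bil X v v <= 0)%R -> v = 0%R.

Lemma valid_step a t : ltr a = J -> uniq a -> t \in a ->
  all (fun q => (t * q == q * t) && (t != q)) (take (index t a) a) ->
  [/\ {in take (index t a) a, forall q, t * q = q * t /\ t != q}, t \in J,
      uniq (rcons (rem t a) t), ltr (rcons (rem t a) t) = J
    & [/\ uniq (t :: rem t a), ltr (t :: rem t a) = J, all [in S] (t :: rem t a) & t \notin rem t a]].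
Proof.
move=> ea ua ta c; have tJ : t \in J by rewrite -(ltr_mem _ ea).
have tr : t \notin rem t a by rewrite mem_rem_uniq // !inE eqxx.
have aS := ltr_all ea.
split=> //; [|exact: rot_uniq | by rewrite rot_ltr |].
  by move=> q /(allP c)/andP[/eqP].
split=> //=; first by rewrite tr rem_uniq.
  by rewrite -ea; apply/setP=> q; rewrite [LHS]inE [RHS]inE (perm_mem (perm_to_rem ta)).
by rewrite JSP //; apply/allP=> q /mem_rem; apply: (allP aS).
Qed.

Lemma om_fire a ts u v : ltr a = J -> uniq a -> valid a ts -> supp J u -> supp J v ->
  om (fire a ts) u v = om a (act (wprod ts) u) (act (wprod ts) v).
Proof.
elim: ts a => [|t ts IH] a ea ua /=; first by rewrite wprod_nil !act1.
case/and3P=> ta c vts su sv.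
have [c' tJ ua' ea' [ur er rS tr]] := valid_step ea ua ta c.
rewrite IH // wprod_cons !actM (init_om _ _ ea ta c').
have wJ : wprod ts \in <<J>>.
  elim: ts (rcons _ _) ea' ua' vts {IH} => [|z ts IHt] b eb ub /=; first by rewrite wprod_nil group1.
  case/and3P=> zb cb vts; have [_ zJ ub' eb' _] := valid_step eb ub zb cb.
  by rewrite wprod_cons groupM ?(IHt _ eb' ub' vts) // mem_gen.
have sw (x : {ffun gT -> R}) : supp J x -> supp J (act (wprod ts) x) by move=> sx; rewrite (supp_act X JS).
have st (x : {ffun gT -> R}) : supp J x -> supp J (act t x).
  by move=> sx; rewrite (supp_act X JS) // mem_gen.
have := @om_rot _ _ _ X t (rem t a) (act t (act (wprod ts) u)) (act t (act (wprod ts) v)) ur rS.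
by rewrite er !st ?sw // => /(_ isT isT) <-; rewrite -!(actM X t t) (S_inv X) ?JSP // !act1.
Qed.

(** Adjacent letters fire alternately, and the sign of om alpha_q alpha_q' records whose turn is
    next. *)
Lemma count_fire a ts q q' : ltr a = J -> uniq a -> valid a ts -> q \in J -> q' \in J ->
  q * q' != q' * q ->
  (count_mem q ts + (0 < om (fire a ts) (al q) (al q'))%R =
   count_mem q' ts + (0 < om a (al q) (al q'))%R)%N.
Proof.
move=> + + + qJ qJ' ne; have qq' : q != q' by apply: contra ne => /eqP->.
have Aneg : (A q q' < 0)%R.
  rewrite lt_neqAle (cartan_le0 X) ?JSP // andbT (cartan_eq0 X) ?JSP //.
  by rewrite (negbTE ne) andbF.
elim: ts a => [|t ts IH] a ea ua //= /and3P[ta c vts].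
have [c' tJ ua' ea' [ur er rS tr]] := valid_step ea ua ta c.
have e := IH _ ea' ua' vts.
have apS := ltr_all ea'.
have psum_al z : z \in J -> z != t -> psum X t (rem t a) (al z) = A t z.
  move=> zJ zt; have := @pair_supp _ _ _ X (t :: rem t a) t (al z) ur rS.
  rewrite er supp_al zJ pairing_al ?JSP // psum_cons ffunE eq_sym (negbTE zt) mulr0 add0r.
  by move/(_ isT).
have [tq|tq] := eqVneq t q.
  have b1 : (0 < om a (al q) (al q'))%R.
    rewrite (init_om _ _ ea ta c') -tq om_init // psum_al -?tq //; last by rewrite tq eq_sym.
    by rewrite tq oppr_gt0.
  have b2 : (0 < om (rcons (rem t a) t) (al q) (al q'))%R = false.
    rewrite -tq omC om_fin // opprK psum_al ?tq //; last by rewrite eq_sym.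
    by apply/negbTE; rewrite -leNgt ltW.
  rewrite b1 (_ : (t == q') = false) /=; last by rewrite tq (negbTE qq').
  by rewrite add1n addSn e b2 addn0 add0n addn1.
have [tq'|tq'] := eqVneq t q'.
  have b1 : (0 < om a (al q) (al q'))%R = false.
    rewrite (init_om _ _ ea ta c') omC -tq' om_init // opprK psum_al //; last by rewrite eq_sym.
    apply/negbTE; rewrite -leNgt ltW // tq' cartanC ?JSP //.
  have b2 : (0 < om (rcons (rem t a) t) (al q) (al q'))%R.
    rewrite -tq' om_fin // psum_al //; last by rewrite eq_sym.
    by rewrite oppr_gt0 tq' cartanC ?JSP.
  by rewrite b1 /= add0n e b2 addn0 add1n addn1.
rewrite !add0n e; congr (_ + nat_of_bool (_ < _)%R)%N.
rewrite (init_om _ _ ea ta c') om_rcons // [om (t :: _) _ _]/= !ffunE.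
by rewrite (negbTE tq) (negbTE tq') /=; ring.
Qed.

(** Only the letter q changes the coordinate at q, so after k firings of q this coordinate is that
    of the k-th power of c^-1, whatever else has fired. *)
Lemma act_fire a ts q v : ltr a = J -> uniq a -> valid a ts -> q \in J ->
  act (wprod ts)^-1 v q = act ((wprod a)^-1 ^+ count_mem q ts) v q.
Proof.
move=> + + + qJ; elim: ts a v => [|t ts IH] a v ea ua.
  by rewrite wprod_nil invg1 /= expg0.
case/and3P=> ta c vts.
have [c' tJ ua' ea' [ur er rS tr]] := valid_step ea ua ta c.
have tS := JSP tJ.
rewrite wprod_cons invMg (invS X tS) actM (IH _ _ ea' ua' vts).
set c0 := wprod a; set k := count_mem q ts.
have ec : wprod (rcons (rem t a) t) = t * c0 * t.
  by rewrite wprod_rcons /c0 (init_wprod ta c') !mulgA (S_inv X) // mul1g.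
have ek : ((t * c0 * t)^-1 ^+ k) * t = t * (c0^-1 ^+ k).
  elim: (k) => [|j IHj]; first by rewrite !expg0 mulg1 mul1g.
  rewrite !expgS -mulgA IHj !invMg (invS X tS) !mulgA; congr (_ * _).
  by rewrite (mulSSr X).
rewrite ec -actM ek /=; have [tq|tq] := eqVneq t q; last first.
  by rewrite add0n -/k actM actE // eq_sym (negbTE tq) mulr0 subr0.
rewrite add1n -/k expgS actM actM /c0 (init_wprod ta c') invMg (invS X tS) actM.
set y := act t _.
have KS : ltr (rem t a) \subset S by apply: ltr_sub; case/andP: rS.
rewrite -tq (act_out X KS) // ?inE // groupV.
apply/(gen_word _ KS); exists (rem t a) => //; apply/allP=> z; by rewrite inE.
Qed.

Lemma prefix_count ts q k : k < count_mem q ts ->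
  exists t1 t2 : seq gT, ts = t1 ++ q :: t2 /\ count_mem q t1 = k.
Proof.
elim: ts k => [|t ts IH] k //=; have [->|ne] := eqVneq t q.
  case: k => [|k]; first by exists [::], ts.
  rewrite add1n ltnS => /IH[t1 [t2 [-> e]]]; exists (q :: t1), t2; split=> //=.
  by rewrite eqxx e.
by rewrite add0n => /IH[t1 [t2 [-> e]]]; exists (t :: t1), t2; rewrite /= (negbTE ne) e.
Qed.

(** r followed by psi r is a firing sequence with product 1. All letters occur in it equally often,
    say f times; the f-th power of c is then trivial, so h divides f, and f > h would repeat a root
    in a root sequence that has no repetitions. *)
Lemma count_order a r q : okst J w a r -> q \in J ->
  count_mem q (r ++ map psi r) = #[wprod a].
Proof.
move=> ok qJ; set ts := r ++ map psi r; set c := wprod a; set h := #[c].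
have [ua ea rr er cr] := ok.
have [v1 ok1] : valid a r /\ okst J w (fire a r) (map psi r).
  by have := @okst_fire a r [::]; rewrite cats0; apply.
have [v2 ok2] : valid (fire a r) (map psi r) /\ okst J w (fire (fire a r) (map psi r)) (map psi (map psi r)).
  by have := @okst_fire (fire a r) (map psi r) [::]; rewrite cats0; apply.
have vts : valid a ts by rewrite valid_cat v1.
have ets : wprod ts = 1.
  by rewrite wprod_cat (wprod_psi JS lw) er (longest_inv JS lw) mul1g (longest_inv JS lw).
(* The product being 1, the form returns to itself and the sign terms of [count_fire] cancel along
   each edge. *)
have cnt : {in J, forall q', count_mem q' ts = count_mem q ts}.
  move=> q' qJ'; have /connectP[p + ->] := conJ qJ qJ'.
  elim: p q qJ => //= z p IH y yJ /andP[/and3P[_ zJ ne] pth].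
  rewrite (IH z zJ pth); have := count_fire ea ua vts yJ zJ ne.
  by rewrite om_fire ?supp_al // ets !act1 => /addIn.
set f := count_mem q ts.
have cJ : c \in <<J>>.
  apply/(gen_word _ JS); exists a => //; apply/allP=> z; by rewrite (ltr_mem _ ea).
have hf : h %| f.
  rewrite order_dvdn -[c]invgK expgVn invg_eq1; apply/eqP.
  apply: (gen_pos JS (X := X)); first by rewrite groupX ?groupV.
  move=> j jJ; rewrite (_ : act _ (al j) = al j) ?pos_al //; apply/ffunP=> z.
  have [zJ|zJ] := boolP (z \in J); last by rewrite (act_out X JS) // groupX ?groupV.
  have := act_fire (al j) ea ua vts zJ; by rewrite ets invg1 act1 cnt // => /esym.
apply/eqP; rewrite eqn_leq [h <= _]dvdn_leq ?andbT //; last first.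
  rewrite -/f lt0n; apply/negP=> /eqP/count_memPn qts.
  have KS : J :\ q \subset S by apply: subset_trans JS; rewrite subsetDl.
  have rK : all [in J :\ q] r.
    apply/allP=> z zr; rewrite !inE (allP (okst_all ok) _ zr) andbT.
    by apply: contraNneq qts => <-; rewrite mem_cat zr.
  have : al q \in roots r.
    rewrite (red_roots rr) ?er; last exact/root_al/JSP.
    by rewrite /inv pos_al; case/andP: lw => _ /forall_inP ->.
  by move/(roots_supp KS rK); rewrite supp_al !inE eqxx.
rewrite -/f leqNgt; apply/negP=> hltf.
have [t0 [t0' [e0 k0]]] := @prefix_count ts q 0 (leq_ltn_trans (leq0n _) hltf).
have [t1 [t1' [e1 k1]]] := @prefix_count ts q h hltf.
(* The root at the occurrence of q preceded by k others is determined, through its pairings with all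
   vectors, by k modulo h. *)
have gam (t t' : seq gT) (k : nat) : ts = t ++ q :: t' -> count_mem q t = k -> forall v,
    bil X (act (wprod t) (al q)) v = (act (c^-1 ^+ k) v q - act (c^-1 ^+ k.+1) v q)%R.
  move=> e ek v; have qS := JSP qJ.
  have vt : valid a t by move: vts; rewrite e valid_cat => /andP[].
  have vtq : valid a (rcons t q) by move: vts; rewrite e -cat_rcons valid_cat => /andP[].
  have := act_fire v ea ua vt qJ; have := act_fire v ea ua vtq qJ.
  rewrite -cats1 count_cat /= eqxx addn0 addn1 ek -/c => <- <-.
  rewrite -{1}(actKV X (wprod t) v) bil_act bil_al // cats1 wprod_rcons invMg (invS X qS) actM.
  by rewrite (actE X _ q qS) eqxx mulr1; ring.
have ee : act (wprod t0) (al q) = act (wprod t1) (al q).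
  apply/eqP; rewrite -subr_eq0; apply/eqP/pd.
    apply: supp_sub JS _; apply/suppP=> z zJ.
    have tw (t t' : seq gT) : ts = t ++ q :: t' -> supp J (act (wprod t) (al q)).
      move=> e; rewrite (supp_act X JS) ?supp_al //; apply/(gen_word _ JS); exists t => //.
      have : all [in J] ts.
        rewrite all_cat (okst_all ok) /= all_map; apply/allP=> y yr /=.
        by apply: (psiJ JS lw); apply: (allP (okst_all ok)).
      by rewrite e all_cat => /andP[].
    by rewrite !ffunE (suppP _ _ (tw _ _ e0)) // (suppP _ _ (tw _ _ e1)) // subr0.
  set d := (_ - _)%R; rewrite {1}/d bilDl -scvN1 bilZl (gam _ _ _ e0 k0) (gam _ _ _ e1 k1).
  have ch : c^-1 ^+ h = 1 by rewrite expgVn expg_order invg1.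
  by rewrite (expgS _ h) ch mulg1 expg0 expg1; lra.
(* The roots of r are positive, and w makes those of psi r negative. *)
have urts : uniq (roots ts).
  rewrite roots_cat er cat_uniq (red_roots_uniq rr) (map_inj_uniq (act_inj (w:=w))).
  have [_ _ rp _ _] := ok1.
  rewrite (red_roots_uniq rp) andbT /=; apply/hasPn=> v /mapP[u ur ->]; apply/negP=> wr.
  have pw := red_roots_pos rr wr; have pu := red_roots_pos rp ur.
  have su : supp J u by apply: roots_supp (okst_all ok1) ur.
  have := longest_neg lw su pu; rewrite (longestV JS lw) => nw.
  have ru := roots_root (red_all rp) ur.
  by have := root_neq0 (root_act w ru); rewrite (pos_neg0 pw nw) eqxx.
have nthr (t t' : seq gT) : ts = t ++ q :: t' -> nth 0%R (roots ts) (size t) = act (wprod t) (al q)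
     /\ size t < size (roots ts).
  move=> e; rewrite size_roots {2}e size_cat /= addnS ltnS leq_addr; split=> //.
  by rewrite e roots_cat nth_cat size_roots ltnn subnn /=.
have [n0 s0] := nthr _ _ e0; have [n1 s1] := nthr _ _ e1.
have : nth 0%R (roots ts) (size t0) == nth 0%R (roots ts) (size t1) by rewrite n0 n1 ee.
rewrite nth_uniq // => /eqP es.
have et : t0 = t1.
  have h0 : take (size t0) ts = t0 by rewrite e0 take_size_cat.
  have h1 : take (size t1) ts = t1 by rewrite e1 take_size_cat.
  by rewrite -h0 es h1.
by have := order_gt0 c; rewrite -/h -k1 -et k0.
Qed.

(** G is invariant under psi, so twice the sum over r is the sum over r and psi r together, where
    each letter occurs h times. *)
Lemma val_rec a r : okst J w a r ->
  (2 * size a * nred (a ++ r) w = (#[wprod a] + 2) * \sum_(q <- a) G q)%N.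
Proof.
move=> ok; rewrite -mulnA (val_sum ok) mulnDr mulnDl addnC; congr (_ + _)%N.
rewrite mulSn mul1n -{2}(eq_big_seq _ (G_psi ok)) -(big_map psi xpredT G) -big_cat.
have [ua ea rr er cr] := ok.
have mem x : x \in r ++ map psi r -> x \in a.
  rewrite (ltr_mem _ ea) mem_cat => /orP[/(allP (okst_all ok))//|/mapP[y yr ->]].
  by apply: (psiJ JS lw); apply: (allP (okst_all ok)).
rewrite big_distrr /= [RHS]big_seq.
have eo q : q \in a -> #[wprod a] = count_mem q (r ++ map psi r).
  by move=> qa; rewrite (count_order ok) // -(ltr_mem _ ea).
under [RHS]eq_bigr => q qa do rewrite (eo q qa).
rewrite -big_seq; elim: (r ++ _) mem => [|x l IH] mem /=.
  by rewrite big_nil big1.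
rewrite big_cons IH; last by move=> y yl; apply: mem; rewrite inE yl orbT.
under [RHS]eq_bigr do rewrite mulnDl.
rewrite big_split /=; congr (_ + _)%N.
rewrite (big_rem x (mem _ (mem_head _ _))) /= eqxx mul1n big_seq big1 ?addn0 // => y.
by rewrite mem_rem_uniq // !inE eq_sym => /andP[/negbTE-> _].
Qed.

End CoxeterNumber.
End J.

Lemma Nval0 : Nval set0 1.
Proof.
move=> w a r lw [ua ea rr er cr].
have -> : a = [::] by case: a ea {ua cr} => // t a /setP/(_ t); rewrite !inE eqxx.
have w1 : w = 1 by have := longest_gen lw; rewrite gen0 inE => /eqP.
move: (red_size rr); rewrite er w1 len1 => /size0nil ->.
by rewrite /= eqxx.
Qed.

Lemma Nval_rec J (G : gT -> nat) h n : J \subset S -> J != set0 ->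
    {in J &, forall s t, connect (fun s t => [&& s \in J, t \in J & s * t != t * s]) s t} ->
    (forall v, supp S v -> (bil X v v <= 0)%R -> v = 0%R) ->
    (forall q, q \in J -> Nval (J :\ q) (G q)) ->
    (forall a, uniq a -> ltr a = J -> #[wprod a] = h) ->
    (2 * #|J| * n = (h + 2) * \sum_(q in J) G q)%N -> Nval J n.
Proof.
move=> JS J0 con pd GP hP e w a r lw ok; have [ua ea rr er cr] := ok.
have szJ : size a = #|J| by rewrite -(card_uniqP ua) -ea; apply: eq_card => q; rewrite inE.
have := val_rec JS lw GP con pd ok; rewrite (hP a ua ea) szJ (big_uniq _ ua) /=.
rewrite (eq_bigl [in J]) => [|q]; last by rewrite (ltr_mem _ ea).
by rewrite -e => /eqP; rewrite eqn_pmul2l ?muln_gt0 ?card_gt0 // => /eqP.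
Qed.

Lemma om_filter J a u v : supp J u -> supp J v ->
  om [seq s <- a | s \in J] u v = om a u v.
Proof.
move=> /suppP su /suppP sv.
have ps t p (y : {ffun gT -> R}) : supp J y -> psum X t [seq s <- p | s \in J] y = psum X t p y.
  move=> /suppP sy; elim: p => //= q p IH; rewrite psum_cons -IH.
  by case: ifP => [_|/negbT /sy ->]; rewrite ?psum_cons // mulr0 add0r.
elim: a => //= t a IH; case: ifP => [tJ|/negbT tJ] /=.
  by rewrite IH !ps //; apply/suppP.
by rewrite su // sv // !mul0r subr0 add0r IH.
Qed.

Section Product.
Variables J K : {set gT}.
Hypotheses (JS : J \subset S) (KS : K \subset S) (dJK : [disjoint J & K]).
Hypothesis cJK : {in J & K, forall s t, s * t = t * s}.

Lemma act_comm y v : y \in <<K>> -> supp J v -> act y v = v.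
Proof.
move=> /(gen_word _ KS)[b + <-] sv; elim: b => [|s b IH] /=; first by rewrite wprod_nil act1.
case/andP=> sK bK; rewrite wprod_cons actM IH //; apply/ffunP=> t.
rewrite actE ?(subsetP KS) // (_ : pair s v = 0%R) ?mul0r ?subr0 //.
rewrite /pairing big1 // => q qS; case: (boolP (q \in J)) => qJ; last first.
  by rewrite (suppP _ _ sv) // mulr0.
have -> : A s q = 0%R; last by rewrite mul0r.
apply/eqP; rewrite (cartan_eq0 X (subsetP KS _ sK) qS) (cJK qJ sK) eqxx andbT.
by apply: contraTneq sK => ->; rewrite (disjointFr dJK qJ).
Qed.

Lemma subseq_roots_filter r : all [in J :|: K] r ->
  subseq (roots [seq s <- r | s \in J]) (roots r).
Proof.
elim: r => //= s r IH /andP[sJK rJK]; case: ifP => sJ /=.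
  by rewrite eqxx map_subseq ?IH.
have sK : s \in K by move: sJK; rewrite inE sJ.
apply: subseq_trans (subseq_cons _ _).
have e : map (act s) (roots [seq i <- r | i \in J]) = roots [seq i <- r | i \in J].
  rewrite -[RHS]map_id; apply/eq_in_map => v vr; apply: act_comm; first by rewrite mem_gen.
  by apply: (roots_supp JS _ vr); apply: filter_all.
by rewrite -{1}e map_subseq ?IH.
Qed.

Lemma wprod_filter r : all [in J :|: K] r ->
  wprod r = wprod [seq s <- r | s \in J] * wprod [seq s <- r | s \in K].
Proof.
elim: r => [_|s r IH /= /andP[sJK rJK]]; first by rewrite /= wprod_nil mulg1.
rewrite wprod_cons IH //; case: (boolP (s \in J)) => sJ.
  by rewrite (disjointFr dJK sJ) wprod_cons mulgA.
have sK : s \in K by move: sJK; rewrite inE (negbTE sJ).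
rewrite sK wprod_cons !mulgA; congr (_ * _).
elim: (r) => [|q l IHl] /=; first by rewrite wprod_nil mulg1 mul1g.
case: ifP => // qJ; rewrite wprod_cons mulgA -(cJK qJ sK) -!mulgA; congr (_ * _).
by rewrite IHl.
Qed.

(** Letters of K fix the vectors supported on J, so deleting them from r only thins out the root
    sequence. *)
Lemma okst_filter a r w : longest X (J :|: K) w -> okst (J :|: K) w a r ->
  longest X J (wprod [seq s <- r | s \in J]) /\
  okst J (wprod [seq s <- r | s \in J]) [seq s <- a | s \in J] [seq s <- r | s \in J].
Proof.
move=> lw ok; have JKS : J :|: K \subset S by rewrite subUset JS KS.
have rJK := okst_all JKS lw ok; have [ua ea rr er cr] := ok.
set rJ := [seq s <- r | s \in J]; set rK := [seq s <- r | s \in K].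
have eprod : w = wprod rJ * wprod rK by rewrite -er wprod_filter.
have gJ : wprod rJ \in <<J>> by apply/(gen_word _ JS); exists rJ; rewrite ?filter_all.
have gK : wprod rK \in <<K>> by apply/(gen_word _ KS); exists rK; rewrite ?filter_all.
have rJS : all [in S] rJ by apply: (all_sub JS); apply: filter_all.
have rKS : all [in S] rK by apply: (all_sub KS); apply: filter_all.
have sz : size r = (size rJ + size rK)%N.
  rewrite !size_filter -count_predUI -[LHS]addn0; congr (_ + _)%N.
    apply/esym/eqP; rewrite -all_count; apply: sub_all rJK => s; by rewrite !inE.
  apply/esym/eqP; rewrite -leqn0 leqNgt -has_count; apply/hasPn=> s _ /=.
  by apply/negP=> /andP[sJ]; rewrite (disjointFr dJK sJ).
have rrJ : red rJ.
  apply: red_of_size => //; have := lenM X (wprod rJ) (wprod rK).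
  rewrite -eprod -er -(red_size rr) sz; have := len_word X rKS.
  by move: (len (wprod rJ)) (len (wprod rK)) (size rJ) (size rK) => n1 n2 n3 n4; clear; lia.
have lJ : longest X J (wprod rJ).
  rewrite /longest gJ; apply/forall_inP=> j jJ; have jS := subsetP JS _ jJ.
  case/andP: lw => _ /forall_inP/(_ j); rewrite inE jJ => /(_ isT).
  rewrite eprod invMg actM act_comm ?groupV //.
  by rewrite (supp_act X JS) ?groupV // supp_al.
split=> //; split=> //; first by rewrite filter_uniq.
  apply/setP=> q; rewrite inE mem_filter (ltr_mem _ ea) inE.
  by case: (q \in J).
rewrite (@compat_eq _ _ _ X _ a); first exact: subseq_pairwise (subseq_roots_filter rJK) cr.
have fJ : all [in J] rJ by apply: filter_all.
by move=> u v ur vr; rewrite om_filter // ?(roots_supp JS fJ ur) ?(roots_supp JS fJ vr).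
Qed.

End Product.

Lemma Nval_prod J K n n' : J \subset S -> K \subset S -> [disjoint J & K] ->
  {in J & K, forall s t, s * t = t * s} -> Nval J n -> Nval K n' -> Nval (J :|: K) (n * n')%N.
Proof.
move=> JS KS dJK cJK vJ vK w a r lw ok.
have JKS : J :|: K \subset S by rewrite subUset JS KS.
have rJK := okst_all JKS lw ok; have [ua ea rr er cr] := ok.
have [lJ okJ] := okst_filter JS KS dJK cJK lw ok.
have dKJ : [disjoint K & J] by rewrite disjoint_sym.
have cKJ : {in K & J, forall s t, s * t = t * s} by move=> s t sK tJ; apply/esym/cJK.
rewrite setUC in lw ok; have [lK okK] := okst_filter KS JS dKJ cKJ lw ok.
have aJK : all [in J :|: K] a by apply/allP=> q; rewrite (ltr_mem _ ea).
have e : w = wprod [seq s <- r | s \in J] * wprod [seq s <- r | s \in K].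
  by rewrite -er; apply: wprod_filter.
rewrite {1}e (nred_prod X JS KS dJK cJK) ?all_cat ?aJK ?rJK ?(longest_gen lJ) ?(longest_gen lK) //.
by rewrite !filter_cat (vJ _ _ _ lJ okJ) (vK _ _ _ lK okK).
Qed.

End Recurrence.

(** * Sortable elements and reduced subwords *)

Section Sortable.
Variables (gT : finGroupType) (S : {set gT}) (R : realFieldType).
Variable X : coxrep S R.
Implicit Types (s t q w x y z g m : gT) (a b r p : seq gT) (v : {ffun gT -> R}).
Implicit Types (i j k : nat) (ps : seq nat).
Notation act := (act X).
Notation len := (len X).
Notation red := (red X).
Notation nred := (nred X).
Notation roots := (roots X).
Notation om := (om X).
Notation compat := (compat X).
Notation sortable := (sortable S).
Notation rsub := (reduced_subword S).
Notation let_ := cinf_letter.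

Lemma reduced_wordP a w : reduced_word S a w <-> red a /\ wprod a = w.
Proof.
split=> [[[aS aw] min]|[ra <-]].
  have aS' : all [in S] a by apply/allP.
  split; last by rewrite /wprod.
  apply: red_of_size => //; have [b rb eb] := red_exists X (wprod a).
  rewrite -eb -(red_size rb); apply: min; split; last by rewrite -aw -/(wprod b) eb.
  by apply/allP; exact: red_all rb.
split; first by split; [apply/allP; exact: red_all ra | ].
move=> b [bS bw]; rewrite (red_size ra) -bw -/(wprod b); apply: (len_word X).
by apply/allP.
Qed.

Lemma let_rot s p k : let_ (rcons p s) k = let_ (s :: p) k.+1.
Proof.
rewrite /let_ size_rcons /=; set n := (size p).+1.
have kn : k %% n < n by rewrite ltn_mod.
have -> : k.+1 %% n = (k %% n).+1 %% n by rewrite -addn1 -modnDml addn1.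
move: (k %% n) kn => i; rewrite ltnS leq_eqVlt => /orP[/eqP->|lt].
  by rewrite modnn nth_rcons ltnn eqxx.
by rewrite modn_small ?ltnS // nth_rcons lt.
Qed.

Lemma div_succ n k : 0 < n -> k.+1 %% n != 0 -> k.+1 %/ n = k %/ n.
Proof.
move=> n0; rewrite {1}(divn_eq k n) -addnS modnMDl => h.
have lt : (k %% n).+1 < n.
  rewrite ltn_neqAle ltn_mod n0 andbT; apply: contra h => /eqP ->; by rewrite modnn.
by rewrite {1}(divn_eq k n) -addnS divnMDl // (divn_small lt) addn0.
Qed.

Lemma mem_block a ps k x : (x \in block a ps k) =
  has (fun i => (i %/ size a == k) && (let_ a i == x)) ps.
Proof.
rewrite inE; apply/mapP/hasP => [[i + ->]|[i ip /andP[ik /eqP ix]]].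
  by rewrite mem_filter => /andP[ik ip]; exists i => //; rewrite ik eqxx.
by exists i => //; rewrite mem_filter ik.
Qed.

Lemma let_headE s p k : s != 1 -> s \notin p -> (let_ (s :: p) k == s) = (k %% (size p).+1 == 0).
Proof.
move=> s1 sp; rewrite /let_ /=; case: (k %% _) => [|i] /=; first by rewrite eqxx.
apply/negbTE; case: (ltnP i (size p)) => h; last by rewrite nth_default // eq_sym.
by apply: contra sp => /eqP <-; rewrite mem_nth.
Qed.

(** Rotating s :: p moves each divider across one occurrence of s and across no other letter. *)
Lemma block_shift s p ps k x : x != s ->
  (x \in block (s :: p) (map succn ps) k) = (x \in block (rcons p s) ps k).
Proof.
move=> xs; rewrite !mem_block has_map; apply: eq_has => i /=.
rewrite size_rcons let_rot; have [e|] := eqVneq (let_ (s :: p) i.+1) x; last by rewrite !andbF.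
rewrite !andbT div_succ //; apply: contra xs => /eqP h.
by rewrite -e /let_ /= h.
Qed.

(** Here the divider is crossed, so occurrences of s move down by one block. *)
Lemma block_head s p ps k : s != 1 -> s \notin p ->
  (s \in block (s :: p) (map succn ps) k.+1) = (s \in block (rcons p s) ps k).
Proof.
move=> s1 sp; rewrite !mem_block has_map; apply: eq_has => i /=.
rewrite size_rcons let_rot let_headE //.
case: (eqVneq (i.+1 %% (size p).+1) 0) => [h|_]; last by rewrite !andbF.
rewrite !andbT.
have := divn_eq i.+1 (size p).+1; rewrite h addn0.
case: (i.+1 %/ _) => // j ej; have -> : i = j * (size p).+1 + size p.
  by move: ej; rewrite mulSn => /eqP; rewrite addSn eqSS => /eqP ->; rewrite addnC.
by rewrite divnMDl // divn_small // addn0 eqSS.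
Qed.

Lemma sorted_split ps : sorted ltn ps ->
  (exists2 ps', sorted ltn ps' & ps = map succn ps') \/
  (exists2 ps', sorted ltn ps' & ps = 0 :: map succn ps').
Proof.
have pos l : all (fun i => 0 < i) l -> sorted ltn l ->
    exists2 l', sorted ltn l' & l = map succn l'.
  move=> l0 sl; exists (map predn l); last first.
    rewrite -map_comp -[LHS]map_id; apply/eq_in_map => i /(allP l0) /=.
    by case: i.
  rewrite sorted_map; apply: (sub_in_sorted (P := fun i => 0 < i)) sl => //.
  by move=> i j; rewrite /in_mem /=; case: i; case: j.
case: ps => [|[|i] ps] srt; first by left; exists [::].
  right; move: srt; rewrite /= (path_sortedE ltn_trans) => /andP[ps0 srt].
  by have [l' sl' ->] := pos ps ps0 srt; exists l'.
left; apply: pos => //=; move: srt; rewrite /= (path_sortedE ltn_trans) => /andP[+ _].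
by apply: sub_all => j; apply: leq_trans.
Qed.

Lemma map_let_rot s p ps : map (let_ (s :: p)) (map succn ps) = map (let_ (rcons p s)) ps.
Proof. by rewrite -map_comp; apply: eq_map => i /=; rewrite let_rot. Qed.

Lemma sorted_succ ps : sorted ltn (map succn ps) = sorted ltn ps.
Proof. by rewrite sorted_map. Qed.

Lemma path0_succ ps : sorted ltn (0 :: map succn ps) = sorted ltn ps.
Proof.
rewrite /= (path_sortedE ltn_trans) all_map -[RHS]sorted_succ.
by rewrite (eq_all (a2 := predT)) ?all_predT.
Qed.

Lemma rsub_shift s p w ps : rsub (s :: p) w (map succn ps) <-> rsub (rcons p s) w ps.
Proof. by rewrite /reduced_subword sorted_succ map_let_rot. Qed.

Lemma rsub_cons s p w ps : s \in S -> len (s * w) < len w ->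
  rsub (s :: p) w (0 :: map succn ps) <-> rsub (rcons p s) (s * w) ps.
Proof.
move=> sS lt; rewrite /reduced_subword path0_succ map_cons map_let_rot.
have -> : let_ (s :: p) 0 = s by rewrite /let_ mod0n.
set b := map _ ps; split=> -[srt /reduced_wordP[rb eb]]; split=> //; apply/reduced_wordP.
  move: rb eb; rewrite red_cons wprod_cons => /and3P[_ rb _] <-.
  by rewrite (mulSS X).
by rewrite red_cons wprod_cons eb (mulSS X) // sS rb lt.
Qed.

Lemma lexi_succ ps ps' :
  ((map succn ps : seqlexi nat) <= (map succn ps' : seqlexi nat))%O =
  ((ps : seqlexi nat) <= (ps' : seqlexi nat))%O.
Proof.
elim: ps ps' => [|i ps IH] [|j ps'] //=.
by rewrite !lexi_cons IH !leEnat !ltnS.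
Qed.

Lemma lexi0 ps ps' :
  (((0 :: ps) : seqlexi nat) <= ((0 :: ps') : seqlexi nat))%O =
  ((ps : seqlexi nat) <= (ps' : seqlexi nat))%O.
Proof. by rewrite lexi_cons lexx. Qed.

Lemma embed a b k : a != [::] -> {subset b <= a} ->
  exists2 ps, sorted ltn ps && all (fun i => k <= i) ps & map (let_ a) ps = b.
Proof.
move=> a0; have n0 : 0 < size a by case: a a0.
elim: b k => [|x b IH] k ba; first by exists [::].
have xa : x \in a by apply: ba; rewrite mem_head.
(* The occurrence of x in block k, at a position not below k since a is nonempty. *)
pose i := size a * k + index x a.
have [|ps /andP[srt lb] e] := IH i.+1; first by move=> y yb; apply: ba; rewrite inE yb orbT.
exists (i :: ps); last first.
  rewrite /= e; congr (_ :: _); rewrite /let_ /i mulnC modnMDl modn_small ?index_mem //.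
  by rewrite nth_index.
have ki : k <= i by rewrite /i; apply: leq_trans (leq_addr _ _); rewrite leq_pmull.
rewrite /= (path_sortedE ltn_trans) srt lb ki /=; apply: sub_all lb => j.
by move=> /ltnW; apply: leq_trans.
Qed.

Lemma rsub_letters a w ps : rsub a w ps -> {subset map (let_ a) ps <= a} /\
   all [in S] (map (let_ a) ps).
Proof.
case=> _ /reduced_wordP[rb _]; have bS := red_all rb; split=> //.
move=> x xb; have xS := allP bS x xb; move/mapP: xb => [i _ ex].
(* For empty a every letter of c^infty is the default 1, which is not in S. *)
case: (posnP (size a)) => [/size0nil a0|n0].
  by move: (S_neq1 X xS); rewrite ex a0 /let_ nth_nil eqxx.
by rewrite ex /let_ mem_nth // ltn_mod.
Qed.

(** A placeholder 1 occupies a position that no reduced word can use, so rotating it only shifts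
    positions. *)
Lemma sortable_skip p w : sortable (1 :: p) w <-> sortable (rcons p 1) w.
Proof.
have no0 ps' : ~ rsub (1 :: p) w (0 :: ps').
  case=> _ /reduced_wordP[/red_all /= /andP[+ _] _].
  rewrite /let_ mod0n /= => h; by have := S_neq1 X h; rewrite eqxx.
have blk ps k : rsub (rcons p 1) w ps ->
    block (1 :: p) (map succn ps) k = block (rcons p 1) ps k.
  move=> rs; apply/setP=> x; have [->|x1] := eqVneq x 1; last by rewrite block_shift.
  have [_ bS] := rsub_letters rs.
  have n1 : 1 \notin map (let_ (rcons p 1)) ps.
    by apply/negP=> /(allP bS) h; have := S_neq1 X h; rewrite eqxx.
  rewrite !mem_block has_map; transitivity false; last first.
    apply/esym/negbTE/hasPn=> i ip; rewrite negb_and orbC; apply/orP; left.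
    by apply: contra n1 => /eqP e; apply/mapP; exists i.
  apply/negbTE/hasPn=> i ip /=; rewrite -let_rot negb_and orbC; apply/orP; left.
  by apply: contra n1 => /eqP e; apply/mapP; exists i.
split=> [[ps [rs min] nest]|[ps [rs min] nest]].
  have [srt _] := rs; case: (sorted_split srt) => [[ps' srt' e]|[ps' srt' e]]; last first.
    by move: rs; rewrite e => /no0.
  rewrite e in rs min nest; have rs' := (rsub_shift _ _ _ _).1 rs.
  exists ps'; last by move=> k; rewrite -!blk.
  split=> // q rq; rewrite -lexi_succ; apply: min; exact/rsub_shift.
exists (map succn ps); last by move=> k; rewrite !blk.
split; first exact/rsub_shift.
move=> q rq; have [srt _] := rq; case: (sorted_split srt) => [[q' srt' e]|[q' srt' e]]; last first.
  by move: rq; rewrite e => /no0.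
by rewrite e lexi_succ; apply: min; apply/rsub_shift; rewrite -e.
Qed.

(** By exchange some reduced word of w begins with s, so the lexicographically first subword uses
    position 0. Removing it shifts the other positions into the rotated c^infty; the inclusions of
    blocks survive because s lies in block 0. *)
Lemma sortable_take s p w : s \in S -> s \notin p -> len (s * w) < len w ->
  sortable (s :: p) w <-> sortable (rcons p s) (s * w).
Proof.
move=> sS sp lt; have s1 := S_neq1 X sS.
have w1 ps a : rsub a w ps -> ps != [::].
  case=> _ /reduced_wordP[_]; case: ps => // e; move: lt.
  by rewrite -e /= wprod_nil mulg1 len1.
have nestE ps : (forall k, block (s :: p) (0 :: map succn ps) k.+1 \subset
                   block (s :: p) (0 :: map succn ps) k) <->
    (forall k, block (rcons p s) ps k.+1 \subset block (rcons p s) ps k).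
  have b0 x k : x != s -> (x \in block (s :: p) (0 :: map succn ps) k) =
      (x \in block (rcons p s) ps k).
    move=> xs; rewrite -block_shift // !mem_block /=.
    by rewrite {1}/let_ mod0n /= [s == x]eq_sym (negbTE xs) andbF.
  have b1 k : (s \in block (s :: p) (0 :: map succn ps) k.+1) =
      (s \in block (rcons p s) ps k).
    by rewrite -block_head // !mem_block /= div0n.
  have b2 : s \in block (s :: p) (0 :: map succn ps) 0.
    by rewrite mem_block /= /let_ mod0n /= eqxx ?div0n.
  split=> H k; apply/subsetP=> x; have [->|xs] := eqVneq x s.
  - by rewrite -!b1; apply: (subsetP (H k.+1)).
  - by rewrite -!b0 //; apply: (subsetP (H k)).
  - case: k => [|k]; first by rewrite b2.
    by rewrite !b1; apply: (subsetP (H k)).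
  - by rewrite !b0 //; apply: (subsetP (H k)).
split=> [[ps [rs min] nest]|[ps [rs min] nest]].
  have [ps' e] : exists ps', ps = 0 :: map succn ps'.
    have [srt /reduced_wordP[rb eb]] := rs.
    have lt' : len (s * wprod (map (let_ (s :: p)) ps)) < len (wprod (map (let_ (s :: p)) ps)).
      by rewrite eb.
    have [b1 [q [b2 [eb' _ es]]]] := exchange rb sS lt'.
    have [sub bS] := rsub_letters rs.
    have sub' : {subset b1 ++ b2 <= rcons p s}.
      move=> y; rewrite mem_cat mem_rcons => yb; apply: sub; rewrite eb' mem_cat inE.
      by case/orP: yb => ->; rewrite ?orbT.
    have [|qs /andP[sq _] eq] := @embed (rcons p s) _ 0 _ sub'; first by case: (p).
    have rq : rsub (s :: p) w (0 :: map succn qs).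
      apply/rsub_cons => //; split=> //; rewrite eq; apply/reduced_wordP.
      rewrite -es eb; split=> //; apply: red_of_size.
        move: bS; rewrite eb' !all_cat /= => /andP[-> /andP[_ ->]] //.
      rewrite -es eb; have := red_size rb; rewrite eb eb' !size_cat /= addnS => e1.
      by have := len_mull X w sS; rewrite -e1; move: lt; rewrite -e1; move: (len (s * w)) => l; clear; lia.
    case: (sorted_split srt) => [[ps' _ e]|[ps' _ ->]]; last by exists ps'.
    have := min _ rq; rewrite e; case: ps' e => [|i ps'] e.
      by have := w1 _ _ rs; rewrite e.
    by rewrite /= lexi_cons leEnat.
  rewrite e in rs min nest; exists ps'; last exact/nestE.
  split; first exact/rsub_cons.
  by move=> q rq; rewrite -lexi_succ -lexi0; apply: min; apply/rsub_cons.
exists (0 :: map succn ps); last exact/nestE.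
split; first exact/rsub_cons.
move=> q rq; have [srt _] := rq; case: (sorted_split srt) => [[q' srt' e]|[q' srt' e]]; last first.
  by rewrite e lexi0 lexi_succ; apply: min; apply/rsub_cons => //; rewrite -e.
rewrite e; case: q' e {srt'} => [|i q'] e; first by have := w1 _ _ rq; rewrite e.
by rewrite /= lexi_cons leEnat.
Qed.

Lemma let_drop s p i : let_ (s :: p) i != s -> let_ (1 :: p) i = let_ (s :: p) i.
Proof. by rewrite /let_ /=; case: (i %% _) => //=; rewrite eqxx. Qed.

(** If s is not a descent, position 0 is not taken, so s is missing from block 0 and, by inclusion,
    from every block. *)
Lemma sortable_drop s p w : s \in S -> s \notin p -> {subset p <= 1 |: S} ->
  len w < len (s * w) -> sortable (s :: p) w <-> sortable (1 :: p) w.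
Proof.
move=> sS sp pS lt; have s1 := S_neq1 X sS.
have let1 i : let_ (1 :: p) i != 1 -> let_ (1 :: p) i = let_ (s :: p) i.
  by rewrite /let_ /=; case: (i %% _) => //=; rewrite eqxx.
have rs1 ps : rsub (1 :: p) w ps -> rsub (s :: p) w ps /\ {in ps, forall i, let_ (1 :: p) i = let_ (s :: p) i}.
  move=> rs; have [_ bS] := rsub_letters rs; have [srt rw] := rs.
  have H : {in ps, forall i, let_ (1 :: p) i = let_ (s :: p) i}.
    move=> i ip; apply: let1; apply: (S_neq1 X); apply: (allP bS); exact: map_f.
  split=> //; split=> //.
  have <- : map (let_ (1 :: p)) ps = map (let_ (s :: p)) ps by apply/eq_in_map.
  by [].
have rs2 ps : rsub (s :: p) w ps -> {in ps, forall i, let_ (s :: p) i != s} ->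
    rsub (1 :: p) w ps.
  move=> [srt rw] H; split=> //.
  have -> : map (let_ (1 :: p)) ps = map (let_ (s :: p)) ps by apply/eq_in_map => i /H /let_drop.
  by [].
have blk ps k : {in ps, forall i, let_ (1 :: p) i = let_ (s :: p) i} ->
    block (1 :: p) ps k = block (s :: p) ps k.
  by move=> H; apply/setP=> x; rewrite !mem_block; apply: eq_in_has => i /H ->.
split=> [[ps [rs min] nest]|[ps [rs min] nest]].
  have H : {in ps, forall i, let_ (s :: p) i != s}.
    have nos k : s \notin block (s :: p) ps k.
      elim: k => [|k IH]; last by apply: contra IH; apply: (subsetP (nest k)).
      rewrite mem_block; apply/hasPn=> i ip; apply/negP=> /andP[/eqP i0].
      rewrite let_headE // => im; have i00 : i = 0.
        by rewrite (divn_eq i (size p).+1) i0 (eqP im).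
      have [srt /reduced_wordP[rb eb]] := rs.
      have : exists ps', ps = 0 :: ps'.
        rewrite i00 in ip; case: (sorted_split srt) => [[ps' _ e]|[ps' _ e]]; last by exists (map succn ps').
        by move: ip; rewrite e => /mapP[].
      case=> ps' e; move: rb eb; rewrite e /= {1 2}/let_ mod0n /= red_cons wprod_cons.
      move=> /and3P[_ _ lt2] e2; move: lt; rewrite -e2 (mulSS X) // => lt3.
      by have := ltn_trans lt2 lt3; rewrite ltnn.
    move=> i ip; apply: contra (nos (i %/ (size p).+1)) => h.
    by rewrite mem_block; apply/hasP; exists i => //; rewrite eqxx h.
  have rs' := rs2 _ rs H; have [_ H'] := rs1 _ rs'.
  exists ps; last by move=> k; rewrite !blk.
  by split=> // q rq; apply: min; have [] := rs1 _ rq.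
have [rs' H'] := rs1 _ rs.
exists ps; last by move=> k; rewrite -!blk.
split=> // q rq; apply: min; apply: rs2 => // i iq.
(* All reduced words of w stay inside the letters of p, so no competing subword contains s. *)
pose J := [set x in p | x \in S].
have JS : J \subset S by apply/subsetP=> x; rewrite inE => /andP[].
have [sub bS] := rsub_letters rs; have [_ /reduced_wordP[rb eb]] := rs.
have wJ : w \in <<J>>.
  apply/(gen_word _ JS); exists (map (let_ (1 :: p)) ps) => //; apply/allP=> x xb.
  rewrite inE (allP bS) // andbT; have := sub _ xb; rewrite inE => /predU1P[x1|//].
  by have := S_neq1 X (allP bS _ xb); rewrite x1 eqxx.
have [_ /reduced_wordP[rc ec]] := rq.
have := red_gen JS rc; rewrite ec => /(_ wJ)/allP/(_ _ (map_f _ iq)).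
by rewrite inE => /andP[ip _]; apply: contraNneq sp => <-.
Qed.

Lemma sortable_gen a w : sortable a w -> w \in <<[set x in a | x \in S]>>.
Proof.
case=> ps [rs _] _; have [sub bS] := rsub_letters rs; have [_ /reduced_wordP[rb eb]] := rs.
have JS : [set x in a | x \in S] \subset S by apply/subsetP=> x; rewrite inE => /andP[].
apply/(gen_word _ JS); exists (map (let_ a) ps) => //; apply/allP=> x xb.
by rewrite inE sub // (allP bS).
Qed.

Lemma sortable1 a : sortable a 1.
Proof.
exists [::]; last by move=> k; apply/subsetP=> x; rewrite !mem_block.
split; last by move=> q _; rewrite lexi0s.
by split=> //; apply/reduced_wordP; rewrite red_nil wprod_nil.
Qed.

(** The weak order: some reduced word of x begins with one of w. *)
Definition weak w x : bool := len w + len (w^-1 * x) == len x.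

Lemma weak_descent s w x : s \in S -> len (s * w) < len w -> weak w x -> len (s * x) < len x.
Proof.
move=> sS lt /eqP <-; have := lenM X (s * w) (w^-1 * x).
have -> : s * w * (w^-1 * x) = s * x by rewrite !mulgA mulgK.
by move: (len (s * x)) (len (s * w)) (len w) (len (w^-1 * x)) lt => a b c d; clear; lia.
Qed.

Lemma weak_cons s w x : s \in S -> len (s * x) < len x ->
  (len (s * w) < len w) && weak w x = weak (s * w) (s * x).
Proof.
move=> sS ltx; apply/andP/idP => [[ltw /eqP e]|wk].
  apply/eqP; have -> : (s * w)^-1 * (s * x) = w^-1 * x.
    by rewrite invMg (invS X sS) -!mulgA (mulSS X).
  have := len_mull X w sS; have := len_mull X x sS; move: e ltw ltx.
  by move: (len (s * x)) (len (s * w)) (len w) (len x) (len (w^-1 * x)) => a b c d f; clear; lia.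
have ltw : len (s * w) < len w.
  case: (ltnP (len (s * w)) (len w)) => // ge.
  have lt2 : len (s * (s * w)) < len (s * w).
    rewrite (mulSS X) //; have := len_mull X w sS; move: ge.
    by move: (len (s * w)) (len w) => a b; clear; lia.
  have := weak_descent sS lt2 wk; rewrite (mulSS X) // => lt3.
  by have := ltn_trans ltx lt3; rewrite ltnn.
split=> //; apply/eqP; move/eqP: wk.
have -> : (s * w)^-1 * (s * x) = w^-1 * x.
  by rewrite invMg (invS X sS) -!mulgA (mulSS X).
have := len_mull X w sS; have := len_mull X x sS; move: ltw ltx.
by move: (len (s * x)) (len (s * w)) (len w) (len x) (len (w^-1 * x)) => a b c d f; clear; lia.
Qed.

Lemma weak_gen (J : {set gT}) w g m : J \subset S -> w \in <<J>> -> g \in <<J>> ->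
  jmin X J m -> weak w (g * m) = weak w g.
Proof.
move=> JS wJ gJ mm; have wgJ : w^-1 * g \in <<J>> by rewrite groupM ?groupV.
by rewrite /weak mulgA (lenJ JS wgJ mm) (lenJ JS gJ mm) addnA eqn_add2r.
Qed.

(** Restricting to elements below x makes the count recursive: x becomes s * x when s is taken, and
    its component in a parabolic subgroup when s is dropped. *)
Definition cnt a x : nat := #|[set w | `[< sortable a w >] & weak w x]|.

Definition letters a := [seq s <- a | s != 1].

(* The letter 1 stands for a letter of the Coxeter word that has been deleted. *)
Definition padded a : bool := uniq (letters a) && all [in 1 |: S] a.

Lemma letters_all a : padded a -> all [in S] (letters a).
Proof.
case/andP=> _ /allP aS; apply/allP=> q; rewrite mem_filter => /andP[q1 /aS].
by rewrite !inE (negbTE q1).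
Qed.

(** The exchanged letter has the root alpha_s, and compatibility makes the roots before it
    orthogonal to alpha_s. So the letters before it commute with s, and s comes to the front. *)
Lemma compat_descent s p r : uniq (s :: p) -> all [in S] (s :: p) -> red r ->
    all [in ltr (s :: p)] r -> compat (s :: p) r -> len (s * wprod r) < len (wprod r) ->
  exists r', [/\ red r', wprod r' = s * wprod r, all [in ltr (s :: p)] r',
    compat (rcons p s) r' & forall P y, nred (P ++ r) y = nred (P ++ s :: r') y].
Proof.
move=> ua aS rr rJ cr lt; have sS : s \in S by case/andP: aS.
have [r1 [q [r2 [er eq es]]]] := exchange rr sS lt.
have JS := ltr_sub aS.
have rS : all [in S] r1 && all [in S] (q :: r2) by rewrite -all_cat -er (red_all rr).
case/andP: rS => r1S /andP[qS r2S].
have urs := red_roots_uniq rr; rewrite er roots_cat cat_uniq /= eq in urs.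
have orth : {in roots r1, forall v, pairing S (ck X) s v = 0%R}.
  move=> v vr; have vr' : v \in roots r by rewrite er roots_cat mem_cat vr.
  apply: (om_init_orth ua aS) (roots_root (red_all rr) vr') (red_roots_pos rr vr')
     (roots_supp JS rJ vr') _ _.
    by case/and3P: urs => _ /norP[h _] _; apply: contraNneq h => <-.
  move: cr; rewrite /compat er roots_cat pairwise_cat => /and3P[/allrelP h _ _].
  by apply: h => //=; rewrite eq mem_head.
have [fs cs] := orth_word sS r1S orth.
have qs : q = s.
  have : act (wprod r1) (al q) = act (wprod r1) (al s) by rewrite eq fs.
  move/act_inj/(congr1 (fun f : {ffun gT -> R} => f q))/eqP; rewrite !ffunE eqxx.
  by rewrite eqr_nat; case: (eqVneq q s).
have csr : s * wprod r1 = wprod r1 * s.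
  elim: r1 cs {er eq es urs orth fs r1S} => [|z l IH] c; first by rewrite wprod_nil mulg1 mul1g.
  rewrite !wprod_cons mulgA (c z (mem_head _ _)).1 -!mulgA IH // => y yl.
  by apply: c; rewrite inE yl orbT.
rewrite qs in er; exists (r1 ++ r2); split.
- apply: red_of_size; first by rewrite all_cat r1S.
  rewrite -es; have := red_size rr; rewrite {1}er !size_cat /= addnS => e1.
  have := len_mull X (wprod r) sS; rewrite -e1; move: lt; rewrite -e1.
  by move: (len (s * wprod r)) => l; clear; lia.
- by [].
- by move: rJ; rewrite er !all_cat /= => /and3P[-> _ ->].
- have sub : subseq (map (act s) (roots (r1 ++ r2))) (roots r).
    rewrite er !roots_cat map_cat /=; apply: cat_subseq.
      rewrite (_ : map (act s) _ = roots r1) // -[RHS]map_id; apply/eq_in_map => v vr.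
      by apply/ffunP=> t; rewrite (actE X _ _ sS) orth // mul0r subr0.
    apply: subseq_trans (subseq_cons _ _); rewrite -!map_comp.
    rewrite (_ : map _ _ = map (act (wprod r1) \o act s) (roots r2)) //.
    by apply: eq_map => v /=; rewrite -!actM csr.
  have := subseq_pairwise sub cr; rewrite pairwise_map /compat.
  have r'J : all [in ltr (s :: p)] (r1 ++ r2).
    by move: rJ; rewrite er !all_cat /= => /and3P[-> _ ->].
  apply: pairwise_impl => u v ur vr; have sa : s \in s :: p by rewrite mem_head.
  have H : om (s :: p) (act s u) (act s v) = om (rcons p s) u v.
    have su := supp_root X JS sa (roots_supp JS r'J ur).
    have sv := supp_root X JS sa (roots_supp JS r'J vr).
    have := @om_rot _ _ _ X s p _ _ ua aS su sv.
    by rewrite -!(actM X s s) (S_inv X) // !act1 => <-.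
  by rewrite -H.
- move=> P y; rewrite er; apply: nred_congr => z; apply: nred_move => //.
  by move=> t /cs[].
Qed.

(** Both sides obey Reading's recursion on the first letter s: elements without the descent s match
    subwords that skip the first position, the others match subwords that use it. The inner
    induction rotates placeholders 1 until a genuine letter is first. *)
Theorem cnt_nred a r : padded a -> red r -> all [in ltr (letters a)] r ->
  compat (letters a) r -> cnt a (wprod r) = nred (letters a ++ r) (wprod r).
Proof.
have [n] := ubnP (size (letters a) + size r); elim: n a r => // n IHn a r.
have [j] := ubnP (find (fun s => s != 1) a); elim: j a => // j IHj a.
case: (posnP (size (letters a))) => [/size0nil la|la0].
  move=> _ _ _ _ + _; rewrite la.
  have -> : ltr [::] = set0 :> {set gT} by apply/setP=> z; rewrite !inE.
  clear IHj; case: r => [_|? ? /andP[]]; last by rewrite inE.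
  rewrite wprod_nil /= eqxx /cnt; transitivity #|[set (1 : gT)]|; last exact: cards1.
  apply: eq_card => w.
  rewrite !inE; apply/andP/eqP => [[/asboolP/sortable_gen]|->].
    rewrite (_ : [set x in a | x \in S] = set0) ?gen0 ?inE; first by move=> /eqP.
    apply/setP=> x; rewrite !inE; apply/negbTE/negP=> /andP[xa xS].
    have : x \in letters a by rewrite mem_filter xa (S_neq1 X xS).
    by rewrite la.
  split; first by apply/asboolP; apply: sortable1.
  by rewrite /weak invg1 mulg1 len1.
case: a la0 => // s p la0 lj ln pad rr rJ cr.
have [s1|s1] := eqVneq s 1.
  rewrite s1 in lj ln pad rJ cr la0 *.
  have el : letters (rcons p 1) = letters (1 :: p).
    by rewrite /letters /= eqxx /= -cats1 filter_cat /= eqxx cats0.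
  rewrite -el in ln rJ cr *.
  have pad' : padded (rcons p 1).
    move: pad; rewrite /padded el => /andP[-> /=]; rewrite all_rcons.
    by case/andP=> -> ->.
  rewrite -(IHj (rcons p 1)) //.
    apply: eq_card => w; rewrite !inE; congr (_ && _).
    by apply/asboolP/asboolP; [move/sortable_skip | move=> h; apply/sortable_skip].
  move: lj; rewrite /= eqxx /= ltnS; apply: leq_ltn_trans.
  have : has (fun s => s != 1) p.
    by move: la0; rewrite -el /letters -cats1 filter_cat /= eqxx cats0 size_filter -has_count.
  by rewrite -cats1 find_cat => ->.
have sS : s \in S.
  by move: pad => /andP[_ /= /andP[]]; rewrite !inE (negbTE s1).
have el : letters (s :: p) = s :: letters p by rewrite /letters /= s1.
have elr : letters (rcons p s) = rcons (letters p) s.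
  by rewrite /letters -cats1 filter_cat /= s1 cats1.
have el1 : letters (1 :: p) = letters p by rewrite /letters /= eqxx.
have aS := letters_all pad; have ua : uniq (letters (s :: p)) by case/andP: pad.
have pS : {subset p <= 1 |: S}.
  by case/andP: pad => _ /= /andP[_ /allP].
rewrite el in ua aS rJ cr ln *.
have slp : s \notin letters p by case/andP: ua.
have sp : s \notin p by apply: contra slp => h; rewrite mem_filter s1 h.
set x := wprod r in rJ cr *.
set K := ltr (letters p); have KS : K \subset S by apply: ltr_sub; case/andP: aS.
have pad1 : padded (1 :: p).
  have ulp : uniq (letters p) by case/andP: ua.
  by case/andP: pad => u /= /andP[_ h]; rewrite /padded el1 /= !inE eqxx h ulp.
set g := wprod (restr K 1 r); set m := rcoset K 1 r.
have ex : x = g * m by rewrite -restr_prod mul1g.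
have gK : g \in <<K>> by apply/(gen_word _ KS); exists (restr K 1 r); rewrite ?restr_all.
have mm : jmin X K m by apply: (rcoset_jmin KS (red_all rr)); apply: jmin1.
have IH1 : cnt (1 :: p) g = nred (letters p ++ restr K 1 r) g.
  have sub : subseq (roots (restr K 1 r)) (roots r).
    have := restr_roots KS (red_all rr) (jmin1 X K).
    by rewrite (_ : map _ _ = roots r) // -[RHS]map_id; apply: eq_map => v; rewrite act1.
  rewrite (IHn (1 :: p)) ?el1 ?restr_all //.
  - have := size_subseq sub; rewrite !size_roots => h.
    by apply: leq_ltn_trans (leq_add (leqnn _) h) _; move: ln; rewrite /= addSn ltnS.
  - exact: restr_red.
  - rewrite (@compat_eq _ _ _ X _ (s :: letters p)); first exact: subseq_pairwise sub cr.
    move=> u v ur vr.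
    have H (z : {ffun gT -> R}) : z \in roots (restr K 1 r) -> z s = 0%R.
      move=> zr; apply/(suppP _ _ (roots_supp KS (restr_all K 1 r) zr)).
      by rewrite inE.
    by rewrite (om_del X [::] (letters p) (H _ ur) (H _ vr)).
(* Without the descent s, w is sortable for the word with s deleted, hence lies in W_K, where being
   below x means being below the component g of x. *)
have A2 : #|[set w | `[< sortable (s :: p) w >] & weak w x] :&: [set w | len w < len (s * w)]|
    = cnt (1 :: p) g.
  apply: eq_card => w; rewrite !inE.
  have eK : [set y in 1 :: p | y \in S] = K.
    apply/setP=> y; rewrite !inE mem_filter; case: (eqVneq y 1) => [->|] //=.
      by apply/negbTE/negP=> /(S_neq1 X); rewrite eqxx.
    move=> y1; case: (boolP (y \in p)) => //= /pS; by rewrite !inE (negbTE y1).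
  apply/andP/andP => [[/andP[/asboolP so wk] lt]|[/asboolP so wk]].
    have so' := (sortable_drop sS sp pS lt).1 so.
    split; first exact/asboolP; have wK := sortable_gen so'; rewrite eK in wK.
    by rewrite -(weak_gen KS wK gK mm) -ex.
  have wK := sortable_gen so; rewrite eK in wK.
  have lt : len w < len (s * w).
    rewrite len_ltl // titsl //; apply/negP=> /negvP/(_ s).
    by rewrite (act_out X KS) ?groupV ?inE // ffunE eqxx ler10.
  by split=> //; rewrite ex (weak_gen KS wK gK mm) wk andbT; apply/asboolP/(sortable_drop sS sp pS lt).
have cE : cnt (s :: p) x =
    (#|[set w | `[< sortable (s :: p) w >] & weak w x] :\: [set w | len w < len (s * w)]| + cnt (1%g :: p) g)%N.
  by rewrite -A2 addnC cardsID.
have F1 : nred (letters p ++ r) x = cnt (1 :: p) g.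
  by rewrite IH1 ex nred_cat_restr //; apply/allP=> y; rewrite inE.
rewrite cE /= -F1 addnC; congr (_ + _)%N.
case: ifP => ltx; last first.
  apply/eqP; rewrite cards_eq0 -subset0; apply/subsetP=> w; rewrite !inE => /andP[nlt].
  rewrite len_ltl // negbK in nlt; case/andP=> _ wk.
  by rewrite (weak_descent sS nlt wk) in ltx.
(* With the descent s: up to commutation r begins with s, so [letters p ++ r] becomes the rotated
   Coxeter word followed by [r']. *)
have [r' [rr' er' rJ' cr' Fr']] := compat_descent ua aS rr rJ cr ltx.
have padr : padded (rcons p s).
  case/andP: pad => _ /= /andP[h1 h2]; rewrite /padded elr all_rcons h1 h2 andbT.
  by rewrite rcons_uniq slp andbT; case/andP: ua.
have eltr : ltr (letters (rcons p s)) = ltr (s :: letters p).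
  by rewrite elr; apply/setP=> y; rewrite !inE mem_rcons inE.
rewrite Fr' -cat_rcons -elr -er' -(IHn (rcons p s)) ?eltr ?elr //; last first.
  have : size r' < size r by rewrite (red_size rr') er' (red_size rr).
  rewrite size_rcons => h; apply: leq_trans (_ : (size (letters p)).+1 + size r <= n).
    by rewrite ltn_add2l.
  by move: ln; rewrite ltnS.
rewrite er' -[RHS](card_imset _ (mulgI s)); apply: eq_card => w.
rewrite !inE; apply/andP/imsetP => [[nlt /andP[/asboolP so wk]]|[w']].
  rewrite len_ltl // negbK in nlt.
  exists (s * w); last by rewrite (mulSS X).
  rewrite inE -weak_cons // nlt wk /= andbT.
  by apply/asboolP/(sortable_take sS sp nlt).
rewrite inE => /andP[/asboolP so wk] ->.
have := wk; rewrite -{1}(mulSS X w' sS) -weak_cons // (mulSS X) // => /andP[lt wk'].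
rewrite wk' andbT; split; first by rewrite -leqNgt ltnW.
by apply/asboolP/(sortable_take sS sp); rewrite (mulSS X).
Qed.

Lemma cnt_all a w : longest X S w -> cnt a w = #|sortable_set S a|.
Proof.
move=> lw; apply: eq_card => x; rewrite !inE; case: `[< _ >] => //=.
have xV : x^-1 \in <<S>> by rewrite (S_gen X) inE.
have := longest_len (subxx S) lw xV; rewrite lenV /weak => <-.
by rewrite addnC eqxx.
Qed.

Theorem sortable_count a n : uniq a -> ltr a = S -> Nval X S n -> #|sortable_set S a| = n.
Proof.
move=> ua ea val; have aS : all [in S] a by apply/allP=> q; rewrite -ea inE.
have [w lw] := longest_ex X (subxx S).
have [r [rr er cr]] : exists r, [/\ red r, wprod r = w & compat a r].
  apply: compat_exists => //; first by rewrite ea (longest_gen lw).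
  move=> u v ru rv; rewrite ea => su sv _ pv.
  by rewrite /inv pv /= (longest_neg lw).
have la : letters a = a.
  by apply/all_filterP/allP=> q /(allP aS); apply: (S_neq1 X).
have pad : padded a.
  by rewrite /padded la ua; apply: sub_all aS => q; rewrite !inE => ->; rewrite orbT.
rewrite -(cnt_all a lw) -er cnt_nred ?la //; last by rewrite ea (red_all rr).
by apply: val; rewrite er.
Qed.

End Sortable.

(** * Classification of the diagrams *)

Section Classification.
Variables (gT : finGroupType) (S : {set gT}) (R : realFieldType).
Variable X : coxrep S R.
Implicit Types (s t q w x y z : gT) (c P L Q : seq gT) (u v : {ffun gT -> R}).
Notation act := (act X).
Notation A := (cartan (ck X)).
Notation pair := (pairing S (ck X)).
Notation bil := (bil X).

Section PosDef.
Local Open Scope ring_scope.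

(** The standard scalar product on the coordinates in S, summed over the group to make it
    invariant. *)
Definition av u v : R := \sum_(w : gT) \sum_(t in S) act w u t * act w v t.

Lemma avC u v : av u v = av v u.
Proof. by apply: eq_bigr => w _; apply: eq_bigr => t _; rewrite mulrC. Qed.

Lemma avDl u u' v : av (u + u') v = av u v + av u' v.
Proof.
rewrite /av -big_split; apply: eq_bigr => w _; rewrite -big_split; apply: eq_bigr => t _.
by rewrite actD ffunE mulrDl.
Qed.

Lemma avZl k u v : av (scv k u) v = k * av u v.
Proof.
rewrite /av mulr_sumr; apply: eq_bigr => w _; rewrite mulr_sumr; apply: eq_bigr => t _.
by rewrite actZ ffunE mulrA.
Qed.

Lemma av_act x u v : av (act x u) (act x v) = av u v.
Proof.
rewrite [RHS](reindex_inj (mulIg x)) /=; apply: eq_bigr => w _.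
by apply: eq_bigr => t _; rewrite !actM.
Qed.

Lemma av_ge0 v : 0 <= av v v.
Proof. by apply: sumr_ge0 => w _; apply: sumr_ge0 => t _; rewrite -expr2 sqr_ge0. Qed.

Lemma av_eq0 v : av v v <= 0 -> {in S, forall t, v t = 0}.
Proof.
move=> h t tS; apply/eqP; rewrite -sqrf_eq0 eq_le sqr_ge0 andbT; apply: le_trans h.
rewrite /av (bigD1 1%g) //= (bigD1 t) //= act1 -expr2 -addrA lerDl addr_ge0 //.
  by apply: sumr_ge0 => i _; rewrite -expr2 sqr_ge0.
by apply: sumr_ge0 => i _; apply: sumr_ge0 => j _; rewrite -expr2 sqr_ge0.
Qed.

Lemma av_al s v : s \in S -> 2 * av v (al s) = pair s v * av (al s) (al s).
Proof.
move=> sS; have := av_act s v (al s).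
rewrite (act_al X sS) (act_refl _ _ sS) (bil_al _ _ sS) -scvN1 avC avZl avC avDl avZl; lra.
Qed.

(** Invariance gives 2 av v alpha_s = (pairing of v with s) av alpha_s alpha_s, and connectedness
    makes the last factor a constant d > 0. So 2 av = d bil on the span of S, and [av] is definite
    there. *)
Lemma posdef : (forall s t, s \in S -> t \in S ->
    connect (fun s t => [&& s \in S, t \in S & (s * t != t * s)%g]) s t) ->
  forall v, supp S v -> bil v v <= 0 -> v = 0.
Proof.
move=> con v sv; have dpos s : s \in S -> 0 < av (al s) (al s).
  move=> sS; rewrite lt_neqAle av_ge0 andbT eq_sym; apply/eqP=> e.
  have := av_eq0 (v := al s); rewrite e lexx => /(_ isT _ sS)/eqP.
  by rewrite ffunE eqxx oner_eq0.
have dstep s t : s \in S -> t \in S -> (s * t != t * s)%g -> av (al s) (al s) = av (al t) (al t).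
  move=> sS tS ne; have := av_al (al t) sS; have := av_al (al s) tS.
  rewrite avC !pairing_al // (cartanC X tS sS) => -> /esym/eqP.
  rewrite -subr_eq0 -mulrBr mulf_eq0 (cartan_eq0 X sS tS) (negbTE ne) andbF /=.
  by rewrite subr_eq0 => /eqP.
have dconst s t : s \in S -> t \in S -> av (al s) (al s) = av (al t) (al t).
  move=> sS tS; have /connectP[p + ->] := con _ _ sS tS.
  elim: p s sS => //= z p IH s sS /andP[/and3P[_ zS ne]] pth.
  by rewrite (dstep s z) // (IH z).
have [s0 s0S|S0] := pickP [in S]; last first.
  by move=> _; apply/ffunP=> t; rewrite ffunE (suppP _ _ sv) // [t \in S]S0.
set d := av (al s0) (al s0); have d0 : 0 < d by apply: dpos.
have key u : supp S u -> 2 * av u v = d * bil u v.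
  move=> su; refine (vec_ind (P := fun u => 2 * av u v = d * bil u v) su _ _).
    rewrite (_ : (0 : {ffun gT -> R}) = scv 0 0) ?avZl ?bilZl; first by ring.
    by apply/ffunP=> t; rewrite !ffunE mul0r.
  move=> k j u' jS _ e; rewrite avDl bilDl avZl bilZl mulrDr e [_ (al j) v]avC.
  have := av_al v jS; rewrite (dconst j s0) // -/d bil_al // => h.
  by rewrite mulrCA h; ring.
move=> b0; have h := key v sv.
have : av v v <= 0 by have : d * bil v v <= 0 by [rewrite pmulr_rle0]; lra.
move/av_eq0=> z; apply/ffunP=> t; rewrite ffunE.
by have [/z//|tS] := boolP (t \in S); rewrite (suppP _ _ sv).
Qed.

End PosDef.

Section Labels.
Local Open Scope ring_scope.

Lemma ck_ge0 m : (2 < m)%N -> 0 < ck X m.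
Proof.
by move=> m2; have := @ck_pos _ _ _ X m 2 m2; rewrite chebSS cheb0 cheb1; lra.
Qed.

Lemma cheb3 (x : R) : cheb x 3 = x ^+ 2 - 1.
Proof. by rewrite !chebSS cheb0 cheb1; ring. Qed.
Lemma cheb4 (x : R) : cheb x 4 = x * (x ^+ 2 - 2).
Proof. by rewrite !chebSS cheb0 cheb1; ring. Qed.
Lemma cheb5 (x : R) : cheb x 5 = x ^+ 4 - 3 * x ^+ 2 + 1.
Proof. by rewrite !chebSS cheb0 cheb1; ring. Qed.
Lemma cheb6 (x : R) : cheb x 6 = x * (x ^+ 2 - 1) * (x ^+ 2 - 3).
Proof. by rewrite !chebSS cheb0 cheb1; ring. Qed.

Lemma cheb_ck_ge0 m k : (0 < k <= m)%N -> (1 < m)%N -> 0 <= cheb (ck X m) k.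
Proof.
move=> /andP[k0]; rewrite leq_eqVlt => /orP[/eqP->|km] m1; first by rewrite ck_root.
by rewrite ltW // ck_pos // k0.
Qed.

Lemma ck3 : ck X 3 = 1.
Proof.
have := @ck_root _ _ _ X 3 isT; rewrite cheb3 => h; have := @ck_ge0 3 isT => h0.
have : (ck X 3 - 1) * (ck X 3 + 1) = 0 by lra.
by move/eqP; rewrite mulf_eq0 => /orP[]/eqP; lra.
Qed.

Lemma ck_ge1 m : (2 < m)%N -> 1 <= ck X m.
Proof.
move=> m2; have h0 := ck_ge0 m2; have := @cheb_ck_ge0 m 3; rewrite m2 (ltnW m2) cheb3.
by move=> /(_ isT isT); nra.
Qed.

Lemma ck2_ge2 m : (3 < m)%N -> 2 <= ck X m ^+ 2.
Proof.
move=> m3; have h0 := ck_ge0 (ltnW m3); have := @cheb_ck_ge0 m 4.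
by rewrite m3 (ltnW (ltnW m3)) cheb4 pmulr_rge0 // => /(_ isT isT); lra.
Qed.

Lemma ck4 : ck X 4 ^+ 2 = 2.
Proof.
have h0 := @ck_ge0 4 isT; have := @ck_root _ _ _ X 4 isT; rewrite cheb4.
by move/eqP; rewrite mulf_eq0 => /orP[]/eqP; lra.
Qed.

(** The exact minimum, at m = 5, is irrational; the rational bound 5 / 2 is just what [no_H5]
    requires. *)
Lemma ck2_ge5 m : (4 < m)%N -> 5 / 2 <= ck X m ^+ 2.
Proof.
move=> m4; have h2 := ck2_ge2 (ltnW m4); have := @cheb_ck_ge0 m 5.
rewrite m4 (ltnW (ltnW (ltnW m4))) cheb5 => /(_ isT isT).
rewrite (_ : ck X m ^+ 4 = ck X m ^+ 2 * ck X m ^+ 2); last by ring.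
by move: (ck X m ^+ 2) h2 => y; nra.
Qed.

Lemma ck2_ge6 m : (5 < m)%N -> 3 <= ck X m ^+ 2.
Proof.
move=> m5; have h2 := ck2_ge2 (ltnW (ltnW m5)); have := @cheb_ck_ge0 m 6.
have h0 := ck_ge0 (ltnW (ltnW (ltnW m5))).
rewrite m5 (ltnW (ltnW (ltnW (ltnW m5)))) cheb6 => /(_ isT isT).
by rewrite pmulr_rge0; [lra | apply: mulr_gt0 => //; lra].
Qed.

End Labels.

Definition com s t := #[s * t] == 2.
Definition adj s t := 2 < #[s * t].
Definition lbl (m : nat) s t := #[s * t] == m.

Lemma order_sym s t : s \in S -> t \in S -> #[s * t] = #[t * s].
Proof. by move=> sS tS; rewrite -[RHS]orderV invMg (invS X sS) (invS X tS). Qed.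

Lemma comC s t : s \in S -> t \in S -> com s t = com t s.
Proof. by move=> sS tS; rewrite /com order_sym. Qed.
Lemma lblC m s t : s \in S -> t \in S -> lbl m s t = lbl m t s.
Proof. by move=> sS tS; rewrite /lbl order_sym. Qed.

Lemma adj_neq s t : s \in S -> adj s t -> s != t.
Proof. by move=> sS; apply: contraTneq => <-; rewrite /adj (S_inv X sS) order1. Qed.

Lemma com_neq s t : s \in S -> com s t -> s != t.
Proof. by move=> sS; apply: contraTneq => <-; rewrite /com (S_inv X sS) order1. Qed.

Lemma com_adj s t : s \in S -> t \in S -> s != t -> com s t = ~~ adj s t.
Proof.
move=> sS tS ne; rewrite /com /adj -leqNgt eqn_leq.
by rewrite (order_gt1 X tS ne) andbT.
Qed.

Lemma cartan_lbl s t m : s \in S -> lbl m s t -> m != 1%N -> A s t = (- ck X m)%R.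
Proof.
move=> sS /eqP o m1; rewrite /cartan; case: eqP => [e|_]; last by rewrite o.
by move: m1; rewrite -o -e (S_inv X sS) order1.
Qed.

Lemma cartan_com s t : s \in S -> t \in S -> com s t -> A s t = 0%R.
Proof.
by move=> sS tS c; apply/eqP; rewrite (cartan_eq0 X sS tS) -(order2_comm X sS tS).
Qed.

Lemma cartan_3 s t : s \in S -> lbl 3 s t -> A s t = (-1)%R.
Proof. by move=> sS l; rewrite (cartan_lbl sS l) ?ck3. Qed.

Lemma cartan_adj s t : s \in S -> t \in S -> adj s t -> (A s t <= -1)%R.
Proof.
move=> sS tS a; have := ck_ge1 a; rewrite /cartan (negbTE (adj_neq sS a)); lra.
Qed.

Definition link (m : nat) s P :=
  if P is t :: P' then lbl m s t && all (com s) P' else true.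

(** A diagram of type A, listed from one end to the other. *)
Fixpoint chain P := if P is s :: P' then link 3 s P' && chain P' else true.

Lemma chain_uniq P : all [in S] P -> chain P -> uniq P.
Proof.
elim: P => //= s P IH /andP[sS PS] /andP[ls cP]; rewrite IH // andbT.
case: P ls PS {IH cP} => // t P /andP[l c] /andP[tS PS]; rewrite inE negb_or.
rewrite (adj_neq sS) /=; last by rewrite /adj (eqP l).
by apply/negP=> /(allP c) h; have := com_neq sS h; rewrite eqxx.
Qed.

Lemma chain_catr L P : chain (L ++ P) -> chain P.
Proof. by elim: L => //= s L IH /andP[_ /IH]. Qed.

Lemma link_catl m s L P : link m s (L ++ P) -> link m s L.
Proof. by case: L => //= t L /andP[-> ]; rewrite all_cat => /andP[]. Qed.

Lemma chain_catl L P : chain (L ++ P) -> chain L.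
Proof. by elim: L => //= s L IH /andP[/link_catl -> /IH]. Qed.

(** Views a path from an inner vertex t, as two paths leaving t whose other letters commute with
    each other. *)
Lemma chain_center L t P : all [in S] L -> t \in S -> all [in S] P ->
  chain (rev L ++ t :: P) = [&& chain (t :: L), chain (t :: P) & allrel com L P].
Proof.
elim: L t P => [|l L IH] t P /=; first by move=> _ _ _; rewrite allrel0l andbT.
move=> /andP[lS LS] tS PS; rewrite rev_cons cat_rcons IH //=; last by rewrite tS.
rewrite allrel_consr allrel_consl (lblC 3 lS tS) //.
have -> : all (com^~ t) L = all (com t) L.
  by apply: eq_in_all => x /(allP LS) xS; rewrite comC.
by case: (lbl 3 t l); case: (all (com t) L); case: (all (com l) P); case: (link 3 t P);
  case: (chain P); case: (link 3 l L); case: (chain L); case: (allrel com L P).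
Qed.

Lemma chain_rev P : all [in S] P -> chain (rev P) = chain P.
Proof.
case: P => // t P /= /andP[tS PS]; rewrite rev_cons -cats1 chain_center //=.
by rewrite allrel0r andbT.
Qed.

Section Norm.
Local Open Scope ring_scope.
Hypothesis pd : forall v, supp S v -> bil v v <= 0 -> v = 0.

Definition comb (l : seq (R * {ffun gT -> R})) := \sum_(p <- l) scv p.1 p.2.

(** The quadratic form at [comb l] expanded over pairs, so that bounds on Cartan entries can be
    substituted. *)
Fixpoint nrm (l : seq (R * {ffun gT -> R})) : R :=
  if l is (k, u) :: l' then
    k ^+ 2 * bil u u + 2 * k * (\sum_(p <- l') p.1 * bil u p.2) + nrm l' else 0.

Lemma bil_comb u l : bil u (comb l) = \sum_(p <- l) p.1 * bil u p.2.
Proof.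
rewrite /comb; elim: l => [|p l IH].
  rewrite !big_nil (_ : (0 : {ffun gT -> R}) = scv 0 0) ?bilZr ?mul0r //.
  by apply/ffunP=> t; rewrite !ffunE mul0r.
by rewrite !big_cons bilDr bilZr IH.
Qed.

Lemma nrmE l : bil (comb l) (comb l) = nrm l.
Proof.
elim: l => [|[k u] l IH] /=; first by rewrite bil_comb big_nil.
rewrite -IH -bil_comb /comb !big_cons /= -/(comb l) bilDl !bilDr !bilZl !bilZr.
by rewrite (bilC _ (comb l) u); ring.
Qed.

Lemma nrm_gt0 l z : all (fun p => supp S p.2) l -> comb l z != 0 -> 0 < nrm l.
Proof.
move=> sl nz; rewrite ltNge; apply/negP=> h; rewrite -nrmE in h.
have : comb l = 0.
  apply: pd h; rewrite /comb; elim: l sl {nz} => [|p l IH] /=.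
    by rewrite big_nil => _; apply/suppP=> t _; rewrite ffunE.
  case/andP=> /suppP sp /IH/suppP sl; rewrite big_cons; apply/suppP=> t tS.
  by rewrite !ffunE sp // sl // mulr0 addr0.
by move=> e; rewrite e ffunE eqxx in nz.
Qed.

(** For a path this is its highest root; it treats paths of all lengths at once. *)
Definition us P : {ffun gT -> R} := \sum_(y <- P) al y.

Lemma us_supp P : all [in S] P -> supp S (us P).
Proof.
move=> PS; apply/suppP=> t tS; rewrite sum_ffunE big_seq big1 // => y yP.
by rewrite ffunE; case: eqP => // e; rewrite e (allP PS) in tS.
Qed.

Lemma bil_us x P : x \in S -> all [in S] P -> bil (al x) (us P) = \sum_(y <- P) A x y.
Proof.
move=> xS; rewrite /us; elim: P => [_|y P IH /= /andP[yS PS]].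
  rewrite !big_nil (_ : (0 : {ffun gT -> R}) = scv 0 0) ?bilZr ?mul0r //.
  by apply/ffunP=> t; rewrite !ffunE mul0r.
by rewrite !big_cons bilDr IH // bil_al // pairing_al.
Qed.

Lemma bil_al2 x y : x \in S -> y \in S -> bil (al x) (al y) = A x y.
Proof. by move=> xS yS; rewrite bil_al // pairing_al. Qed.

Lemma us_chain P : all [in S] P -> chain P -> P != [::] -> bil (us P) (us P) = 2.
Proof.
elim: P => // s P IH /= /andP[sS PS] /andP[ls cP] _.
have -> : us (s :: P) = al s + us P by rewrite /us big_cons.
rewrite bilDl !bilDr (bilC _ (us P) (al s)) bil_us // bil_al2 // cartan_ss.
case: P ls PS cP IH => [|t P] ls PS cP IH.
  have -> : us [::] = comb [::] by rewrite /us /comb !big_nil.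
  by rewrite bil_comb !big_nil !addr0.
rewrite IH // big_cons; case/andP: ls => l c; have /andP[tS PS'] : (t \in S) && all [in S] P by [].
rewrite cartan_3 // big_seq big1 ?addr0; first by ring.
by move=> y yP; apply: cartan_com => //; [exact: (allP PS') | exact: (allP c)].
Qed.

Lemma comb_neq0 (l : seq (R * {ffun gT -> R})) k u z :
  all (fun p => (0 <= p.1) && pos p.2) l -> (k, u) \in l -> 0 < k * u z -> comb l z != 0.
Proof.
move=> pl ul h; have e : comb l z = \sum_(p <- l) p.1 * p.2 z.
  rewrite /comb; elim: l {pl ul} => [|p l IH]; first by rewrite !big_nil ffunE.
  by rewrite !big_cons !ffunE IH.
rewrite e (big_rem _ ul) /= gt_eqF //; apply: ltr_wpDr h.
rewrite big_seq; apply: sumr_ge0 => p /mem_rem /(allP pl)/andP[h1 /posP h2].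
exact: mulr_ge0.
Qed.

Lemma us_pos P : pos (us P).
Proof.
apply/posP=> t; rewrite sum_ffunE; apply: sumr_ge0 => y _; exact/posP/pos_al.
Qed.

Lemma rs_le x y P : x \in S -> all [in S] P -> x \notin P -> y \in P ->
  \sum_(z <- P) A x z <= A x y.
Proof.
move=> xS PS xP yP; rewrite (big_rem y yP) /= gerDl big_seq; apply: sumr_le0 => z.
move/mem_rem => zP; apply: (cartan_le0 X) => //; first exact: (allP PS).
by apply: contraNneq xP => ->.
Qed.

Lemma rs_adj x P : x \in S -> all [in S] P -> x \notin P -> has (adj x) P ->
  \sum_(z <- P) A x z <= -1.
Proof.
move=> xS PS xP /hasP[y yP a]; apply: le_trans (rs_le xS PS xP yP) _.
by apply: cartan_adj => //; apply: (allP PS).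
Qed.

(** How forbidden diagrams are refuted: a nonnegative combination that does not vanish has positive
    norm. *)
Lemma nrm_contra l k u z : all (fun p => supp S p.2) l ->
  all (fun p => (0 <= p.1) && pos p.2) l -> (k, u) \in l -> 0 < k * u z -> nrm l <= 0 -> False.
Proof.
by move=> sl pl ul h; rewrite leNgt (nrm_gt0 sl (comb_neq0 pl ul h)).
Qed.

Lemma al_pos1 (k : R) z : 0 < k -> 0 < k * (al z : {ffun gT -> R}) z.
Proof. by move=> k0; rewrite ffunE eqxx mulr1. Qed.

(** y and z contribute two Cartan entries of at most -1, so alpha_x plus the root of the path has
    norm at most 2 + 2 - 4. *)
Lemma no_cycle P x y z : all [in S] P -> chain P -> x \in S -> x \notin P ->
  y \in P -> z \in P -> y != z -> adj x y -> adj x z -> False.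
Proof.
move=> PS cP xS xP yP zP yz axy axz.
have P0 : P != [::] by case: (P) yP.
have r2 : \sum_(t <- P) A x t <= -2.
  rewrite (big_rem y yP) /=; have zr : z \in rem y P.
    by rewrite mem_rem_uniq ?(chain_uniq PS) // !inE eq_sym yz.
  have xr : x \notin rem y P by apply: contra xP => /mem_rem.
  have rS : all [in S] (rem y P) by apply/allP=> t /mem_rem /(allP PS).
  have := rs_le xS rS xr zr; have := cartan_adj xS (allP PS _ yP) axy.
  have := cartan_adj xS (allP PS _ zP) axz; lra.
apply: (@nrm_contra [:: (1, al x); (1, us P)] 1 (al x) x); rewrite /= ?mem_head ?ler01 ?al_pos1 //.
- by rewrite supp_al xS us_supp.
- by rewrite pos_al us_pos.
rewrite !big_cons !big_nil /= bil_al2 // cartan_ss bil_us // us_chain //; lra.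
Qed.

(** Affine D, including one vertex with four neighbours: the four ends have weight 1 and the path
    has weight 2. *)
Lemma no_D P x1 x2 x3 x4 : all [in S] P -> chain P -> P != [::] ->
  all [in S] [:: x1; x2; x3; x4] -> uniq [:: x1, x2, x3, x4 & P] ->
  has (adj x1) P -> has (adj x2) P -> has (adj x3) P -> has (adj x4) P -> False.
Proof.
move=> PS cP P0 /and5P[S1 S2 S3 S4 _] /and5P[n1 n2 n3 n4 _] a1 a2 a3 a4.
move: n1 n2 n3; rewrite !inE !negb_or.
move=> /and4P[n12 n13 n14 n1] /and3P[n23 n24 n2] /andP[n34 n3].
have r1 := rs_adj S1 PS n1 a1; have r2 := rs_adj S2 PS n2 a2.
have r3 := rs_adj S3 PS n3 a3; have r4 := rs_adj S4 PS n4 a4.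
apply: (@nrm_contra [:: (1, al x1); (1, al x2); (1, al x3); (1, al x4); (2, us P)] 1 (al x1) x1);
  rewrite /= ?mem_head ?ler01 ?ler0n ?al_pos1 //.
- by rewrite !supp_al S1 S2 S3 S4 us_supp.
- by rewrite !pos_al us_pos.
rewrite !big_cons !big_nil /= !bil_al2 // !cartan_ss !bil_us // us_chain //.
have := cartan_le0 X S1 S2 n12; have := cartan_le0 X S1 S3 n13.
have := cartan_le0 X S1 S4 n14; have := cartan_le0 X S2 S3 n23.
have := cartan_le0 X S2 S4 n24; have := cartan_le0 X S3 S4 n34; lra.
Qed.

Lemma lbl4 x y : x \in S -> y \in S -> (3 < #[(x * y)%g])%N ->
  exists2 c, A x y = - c & (0 < c) /\ 2 <= c ^+ 2.
Proof.
move=> xS yS o; exists (ck X #[(x * y)%g]).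
  by rewrite /cartan (negbTE (adj_neq xS (ltnW o))).
by split; [apply: ck_ge0; apply: ltnW | apply: ck2_ge2].
Qed.

(** Affine B: one fork is replaced by an edge of Cartan entry - c, whose end gets weight c. The norm
    is at most 4 - 2 c^2. *)
Lemma no_B P x1 x2 x3 y : all [in S] P -> chain P ->
  all [in S] [:: x1; x2; x3] -> uniq [:: x1, x2, x3 & P] ->
  has (adj x1) P -> has (adj x2) P -> y \in P -> (3 < #[(x3 * y)%g])%N -> False.
Proof.
move=> PS cP /and4P[S1 S2 S3 _] /and4P[n1 n2 n3 _] a1 a2 yP o.
have P0 : P != [::] by case: (P) yP.
move: n1 n2; rewrite !inE !negb_or.
move=> /and3P[n12 n13 n1] /andP[n23 n2].
have r1 := rs_adj S1 PS n1 a1; have r2 := rs_adj S2 PS n2 a2.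
have r3 := rs_le S3 PS n3 yP.
have [c ec [c0 c2]] := lbl4 S3 (allP PS _ yP) o; rewrite ec in r3.
apply: (@nrm_contra [:: (1, al x1); (1, al x2); (c, al x3); (2, us P)] 1 (al x1) x1);
  rewrite /= ?mem_head ?ler01 ?ler0n ?al_pos1 ?(ltW c0) //.
- by rewrite !supp_al S1 S2 S3 us_supp.
- by rewrite !pos_al us_pos.
rewrite !big_cons !big_nil /= !bil_al2 // !cartan_ss !bil_us // us_chain //.
have := cartan_le0 X S1 S2 n12.
have h13 : c * A x1 x3 <= 0 by rewrite pmulr_rle0 // (cartan_le0 X).
have h23 : c * A x2 x3 <= 0 by rewrite pmulr_rle0 // (cartan_le0 X).
have h3 : c * \sum_(z <- P) A x3 z <= - c ^+ 2 by rewrite expr2 -mulrN ler_pM2l.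
by move: h3 h13 h23; move: (\sum_(z <- P) A x3 z) (A x1 x3) (A x2 x3) => a b d; lra.
Qed.

Lemma no_C P x1 x2 y1 y2 : all [in S] P -> chain P -> x1 \in S -> x2 \in S ->
  uniq [:: x1, x2 & P] -> y1 \in P -> y2 \in P ->
  (3 < #[(x1 * y1)%g])%N -> (3 < #[(x2 * y2)%g])%N -> False.
Proof.
move=> PS cP S1 S2 /and3P[n1 n2 _] yP1 yP2 o1 o2.
have P0 : P != [::] by case: (P) yP1.
move: n1; rewrite !inE !negb_or => /andP[n12 n1].
have r1 := rs_le S1 PS n1 yP1; have r2 := rs_le S2 PS n2 yP2.
have [c ec [c0 c2]] := lbl4 S1 (allP PS _ yP1) o1; rewrite ec in r1.
have [d ed [d0 d2]] := lbl4 S2 (allP PS _ yP2) o2; rewrite ed in r2.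
apply: (@nrm_contra [:: (c, al x1); (d, al x2); (2, us P)] c (al x1) x1);
  rewrite /= ?mem_head ?ler01 ?ler0n ?al_pos1 ?(ltW c0) ?(ltW d0) //.
- by rewrite !supp_al S1 S2 us_supp.
- by rewrite !pos_al us_pos.
rewrite !big_cons !big_nil /= !bil_al2 // !cartan_ss !bil_us // us_chain //.
have h12 : c * d * A x1 x2 <= 0 by rewrite pmulr_rle0 ?mulr_gt0 // (cartan_le0 X).
have h1 : c * \sum_(z <- P) A x1 z <= - c ^+ 2 by rewrite expr2 -mulrN ler_pM2l.
have h2 : d * \sum_(z <- P) A x2 z <= - d ^+ 2 by rewrite expr2 -mulrN ler_pM2l.
by move: h1 h2 h12; move: (\sum_(z <- P) A x1 z) (\sum_(z <- P) A x2 z) (A x1 x2) => a b e; lra.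
Qed.

Definition wvec (l : seq (R * gT)) := [seq (p.1, al p.2 : {ffun gT -> R}) | p <- l].
Definition wgood (l : seq (R * gT)) :=
  [&& all (fun p => 0 <= p.1) l, all [in S] (map snd l) & uniq (map snd l)].

Lemma w_contra l k x : wgood l -> (k, x) \in l -> 0 < k -> nrm (wvec l) <= 0 -> False.
Proof.
move=> /and3P[l0 lS lu] xl k0; apply: (@nrm_contra _ k (al x) x); rewrite ?al_pos1 //.
- by rewrite all_map; move: lS; rewrite all_map; apply: sub_all => p /=; rewrite supp_al.
- by rewrite all_map; apply: sub_all l0 => p /= ->; rewrite pos_al.
- by apply/mapP; exists (k, x).
Qed.

(** The edges of x other than the one to y have nonpositive entries and nonnegative weights, so
    leaving them out only raises the bound. *)
Lemma w_step k x k' y b l : wgood ((k, x) :: l) -> (k', y) \in l -> A x y <= b ->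
  nrm (wvec ((k, x) :: l)) <= 2 * k ^+ 2 + 2 * k * k' * b + nrm (wvec l).
Proof.
move=> /and3P[/= /andP[k0 l0] /andP[xS lS] /andP[xl lu]] yl Ab.
rewrite bil_al2 // cartan_ss lerD2r mulrC lerD2l -mulrA -[2 * k * k' * b]mulrA.
rewrite -[in leRHS]mulrA; apply: ler_wpM2l => //; apply: ler_wpM2l => //.
rewrite big_map (big_rem _ yl) /= bil_al2 //; last by apply: (allP lS); apply: (map_f snd yl).
have yk : 0 <= k' by apply: (allP l0 _ yl).
apply: le_trans (_ : k' * A x y <= _); last by apply: ler_wpM2l.
rewrite gerDl big_seq; apply: sumr_le0 => p /mem_rem pl.
have pS : p.2 \in S by apply: (allP lS); apply: (map_f snd pl).
rewrite bil_al2 //; apply: mulr_ge0_le0; first exact: (allP l0 _ pl).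
by apply: (cartan_le0 X) => //; apply: contraNneq xl => ->; apply: (map_f snd pl).
Qed.

Lemma w_one k x : x \in S -> nrm (wvec [:: (k, x)]) = 2 * k ^+ 2.
Proof. by move=> xS; rewrite /= big_nil bil_al2 // cartan_ss; ring. Qed.

Local Open Scope ring_scope.

(** A tree is listed from the leaves inwards: an entry holds a weight, a vertex, the weight and name
    of its neighbour towards the root, and a bound for that edge. The last entry is the root, which
    has no such neighbour. *)
Fixpoint tnorm (l : seq (R * gT * R * gT * R)) : R :=
  if l is (k, x, k', y, b) :: l' then
    2 * k ^+ 2 + (if l' is [::] then 0 else 2 * k * k' * b) + tnorm l' else 0.

Definition tproj (l : seq (R * gT * R * gT * R)) : seq (R * gT) :=
  [seq p.1.1.1 | p <- l].

Fixpoint tedges (l : seq (R * gT * R * gT * R)) : Prop :=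
  if l is (k, x, k', y, b) :: l' then
    (if l' is [::] then True else (k', y) \in tproj l' /\ A x y <= b) /\ tedges l' else True.

Lemma wgood_cons p l : wgood (p :: l) -> wgood l.
Proof. by case/and3P=> /= /andP[_ l0] /andP[_ lS] /andP[_ lu]; rewrite /wgood l0 lS. Qed.

Lemma nrm_tnorm l : wgood (tproj l) -> tedges l -> nrm (wvec (tproj l)) <= tnorm l.
Proof.
elim: l => [|[[[[k x] k'] y] b] l IH] // g [e tl].
have {}IH := IH (wgood_cons g) tl; case: l g e tl IH => [|p l] g e tl IH.
  rewrite [wvec _]/= w_one; last by case/and3P: g => _ /= /andP[].
  by rewrite /= !addr0.
case: e => ml Ab; apply: le_trans (w_step g ml Ab) _.
by rewrite [tnorm _]/= -/(tnorm _) lerD2l.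
Qed.

Lemma tree_contra k x k' y b l : wgood (tproj ((k, x, k', y, b) :: l)) -> 0 < k ->
  tedges ((k, x, k', y, b) :: l) -> tnorm ((k, x, k', y, b) :: l) <= 0 -> False.
Proof.
move=> g k0 tl h; apply: (w_contra (k := k) (x := x) g _ k0); first by rewrite mem_head.
exact: le_trans (nrm_tnorm g tl) h.
Qed.

Lemma cartan_3le x y : x \in S -> y \in S -> lbl 3 x y -> A x y <= -1.
Proof. by move=> xS yS l; apply: cartan_adj => //; rewrite /adj (eqP l). Qed.

Lemma allPP (T : eqType) (a : pred T) (s : seq T) : all a s -> foldr (fun (x : T) (Q : Prop) => a x /\ Q) True s.
Proof. by elim: s => //= x s IH /andP[-> /IH]. Qed.

(* For the affine diagrams the weights are the coefficients of the null root. *)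
Lemma no_E6 (v l1 l2 r1 r2 q q' : gT) : all [in S] [:: l2; l1; r2; r1; q'; q; v] ->
  uniq [:: l2; l1; r2; r1; q'; q; v] ->
  lbl 3 l1 v -> lbl 3 l2 l1 -> lbl 3 r1 v -> lbl 3 r2 r1 -> lbl 3 q v -> lbl 3 q' q -> False.
Proof.
move=> aS u e1 e2 e3 e4 e5 e6.
apply: (@tree_contra 1 l2 2 l1 (-1) [:: (2, l1, 3, v, -1); (1, r2, 2, r1, -1); (2, r1, 3, v, -1);
   (1, q', 2, q, -1); (2, q, 3, v, -1); (3, v, 0, v, 0)]); rewrite ?ltr01 //.
- by rewrite /wgood aS u !andbT /= ?ler0n ?ler01.
- have [/= l2S [l1S [r2S [r1S [q'S [qS [vS _]]]]]]] := allPP aS.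
  by do !split; rewrite ?cartan_3le // /tproj /= !inE eqxx ?orbT.
by rewrite /=; lra.
Qed.

Lemma no_E7 (v l1 l2 l3 r1 r2 r3 q : gT) : all [in S] [:: l3; l2; l1; r3; r2; r1; q; v] ->
  uniq [:: l3; l2; l1; r3; r2; r1; q; v] ->
  lbl 3 l1 v -> lbl 3 l2 l1 -> lbl 3 l3 l2 -> lbl 3 r1 v -> lbl 3 r2 r1 -> lbl 3 r3 r2 ->
  lbl 3 q v -> False.
Proof.
move=> aS u e1 e2 e3 e4 e5 e6 e7.
apply: (@tree_contra 1 l3 2 l2 (-1) [:: (2, l2, 3, l1, -1); (3, l1, 4, v, -1); (1, r3, 2, r2, -1);
   (2, r2, 3, r1, -1); (3, r1, 4, v, -1); (2, q, 4, v, -1); (4, v, 0, v, 0)]); rewrite ?ltr01 //.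
- by rewrite /wgood aS u !andbT /= ?ler0n ?ler01.
- have [/= l3S [l2S [l1S [r3S [r2S [r1S [qS [vS _]]]]]]]] := allPP aS.
  by do !split; rewrite ?cartan_3le // /tproj /= !inE eqxx ?orbT.
by rewrite /=; lra.
Qed.

Lemma no_E8 (v l1 l2 r1 r2 r3 r4 r5 q : gT) : all [in S] [:: l2; l1; r5; r4; r3; r2; r1; q; v] ->
  uniq [:: l2; l1; r5; r4; r3; r2; r1; q; v] ->
  lbl 3 l1 v -> lbl 3 l2 l1 -> lbl 3 r1 v -> lbl 3 r2 r1 -> lbl 3 r3 r2 -> lbl 3 r4 r3 ->
  lbl 3 r5 r4 -> lbl 3 q v -> False.
Proof.
move=> aS u e1 e2 e3 e4 e5 e6 e7 e8.
apply: (@tree_contra 2 l2 4 l1 (-1) [:: (4, l1, 6, v, -1); (1, r5, 2, r4, -1); (2, r4, 3, r3, -1);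
   (3, r3, 4, r2, -1); (4, r2, 5, r1, -1); (5, r1, 6, v, -1); (3, q, 6, v, -1); (6, v, 0, v, 0)]);
  rewrite ?ltr0n //.
- by rewrite /wgood aS u !andbT /= ?ler0n ?ler01.
- have [/= l2S [l1S [r5S [r4S [r3S [r2S [r1S [qS [vS _]]]]]]]]] := allPP aS.
  by do !split; rewrite ?cartan_3le // /tproj /= !inE eqxx ?orbT.
by rewrite /=; lra.
Qed.

Lemma cartan_lblle x y m : x \in S -> lbl m x y -> (3 < m)%N -> A x y <= - ck X m.
Proof. by move=> xS l m3; rewrite (cartan_lbl xS l) //; case: m m3 {l} => [|[]]. Qed.

(** All roots are normalised to norm 2, hence the factor c in the weights beyond the edge m. The
    bound is 12 - 6 c^2. *)
Lemma no_F4 (v1 v2 v3 q q' : gT) m : all [in S] [:: v3; v2; v1; q'; q] -> uniq [:: v3; v2; v1; q'; q] ->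
  lbl 3 v3 v2 -> lbl 3 v2 v1 -> lbl m v1 q -> (3 < m)%N -> lbl 3 q' q -> False.
Proof.
move=> aS u e1 e2 e3 m3 e4; have c0 := ck_ge0 (ltnW m3); have c2 := ck2_ge2 m3.
pose c := ck X m; rewrite -/c in c0 c2.
apply: (@tree_contra 1 v3 2 v2 (-1) [:: (2, v2, 3, v1, -1); (3, v1, 2 * c, q, - c);
   (c, q', 2 * c, q, -1); (2 * c, q, 0, q, 0)]); rewrite ?ltr01 //.
- by rewrite /wgood aS u !andbT /= ?ler0n ?ler01 (ltW c0) pmulr_rge0 ?ltr0n ?(ltW c0).
- have [/= v3S [v2S [v1S [q'S [qS _]]]]] := allPP aS.
  by do !split; rewrite ?cartan_3le ?(cartan_lblle _ e3) // /tproj /= !inE eqxx ?orbT.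
by rewrite /=; nra.
Qed.

(** These weights give the bound 54 - 24 c^2, negative once c^2 exceeds 9 / 4. *)
Lemma no_F45 (v1 v2 q q' : gT) m : all [in S] [:: v2; v1; q'; q] -> uniq [:: v2; v1; q'; q] ->
  lbl 3 v2 v1 -> lbl m v1 q -> (4 < m)%N -> lbl 3 q' q -> False.
Proof.
move=> aS u e2 e3 m3 e4; have c0 := ck_ge0 (ltnW (ltnW m3)); have c2 := ck2_ge5 m3.
pose c := ck X m; rewrite -/c in c0 c2.
apply: (@tree_contra 3 v2 6 v1 (-1) [:: (6, v1, 4 * c, q, - c);
   (2 * c, q', 4 * c, q, -1); (4 * c, q, 0, q, 0)]); rewrite ?ltr0n //.
- by rewrite /wgood aS u !andbT /= ?ler0n ?ler01 !pmulr_rge0 ?ltr0n ?(ltW c0).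
- have [/= v2S [v1S [q'S [qS _]]]] := allPP aS.
  by do !split; rewrite ?cartan_3le ?(cartan_lblle _ e3) ?(ltnW m3) // /tproj /= !inE eqxx ?orbT.
by rewrite /=; nra.
Qed.

(** The bound is 20 - 8 c^2, which vanishes exactly at c^2 = 5 / 2. *)
Lemma no_H5 (v1 v2 v3 v4 q : gT) m : all [in S] [:: v4; v3; v2; v1; q] -> uniq [:: v4; v3; v2; v1; q] ->
  lbl 3 v4 v3 -> lbl 3 v3 v2 -> lbl 3 v2 v1 -> lbl m v1 q -> (4 < m)%N -> False.
Proof.
move=> aS u e1 e2 e3 e4 m3; have c0 := ck_ge0 (ltnW (ltnW m3)); have c2 := ck2_ge5 m3.
pose c := ck X m; rewrite -/c in c0 c2.
apply: (@tree_contra 1 v4 2 v3 (-1) [:: (2, v3, 3, v2, -1); (3, v2, 4, v1, -1);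
   (4, v1, 2 * c, q, - c); (2 * c, q, 0, q, 0)]); rewrite ?ltr01 //.
- by rewrite /wgood aS u !andbT /= ?ler0n ?ler01 !pmulr_rge0 ?ltr0n ?(ltW c0).
- have [/= v4S [v3S [v2S [v1S [qS _]]]]] := allPP aS.
  by do !split; rewrite ?cartan_3le ?(cartan_lblle _ e4) ?(ltnW m3) // /tproj /= !inE eqxx ?orbT.
by rewrite /=; nra.
Qed.

Lemma no_G2 (v1 v2 q : gT) m : all [in S] [:: v2; v1; q] -> uniq [:: v2; v1; q] ->
  lbl 3 v2 v1 -> lbl m v1 q -> (5 < m)%N -> False.
Proof.
move=> aS u e3 e4 m3; have c0 := ck_ge0 (ltnW (ltnW (ltnW m3))); have c2 := ck2_ge6 m3.
pose c := ck X m; rewrite -/c in c0 c2.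
apply: (@tree_contra 1 v2 2 v1 (-1) [:: (2, v1, c, q, - c); (c, q, 0, q, 0)]); rewrite ?ltr01 //.
- by rewrite /wgood aS u !andbT /= ?ler0n ?ler01 (ltW c0).
- have [/= v2S [v1S [qS _]]] := allPP aS.
  by do !split; rewrite ?cartan_3le ?(cartan_lblle _ e4) ?(ltnW (ltnW m3)) // /tproj /= !inE eqxx ?orbT.
by rewrite /=; nra.
Qed.

End Norm.
End Classification.

(** * Extending a longest path with labels 3 *)

Section Classify.
Variables (gT : finGroupType) (S : {set gT}) (R : realFieldType).
Variable X : coxrep S R.
Implicit Types (s t q w x y z v l r : gT) (c P L Q T : seq gT).
Hypothesis pd : forall u, supp S u -> (bil X u u <= 0)%R -> u = 0%R.

Lemma cat_at x P : x \in P -> exists L T, P = L ++ x :: T.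
Proof. by case/splitPr=> L T; exists L, T. Qed.

Lemma uniq_cons3 x y z P : x != y -> x != z -> y != z -> x \notin P -> y \notin P -> z \notin P ->
  uniq P -> uniq [:: x, y, z & P].
Proof. by rewrite /= !inE !negb_or => -> -> -> -> -> -> ->. Qed.

Lemma uniq_sub P c T : perm_eq P (c ++ T) -> uniq P -> uniq c.
Proof. by move/perm_uniq=> ->; rewrite cat_uniq => /andP[]. Qed.

Lemma all_sub_perm P c T : perm_eq P (c ++ T) -> all [in S] P -> all [in S] c.
Proof. by move/perm_all=> ->; rewrite all_cat => /andP[]. Qed.

Lemma chain_lbl P x y L T : P = L ++ x :: y :: T -> all [in S] P -> chain P -> lbl 3 y x.
Proof.
move=> -> PS /chain_catr /= /andP[/andP[l _] _].
by rewrite (lblC X) //; apply: (allP PS); rewrite mem_cat !inE eqxx ?orbT.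
Qed.

Lemma lbl_adj m s t : lbl m s t -> 2 < m -> adj s t.
Proof. by move=> /eqP; rewrite /adj => ->. Qed.

Lemma adj_lbl s t : adj s t -> lbl 3 s t || (3 < #[s * t]).
Proof. by rewrite /adj /lbl leq_eqVlt eq_sym. Qed.

Lemma adjC s t : s \in S -> t \in S -> adj s t = adj t s.
Proof. by move=> sS tS; rewrite /adj (order_sym X sS tS). Qed.

(** A second neighbour of x on the path would close a cycle. *)
Lemma com_others P x y : all [in S] P -> chain P -> x \in S -> x \notin P -> y \in P ->
  adj x y -> {in P, forall z, z != y -> com x z}.
Proof.
move=> PS cP xS xP yP a z zP ne.
rewrite (com_adj X xS (allP PS _ zP)); last by apply: contraNneq xP => ->.
by apply/negP=> a'; apply: (no_cycle pd PS cP xS xP zP yP ne).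
Qed.

Lemma chain_mid P x y T : chain (P ++ x :: y :: T) -> lbl 3 x y.
Proof. by move/chain_catr=> /= /andP[/andP[]]. Qed.

(* Diagrams: in [typL m q P] the vertex q is joined by an edge labelled m to the
   head of the path P; [typT v x L T] is the star with centre v and arms [:: x],
   L and T; [typF] is F_4. *)
Definition typL m q P := [&& chain P, P != [::] & link m q P].

Definition typT v x L T := [&& chain (rev L ++ v :: T), lbl 3 x v & all (com x) (L ++ T)].

Definition typF r v q q' := [&& lbl 3 r v, lbl 4 v q, lbl 3 q q', com r q, com r q' & com v q'].

Lemma link_cons q v T : all [in S] (v :: T) -> chain (v :: T) -> q \in S -> q \notin v :: T ->
  adj q v -> link #[q * v] q (v :: T).
Proof.
move=> PS cP qS qP a; rewrite /link /lbl eqxx; apply/allP=> y yT.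
apply: (com_others PS cP qS qP (mem_head _ _) a); first by rewrite inE yT orbT.
apply: contraTneq (chain_uniq X PS cP) => e; by rewrite /= -e yT.
Qed.

Section Max.
Variable N : nat.
Hypothesis mx : forall Q, all [in S] Q -> chain Q -> size Q <= N.

(** A label 3 would prolong the path beyond the maximal size N. *)
Lemma max_cons P x y T : P = y :: T -> all [in S] P -> chain P -> size P = N -> x \in S ->
  x \notin P -> adj x y -> 3 < #[x * y].
Proof.
move=> -> PS cP sP xS xP a; case/orP: (adj_lbl a) => // l3.
have := @mx (x :: y :: T); have := link_cons PS cP xS xP a; rewrite (eqP l3) => lk.
have -> : all [in S] [:: x, y & T] by rewrite /= xS.
have -> : chain [:: x, y & T] by move: lk cP => /= -> ->.
by move/(_ isT isT); move: sP => /= <-; rewrite ltnn.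
Qed.

Lemma max_end P x y L T : P = L ++ y :: T -> all [in S] P -> chain P -> size P = N -> x \in S ->
  x \notin P -> adj x y -> nilp L || nilp T -> 3 < #[x * y].
Proof.
move=> eP PS cP sP xS xP a /orP[] /nilP e.
  by apply: (@max_cons P x y T) => //; rewrite eP e.
apply: (@max_cons (rev P) x y (rev L)); rewrite ?all_rev ?(chain_rev X) ?size_rev ?mem_rev //.
by rewrite eP e -cat_rcons cats0 rev_rcons.
Qed.

(** On the segment from v to a neighbour v' of q', the vertices l and q hang at v and q' at v'. If
    the path goes on beyond v' this is affine D; if v' is its end, maximality gives the edge of q' a
    label above 3, and this is affine B. *)
Lemma T_arm L v T l q q' L' : L = l :: L' ->
  all [in S] (rev L ++ v :: T) -> size (rev L ++ v :: T) = N ->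
  chain (rev L ++ v :: T) -> q \in S -> q \notin rev L ++ v :: T -> adj q v ->
  q' \in S -> q' \notin rev L ++ v :: T -> q' != q -> has (adj q') T -> False.
Proof.
move=> eL PS sP cP qS qP aq q'S q'P ne /hasP[v' /cat_at[c [T2 eT]] a].
have u := chain_uniq X PS cP.
pose s := v :: rcons c v'.
have eP : rev L ++ v :: T = (rev L' ++ [:: l]) ++ s ++ T2.
  by rewrite eL rev_cons -cats1 eT /s /= cat_rcons.
rewrite eP in u; have [] : [/\ all [in S] s, chain s & l \in S].
  split; first by apply/allP=> y ys; apply: (allP PS); rewrite eP !mem_cat ys !orbT.
    by move: cP; rewrite eP => /chain_catr/chain_catl.
  by apply: (allP PS); rewrite eP !mem_cat inE eqxx !orbT.
move=> sS cs lS; have v's : v' \in s by rewrite inE mem_rcons mem_head orbT.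
have sub : {subset s <= rev L ++ v :: T} by move=> y ys; rewrite eP !mem_cat ys orbT.
have ls : l \notin s.
  move: u; rewrite -catA cat_uniq /= => /and3P[_ _ /andP[]].
  by move=> h _; apply: contra h => ls; rewrite -cat_cons mem_cat ls.
have lP : l \in rev L ++ v :: T by rewrite eP !mem_cat inE eqxx orbT.
have alv : adj l v.
  move: cP; rewrite eL rev_cons cat_rcons => /chain_mid lb; exact: lbl_adj lb _.
have us : uniq s by apply: (chain_uniq X sS).
have qs : q \notin s by apply: contra qP => /sub.
have q's : q' \notin s by apply: contra q'P => /sub.
have hv z : adj z v -> has (adj z) s by move=> h; rewrite /= h.
have hv' z : adj z v' -> has (adj z) s by move=> h; apply/hasP; exists v'.
have lq : l != q by apply: contraNneq qP => <-.
have lq' : l != q' by apply: contraNneq q'P => <-.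
case: T2 eT eP u => [|r' T2] eT eP u.
  apply: (no_B pd (x1 := l) (x2 := q) (x3 := q') sS cs _ _ (hv _ alv) (hv _ aq) v's).
  - by rewrite /= lS qS q'S.
  - by apply: uniq_cons3 => //; rewrite eq_sym.
  apply: (@max_end _ q' v' (rev L ++ v :: c) [::] _ PS) => //; last by rewrite orbT.
  by rewrite eT -catA.
have r's : r' \notin s.
  move: u; rewrite cat_uniq => /and3P[_ _]; rewrite cat_uniq => /and3P[_ + _].
  by rewrite /= negb_or => /andP[].
have r'P : r' \in rev L ++ v :: T by rewrite eP !mem_cat mem_head !orbT.
have r'S : r' \in S by apply: (allP PS).
have ar' : adj r' v'.
  move: cP; rewrite eT -cat_cons catA => /chain_mid lb.
  by rewrite (adjC r'S (allP sS _ v's)); apply: (lbl_adj lb).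
have lr' : l != r'.
  move: u; rewrite cat_uniq => /and3P[_ /hasPn h _]; apply: contraTneq (h r' _) => [<-|].
    by rewrite mem_cat mem_seq1 eqxx orbT.
  by rewrite mem_cat mem_head orbT.
have r'q : q != r' by apply: contraNneq qP => ->.
have r'q' : q' != r' by apply: contraNneq q'P => ->.
apply: (no_D pd (x1 := l) (x2 := q) (x3 := q') (x4 := r') sS cs _ _ _ (hv _ alv) (hv _ aq) (hv' _ a) (hv' _ ar')) => //.
- by rewrite /= lS qS q'S r'S.
rewrite cons_uniq uniq_cons3 // ?andbT; last by rewrite eq_sym.
by rewrite in_cons negb_or lq in_cons negb_or lq' in_cons negb_or lr'.
Qed.

Lemma ctr_rev L v T : rev (rev L ++ v :: T) = rev T ++ v :: L.
Proof. by rewrite rev_cat revK rev_cons cat_rcons. Qed.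

(** Joined to the path, q' falls under [T_arm] on either side or is a fourth neighbour of v. Joined
    to q by a label above 3 it gives affine B; by a label 3 it makes the arm of q of length 2, and
    maximality makes the other arms at least as long, which is affine E_6. *)
Lemma T_extra L v T l r L' T' q q' : L = l :: L' -> T = r :: T' ->
  all [in S] (rev L ++ v :: T) -> size (rev L ++ v :: T) = N ->
  chain (rev L ++ v :: T) -> q \in S -> q \notin rev L ++ v :: T -> lbl 3 q v ->
  q' \in S -> q' \notin q :: rev L ++ v :: T -> has (adj q') (q :: rev L ++ v :: T) -> False.
Proof.
move=> eL eT PS sP cP qS qP l3 q'S; rewrite inE negb_or => /andP[ne q'P] aq'.
have aq := lbl_adj l3 isT; have u := chain_uniq X PS cP.
have [lS [rS vS]] : l \in S /\ r \in S /\ v \in S.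
  by split; [|split]; apply: (allP PS); rewrite mem_cat ?mem_rev ?eL ?eT !inE eqxx ?orbT.
have alv : lbl 3 l v by move: cP; rewrite eL rev_cons cat_rcons => /chain_mid.
have arv : lbl 3 r v by move: cP; rewrite eT (lblC X) // => /chain_mid.
have [lP rP] : l \in rev L ++ v :: T /\ r \in rev L ++ v :: T.
  by rewrite !mem_cat ?mem_rev eL eT !inE !eqxx ?orbT.
have [lr [lv rv]] : l != r /\ l != v /\ r != v.
  move: u; rewrite eL eT rev_cons cat_rcons cat_uniq => /and3P[_ _] /=.
  by rewrite !inE !negb_or -!andbA => /and5P[-> -> _ + _]; rewrite eq_sym => ->.
have nqq z : z \in rev L ++ v :: T -> q != z /\ q' != z.
  by move=> zP; split; [apply: contraNneq qP | apply: contraNneq q'P] => ->.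
have vP : v \in rev L ++ v :: T by rewrite mem_cat mem_head orbT.
have [[ql q'l] [[qr q'r] [qv q'v]]] := (nqq _ lP, (nqq _ rP, nqq _ vP)).
have [hP|hP] := boolP (has (adj q') (rev L ++ v :: T)).
  move: hP; rewrite has_cat has_rev /= => /or3P[h|h|h].
  - have e := ctr_rev L v T.
    apply: (@T_arm T v L r q q' T' eT) => //; rewrite -e ?all_rev ?size_rev ?(chain_rev X PS) ?mem_rev //.
  - apply: (no_D pd (P := [:: v]) (x1 := l) (x2 := r) (x3 := q) (x4 := q')); rewrite /= ?vS ?lS ?rS ?qS ?q'S //.
    + by rewrite !inE !negb_or lr lv rv qv q'v (eq_sym l q) ql (eq_sym l q') q'l (eq_sym r q) qr (eq_sym r q') q'r (eq_sym q) ne.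
    + by rewrite (lbl_adj alv).
    + by rewrite (lbl_adj arv).
    + by rewrite aq.
    + by rewrite h.
  - by apply: (@T_arm L v T l q q' L').
move: aq'; rewrite /= (negbTE hP) orbF => a.
case/orP: (adj_lbl a) => [l3'|l4]; last first.
  apply: (no_B pd (P := [:: q; v]) (x1 := l) (x2 := r) (x3 := q') (y := q)); rewrite /= ?vS ?lS ?rS ?qS ?q'S ?l3 //.
  - by rewrite !inE !negb_or lr lv rv qv q'v (eq_sym l q) ql (eq_sym l q') q'l (eq_sym r q) qr (eq_sym r q') q'r ne.
  - by rewrite (lbl_adj alv) ?orbT.
  - by rewrite (lbl_adj arv) ?orbT.
  - by rewrite mem_head.
have comq' z : z \in rev L ++ v :: T -> com q' z.
  move=> zP; rewrite (com_adj X q'S (allP PS _ zP)); first by apply: contra hP => h; apply/hasP; exists z.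
  by case: (nqq z zP).
have comq z : z \in rev L ++ v :: T -> z != v -> com q z.
  exact: (com_others PS cP qS qP vP aq).
(* The arm q, q' can replace either arm of the path; comparing sizes with N shows that the replaced
   arm has at least 2 vertices. *)
have long U : {subset U <= rev L ++ v :: T} -> chain (v :: U) -> (size U).+3 <= N.
  move=> UP cU; apply: (@mx [:: q', q, v & U]).
    by rewrite /= q'S qS vS; apply/allP=> z /UP /(allP PS).
  have uv : v \notin U.
    have /(chain_uniq X)/(_ cU) : all [in S] (v :: U) by rewrite /= vS; apply/allP=> z /UP /(allP PS).
    by case/andP.
  have c1 : all (com q') U by apply/allP=> z /UP /comq'.
  have c2 : all (com q) U.
    by apply/allP=> z zU; apply: comq; [apply: UP | apply: contraNneq uv => <-].
  by move: cU => /= ->; rewrite l3' l3 c1 c2 comq'.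
have [cL cT] : chain (v :: L) /\ chain (v :: T).
  by split; [move: cP; rewrite -(chain_rev X PS) ctr_rev => /chain_catr | apply: chain_catr cP].
have TP : {subset T <= rev L ++ v :: T} by move=> z zT; rewrite mem_cat inE zT !orbT.
have LP : {subset L <= rev L ++ v :: T} by move=> z zT; rewrite mem_cat mem_rev zT.
have := long _ TP cT; have := long _ LP cL; rewrite -sP size_cat size_rev /= eL eT /=.
case: L' eL => [|l2 L'] eL; first by move=> _; rewrite !addSn add0n ltnn.
case: T' eT => [|r2 T'] eT; first by rewrite /= addn2 !ltnS ltnn.
move=> _ _; have [l2P r2P] : l2 \in rev L ++ v :: T /\ r2 \in rev L ++ v :: T.
  by split; [apply: LP; rewrite eL | apply: TP; rewrite eT]; rewrite !inE eqxx orbT.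
have [[ql2 q'l2] [qr2 q'r2]] := (nqq _ l2P, nqq _ r2P).
apply: (no_E6 pd (v := v) (l1 := l) (l2 := l2) (r1 := r) (r2 := r2) (q := q) (q' := q')) => //.
- by rewrite /= (allP PS _ l2P) (allP PS _ r2P) lS rS q'S qS vS.
- have pP : perm_eq [:: q', q & rev L ++ v :: T] ([:: l2; l; r2; r; q'; q; v] ++ L' ++ T').
    by apply/seq.permP=> z; rewrite /= !count_cat count_rev eL eT /=; clear; lia.
  by apply: (uniq_sub pP); rewrite /= inE negb_or ne q'P qP.
- by move: cL; rewrite eL /= (lblC X 3 (allP PS _ l2P) lS) => /and3P[_ /andP[]].
- by move: cT; rewrite eT /= (lblC X 3 (allP PS _ r2P) rS) => /and3P[_ /andP[]].
Qed.

(** A label above 3 at q' gives affine C, and maximality forces such a label at an end of the path;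
    a label 3 at an inner vertex gives affine B. *)
Lemma L_arm P v T q q' : P = v :: T -> all [in S] P -> size P = N -> chain P ->
  q \in S -> q \notin P -> 3 < #[q * v] -> q' \in S -> q' \notin P -> q' != q ->
  has (adj q') P -> False.
Proof.
move=> eP PS sP cP qS qP o q'S q'P ne /hasP[v' v'P a].
have vP : v \in P by rewrite eP mem_head.
case: (leqP #[q' * v'] 3) => [o3|o4]; last first.
  by apply: (no_C pd PS cP qS q'S _ vP v'P o o4); rewrite /= inE negb_or eq_sym ne qP q'P (chain_uniq X).
have [c [T2 eP']] := cat_at v'P.
have [c0|c0] := boolP (nilp c || nilp T2).
  by have := max_end eP' PS cP sP q'S q'P a c0; rewrite ltnNge o3.
rewrite negb_or in c0; case: c eP' c0 => // v0 c eP'; case: T2 eP' => // r' T2 eP' _.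
have ev : v0 = v by move: eP'; rewrite eP => -[].
rewrite {}ev in eP'; pose s := v :: rcons c v'.
have eP2 : P = s ++ r' :: T2 by rewrite eP' /s /= cat_rcons.
have u := chain_uniq X PS cP; rewrite eP2 cat_uniq in u; case/and3P: u => us /= + _.
rewrite negb_or => /andP[r's _].
have sub : {subset s <= P} by move=> y ys; rewrite eP2 mem_cat ys.
have r'P : r' \in P by rewrite eP2 mem_cat mem_head orbT.
have v's : v' \in s by rewrite inE mem_rcons mem_head orbT.
have sS : all [in S] s by apply/allP=> y /sub /(allP PS).
apply: (no_B pd (P := s) (x1 := q') (x2 := r') (x3 := q) (y := v)) => //.
- by move: cP; rewrite eP2 => /chain_catl.
- by rewrite /= q'S qS (allP PS).
- apply: uniq_cons3 => //; [|by apply: contraNneq qP => <-| |].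
  + by apply: contraNneq q'P => ->.
  + by apply: contra q'P => /sub.
  + by apply: contra qP => /sub.
- by apply/hasP; exists v'.
- apply/hasP; exists v' => //; rewrite (adjC (allP PS _ r'P) (allP PS _ v'P)).
  by move: cP; rewrite eP' => /chain_mid /lbl_adj; apply.
- exact: mem_head.
Qed.

(** By [L_arm] the vertex q' can only continue beyond q. Then [no_F45] leaves the label 4 and
    [no_F4] a path of two vertices, that is, F_4. *)
Lemma L_extra P v T q m q' : P = v :: T -> all [in S] P -> size P = N -> chain P ->
  q \in S -> q \notin P -> lbl m q v -> 3 < m -> q' \in S -> q' \notin q :: P ->
  has (adj q') (q :: P) -> exists r, [/\ T = [:: r], lbl 4 q v, lbl 3 q' q & ~~ has (adj q') P].
Proof.
move=> eP PS sP cP qS qP lm m3 q'S; rewrite inE negb_or => /andP[ne q'P] h.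
have o : 3 < #[q * v] by rewrite (eqP lm).
have hP : ~~ has (adj q') P by apply/negP; apply: (L_arm eP PS sP cP qS qP o q'S q'P ne).
move: h; rewrite /= (negbTE hP) orbF => a.
have vP : v \in P by rewrite eP mem_head.
have vS : v \in S := allP PS _ vP.
have q'v : q' != v by apply: contraNneq q'P => ->.
have qv : q != v by apply: contraNneq qP => ->.
case/orP: (adj_lbl a) => [l3|l4]; last first.
  case: (no_C pd (P := [:: q]) (x1 := v) (x2 := q') (y1 := q) (y2 := q)); rewrite /= ?qS ?inE ?eqxx //.
    by rewrite negb_or eq_sym q'v eq_sym qv ne.
  by rewrite (order_sym X).
have lmv : lbl m v q by rewrite (lblC X).
have N2 : 2 <= N by apply: (@mx [:: q'; q]); rewrite /= ?q'S ?qS ?l3.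
case: T eP => [|r T] eP; first by rewrite -sP eP in N2.
have rP : r \in P by rewrite eP !inE eqxx orbT.
have rS : r \in S := allP PS _ rP.
have lr : lbl 3 r v by rewrite (lblC X) //; move: cP; rewrite eP /= => /andP[/andP[]].
have u := chain_uniq X PS cP.
have q'r : q' != r by apply: contraNneq q'P => ->.
have qr : q != r by apply: contraNneq qP => ->.
have vr : v != r by move: u; rewrite eP /= inE negb_or => /andP[/andP[]].
have m4 : m = 4.
  apply/eqP; rewrite eqn_leq m3 andbT leqNgt; apply/negP=> m4.
  apply: (no_F45 pd (v1 := v) (v2 := r) (q := q) (q' := q') _ _ lr lmv m4 l3).
    by rewrite /= rS vS q'S qS.
  by rewrite /= !inE !negb_or (eq_sym r v) vr (eq_sym r q') q'r (eq_sym r q) qr (eq_sym v q') q'v (eq_sym v) qv ne.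
rewrite m4 in lm; case: T eP => [|r2 T] eP; first by exists r.
have r2P : r2 \in P by rewrite eP !inE eqxx !orbT.
have r2S : r2 \in S := allP PS _ r2P.
have lr2 : lbl 3 r2 r by rewrite (lblC X) //; move: cP; rewrite eP /= => /and3P[_ /andP[]].
have q'r2 : q' != r2 by apply: contraNneq q'P => ->.
have qr2 : q != r2 by apply: contraNneq qP => ->.
have [vr2 rr2] : v != r2 /\ r != r2.
  by move: u; rewrite eP /= !inE !negb_or -!andbA => /and5P[_ -> _ -> _].
case: (no_F4 pd (v1 := v) (v2 := r) (v3 := r2) (q := q) (q' := q') _ _ lr2 lr lmv m3 l3).
  by rewrite /= r2S rS vS q'S qS.
rewrite /= !inE !negb_or (eq_sym r v) vr (eq_sym r q') q'r (eq_sym r q) qr (eq_sym v q') q'v (eq_sym v) qv ne.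
by rewrite (eq_sym r2 r) rr2 (eq_sym r2 v) vr2 (eq_sym r2 q') q'r2 (eq_sym r2) qr2.
Qed.

(** Joined to q' by a label 3, q'' would form with q' and q a path of three letters, against N = 2.
    The other positions give affine B, affine C, a cycle, or fall under [L_arm]. *)
Lemma F_extra v r q q' q'' : N = 2 -> all [in S] [:: v; r] -> chain [:: v; r] ->
  q \in S -> q \notin [:: v; r] -> lbl 4 q v -> q' \in S -> q' \notin [:: q; v; r] -> lbl 3 q' q ->
  q'' \in S -> q'' \notin [:: q'; q; v; r] -> has (adj q'') [:: q'; q; v; r] -> False.
Proof.
move=> N2 PS cP qS qP l4 q'S; rewrite inE negb_or => /andP[ne q'P] l3 q''S.
rewrite inE negb_or => /andP[ne'' ]; rewrite inE negb_or => /andP[neq q''P].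
have vS : v \in S by apply: (allP PS); rewrite mem_head.
have o : 3 < #[q * v] by rewrite (eqP l4).
have ov : 3 < #[v * q] by rewrite (order_sym X).
have [q'v qv q''v] : [/\ q' != v, q != v & q'' != v].
  by split; [move: q'P | move: qP | move: q''P]; rewrite !inE negb_or => /andP[].
have hP : ~~ has (adj q'') [:: v; r].
  by apply/negP; apply: (@L_arm [:: v; r] v [:: r] q q'').
rewrite -[[:: q', q & _]]/([:: q'; q] ++ [:: v; r]) has_cat (negbTE hP) orbF [has _ _]/= orbF => /orP[a|a]; last first.
  case/orP: (adj_lbl a) => l.
    apply: (no_B pd (P := [:: q]) (x1 := q') (x2 := q'') (x3 := v) (y := q)); rewrite /= ?qS ?q'S ?q''S ?vS ?inE ?eqxx ?a ?(lbl_adj l3) //.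
    by rewrite !negb_or (eq_sym q') ne'' q'v ne q''v neq (eq_sym v) qv.
  apply: (no_C pd (P := [:: q]) (x1 := q'') (x2 := v) (y1 := q) (y2 := q)); rewrite /= ?qS ?inE ?eqxx //.
  by rewrite negb_or q''v neq (eq_sym v) qv.
have [aq|naq] := boolP (adj q'' q).
  have l3q : lbl 3 q q' by rewrite (lblC X).
  by apply: (no_cycle pd (P := [:: q; q']) (x := q'') (y := q) (z := q')); rewrite /= ?qS ?q'S ?q''S ?l3q ?inE ?eqxx ?orbT ?negb_or ?neq ?ne'' // eq_sym.
case/orP: (adj_lbl a) => l.
  have := @mx [:: q''; q'; q]; rewrite N2 /= q''S q'S qS l l3 (com_adj X q''S qS neq) naq.
  by move=> /(_ isT isT).
apply: (no_C pd (P := [:: q; q']) (x1 := v) (x2 := q'') (y1 := q) (y2 := q')); rewrite /= ?qS ?q'S ?inE ?eqxx ?orbT //.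
  by rewrite (lblC X) // l3.
by rewrite !negb_or (eq_sym v q'') q''v (eq_sym v q) qv (eq_sym v) q'v neq ne'' (eq_sym q) ne.
Qed.

End Max.
Lemma max_chain : exists P, [/\ all [in S] P, chain P &
  forall Q, all [in S] Q -> chain Q -> size Q <= size P].
Proof.
pose ok n := [exists t : n.-tuple gT, all [in S] t && chain t].
have ex : exists n, ok n by exists 0; apply/existsP; exists [tuple].
have bd n : ok n -> n <= #|S|.
  case/existsP=> t /andP[tS ct]; rewrite -(size_tuple t) cardE.
  apply: uniq_leq_size; first exact: (chain_uniq X).
  by move=> x xt; rewrite mem_enum (allP tS).
case: (ex_maxnP ex bd) => n /existsP[t /andP[tS ct]] mx; exists t; split=> // Q QS cQ.
by rewrite size_tuple; apply: mx; apply/existsP; exists (in_tuple Q); rewrite QS.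
Qed.

Lemma ltr_full P : all [in S] P -> (forall q, q \in S -> q \notin P -> False) -> ltr P = S.
Proof.
move=> PS h; apply/setP=> q; rewrite inE; apply/idP/idP=> [/(allP PS)//|qS].
by apply/negPn/negP; apply: h.
Qed.

(** Starts from a longest path P with labels 3. If a vertex is left, some q outside is joined to a
    vertex v of P: label 3 leads to a star with three arms, while a larger label forces v to be an
    end of P and leads to B, F_4, H or a dihedral diagram. *)
Theorem classify : S != set0 ->
    {in S &, forall s t, connect (fun s t => [&& s \in S, t \in S & adj s t]) s t} ->
  [\/ exists P, [/\ chain P, uniq P & ltr P = S],
      exists m q P, [/\ typL m q P, uniq (q :: P), ltr (q :: P) = S &
         m = 4 \/ (m = 5 /\ size P <= 3) \/ (5 < m /\ size P = 1%N)],
      exists v x L T, [/\ typT v x L T, uniq (x :: rev L ++ v :: T), ltr (x :: rev L ++ v :: T) = S,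
         size L <= size T & size L = 1%N \/ size L = 2 /\ size T <= 4]
    | exists r v q q', [/\ typF r v q q', uniq [:: r; v; q; q'] & ltr [:: r; v; q; q'] = S]].
Proof.
move=> S0 con.
have ext P q : all [in S] P -> P != [::] -> q \in S -> q \notin P ->
    exists q', [/\ q' \in S, q' \notin P & has (adj q') P].
  case: P => // p P PS _ qS qP; have pS : p \in S by case/andP: PS.
  have /connectP[c pth e] := con p q pS qS.
  have {e} : last p c \notin p :: P by rewrite -e.
  move: (mem_head p P) pth; move: {1 3 4}p => y; elim: c y => /= [|z c IH] y yP; first by rewrite yP.
  case/andP=> /and3P[yS zS a] pth lP; have [zP|zP] := boolP (z \in p :: P); first exact: (IH z).
  by exists z; split=> //; rewrite -[_ || _]/(has (adj z) (p :: P)); apply/hasP; exists y => //; rewrite adjC.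
have [P [PS cP mx]] := max_chain.
have P0 : P != [::].
  have [s sS] := set0Pn _ S0; have := mx [:: s]; rewrite /= sS => /(_ isT isT).
  by case: (P).
have u := chain_uniq X PS cP.
have full Q : all [in S] Q -> ltr Q = S \/ exists2 q, q \in S & q \notin Q.
  move=> QS; have [->|ne] := eqVneq (ltr Q) S; [by left | right].
  have [q /andP[qS qQ]|h] := pickP [pred q in S | q \notin Q]; first by exists q.
  by case/eqP: ne; apply: ltr_full => // q qS qQ; have := h q; rewrite /= qS qQ.
have [fl|[q0 q0S q0P]] := full P PS; first by constructor 1; exists P.
have [q [qS qP /hasP[v vP a]]] := ext P q0 PS P0 q0S q0P.
have vS := allP PS _ vP.
have [L [T eP]] := cat_at vP; move: (revK L) eP; move: (rev L) => {}L <- eP.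
(* L is listed from v outwards, and reversing the path exchanges the two arms. *)
wlog LT : L T P PS cP P0 mx u {q0P} qP vP eP / size L <= size T.
  move=> W; case: (leqP (size L) (size T)) => [|/ltnW] le; first exact: (W L T P).
  apply: (W T L (rev P)); rewrite ?all_rev ?(chain_rev X) ?size_rev ?rev_uniq ?mem_rev //.
    by rewrite -size_eq0 size_rev size_eq0.
  by rewrite eP ctr_rev.
have mx' : forall Q, all [in S] Q -> chain Q -> size Q <= size P by [].
case: (leqP #[q * v] 3) => [o3|o4].
  have l3 : lbl 3 q v by rewrite /lbl eqn_leq o3.
  case: L eP LT => [|l L] eP LT.
    by have := max_cons mx eP PS cP erefl qS qP a; rewrite ltnNge o3.
  case: T eP LT => [//|r T] eP LT.
  constructor 3; exists v, q, (l :: L), (r :: T); rewrite -eP.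
  have fl : ltr (q :: P) = S.
    apply: ltr_full => [|q' q'S q'P]; first by rewrite /= qS.
    have [] := ext (q :: P) q'; rewrite /= ?qS // => q2 [q2S q2P h2].
    move: PS cP qP q2P h2 mx; rewrite eP => PS' cP' qP' q2P h2 mx2.
    exact: (T_extra mx2 (erefl (l :: L)) (erefl (r :: T)) PS' erefl cP' qS qP' l3 q2S q2P h2).
  have cq := com_others PS cP qS qP vP a.
  have vn z : z \in (l :: L) ++ r :: T -> z \in P /\ z != v.
    move=> zP; split; first by move: zP; rewrite eP !mem_cat mem_rev !inE => /orP[->|->]; rewrite ?orbT.
    move: u; rewrite eP cat_uniq rev_uniq => /and3P[_ /norP[h _] /andP[h' _]].
    by apply: contraTneq zP => ->; rewrite mem_cat negb_or h' andbT; move: h; rewrite mem_rev.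
  split=> //; [|by rewrite /= qP u|].
    by rewrite /typT -eP cP l3; apply/allP=> z /vn[zP zv]; apply: cq.
  have sub z : z \in (l :: L) ++ r :: T -> z \in S by move=> /vn[/(allP PS)].
  have cT : chain (v :: r :: T) by move: cP; rewrite eP => /chain_catr.
  have TS : all [in S] (v :: r :: T) by apply/allP=> z; rewrite inE => /predU1P[->//|zT]; apply: sub; rewrite mem_cat zT orbT.
  have LS : all [in S] (v :: l :: L) by apply/allP=> z; rewrite inE => /predU1P[->//|zT]; apply: sub; rewrite mem_cat zT.
  have cL : chain (v :: l :: L) by move: cP; rewrite -(chain_rev X PS) eP ctr_rev => /chain_catr.
  case: L eP LT fl vn LS sub cL => [|l2 L] eP LT fl vn LS sub cL; first by left.
  case: T eP LT fl vn TS sub cT => [//|r2 T] eP LT fl vn TS sub cT; right.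
  have uP : uniq (q :: P) by rewrite /= qP.
  case: L eP LT fl vn LS sub cL => [|l3' L] eP LT fl vn LS sub cL; last first.
    case: T eP LT fl vn TS sub cT => [//|r3 T] eP LT fl vn TS sub cT.
    have pP : perm_eq (q :: P) ([:: l3'; l2; l; r3; r2; r; q; v] ++ L ++ T).
      by apply/seq.permP=> z; rewrite eP /= !count_cat count_rev /=; clear; lia.
    have aS : all [in S] (q :: P) by rewrite /= qS.
    case: (no_E7 pd (all_sub_perm pP aS) (uniq_sub pP uP)) => //.
    - exact: (chain_lbl (L := [::]) erefl LS cL).
    - exact: (chain_lbl (L := [:: v]) erefl LS cL).
    - exact: (chain_lbl (L := [:: v; l]) erefl LS cL).
    - exact: (chain_lbl (L := [::]) erefl TS cT).
    - exact: (chain_lbl (L := [:: v]) erefl TS cT).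
    - exact: (chain_lbl (L := [:: v; r]) erefl TS cT).
  split=> //; rewrite leqNgt; apply/negP.
  case: T eP LT fl vn TS sub cT => [|r3 [|r4 [|r5 T]]] eP LT fl vn TS sub cT //= _.
  have pP : perm_eq (q :: P) ([:: l2; l; r5; r4; r3; r2; r; q; v] ++ T).
    by apply/seq.permP=> z; rewrite eP /=; clear; lia.
  have aS : all [in S] (q :: P) by rewrite /= qS.
  apply: (no_E8 pd (all_sub_perm pP aS) (uniq_sub pP uP)) => //.
  - exact: (chain_lbl (L := [::]) erefl LS cL).
  - exact: (chain_lbl (L := [:: v]) erefl LS cL).
  - exact: (chain_lbl (L := [::]) erefl TS cT).
  - exact: (chain_lbl (L := [:: v]) erefl TS cT).
  - exact: (chain_lbl (L := [:: v; r]) erefl TS cT).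
  - exact: (chain_lbl (L := [:: v; r; r2]) erefl TS cT).
  - exact: (chain_lbl (L := [:: v; r; r2; r3]) erefl TS cT).
have [m em] : exists m, m = #[q * v] by exists #[q * v].
have lm : lbl m q v by rewrite /lbl em.
have lmv : lbl m v q by rewrite (lblC X).
rewrite -em in o4; have uP : uniq (q :: P) by rewrite /= qP.
have aS : all [in S] (q :: P) by rewrite /= qS.
case: L eP LT => [|l L] eP LT; last first.
  case: T eP LT => [//|r T] eP _.
  have pP : perm_eq (q :: P) ([:: l; r; q; v] ++ L ++ T).
    by apply/seq.permP=> z; rewrite eP /= !count_cat count_rev /=; clear; lia.
  have /and5P[lS rS _ _ _] := all_sub_perm pP aS.
  case: (no_B pd (P := [:: v]) (x1 := l) (x2 := r) (x3 := q) (y := v)); rewrite /= ?lS ?rS ?qS ?vS ?inE ?eqxx //.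
  - by have := uniq_sub pP uP; rewrite /= !inE.
  - by move: cP; rewrite eP rev_cons cat_rcons => /chain_mid/lbl_adj->.
  - by rewrite (adjC rS vS); move: cP; rewrite eP => /chain_mid/lbl_adj->.
  - by rewrite -em.
clear LT; rewrite /= in eP; have cPv : chain (v :: T) by rewrite -eP.
have PvS : all [in S] (v :: T) by rewrite -eP.
have [fl|[q1 q1S q1P]] := full (q :: P) aS.
  constructor 2; exists m, q, P; split=> //.
    by rewrite /typL cP P0 em eP /=; apply: link_cons; rewrite // -?eP.
  have [->|m4] := eqVneq m 4; [by left | right].
  have [m5|m5] := leqP m 5; [left | right].
    have {m5}m5 : m = 5 by apply/eqP; rewrite eqn_leq m5 ltn_neqAle eq_sym m4.
    split=> //; rewrite leqNgt; apply/negP; rewrite eP /=.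
    case: T eP cPv PvS => [|r [|r2 [|r3 T]]] eP cPv PvS //= _.
    have pP : perm_eq (q :: P) ([:: r3; r2; r; v; q] ++ T).
      by apply/seq.permP=> z; rewrite eP /=; clear; lia.
    apply: (no_H5 pd (all_sub_perm pP aS) (uniq_sub pP uP) _ _ _ lmv); rewrite ?m5 //.
    - exact: (chain_lbl (L := [:: v; r]) erefl PvS cPv).
    - exact: (chain_lbl (L := [:: v]) erefl PvS cPv).
    - exact: (chain_lbl (L := [::]) erefl PvS cPv).
  split=> //; rewrite eP /=; case: T eP cPv PvS => [|r T] eP cPv PvS //=.
  have pP : perm_eq (q :: P) ([:: r; v; q] ++ T) by apply/seq.permP=> z; rewrite eP /=; clear; lia.
  case: (no_G2 pd (all_sub_perm pP aS) (uniq_sub pP uP) _ lmv m5).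
  exact: (chain_lbl (L := [::]) erefl PvS cPv).
have [q' [q'S q'P h]] := ext (q :: P) q1 aS isT q1S q1P.
have [r [eT l4 l3 hP]] := L_extra mx (erefl (v :: T)) PvS (congr1 size (esym eP)) cPv qS
  (etrans (congr1 (fun Q => q \notin Q) (esym eP)) qP) lm o4 q'S
  (etrans (congr1 (fun Q => q' \notin q :: Q) (esym eP)) q'P)
  (etrans (congr1 (fun Q => has (adj q') (q :: Q)) (esym eP)) h).
rewrite {}eT in eP cPv PvS hP; rewrite eP in q'P qP.
have rS : r \in S by case/and3P: PvS.
have [q'r q'v] : q' != r /\ q' != v.
  by move: q'P; rewrite !inE !negb_or => /and3P[_ -> ->].
have qr : q != r by move: qP; rewrite !inE !negb_or => /andP[].
have rv : r != v by have := chain_uniq X PvS cPv; rewrite /= inE eq_sym andbT.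
constructor 4; exists r, v, q, q'; split.
- rewrite /typF (lblC X 3 rS vS) (lblC X 4 vS qS) (lblC X 3 qS q'S) l4 l3.
  rewrite (comC X rS qS) (comC X rS q'S) (comC X vS q'S) (com_adj X q'S rS q'r) (com_adj X q'S vS q'v).
  move: hP; rewrite /= orbF negb_or => /andP[-> ->]; rewrite !andbT.
  apply/andP; split; first by move: cPv; rewrite /= !andbT.
  by apply: (com_others PvS cPv qS qP (mem_head _ _) a); rewrite ?inE ?eqxx ?orbT.
- have pP : perm_eq [:: q'; q; v; r] ([:: r; v; q; q'] ++ [::]).
    by apply/seq.permP=> z /=; clear; lia.
  by apply: (uniq_sub pP); rewrite cons_uniq q'P cons_uniq qP /= inE eq_sym rv.
apply: ltr_full => [|q2 q2S q2P]; first by rewrite /= rS vS qS q'S.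
have aS' : all [in S] [:: q'; q; v; r] by rewrite /= rS vS qS q'S.
have q2P' : q2 \notin [:: q'; q; v; r].
  by move: q2P; rewrite !inE !negb_or => /and4P[-> -> -> ->].
have [q3 [q3S q3P h3]] := ext _ q2 aS' isT q2S q2P'.
have N2 : size P = 2 by rewrite eP.
exact: (F_extra mx N2 PvS cPv qS qP l4 q'S q'P l3 q3S q3P h3).
Qed.

End Classify.

(** * Solving the recurrence *)

Section Catalan.
Local Open Scope nat_scope.

Definition catalan n := 'C(n.*2, n) - 'C(n.*2, n.+1).

Lemma catalan_bin n : n.+1 * catalan n = 'C(n.*2, n).
Proof.
rewrite /catalan mulnBr mul_bin_left -addnn addnK mulSn; lia.
Qed.

Lemma catalanS n : n.+2 * catalan n.+1 = (4 * n + 2) * catalan n.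
Proof.
have e1 : n.+1 * 'C(n.+1.*2, n.+1) = (n.+1.*2) * 'C(n.*2.+1, n).
  by rewrite doubleS -mul_bin_diag.
have e2 : n.+1 * 'C(n.*2.+1, n) = (n.*2.+1) * 'C(n.*2, n).
  rewrite [in RHS]mul_bin_diag -(@bin_sub (n.*2.+1) n.+1); last by lia.
  by rewrite (_ : n.*2.+1 - n.+1 = n) //; lia.
have := catalan_bin n.+1; have := catalan_bin n; move: e1 e2.
move: ('C(n.+1.*2, n.+1)) ('C(n.*2.+1, n)) ('C(n.*2, n)) (catalan n) (catalan n.+1) => a b c d e.
rewrite -!muln2 => e1 e2 e3 e4.
have : n.+1 * a = n.+1 * ((4 * n + 2) * d).
  rewrite e1; have -> : n.+1 * 2 * b = 2 * (n.+1 * b) by ring.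
  by rewrite e2 -e3; ring.
by move/eqP; rewrite eqn_pmul2l // -e4 => /eqP.
Qed.

Lemma sum_recl (F : nat -> nat) n : \sum_(i < n.+1) F i = F 0 + \sum_(i < n) F i.+1.
Proof. by rewrite big_ord_recl. Qed.

Lemma catalan0 : catalan 0 = 1. Proof. by []. Qed.

(** The sum is added to its reversal under i -> n - i. *)
Lemma catalan_conv2 n : 2 * \sum_(i < n.+1) i * (catalan i * catalan (n - i)) =
  n * \sum_(i < n.+1) catalan i * catalan (n - i).
Proof.
rewrite mul2n -addnn {2}(reindex_inj rev_ord_inj) /= -big_split big_distrr /=.
apply: eq_bigr => i _; have := ltn_ord i; rewrite ltnS subSS => le.
by rewrite subKn // [catalan (n - i) * _]mulnC -mulnDl subnKC.
Qed.

(** Segner's recurrence: with weights i + 2, [catalanS] turns the convolution at n + 1 into the one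
    at n, and [catalan_conv2] evaluates the weighted sums at both levels. *)
Lemma catalan_conv n : \sum_(i < n.+1) catalan i * catalan (n - i) = catalan n.+1.
Proof.
elim: n => [|n IH]; first by rewrite big_ord_recl big_ord0.
have h1 := catalan_conv2 n; have h2 := catalan_conv2 n.+1; have h3 := catalanS n.+1.
rewrite IH in h1.
rewrite (sum_recl (fun i => i * (catalan i * catalan (n.+1 - i)))) mul0n add0n in h2.
rewrite (sum_recl (fun i => catalan i * catalan (n.+1 - i))) subn0 catalan0 mul1n in h2 *.
have e : \sum_(i < n.+1) i.+1 * (catalan i.+1 * catalan (n.+1 - i.+1)) +
   \sum_(i < n.+1) (catalan i.+1 * catalan (n.+1 - i.+1)) =
   4 * (\sum_(i < n.+1) i * (catalan i * catalan (n - i))) + 2 * catalan n.+1.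
  rewrite -IH -big_split !big_distrr -big_split; apply: eq_bigr => i _ /=.
  have := catalanS i; rewrite subSS; move: (catalan i) (catalan i.+1) (catalan (n - i)) => a b c e.
  have -> : i.+1 * (b * c) + b * c = i.+2 * b * c by ring.
  by rewrite e; ring.
move: h1 h2 h3 e.
move: (\sum_(i < n.+1) i * _) (\sum_(i < n.+1) i.+1 * _) (\sum_(i < n.+1) catalan i.+1 * _).
move: (catalan n.+1) (catalan n.+2) => a b c d f; clear; nia.
Qed.

Lemma catalan_weight n : 2 * \sum_(i < n.+1) i * (catalan i * catalan (n - i)) = n * catalan n.+1.
Proof. by rewrite catalan_conv2 catalan_conv. Qed.

(** The recurrence for A_n, with h = n + 1: deleting a vertex leaves two paths. *)
Lemma catalanA n : 2 * n * catalan n.+1 =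
  (n.+1 + 2) * \sum_(i < n) catalan i.+1 * catalan (n - i).
Proof.
have := catalan_conv n.+1; rewrite big_ord_recl big_ord_recr /= !subn0 (_ : catalan 0 = 1) //.
rewrite /bump leq0n add1n subnn (_ : catalan 0 = 1) // mul1n muln1.
under eq_bigr => i _ do rewrite /bump leq0n add1n subSS.
have := catalanS n.+1; move: (\sum_(i < n) _) (catalan n.+1) (catalan n.+2) => a b c.
clear; nia.
Qed.

(** The recurrence for B_(k+1), with h = 2 (k + 1). The first term deletes the end vertex at the
    edge of label 4. *)
Lemma catalanB k : 2 * k.+1 * (k.+2 * catalan k.+1) =
  (2 * k.+1 + 2) * (catalan k.+1 + \sum_(i < k) (i.+2 * catalan i.+1) * catalan (k - i)).
Proof.
have h := catalan_weight k.+1; have h' := catalan_conv k.+1; have := catalanS k.+1.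
rewrite (sum_recl (fun i => i * (catalan i * catalan (k.+1 - i)))) big_ord_recr /= subnn catalan0 muln1 mul0n add0n in h.
rewrite (sum_recl (fun i => catalan i * catalan (k.+1 - i))) big_ord_recr /= subnn catalan0 muln1 subn0 mul1n in h'.
have -> : \sum_(i < k) (i.+2 * catalan i.+1) * catalan (k - i) =
   \sum_(i < k) i.+1 * (catalan i.+1 * catalan (k.+1 - i.+1)) +
   \sum_(i < k) catalan i.+1 * catalan (k.+1 - i.+1).
  rewrite -big_split; apply: eq_bigr => i _ /=; rewrite subSS; ring.
move: h h'; move: (\sum_(i < k) i.+1 * _) (\sum_(i < k) catalan i.+1 * _) (catalan k.+1) (catalan k.+2) => a b c d.
clear; nia.
Qed.

(** The recurrence for D_(j+3), where h + 2 cancels against twice the rank. The terms delete one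
    short arm, the centre, the other short arm, and the vertices of the long arm. *)
Lemma catalanD j : (3 * j + 7) * catalan j.+2 =
  catalan j.+3 + 4 * catalan j.+1 + catalan j.+3 +
  \sum_(i < j) ((3 * i + 7) * catalan i.+2) * catalan (j - i).
Proof.
have h := catalan_weight j.+2; have h' := catalan_conv j.+2; have := catalanS j.+2.
rewrite (sum_recl (fun i => i * (catalan i * catalan (j.+2 - i)))) mul0n add0n in h.
rewrite (sum_recl (fun i => catalan i * catalan (j.+2 - i))) subn0 catalan0 mul1n in h'.
rewrite (sum_recl (fun i => i.+1 * (catalan i.+1 * catalan (j.+2 - i.+1)))) big_ord_recr /= subnn subSS subn0 catalan0 muln1 in h.
rewrite (sum_recl (fun i => catalan i.+1 * catalan (j.+2 - i.+1))) big_ord_recr /= subnn subSS subn0 catalan0 muln1 in h'.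
have -> : \sum_(i < j) ((3 * i + 7) * catalan i.+2) * catalan (j - i) =
   3 * \sum_(i < j) i.+2 * (catalan i.+2 * catalan (j.+2 - i.+2)) +
   \sum_(i < j) catalan i.+2 * catalan (j.+2 - i.+2).
  rewrite big_distrr -big_split; apply: eq_bigr => i _ /=; rewrite !subSS; ring.
rewrite (_ : catalan 1 = 1) // !mul1n in h h'.
move: h h'; move: (\sum_(i < j) i.+2 * _) (\sum_(i < j) catalan i.+2 * _) (catalan j.+1) (catalan j.+2) (catalan j.+3) => a b c d e.
clear; nia.
Qed.

End Catalan.

(** * Values of the count for each diagram *)

Section Values.
Variables (gT : finGroupType) (S : {set gT}) (R : realFieldType).
Variable X : coxrep S R.
Implicit Types (s t q w x y z v l r : gT) (c P L Q T : seq gT).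
Hypothesis pd : forall u, supp S u -> (bil X u u <= 0)%R -> u = 0%R.

Definition ordh (J : {set gT}) h := forall a, uniq a -> ltr a = J -> #[wprod a] = h.

Fixpoint conn Q := if Q is q :: Q' then nilp Q' || (has (adj q) Q' && conn Q') else true.

Lemma adj_ncom s t : s \in S -> t \in S -> adj s t -> s * t != t * s.
Proof.
move=> sS tS a; have := adj_neq X sS a; apply: contraNneq => e.
have := order2_comm X sS tS; rewrite (adj_neq X sS a) e eqxx /=.
by move: a; rewrite /adj e => + h; rewrite (eqP h).
Qed.

Lemma com_comm s t : s \in S -> t \in S -> com s t -> s * t = t * s.
Proof. by move=> sS tS; rewrite /com (order2_comm X sS tS) => /andP[_ /eqP]. Qed.

Lemma conn_connect Q : all [in S] Q -> conn Q ->
  {in ltr Q &, forall s t, connect (fun s t => [&& s \in ltr Q, t \in ltr Q & s * t != t * s]) s t}.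
Proof.
elim: Q => [|q Q IH] /=; first by move=> _ _ s t; rewrite inE.
case/andP=> qS QS /orP[/nilP->|/andP[/hasP[y yQ a] cQ]] s t; rewrite !inE.
  by move=> /eqP-> /eqP->; apply: connect0.
have sub u v : u \in Q -> v \in Q ->
    connect (fun s t => [&& s \in ltr (q :: Q), t \in ltr (q :: Q) & s * t != t * s]) u v.
  move=> uQ vQ; have := IH QS cQ u v; rewrite !inE => /(_ uQ vQ).
  apply: connect_sub => u' v'; rewrite !inE => /and3P[uQ' vQ' ne]; apply: connect1.
  by rewrite !inE uQ' vQ' ne !orbT.
have yS := allP QS _ yQ; have ne := adj_ncom qS yS a.
have qy : connect (fun s t => [&& s \in ltr (q :: Q), t \in ltr (q :: Q) & s * t != t * s]) q y.
  by apply: connect1; rewrite !inE eqxx yQ ne orbT.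
have yq : connect (fun s t => [&& s \in ltr (q :: Q), t \in ltr (q :: Q) & s * t != t * s]) y q.
  by apply: connect1; rewrite !inE eqxx yQ orbT [y * q == _]eq_sym ne.
case/predU1P=> [->|sQ] /predU1P[->|tQ]; first exact: connect0.
- exact: connect_trans qy (sub _ _ yQ tQ).
- exact: connect_trans (sub _ _ sQ yQ) yq.
- exact: sub.
Qed.

Lemma Nval_seq Q (g : gT -> nat) h n : all [in S] Q -> uniq Q -> Q != [::] -> conn Q ->
  ordh (ltr Q) h -> {in Q, forall q, Nval X (ltr Q :\ q) (g q)} ->
  (2 * size Q * n = (h + 2) * \sum_(q <- Q) g q)%N -> Nval X (ltr Q) n.
Proof.
move=> QS u Q0 cQ oh gv e; apply: (Nval_rec (G := g) (h := h)).
- by apply: ltr_sub.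
- by apply/set0Pn; case: Q Q0 {QS u cQ oh gv e} => // q Q _; exists q; rewrite inE mem_head.
- exact: conn_connect.
- exact: pd.
- by move=> q; rewrite inE; apply: gv.
- exact: oh.
have -> : #|ltr Q| = size Q by rewrite cardsE; apply/card_uniqP.
rewrite e big_uniq //; congr (_ * _)%N; apply: eq_bigl => q; by rewrite inE.
Qed.

Lemma Nval_cat P Q n n' : all [in S] P -> all [in S] Q -> allrel (@com gT) P Q ->
  Nval X (ltr P) n -> Nval X (ltr Q) n' -> Nval X (ltr (P ++ Q)) (n * n')%N.
Proof.
move=> PS QS /allrelP c h1 h2.
have -> : ltr (P ++ Q) = ltr P :|: ltr Q by apply/setP=> q; rewrite !inE mem_cat.
apply: Nval_prod => //; rewrite ?ltr_sub //.
  rewrite disjoint_subset; apply/subsetP=> q; rewrite !inE => qP; apply/negP=> qQ.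
  by have := com_neq X (allP PS _ qP) (c q q qP qQ); rewrite eqxx.
move=> s t; rewrite !inE => sP tQ; apply: com_comm; [exact: (allP PS)|exact: (allP QS)|exact: c].
Qed.

Lemma ltr_del P q Q : uniq (P ++ q :: Q) -> ltr (P ++ q :: Q) :\ q = ltr (P ++ Q).
Proof.
have -> : uniq (P ++ q :: Q) = uniq (q :: P ++ Q).
  by apply/perm_uniq; rewrite -cat1s perm_catCA.
case/andP=> nq _.
apply/setP=> y; rewrite !inE !mem_cat !inE; case: eqP => [->|] //=.
by apply/esym/negbTE; move: nq; rewrite mem_cat.
Qed.

Lemma chain_split P q Q : all [in S] (P ++ q :: Q) -> chain (P ++ q :: Q) ->
  [/\ chain P, chain Q & allrel (@com gT) P Q].
Proof.
move=> aS cP; split; [exact: chain_catl cP | by move: cP => /chain_catr /= /andP[] |].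
move: aS cP; rewrite -{1 2}(revK P) => aS; rewrite all_cat /= in aS; case/and3P: aS => PS qS QS.
rewrite all_rev in PS; rewrite (chain_center X PS qS QS) => /and3P[_ _ h].
by apply/allrelP=> s t sP tQ; apply: (allrelP h) => //; rewrite mem_rev.
Qed.

Lemma chain_conn P : chain P -> conn P.
Proof.
elim: P => // s [|t P] IH // /andP[/andP[l _] c].
by rewrite [conn _]/= -/(conn (t :: P)) IH // (lbl_adj l).
Qed.

Lemma sum_index P (F : nat -> nat) : uniq P ->
  (\sum_(q <- P) F (index q P) = \sum_(i < size P) F i)%N.
Proof.
case: P => [|p P] u; first by rewrite big_nil big_ord0.
rewrite (big_nth p) big_mkord; apply: eq_bigr => i _; by rewrite index_uniq.
Qed.

Lemma index_mid P q Q : uniq (P ++ q :: Q) -> index q (P ++ q :: Q) = size P.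
Proof.
rewrite cat_uniq => /and3P[_ /= /norP[nq _] _].
by rewrite index_cat (negbTE nq) /= eqxx addn0.
Qed.

Lemma size_mid P q Q n : size (P ++ q :: Q) <= n -> size P < n /\ size Q < n.
Proof. by rewrite size_cat /=; lia. Qed.

Lemma ltr_perm P Q : perm_eq P Q -> ltr P = ltr Q.
Proof. by move/perm_mem=> h; apply/setP=> y; rewrite !inE h. Qed.

Lemma ltr_nil : ltr ([::] : seq gT) = set0.
Proof. by apply/setP=> y; rewrite !inE. Qed.

Definition ordA := forall P, all [in S] P -> chain P -> P != [::] -> ordh (ltr P) (size P).+1.

Lemma Nval_chain P : ordA -> all [in S] P -> chain P -> Nval X (ltr P) (catalan (size P).+1).
Proof.
move=> oA; have [n] := ubnP (size P); elim: n P => // n IH P; rewrite ltnS => sP PS cP.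
have [->|P0] := eqVneq P [::]; first by rewrite ltr_nil; apply: Nval0.
have u := chain_uniq X PS cP.
apply: (@Nval_seq P (fun q => catalan (index q P).+1 * catalan (size P - index q P))%N (size P).+1) => //.
- exact: chain_conn.
- exact: oA.
- move=> q /cat_at[A [B e]]; move: u PS cP sP; rewrite e => u PS cP sP; rewrite ltr_del //.
  have [cA cB cAB] := chain_split PS cP; rewrite index_mid //.
  move: PS; rewrite all_cat /= => /and3P[AS qS BS].
  have [sA sB] := size_mid sP; rewrite size_cat addKn.
  by apply: Nval_cat => //; apply: IH.
rewrite (sum_index (fun i => catalan i.+1 * catalan (size P - i)))%N //.
exact: catalanA.
Qed.

Definition ordL m N (hv : nat -> nat) := forall q P, all [in S] (q :: P) -> typL m q P ->
  size P <= N -> ordh (ltr (q :: P)) (hv (size P)).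

Lemma typL_uniq m q P : 1 < m -> all [in S] (q :: P) -> typL m q P -> uniq (q :: P).
Proof.
move=> m1 /= /andP[qS PS] /and3P[cP _ lk]; rewrite (chain_uniq X) // andbT.
case: P lk PS {cP} => // t P /andP[/eqP l c] /= /andP[tS PS]; rewrite inE negb_or.
apply/andP; split.
  by apply: contraTneq m1 => e; rewrite -l -e (S_inv X qS) order1.
by apply/negP=> /(allP c) /(com_neq X qS); rewrite eqxx.
Qed.

Lemma Nval_L m N (hv bv : nat -> nat) q P : ordA -> ordL m N hv -> 2 < m -> bv 0 = 2 ->
  (forall k, 0 < k <= N ->
     2 * k.+1 * bv k = (hv k + 2) * (catalan k.+1 + \sum_(i < k) bv i * catalan (k - i)))%N ->
  all [in S] (q :: P) -> (P != [::] -> typL m q P) -> size P <= N -> Nval X (ltr (q :: P)) (bv (size P)).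
Proof.
move=> oA oL m2 b0 rec; have [n] := ubnP (size P); elim: n P => // n IH P; rewrite ltnS => sP QS tL sN.
have [->|P0] := eqVneq P [::].
  rewrite /= b0; apply: (@Nval_chain [:: q]) => //=; by case/andP: QS => ->.
have {}tL := tL P0; have u := typL_uniq (ltnW m2) QS tL.
have [qS PS] : q \in S /\ all [in S] P by case/andP: QS.
have [cP _ lk] := and3P tL.
pose g y := if y == q then catalan (size P).+1 else
  (bv (index y P) * catalan (size P - index y P))%N.
apply: (@Nval_seq (q :: P) g (hv (size P))) => //.
- rewrite /= chain_conn // andbT; case: P P0 lk {sP QS tL sN u PS cP g} => //= t P _ /andP[l _].
  by rewrite (lbl_adj l).
- exact: oL.
- move=> y; rewrite inE => /predU1P[->|].
    rewrite /g eqxx -[q :: P]cat0s ltr_del //=; exact: Nval_chain.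
  move=> yP; have yq : (y == q) = false by apply: contraTF yP => /eqP->; case/andP: u.
  rewrite /g yq; case/cat_at: yP => A [B e]; have uP : uniq P by case/andP: u.
  rewrite e in u uP PS cP lk sP sN *; rewrite -cat_cons ltr_del // index_mid //.
  have [cA cB cAB] := chain_split PS cP.
  move: PS; rewrite all_cat /= => /and3P[AS yS BS].
  have [sA sB] := size_mid sP; have [sA' _] := size_mid sN.
  rewrite size_cat addKn -cat_cons; apply: Nval_cat => //.
  + by rewrite /= qS.
  + rewrite allrel_consl cAB andbT; case: (A) lk => [|t A'] /=; first by case/andP.
    by case/andP=> _; rewrite all_cat => /andP[_ /= /andP[]].
  + apply: IH => //; [by rewrite /= qS | | exact: ltnW].
    by move=> A0; rewrite /typL cA A0 (link_catl lk).
  + exact: Nval_chain.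
rewrite big_cons {1}/g eqxx [size _]/= rec; last by rewrite lt0n size_eq0 P0.
congr (_ * (_ + _))%N; rewrite -(sum_index (fun i => bv i * catalan (size P - i)))%N; last by case/andP: u.
rewrite !big_seq; apply: eq_bigr => y yP; rewrite /g.
by case: eqP yP u => // -> /= ->.
Qed.

Definition ordT (D : nat -> nat -> bool) (hv : nat -> nat -> nat) := forall v x L T,
  all [in S] (x :: rev L ++ v :: T) -> uniq (x :: rev L ++ v :: T) -> typT v x L T ->
  L != [::] -> T != [::] -> D (size L) (size T) -> ordh (ltr (x :: rev L ++ v :: T)) (hv (size L) (size T)).

(** Deleting x leaves a path; deleting v leaves three paths, the 2 being the value of x alone;
    deleting a vertex of an arm leaves a smaller star and a path. D is closed downwards so that the
    induction stays inside it, and an empty arm means type A. *)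
Lemma Nval_T D (hv tv : nat -> nat -> nat) v x L T : ordA -> ordT D hv ->
  (forall i j i' j', i' <= i -> j' <= j -> D i j -> D i' j') ->
  (forall i, tv i 0 = catalan i.+3) -> (forall j, tv 0 j = catalan j.+3) ->
  (forall i j, D i.+1 j.+1 -> 2 * (i + j).+4 * tv i.+1 j.+1 = (hv i.+1 j.+1 + 2) *
     (catalan (i + j).+4 + 2 * (catalan i.+2 * catalan j.+2) +
      \sum_(k < i.+1) tv k j.+1 * catalan (i.+1 - k) +
      \sum_(k < j.+1) tv i.+1 k * catalan (j.+1 - k)))%N ->
  all [in S] (x :: rev L ++ v :: T) -> uniq (x :: rev L ++ v :: T) -> typT v x L T ->
  D (size L) (size T) -> Nval X (ltr (x :: rev L ++ v :: T)) (tv (size L) (size T)).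
Proof.
move=> oA oT Ddown tv0 tv0' rec; have [n] := ubnP (size L + size T).
elim: n v x L T => // n IH v x L T; rewrite ltnS => sn QS u tT dLT.
have /and3P[cP l3 cx] := tT; have [xS PS] : x \in S /\ all [in S] (rev L ++ v :: T) by case/andP: QS.
have [LS vS TS] : [/\ all [in S] L, v \in S & all [in S] T].
  by move: PS; rewrite all_cat all_rev /= => /and3P[].
have /and3P[cvL cvT cLT] : [&& chain (v :: L), chain (v :: T) & allrel (@com gT) L T].
  by rewrite -(chain_center X).
rewrite all_cat in cx; have [cxL cxT] := andP cx.
have [L0|L0] := eqVneq L [::].
  rewrite L0 tv0'; have := @Nval_chain [:: x, v & T] oA; apply; first by move: QS; rewrite L0.
  by rewrite /= l3 cxT.
have [T0|T0] := eqVneq T [::].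
  rewrite T0 tv0 /=; have -> : ltr (x :: rev L ++ [:: v]) = ltr [:: x, v & L].
    by apply: ltr_perm; apply/seq.permP=> z; rewrite /= count_cat count_rev /=; clear; lia.
  apply: (@Nval_chain [:: x, v & L] oA); first by rewrite /= xS vS.
  by rewrite /= l3 cxL.
have pQ : perm_eq (x :: rev L ++ v :: T) ([:: x; v] ++ L ++ T).
  by apply/seq.permP=> z; rewrite /= !count_cat count_rev /=; clear; lia.
have eJ := ltr_perm pQ.
have u' : uniq ([:: x; v] ++ L ++ T) by rewrite -(perm_uniq pQ).
pose g y := if y == x then catalan (size L + size T).+2 else
  if y == v then (2 * (catalan (size L).+1 * catalan (size T).+1))%N else
  if y \in L then (tv (index y L) (size T) * catalan (size L - index y L))%N
  else (tv (size L) (index y T) * catalan (size T - index y T))%N.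
have uLT : uniq (L ++ T) by case/and3P: u'.
have [uL uT] : uniq L /\ uniq T by move: uLT; rewrite cat_uniq => /and3P[].
have nxv y : y \in L ++ T -> ((y == x) = false) * ((y == v) = false).
  move=> yLT; case/and3P: u'; rewrite /= inE negb_or => /andP[_ h1] h2 _.
  by split; apply/eqP=> e; [move: h1 | move: h2]; rewrite -e yLT.
have nxvL y : y \in L -> ((y == x) = false) * ((y == v) = false).
  by move=> yL; apply: nxv; rewrite mem_cat yL.
have nxvT y : y \in T -> ((y == x) = false) * ((y == v) = false).
  by move=> yT; apply: nxv; rewrite mem_cat yT orbT.
have nT y : y \in T -> (y \in L) = false.
  move=> yT; apply/negP=> yL; move: uLT; rewrite cat_uniq => /and3P[_ /hasPn/(_ _ yT)].
  by rewrite yL.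
apply: (@Nval_seq (x :: rev L ++ v :: T) g (hv (size L) (size T))) => //.
- rewrite /= chain_conn // andbT; apply/orP; right; apply/hasP; exists v.
    by rewrite mem_cat mem_head orbT.
  by rewrite (lbl_adj l3).
- exact: oT.
- move=> y; rewrite inE mem_cat mem_rev inE => /or4P[/eqP->|yL|/eqP->|yT].
  + rewrite /g eqxx -[x :: _]cat0s ltr_del //=.
    have -> : (size L + size T).+2 = (size (rev L ++ v :: T)).+1.
      by rewrite size_cat size_rev /= addnS.
    exact: Nval_chain.
  + rewrite /g !(nxvL y yL) yL.
    case/cat_at: yL => A [B e]; rewrite eJ; subst L.
    rewrite (_ : [:: x; v] ++ (A ++ y :: B) ++ T = ([:: x; v] ++ A) ++ y :: (B ++ T)); last by rewrite -!catA.
    rewrite ltr_del; last by rewrite -!catA /= in u' *.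
    have cA : chain (v :: A) by rewrite -[v :: A]cat0s; apply: (@chain_catl _ (v :: A) (y :: B)).
    have aS : all [in S] ((v :: A) ++ y :: B) by rewrite /= vS.
    have [_ cB cAB] := chain_split aS cvL; rewrite index_mid //.
    have sA : size A + size T < n by move: sn; rewrite size_cat /=; clear; lia.
    have sD : size A <= size (A ++ y :: B) by rewrite size_cat leq_addr.
    rewrite size_cat addKn.
    have -> : ltr (([:: x; v] ++ A) ++ B ++ T) = ltr ((x :: rev A ++ v :: T) ++ B).
      by apply: ltr_perm; apply/seq.permP=> z; rewrite /= !(count_cat, count_rev) /=; clear; lia.
    move: LS; rewrite all_cat /= => /and3P[AS yS BS].
    have qA : all [in S] (x :: rev A ++ v :: T) by rewrite /= xS all_cat all_rev AS /= vS.
    rewrite -[x :: _ ++ B]cat_cons; apply: Nval_cat => //.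
    * rewrite allrel_consl allrel_catl; move: cxL; rewrite all_cat /= => /and3P[_ _ ->] /=.
      have -> : allrel (@com gT) (rev A) B.
        by apply/allrelP=> s t; rewrite mem_rev => sA'; apply: (allrelP cAB); rewrite inE sA' orbT.
      rewrite allrel_consl; move: cAB; rewrite allrel_consl => /andP[-> _] /=.
      apply/allrelP=> s t sT tB; rewrite (comC X (allP TS _ sT) (allP BS _ tB)).
      by apply: (allrelP cLT) => //; rewrite mem_cat inE tB !orbT.
    * apply: IH => //.
      - apply: (subseq_uniq _ u); rewrite /= eqxx rev_cat rev_cons -cats1 -!catA catA.
        exact: suffix_subseq.
      - rewrite /typT (chain_center X) // cA cvT l3 all_cat cxT andbT.
        move: cxL; rewrite all_cat => /andP[-> _]; rewrite !andbT /=.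
        by apply/allrelP=> s t sA' tT'; apply: (allrelP cLT) => //; rewrite mem_cat sA'.
      - by apply: Ddown dLT.
    * exact: Nval_chain.
  + rewrite /g (_ : (v == x) = false) ?eqxx; last first.
      by apply/eqP=> e; move: u'; rewrite e /= inE eqxx.
    rewrite eJ (_ : [:: x; v] ++ L ++ T = [:: x] ++ v :: (L ++ T)) // ltr_del //.
    apply: Nval_cat; rewrite /= ?xS ?all_cat ?LS //.
    * by rewrite allrel_consl allrel0l andbT all_cat cxL.
    * by apply: (@Nval_chain [:: x] oA); rewrite /= ?xS.
    by apply: Nval_cat => //; apply: Nval_chain => //; [case/andP: cvL | case/andP: cvT].
  + rewrite /g !(nxvT y yT) (nT y yT).
    case/cat_at: yT => A [B e]; subst T.
    have eQ : x :: rev L ++ v :: A ++ y :: B = (x :: rev L ++ v :: A) ++ y :: B by rewrite /= -catA.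
    rewrite eQ ltr_del -?eQ //.
    have cA : chain (v :: A) by rewrite -[v :: A]cat0s; apply: (@chain_catl _ (v :: A) (y :: B)).
    have aS : all [in S] ((v :: A) ++ y :: B) by rewrite /= vS.
    have [_ cB cAB] := chain_split aS cvT; rewrite index_mid //.
    have sA : size L + size A < n by move: sn; rewrite size_cat /=; clear; lia.
    have sD : size A <= size (A ++ y :: B) by rewrite size_cat leq_addr.
    rewrite [size (A ++ _)]size_cat addKn.
    move: TS; rewrite all_cat /= => /and3P[AS yS BS].
    apply: (@Nval_cat (x :: rev L ++ v :: A)) => //.
    * by rewrite /= xS all_cat all_rev LS /= vS.
    * rewrite allrel_consl allrel_catl; move: cxT; rewrite all_cat /= => /and3P[_ _ ->] /=.
      apply/andP; split=> //; apply/allrelP=> s t; rewrite mem_rev => sL tB.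
      by apply: (allrelP cLT) => //; rewrite mem_cat inE tB !orbT.
    * apply: IH => //.
      - by rewrite /= xS all_cat all_rev LS /= vS.
      - apply: (subseq_uniq _ u); rewrite /= eqxx -[v :: A ++ _]cat_cons catA; exact: prefix_subseq.
      - rewrite /typT (chain_center X) // cA cvL l3 all_cat cxL /=.
        move: cxT; rewrite all_cat => /andP[-> _]; rewrite !andbT /=.
        by apply/allrelP=> s t sA' tT'; apply: (allrelP cLT) => //; rewrite mem_cat tT'.
      - by apply: Ddown dLT.
    * exact: Nval_chain.
have sQ : size (x :: rev L ++ v :: T) = (size L + size T).+2.
  by rewrite /= size_cat size_rev /= addnS.
rewrite sQ (perm_big _ pQ) /= !big_cons big_cat /=.
have -> : (\sum_(y <- L) g y = \sum_(k < size L) tv k (size T) * catalan (size L - k))%N.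
  rewrite -(sum_index (fun i => tv i (size T) * catalan (size L - i)))%N // !big_seq.
  apply: eq_bigr => y yL; by rewrite /g !(nxvL y yL) yL.
have -> : (\sum_(y <- T) g y = \sum_(k < size T) tv (size L) k * catalan (size T - k))%N.
  rewrite -(sum_index (fun i => tv (size L) i * catalan (size T - i)))%N // !big_seq.
  apply: eq_bigr => y yT; by rewrite /g !(nxvT y yT) nT.
rewrite /g eqxx (_ : (v == x) = false) ?eqxx; last first.
  by apply/eqP=> e; move: u'; rewrite e /= inE eqxx.
rewrite -/g; move: dLT; case: (L) L0 => // l L' _; case: (T) T0 => // t T' _ /= d.
by rewrite addnS addSn rec // !addnA.
Qed.

(** Deleting an end leaves B_3, of value 20; deleting an inner vertex leaves A_1 and A_2, of value
    10. So 8 times 105 equals 14 times 60. *)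
Lemma Nval_F h r v q q' : ordA -> ordL 4 2 (fun k => 2 * k.+1)%N ->
  h = 12 -> ordh (ltr [:: r; v; q; q']) h ->
  all [in S] [:: r; v; q; q'] -> uniq [:: r; v; q; q'] -> typF r v q q' ->
  Nval X (ltr [:: r; v; q; q']) 105.
Proof.
move=> oA oL eh oh aS u /and5P[l1 l2 l3 c1 /andP[c2 c3]].
have /and5P[rS vS qS q'S _] := aS.
have NB (a b c : gT) : all [in S] [:: a; b; c] -> typL 4 a [:: b; c] -> Nval X (ltr [:: a; b; c]) 20.
  move=> abS tL; apply: (@Nval_L 4 2 (fun k => 2 * k.+1)%N (fun k => k.+2 * catalan k.+1)%N a [:: b; c] oA oL) => //.
  by move=> k _; apply: catalanB.
pose g y := if y == r then 20 else if y == v then 10 else if y == q then 10 else 20.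
have [rv rq rq'] : [/\ r != v, r != q & r != q'].
  by move: u; rewrite /= !inE !negb_or -!andbA => /and5P[-> -> -> _ _].
have [vq vq' qq'] : [/\ v != q, v != q' & q != q'].
  by move: u; rewrite /= !inE !negb_or -!andbA => /and5P[_ _ _ -> /andP[-> /andP[-> _]]].
apply: (@Nval_seq [:: r; v; q; q'] g h) => //.
- by rewrite /= (lbl_adj l1) // (lbl_adj l2) ?orbT // (lbl_adj l3) ?orbT.
- move=> y; rewrite !inE => /or4P[]/eqP->; rewrite /g ?eqxx.
  + rewrite -[[:: r, v & _]]cat0s ltr_del //=; apply: NB; first by rewrite /= vS qS q'S.
    by rewrite /typL /= l3 l2 c3.
  + rewrite eq_sym (negbTE rv) -[[:: r, v & _]]/([:: r] ++ v :: [:: q; q']) ltr_del //.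
    apply: (@Nval_cat _ _ 2 5); rewrite /= ?rS ?qS ?q'S //; first by rewrite /allrel /= c1 c2.
      by apply: (@Nval_chain [:: r] oA); rewrite /= ?rS.
    by apply: (@Nval_chain [:: q; q'] oA); rewrite /= ?qS ?q'S ?l3.
  + rewrite eq_sym (negbTE rq) eq_sym (negbTE vq) -[[:: r, v & _]]/([:: r; v] ++ q :: [:: q']) ltr_del //.
    apply: (@Nval_cat _ _ 5 2); rewrite /= ?rS ?vS ?q'S //; first by rewrite /allrel /= c2 c3.
      by apply: (@Nval_chain [:: r; v] oA); rewrite /= ?rS ?vS ?l1.
    by apply: (@Nval_chain [:: q'] oA); rewrite /= ?q'S.
  + rewrite eq_sym (negbTE rq') eq_sym (negbTE vq') eq_sym (negbTE qq').
    rewrite -[[:: r, v & _]]/([:: r; v; q] ++ q' :: [::]) ltr_del // cats0.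
    have -> : ltr [:: r; v; q] = ltr [:: q; v; r].
      by apply: ltr_perm; apply/seq.permP=> z /=; clear; lia.
    apply: NB; first by rewrite /= vS qS rS.
    by rewrite /typL /= (lblC X 3 vS rS) l1 (lblC X 4 qS vS) l2 (comC X qS rS) c1.
rewrite eh !big_cons big_nil /g eqxx eq_sym (negbTE rv) eqxx eq_sym (negbTE rq) eq_sym (negbTE vq) eqxx.
by rewrite eq_sym (negbTE rq') eq_sym (negbTE vq') eq_sym (negbTE qq').
Qed.

End Values.

(** * Characteristic polynomials of Coxeter elements *)

Section Determinants.
Local Open Scope ring_scope.
Variables (gT : finGroupType) (K : comNzRingType) (M : gT -> gT -> K).
Implicit Types (q v y : gT) (s P Q : seq gT).

Definition detf n (f : 'I_n -> gT) := \det (\matrix_(i, j) M (f i) (f j)).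
Definition dets Q := detf (fun i : 'I_(size Q) => nth 1%g Q i).

(** Renumbering permutes rows and columns alike, and the two signs cancel. *)
Lemma detf_eq n m (f : 'I_n -> gT) (g : 'I_m -> gT) : n = m -> injective f -> injective g ->
  (forall i, exists j, f i = g j) -> detf f = detf g.
Proof.
move=> e; case: m / e g => g fi gi ex.
pose s i := odflt i [pick j | f i == g j].
have sE i : g (s i) = f i.
  by rewrite /s; case: pickP => [j /eqP->|h] //; case: (ex i) => j /eqP e; rewrite h in e.
have si : injective s by move=> i j /(congr1 g); rewrite !sE => /fi.
rewrite /detf; have -> : \matrix_(i, j) M (f i) (f j) =
    row_perm (perm si) (col_perm (perm si) (\matrix_(i, j) M (g i) (g j))).
  by apply/matrixP=> i j; rewrite !mxE !permE !sE.
rewrite row_permE col_permE !det_mulmx !det_perm odd_permV mulrC -mulrA -signr_addb addbb.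
by rewrite mulr1.
Qed.

Lemma nth_inj Q : uniq Q -> injective (fun i : 'I_(size Q) => nth 1%g Q i).
Proof. by move=> u i j /eqP; rewrite nth_uniq // => /eqP/val_inj. Qed.

Lemma dets_perm P Q : uniq P -> perm_eq P Q -> dets P = dets Q.
Proof.
move=> u p; apply: detf_eq; [exact: perm_size | exact: nth_inj | by apply: nth_inj; rewrite -(perm_uniq p) |].
move=> i; have iQ : nth 1%g P i \in Q by rewrite -(perm_mem p) mem_nth.
have lt : (index (nth 1%g P i) Q < size Q)%N by rewrite index_mem.
by exists (Ordinal lt); rewrite /= nth_index.
Qed.

Lemma dets_nil : dets [::] = 1. Proof. exact: det_mx00. Qed.

Lemma dets_iso q s : (forall y, y \in s -> M q y = 0) -> dets (q :: s) = M q q * dets s.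
Proof.
move=> h; rewrite /dets /detf (expand_det_row _ ord0) /= big_ord_recl big1 => [|i _]; last first.
  by rewrite mxE /= h ?mul0r // mem_nth //; apply: ltn_ord.
rewrite addr0 mxE /= /cofactor expr0 mul1r; congr (_ * \det _).
by apply/matrixP=> i j; rewrite !mxE !lift0.
Qed.

Lemma dets_leaf q v s : (forall y, y \in s -> M q y = 0 /\ M y q = 0) ->
  dets (q :: v :: s) = M q q * dets (v :: s) - M q v * M v q * dets s.
Proof.
move=> h; rewrite /dets /detf (expand_det_row _ ord0) /= 2!big_ord_recl big1 => [|i _]; last first.
  have iS : nth 1%g s i \in s by rewrite mem_nth //; apply: ltn_ord.
  by rewrite mxE /= (h _ iS).1 mul0r.
rewrite addr0 !mxE /= /cofactor expr0 mul1r; congr (_ * \det _ + _).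
  by apply/matrixP=> i j; rewrite !mxE !lift0.
rewrite -mulrA -mulrN; congr (_ * _); rewrite lift0 expr1 mulN1r; congr (- _).
rewrite (expand_det_col _ ord0) big_ord_recl big1 => [|i _]; last first.
  have iS : nth 1%g s i \in s by rewrite mem_nth //; apply: ltn_ord.
  by rewrite !mxE /= (h _ iS).2 mul0r.
rewrite addr0 !mxE /= /cofactor expr0 mul1r; congr (_ * \det _).
by apply/matrixP=> i j; rewrite !mxE !lift0.
Qed.

End Determinants.

Section Coxpoly.
Local Open Scope ring_scope.
Variables (gT : finGroupType) (K : fieldType) (A : gT -> gT -> K).
Hypothesis A_sym : forall s t, A s t = A t s.
Implicit Types (s t q v y : gT) (w p a P Q L T : seq gT).

Definition Umat a s t : K := if s == t then 1 else if (index s a < index t a)%N then A s t else 0.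

Definition Cmat a s t : {poly K} := 'X * (Umat a s t)%:P + (Umat a t s)%:P.

Lemma Cmat_diag a s : Cmat a s s = 'X + 1.
Proof. by rewrite /Cmat /Umat eqxx mulr1. Qed.

Lemma index_lt a s t : s \in a -> t \in a -> s != t -> (index s a < index t a)%N = ~~ (index t a < index s a)%N.
Proof.
move=> sa ta ne; rewrite -leqNgt ltn_neqAle; apply/andP/idP=> [[]//|->]; split=> //.
apply: contraNneq ne => /(congr1 (nth 1%g a)); rewrite !nth_index // => ->; exact: eqxx.
Qed.

Lemma Cmat_com a s t : s \in a -> t \in a -> s != t -> A s t = 0 -> Cmat a s t = 0.
Proof.
move=> sa ta ne a0; rewrite /Cmat /Umat (negbTE ne) eq_sym (negbTE ne) (A_sym t s) a0.
by rewrite !if_same !mulr0 addr0.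
Qed.

(** The order of s and t in a drops out of the product; this is why leaf expansions give the same
    result for all Coxeter words. *)
Lemma Cmat_mul a s t : s \in a -> t \in a -> s != t ->
  Cmat a s t * Cmat a t s = 'X * ((A s t) ^+ 2)%:P.
Proof.
move=> sa ta ne; rewrite /Cmat /Umat (negbTE ne) eq_sym (negbTE ne) (index_lt sa ta ne) (A_sym t s).
by case: (index t a < _)%N; rewrite /= polyC_exp polyC0; ring.
Qed.

Lemma det_Umat a : uniq a -> dets (Umat a) a = 1.
Proof.
move=> u; rewrite /dets /detf -det_tr det_trig.
  by rewrite big1 // => i _; rewrite !mxE /Umat eqxx.
apply/is_trig_mxP=> i j ij; rewrite !mxE /Umat nth_uniq // !index_uniq //.
by rewrite ltnNge (ltnW ij) gtn_eqF.
Qed.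

Variables (J : {set gT}).
Hypothesis A_diag : {in J, forall s, A s s = 2}.
Notation f := (@enum_val gT (mem J)).

Definition rmx s : 'M[K]_#|J| := \matrix_(i, j) ((i == j)%:R - A s (f j) * (f i == s)%:R).
Definition gmx w : 'M[K]_#|J| := \big[mulmx/1%:M]_(s <- w) rmx s.

Lemma gmx_cons s w i j : gmx (s :: w) i j =
  gmx w i j - (f i == s)%:R * \sum_k A s (f k) * gmx w k j.
Proof.
have -> : gmx (s :: w) = rmx s *m gmx w by rewrite /gmx big_cons.
rewrite mxE (eq_bigr (fun k => (i == k)%:R * gmx w k j - A s (f k) * (f i == s)%:R * gmx w k j)); last first.
  by move=> k _; rewrite [rmx s i k]mxE mulrBl.
rewrite sumrB (bigD1 i) //= eqxx mul1r big1 ?addr0; last by move=> k ki; rewrite eq_sym (negbTE ki) mul0r.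
by congr (_ - _); rewrite mulr_sumr; apply: eq_bigr => k _; ring.
Qed.

Lemma gmx_out w i j : f i \notin w -> gmx w i j = (i == j)%:R.
Proof.
elim: w => [|s w IH]; first by rewrite /gmx big_nil mxE.
by rewrite inE negb_or gmx_cons => /andP[/negbTE-> h]; rewrite mul0r subr0 IH.
Qed.

Lemma gmx_catr p w i j : f i \notin p -> gmx (p ++ w) i j = gmx w i j.
Proof.
elim: p => //= s p IH; rewrite inE negb_or gmx_cons => /andP[/negbTE-> h].
by rewrite mul0r subr0 IH.
Qed.

(** This is U c = - U^T. The letters before f i do not touch row i, and the reflection of f i
    subtracts the rows of the later letters in their final form, which U adds back. What remains
    comes from rows of the identity. *)
Lemma Umat_gmx a i j : uniq a -> ltr a = J ->
  \sum_k Umat a (f i) (f k) * gmx a k j = - Umat a (f j) (f i).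
Proof.
move=> u ea; have mJ y : (y \in J) = (y \in a) by rewrite -ea inE.
have fa k : f k \in a by rewrite -mJ; apply: enum_valP.
have finj k k' : (f k == f k') = (k == k') by rewrite (inj_eq enum_val_inj).
have [p [w e]] := cat_at (fa i).
have idx k : (index (f i) a < index (f k) a)%N = (f k \in w).
  have iE : index (f i) a = size p by move: u; rewrite e => /index_mid.
  have := fa k; rewrite iE {1 2}e mem_cat inE index_cat.
  move: u; rewrite e cat_uniq /= => /and3P[_ /norP[ip /hasPn h] /andP[iw _]].
  have [kp _|kp /=] := boolP (f k \in p).
    rewrite ltnNge ltnW ?index_mem //=; apply/esym/negbTE/negP=> kw.
    by have := h _ kw; rewrite kp.
  by rewrite (eq_sym (f i)); case: eqVneq => [-> _|ne /= kw]; rewrite ?addn0 ?ltnn ?(negbTE iw) // kw -addSnnS leq_addr.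
have idx' : (index (f j) a < index (f i) a)%N = (f j \in p).
  have iE : index (f i) a = size p by move: u; rewrite e => /index_mid.
  rewrite iE {1}e index_cat; case: ifP => jp; first by rewrite index_mem.
  by rewrite ltnNge leq_addr.
have ip : f i \notin p.
  by move: u; rewrite e cat_uniq /= => /and3P[_ /norP[]].
have iw : f i \notin w by move: u; rewrite e cat_uniq /= => /and3P[_ _ /andP[]].
have gi : gmx a i j = (i == j)%:R - \sum_k A (f i) (f k) * gmx w k j.
  by rewrite {1}e gmx_catr // gmx_cons eqxx mul1r gmx_out.
have gw k : f k \in w -> gmx a k j = gmx w k j.
  move=> kw; rewrite e -cat_rcons gmx_catr // mem_rcons inE negb_or.
  move: u; rewrite e cat_uniq /= => /and3P[_ /norP[_ /hasPn/(_ _ kw) ->] _].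
  by rewrite andbT; apply: contraNneq iw => <-.
rewrite (bigD1 i) //= {1}/Umat eqxx mul1r gi.
have -> : \sum_(k | k != i) Umat a (f i) (f k) * gmx a k j =
    \sum_(k | f k \in w) A (f i) (f k) * gmx w k j.
  rewrite [RHS]big_mkcond [LHS]big_mkcond /=; apply: eq_bigr => k _.
  rewrite /Umat finj (eq_sym i k); case: (eqVneq k i) => [->|ne]; first by rewrite (negbTE iw).
  by rewrite idx; case: ifP => [/gw->|]; rewrite ?mul0r.
have -> : \sum_k A (f i) (f k) * gmx w k j = \sum_(k | f k \in w) A (f i) (f k) * gmx w k j +
    \sum_(k | f k \notin w) A (f i) (f k) * gmx w k j by rewrite (bigID (fun k => f k \in w)).
move: (\sum_(k | f k \in w) _) => s1.
have -> : forall s2 : K, (i == j)%:R - (s1 + s2) + s1 = (i == j)%:R - s2 by move=> s2; ring.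
have -> : \sum_(k | f k \notin w) A (f i) (f k) * gmx w k j = if f j \in w then 0 else A (f i) (f j).
  case: ifP => jw.
    apply: big1 => k kw; rewrite gmx_out // (_ : (k == j) = false) ?mulr0 //.
    by apply: contraNF kw => /eqP->.
  rewrite (bigD1 j) ?jw //= gmx_out ?jw // eqxx mulr1 big1 ?addr0 // => k /andP[kw kj].
  by rewrite gmx_out // (negbTE kj) mulr0.
rewrite /Umat finj idx'; have [ij|ne] := eqVneq i j.
  by rewrite -ij (negbTE iw) A_diag ?enum_valP //= mulr1n; ring.
rewrite sub0r A_sym; congr (- _).
have := fa j; rewrite {1}e mem_cat inE finj (eq_sym j) (negbTE ne) /=.
case: (boolP (f j \in p)) => [jp _|_ /= ->] //; case: ifP => // jw.
by move: u; rewrite e cat_uniq /= => /and3P[_ /norP[_ /hasPn/(_ _ jw)]]; rewrite jp.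
Qed.

Lemma char_gmx a : uniq a -> ltr a = J -> char_poly (gmx a) = dets (Cmat a) a.
Proof.
move=> u ea; have sa : size a = #|J| by rewrite -ea cardsE; apply/esym/card_uniqP.
have ex (i : 'I_(size a)) : exists j, nth 1%g a i = f j.
  have ia : nth 1%g a i \in J by rewrite -ea inE mem_nth.
  by exists (enum_rank_in ia (nth 1%g a i)); rewrite enum_rankK_in.
have e1 : \det (\matrix_(i, j) (Umat a (f i) (f j))%:P : 'M[{poly K}]_#|J|) = 1.
  have -> : (\matrix_(i, j) (Umat a (f i) (f j))%:P : 'M[{poly K}]_#|J|) =
    map_mx polyC (\matrix_(i, j) Umat a (f i) (f j)) by apply/matrixP=> i j; rewrite !mxE.
  rewrite det_map_mx -[RHS](polyC1 K) -(det_Umat u) /dets; congr (_%:P); apply/esym/detf_eq => //.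
  - exact: nth_inj.
  - exact: enum_val_inj.
have -> : dets (Cmat a) a = detf (Cmat a) f.
  by apply: detf_eq => //; [exact: nth_inj | exact: enum_val_inj].
rewrite /char_poly -[LHS]mul1r -e1 -det_mulmx /detf; congr (\det _); apply/matrixP=> i j.
rewrite !mxE /char_poly_mx; under eq_bigr => k _ do rewrite !mxE mulrBr -polyCM.
rewrite sumrB -rmorph_sum /= Umat_gmx // rmorphN opprK; congr (_ + _).
rewrite (bigD1 j) //= eqxx mulr1n big1 ?addr0 1?mulrC // => k kj.
by rewrite (negbTE kj) mulr0n mulr0.
Qed.

(** The characteristic polynomial of a Coxeter element of A_n, in the form that leaf expansion
    produces. *)
Fixpoint phi n : {poly K} := if n is n'.+1 then
  if n' is n''.+1 then ('X + 1) * phi n' - 'X * phi n'' else 'X + 1 else 1.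

Lemma phiSS n : phi n.+2 = ('X + 1) * phi n.+1 - 'X * phi n. Proof. by []. Qed.

Lemma phiE n : phi n = \sum_(i < n.+1) 'X^i.
Proof.
have: phi n = \sum_(i < n.+1) 'X^i /\ phi n.+1 = \sum_(i < n.+2) 'X^i.
  elim: n => [|n [e1 e2]]; first by rewrite /= !big_ord_recr big_ord0 /= add0r expr0 expr1 addrC.
  split=> //; rewrite phiSS e2 e1 [RHS]big_ord_recr /= [in RHS]big_ord_recr /= [in LHS]big_ord_recr /=.
  by rewrite !exprS; ring.
by case.
Qed.

Lemma phi_mul n : ('X - 1) * phi n = 'X^(n.+1) - 1.
Proof. by rewrite phiE [RHS]subrX1. Qed.

(** Leaf expansion from the free end of the path P, with T not joined to P. *)
Lemma dets_chain a P T : uniq a -> {subset P ++ T <= a} -> uniq (P ++ T) ->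
  (forall L s t Q, P = L ++ s :: t :: Q -> A s t ^+ 2 = 1 /\ {in Q ++ T, forall y, A s y = 0}) ->
  (forall L s, P = L ++ [:: s] -> {in T, forall y, A s y = 0}) ->
  dets (Cmat a) (P ++ T) = phi (size P) * dets (Cmat a) T.
Proof.
move=> ua; have [n] := ubnP (size P); elim: n P => // n IH [|s [|t P]] sn sub u h1 h2.
- by rewrite mul1r.
- rewrite /= dets_iso ?Cmat_diag // => y yT; apply: Cmat_com; rewrite ?sub ?inE ?eqxx ?yT ?orbT //.
    by apply: contraTneq u => ->; rewrite /= yT.
  exact: (h2 [::]).
have [as1 as0] := h1 [::] s t P erefl.
have [sa ta] : s \in a /\ t \in a by split; apply: sub; rewrite !inE eqxx ?orbT.
have st : s != t by move: u; rewrite /= inE negb_or => /andP[/andP[]].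
rewrite !cat_cons dets_leaf => [|y yP].
  rewrite Cmat_diag Cmat_mul // as1 mulr1 -cat_cons [size _]/= phiSS mulrBl -!mulrA.
  rewrite (IH (t :: P)) ?(IH P) //.
  - by move: sn; rewrite /= !ltnS => /ltnW.
  - by move=> y yP; apply: sub; rewrite !inE yP !orbT.
  - by case/and3P: u.
  - by move=> L s' t' Q e; apply: (h1 [:: s, t & L]); rewrite e.
  - by move=> L s' e; apply: (h2 [:: s, t & L]); rewrite e.
  - by move=> y yP; apply: sub; rewrite inE yP orbT.
  - by case/andP: u.
  - by move=> L s' t' Q e; apply: (h1 (s :: L)); rewrite e.
  - by move=> L s' e; apply: (h2 (s :: L)); rewrite e.
have ya : y \in a by apply: sub; rewrite !inE yP !orbT.
have ys : s != y by apply: contraTneq u => ->; rewrite /= inE yP orbT.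
by split; [|rewrite eq_sym in ys]; rewrite Cmat_com // A_sym ?as0 // A_sym as0.
Qed.

End Coxpoly.

(** * Matrices of finite order and their eigenvalues *)

Section MatrixOrder.
Local Open Scope ring_scope.

(** Having finite order, C has a minimal polynomial with distinct linear factors; if all eigenvalues
    are h-th roots of unity, it divides X^h - 1. *)
Lemma mx_order_dvd n (C : 'M[algC]_n.+1) N h : (0 < N)%N -> C ^+ N = 1 ->
  (forall l, poly.root (char_poly C) l -> l ^+ h = 1) -> C ^+ h = 1.
Proof.
move=> N0 CN rt; have [z pz] := C_prim_root_exists N0.
have hX k : horner_mx C ('X^k - 1) = C ^+ k - 1.
  by rewrite rmorphB rmorphXn /= horner_mx_X rmorph1.
have /(dvdp_prod_XsubC (F := fun i => z ^+ i))[m pm] :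
    mxminpoly C %| \prod_(i <- index_iota 0 N) ('X - (z ^+ i)%:P).
  by rewrite (factor_Xn_sub_1 pz); apply: mxminpoly_min; rewrite hX CN subrr.
have : mxminpoly C %| 'X^h - 1.
  rewrite (eqp_dvdl _ pm) -(big_map (fun i => z ^+ i) xpredT (fun x => 'X - x%:P)).
  apply: uniq_roots_dvdp; last first.
    rewrite uniq_rootsE map_inj_in_uniq ?mask_uniq ?iota_uniq // => i j /mem_mask + /mem_mask.
    rewrite !mem_index_iota => /andP[_ iN] /andP[_ jN] /eqP.
    by rewrite (eq_prim_root_expr pz) !modn_small // => /eqP.
  apply/allP=> _ /mapP[i im ->]; rewrite /poly.root !hornerE subr_eq0; apply/eqP/rt.
  rewrite -root_mxminpoly (eqp_root pm) -(big_map (fun i => z ^+ i) xpredT (fun x => 'X - x%:P)).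
  by rewrite root_prod_XsubC map_f.
by move/(mxminpoly_minP)/eqP; rewrite hX subr_eq0 => /eqP.
Qed.

Lemma iter_mulmx n (C : 'M[algC]_n.+1) k : iter k (mulmx C) 1%:M = C ^+ k.
Proof. by elim: k => //= k ->; rewrite exprS. Qed.

(** Powers appear as iterated products because the size #|J| is not syntactically a successor. *)
Lemma iter_mx_order n (C : 'M[algC]_n) N h : (0 < n)%N -> (0 < N)%N ->
  iter N (mulmx C) 1%:M = 1%:M -> (forall l, poly.root (char_poly C) l -> l ^+ h = 1) ->
  iter h (mulmx C) 1%:M = 1%:M.
Proof. by case: n C => // n C _ N0; rewrite !iter_mulmx; apply: mx_order_dvd. Qed.

Lemma eigen_iter n (C : 'M[algC]_n) l N : poly.root (char_poly C) l ->
  iter N (mulmx C) 1%:M = 1%:M -> l ^+ N = 1.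
Proof.
rewrite -eigenvalue_root_char => /eigenvalueP[v vC v0] CN.
have : v *m iter N (mulmx C) 1%:M = l ^+ N *: v.
  elim: N {CN} => [|k IH]; first by rewrite mulmx1 scale1r.
  by rewrite iterS mulmxA vC -scalemxAl IH scalerA exprS.
rewrite CN mulmx1 -{1}[v]scale1r => /eqP; rewrite -subr_eq0 -scalerBl scaler_eq0 (negbTE v0) orbF.
by rewrite subr_eq0 => /eqP.
Qed.

Lemma char_poly_roots n (C : 'M[algC]_n) h z es : h.-primitive_root z -> size es = n ->
  uniq es -> all (fun e => e < h)%N es -> {in es, forall e, (char_poly C).[z ^+ e] = 0} ->
  char_poly C = \prod_(e <- es) ('X - (z ^+ e)%:P).
Proof.
move=> pz sz u lt rt; rewrite -(big_map (fun i => z ^+ i) xpredT (fun x => 'X - x%:P)).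
rewrite [LHS](@all_roots_prod_XsubC _ _ (map (fun i => z ^+ i) es)).
- by rewrite (monicP (char_poly_monic C)) scale1r.
- by rewrite size_char_poly size_map sz.
- by apply/allP=> _ /mapP[e ee ->]; apply/rootP/rt.
rewrite uniq_rootsE map_inj_in_uniq // => i j /(allP lt) il /(allP lt) jl /eqP.
by rewrite (eq_prim_root_expr pz) !modn_small // => /eqP.
Qed.

End MatrixOrder.

Section Orders.
Local Open Scope ring_scope.
Variables (gT : finGroupType) (S : {set gT}) (R : realFieldType).
Variables (X : coxrep S R) (io : {rmorphism R -> algC}).
(** Normalised so that [gmx AC S] is convertible to the matrices in the definition of the
    exponents. *)
Definition AC (s t : gT) : algC := 2 * coxeter_form s t.
Hypothesis ioA : {in S &, forall s t, io (cartan (ck X) s t) = AC s t}.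
Implicit Types (s t q v x y : gT) (w a P Q L T : seq gT).

Lemma AC_sym s t : AC s t = AC t s.
Proof.
rewrite /AC /coxeter_form; have -> // : #[(s * t)%g] = #[(t * s)%g].
by rewrite -(orderJ (s * t)%g s) conjgE -!mulgA mulKg.
Qed.

Lemma AC_diag (J : {set gT}) : J \subset S -> {in J, forall s, AC s s = 2}.
Proof. by move=> /subsetP JS s /JS sS; rewrite -ioA // cartan_ss rmorph_nat. Qed.

Section Par.
Variable J : {set gT}.
Hypothesis JS : J \subset S.
Notation f := (@enum_val gT (mem J)).
Notation gmx := (gmx AC J).

Lemma fS (i : 'I_#|J|) : f i \in S.
Proof. by apply: (subsetP JS); apply: enum_valP. Qed.

Lemma act_gmx w i j : all [in J] w -> io (act X (wprod w) (al (f j)) (f i)) = gmx w i j.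
Proof.
elim: w i => [|s w IH] i /=.
  by rewrite wprod_nil act1 ffunE /gmx big_nil mxE (inj_eq enum_val_inj) rmorph_nat.
case/andP=> sJ wJ; have sS := subsetP JS _ sJ; rewrite wprod_cons actM (act_gen X sS) ffunE.
rewrite gmx_cons rmorphB rmorphM rmorph_nat IH // mulrC; congr (_ - _ * _).
rewrite /pairing rmorph_sum (bigID [in J]) /= [X in _ + X]big1 ?addr0.
  rewrite (eq_bigl [in J]); last first.
    by move=> y; rewrite andb_idl // => /(subsetP JS).
  rewrite big_enum_val; apply: eq_bigr => k _ /=.
  by rewrite rmorphM IH // ioA // fS.
move=> y /andP[yS yJ]; rewrite (act_out X JS) //; last by apply/(gen_word _ JS); exists w.
rewrite ffunE (_ : (y == f j) = false) ?mulr0 ?rmorph0 //.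
by apply: contraNF yJ => /eqP->; apply: enum_valP.
Qed.

Lemma gmx_eq1 w : all [in J] w -> gmx w = 1%:M <-> wprod w = 1%g.
Proof.
move=> wJ; have wg : wprod w \in <<J>>%g by apply/(gen_word _ JS); exists w.
split=> [e|e]; last first.
  apply/matrixP=> i j; rewrite -act_gmx // e act1 ffunE mxE (inj_eq enum_val_inj).
  by rewrite rmorph_nat.
apply: (gen_pos (X := X) JS wg) => t tJ; have tE : f (enum_rank_in tJ t) = t by rewrite enum_rankK_in.
suff -> : act X (wprod w) (al t) = al t by apply: pos_al.
apply/ffunP=> y; have [yJ|yJ] := boolP (y \in J); last by rewrite (act_out X JS).
have yE : f (enum_rank_in yJ y) = y by rewrite enum_rankK_in.
apply: (fmorph_inj io); rewrite -{1}tE -{1}yE act_gmx // e mxE ffunE rmorph_nat.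
by rewrite -(inj_eq enum_val_inj) tE yE.
Qed.

Lemma gmx_cat a w : gmx (a ++ w) = gmx a *m gmx w.
Proof.
elim: a => [|s a IH]; first by rewrite {2}/gmx big_nil mul1mx.
have e b : gmx (s :: b) = rmx AC J s *m gmx b by rewrite /gmx big_cons.
by rewrite cat_cons !e IH mulmxA.
Qed.

Lemma gmx_pow a k : gmx (flatten (nseq k a)) = iter k (mulmx (gmx a)) 1%:M.
Proof.
elim: k => [|k IH]; first by rewrite /gmx big_nil.
by rewrite iterS -IH -gmx_cat.
Qed.

Lemma wprod_pow a k : wprod (flatten (nseq k a)) = (wprod a ^+ k)%g.
Proof. by elim: k => [|k IH]; rewrite ?wprod_nil //= wprod_cat IH expgS. Qed.

(** The exponent 1 makes the primitive root z an eigenvalue, so h divides the order; all eigenvalues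
    being h-th roots of unity, the order divides h. *)
Lemma order_type h (es : seq nat) (z : algC) a : J != set0 -> uniq a -> ltr a = J ->
  h.-primitive_root z -> 1%N \in es ->
  char_poly (gmx a) = \prod_(e <- es) ('X - (z ^+ e)%:P) -> #[wprod a] = h.
Proof.
move=> J0 ua ea pz e1 ch; have aJ : all [in J] a by apply/allP=> y; rewrite -ea inE.
have pow k : iter k (mulmx (gmx a)) 1%:M = 1%:M <-> (wprod a ^+ k = 1)%g.
  rewrite -gmx_pow -wprod_pow; apply: gmx_eq1; apply/allP=> y /flattenP[b].
  by rewrite mem_nseq => /andP[_ /eqP->] /(allP aJ).
apply/eqP; rewrite eqn_dvd; apply/andP; split; last first.
  rewrite (prim_order_dvd pz); apply/eqP; apply: (@eigen_iter _ (gmx a)).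
    rewrite ch; apply/rootP; rewrite horner_prod (big_rem _ e1) /= !hornerE expr1 subrr; exact: mul0r.
  by apply/pow; rewrite expg_order.
rewrite order_dvdn; apply/eqP/pow; apply: (@iter_mx_order _ _ #[wprod a]) => //.
- by rewrite card_gt0.
- by apply/pow; rewrite expg_order.
move=> l; rewrite ch -(big_map (fun i => z ^+ i) xpredT (fun x : algC => 'X - x%:P)) root_prod_XsubC.
by case/mapP=> e _ ->; rewrite exprAC (prim_expr_order pz) expr1n.
Qed.

End Par.
End Orders.

(** * Cyclotomic polynomials at primitive roots of unity *)

Section Cyclotomic.
Local Open Scope ring_scope.
Variable K : fieldType.
Implicit Types (x z : K).

Lemma prim_neq1 h x k : h.-primitive_root x -> (0 < k < h)%N -> x ^+ k != 1.
Proof.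
move=> px /andP[k0 kh]; rewrite -(prim_order_dvd px); apply/negP=> /(dvdn_leq k0).
by rewrite leqNgt kh.
Qed.

Lemma prim_half m x : (0 < m)%N -> (2 * m).-primitive_root x -> x ^+ m = -1.
Proof.
move=> m0 px; have := prim_expr_order px; rewrite mulnC exprM => /eqP.
rewrite sqrf_eq1 => /orP[]/eqP // e; have := prim_neq1 (k := m) px; rewrite e eqxx.
by rewrite m0 mul2n -addnn -{1}[m]addn0 ltn_add2l m0 => /(_ isT).
Qed.

Lemma mulf_left x z : x * z = 0 -> x != 0 -> z = 0.
Proof. by move/eqP; rewrite mulf_eq0 => /orP[/eqP->|/eqP//]; rewrite eqxx. Qed.

Lemma prim_opp h x k : h.-primitive_root x -> (0 < 2 * k < h)%N -> x ^+ k + 1 != 0.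
Proof.
move=> px lt; apply: contraNneq (prim_neq1 px lt) => /eqP; rewrite addr_eq0 => /eqP e.
by rewrite mulnC exprM e sqrrN expr1n.
Qed.

Lemma prim10 x : 10.-primitive_root x -> x ^+ 4 - x ^+ 3 + x ^+ 2 - x + 1 = 0.
Proof.
move=> px; have e := @prim_half 5 x isT px.
by apply: (mulf_left (x := x ^+ 1 + 1)); [ring: e | apply: (prim_opp px)].
Qed.

Lemma prim12 x : 12.-primitive_root x -> x ^+ 4 - x ^+ 2 + 1 = 0.
Proof.
move=> px; have e := @prim_half 6 x isT px.
by apply: (mulf_left (x := x ^+ 2 + 1)); [ring: e | apply: (prim_opp px)].
Qed.

Lemma prim18 x : 18.-primitive_root x -> x ^+ 6 - x ^+ 3 + 1 = 0.
Proof.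
move=> px; have e := @prim_half 9 x isT px.
by apply: (mulf_left (x := x ^+ 3 + 1)); [ring: e | apply: (prim_opp px)].
Qed.

Lemma prim30 x : 30.-primitive_root x ->
  x ^+ 8 + x ^+ 7 - x ^+ 5 - x ^+ 4 - x ^+ 3 + x + 1 = 0.
Proof.
move=> px; have e := @prim_half 15 x isT px.
(* Times this factor the polynomial becomes (x^15 + 1) (x + 1). *)
apply: (mulf_left (x := (x ^+ 5 + 1) * (x ^+ 3 + 1))).
  by ring: e.
by rewrite mulf_neq0 // ?(prim_opp px).
Qed.

Lemma phi_root n x : x ^+ n.+1 = 1 -> x != 1 -> (phi K n).[x] = 0.
Proof.
move=> e ne; apply: (mulf_left (x := x - 1)); last by rewrite subr_eq0.
have := congr1 (fun p : {poly K} => p.[x]) (phi_mul K n).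
by rewrite /= !hornerE e subrr.
Qed.

Lemma Xn1_prod m (z : K) : (0 < m)%N -> (2 * m).-primitive_root z ->
  'X^m + 1 = \prod_(e <- [seq i.*2.+1 | i <- iota 0 m]) ('X - (z ^+ e)%:P).
Proof.
move=> m0 pz; rewrite -(big_map (fun i => z ^+ i) xpredT (fun x => 'X - x%:P)).
have e : 'X^m + 1 = 'X^m - (-1)%:P :> {poly K} by rewrite polyCN opprK.
rewrite [LHS](@all_roots_prod_XsubC _ _ (map (fun i => z ^+ i) [seq i.*2.+1 | i <- iota 0 m])).
- by rewrite e lead_coefDl ?lead_coefXn ?scale1r // size_polyXn size_opp (leq_ltn_trans (size_polyC_leq1 _)).
- by rewrite !size_map size_iota e size_XnsubC.
- apply/allP=> _ /mapP[_ /mapP[i _ ->] ->]; apply/rootP; rewrite !hornerE.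
  rewrite exprAC (prim_half m0 pz) -addn1 exprD -muln2 mulnC exprM sqrrN !expr1n expr1 mul1r.
  exact: addNr.
rewrite uniq_rootsE -map_comp map_inj_in_uniq ?iota_uniq // => i j /=.
rewrite !mem_iota /= add0n => im jm /eqP; rewrite (eq_prim_root_expr pz) !modn_small; lia.
Qed.

End Cyclotomic.

(** * Coxeter numbers and exponents of each type *)

Section TypeData.
Local Open Scope ring_scope.
Variables (gT : finGroupType) (S : {set gT}) (R : realFieldType).
Variables (X : coxrep S R) (io : {rmorphism R -> algC}).
Hypothesis ioA : {in S &, forall s t, io (cartan (ck X) s t) = AC s t}.
Hypothesis zprim : forall h, (0 < h)%N -> h.-primitive_root (zeta h).
Hypothesis zetaM : forall k m, (0 < k)%N -> (0 < m)%N -> zeta (k * m) ^+ k = zeta m.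
Hypothesis ck2 : forall m, (1 < m)%N -> io (ck X m) ^+ 2 = 2 + zeta m + (zeta m)^-1.
Implicit Types (s t q v x y : gT) (w a P Q L T : seq gT) (es : seq nat).
Notation phi := (phi algC).
Notation AC := (@AC gT).

Lemma AC_com s t : s \in S -> t \in S -> com s t -> AC s t = 0.
Proof. by move=> sS tS c; rewrite -ioA // (cartan_com X) // rmorph0. Qed.

Lemma AC_lbl m s t : s \in S -> t \in S -> lbl m s t -> m != 1%N -> AC s t ^+ 2 = io (ck X m) ^+ 2.
Proof. by move=> sS tS l m1; rewrite -ioA // (cartan_lbl X sS l m1) rmorphN sqrrN. Qed.

Lemma AC_3 s t : s \in S -> t \in S -> lbl 3 s t -> AC s t ^+ 2 = 1.
Proof. by move=> sS tS l; rewrite (AC_lbl sS tS l) // ck3 rmorph1 expr1n. Qed.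

Lemma char_dets Q a : all [in S] Q -> uniq Q -> uniq a -> ltr a = ltr Q ->
  char_poly (gmx AC (ltr Q) a) = dets (Cmat AC a) Q /\ a =i Q.
Proof.
move=> QS uQ ua e; have m : a =i Q by move=> y; have /setP/(_ y) := e; rewrite !inE.
split=> //; rewrite (char_gmx (@AC_sym gT)) //; last exact: (AC_diag ioA (ltr_sub QS)).
by apply: dets_perm => //; apply: uniq_perm.
Qed.

Lemma dets_chainT a P T : all [in S] (P ++ T) -> {subset P ++ T <= a} -> uniq a -> uniq (P ++ T) ->
  chain P -> allrel (@com gT) P T -> dets (Cmat AC a) (P ++ T) = phi (size P) * dets (Cmat AC a) T.
Proof.
move=> aS sub ua u cP cT; have inS y : y \in P ++ T -> y \in S by apply: (allP aS).
apply: dets_chain => //; first exact: AC_sym.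
  move=> L s t Q e; move: cP; rewrite e => /chain_catr /= /andP[/andP[l c] _].
  have [sP tP] : s \in P /\ t \in P by rewrite e !mem_cat !inE !eqxx !orbT.
  have sS : s \in S by apply: inS; rewrite mem_cat sP.
  split; first by apply: AC_3 => //; apply: inS; rewrite mem_cat tP.
  move=> y; rewrite mem_cat => /orP[yQ|yT]; apply: AC_com => //.
  - by apply: inS; rewrite mem_cat e mem_cat !inE yQ !orbT.
  - exact: (allP c).
  - by apply: inS; rewrite mem_cat yT orbT.
  - exact: (allrelP cT).
move=> L s e y yT; have sP : s \in P by rewrite e mem_cat mem_head orbT.
by apply: AC_com; rewrite ?inS ?mem_cat ?sP ?yT ?orbT //; apply: (allrelP cT).
Qed.

Lemma dets_chain0 a P : all [in S] P -> {subset P <= a} -> uniq a -> chain P ->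
  dets (Cmat AC a) P = phi (size P).
Proof.
move=> PS sub ua cP; have := @dets_chainT a P [::]; rewrite cats0 => -> //; last exact: allrel0r.
  by rewrite dets_nil mulr1.
exact: (chain_uniq X).
Qed.

Lemma dets_leafA a q v T : uniq a -> {subset q :: v :: T <= a} -> uniq (q :: v :: T) ->
  (forall y, y \in T -> AC q y = 0) -> dets (Cmat AC a) (q :: v :: T) =
  ('X + 1) * dets (Cmat AC a) (v :: T) - 'X * ((AC q v) ^+ 2)%:P * dets (Cmat AC a) T.
Proof.
move=> ua sub u c; have qa : q \in a by apply: sub; rewrite mem_head.
have va : v \in a by apply: sub; rewrite !inE eqxx orbT.
have qv : q != v by move: u; rewrite /= inE negb_or => /andP[/andP[]].
rewrite dets_leaf => [|y yT]; first by rewrite Cmat_diag (Cmat_mul (@AC_sym gT)).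
have ya : y \in a by apply: sub; rewrite !inE yT !orbT.
have qy : q != y by apply: contraTneq u => ->; rewrite /= inE yT orbT.
split; apply: (Cmat_com (@AC_sym gT)) => //; first exact: c.
  by rewrite eq_sym.
by rewrite AC_sym c.
Qed.

Lemma char_typA P a : all [in S] P -> chain P -> uniq a -> ltr a = ltr P ->
  char_poly (gmx AC (ltr P) a) = phi (size P).
Proof.
move=> PS cP ua e; have [-> m] := char_dets PS (chain_uniq X PS cP) ua e.
by apply: dets_chain0 => // y; rewrite m.
Qed.

Lemma char_typL m q P a : (1 < m)%N -> all [in S] (q :: P) -> typL m q P -> uniq a -> ltr a = ltr (q :: P) ->
  char_poly (gmx AC (ltr (q :: P)) a) =
  ('X + 1) * phi (size P) - 'X * (io (ck X m) ^+ 2)%:P * phi (size P).-1.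
Proof.
move=> m1 QS tL ua e; have u := typL_uniq X m1 QS tL.
have [-> mm] := char_dets QS u ua e; have /and3P[cP P0 lk] := tL.
case: P P0 cP lk QS u e mm {tL} => // v T _ cP lk QS u e mm; have /and3P[qS vS TS] := QS.
case/andP: lk => l c; have PS : all [in S] (v :: T) by rewrite /= vS.
rewrite dets_leafA //; [|by move=> y; rewrite mm|by move=> y yT; apply: AC_com => //; [exact: (allP TS)|exact: (allP c)]].
rewrite (AC_lbl qS vS l); last by case: (m) m1 => [|[]].
rewrite (dets_chain0 PS) //; last by move=> y yP; rewrite mm inE yP orbT.
rewrite (dets_chain0 TS) //; first by move=> y yP; rewrite mm !inE yP !orbT.
by case/andP: cP.
Qed.

Lemma char_typT v x L T a : all [in S] (x :: rev L ++ v :: T) -> uniq (x :: rev L ++ v :: T) ->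
  typT v x L T -> uniq a -> ltr a = ltr (x :: rev L ++ v :: T) ->
  char_poly (gmx AC (ltr (x :: rev L ++ v :: T)) a) =
  ('X + 1) * phi (size L + size T).+1 - 'X * (phi (size L) * phi (size T)).
Proof.
move=> QS u tT ua e; have [-> mm] := char_dets QS u ua e; have /and3P[cP l3 cx] := tT.
have pQ : perm_eq (x :: rev L ++ v :: T) (x :: v :: L ++ T).
  by apply/seq.permP=> z; rewrite /= !count_cat count_rev /=; clear; lia.
have xS : x \in S by case/andP: QS.
have PS : all [in S] (rev L ++ v :: T) by case/andP: QS.
have [LS vS TS] : [/\ all [in S] L, v \in S & all [in S] T].
  by move: PS; rewrite all_cat all_rev /= => /and3P[].
have /and3P[cvL cvT cLT] : [&& chain (v :: L), chain (v :: T) & allrel (@com gT) L T].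
  by rewrite -(chain_center X).
have mQ y : (y \in a) = (y \in x :: v :: L ++ T) by rewrite mm (perm_mem pQ).
have uQ : uniq (x :: v :: L ++ T) by rewrite -(perm_uniq pQ).
have LTS : all [in S] (L ++ T) by rewrite all_cat LS.
rewrite (dets_perm _ u pQ) dets_leafA //; [|by move=> y; rewrite mQ|]; last first.
  by move=> y yT; apply: AC_com => //; [exact: (allP LTS)|exact: (allP cx)].
rewrite (AC_3 xS vS l3) mulr1.
have p2 : perm_eq (v :: L ++ T) (rev L ++ v :: T).
  by apply/seq.permP=> z; rewrite /= !count_cat count_rev /=; clear; lia.
rewrite (dets_perm _ _ p2); last by case/andP: uQ.
rewrite (dets_chain0 PS) //; last by move=> y yP; rewrite mm inE yP orbT.
rewrite dets_chainT //; [|by move=> y yP; rewrite mQ !inE yP !orbT|by case/and3P: uQ|by case/andP: cvL].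
rewrite (dets_chain0 TS) //; last by case/andP: cvT.
  by rewrite size_cat size_rev /= addnS.
by move=> y yT; rewrite mQ !inE mem_cat yT !orbT.
Qed.

Lemma io_ck4 : io (ck X 4) ^+ 2 = 2.
Proof. by rewrite -rmorphXn /= ck4 rmorph_nat. Qed.

Lemma char_typF r v q q' a : all [in S] [:: r; v; q; q'] -> uniq [:: r; v; q; q'] ->
  typF r v q q' -> uniq a -> ltr a = ltr [:: r; v; q; q'] ->
  char_poly (gmx AC (ltr [:: r; v; q; q']) a) =
  ('X + 1) * (('X + 1) * phi 2 - 'X * 2%:P * phi 1) - 'X * phi 2.
Proof.
move=> QS u /and5P[l1 l2 l3 c1 /andP[c2 c3]] ua e; have [-> mm] := char_dets QS u ua e.
have /and5P[rS vS qS q'S _] := QS.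
have m3 y : y \in [:: q; q'] -> y \in a by rewrite mm !inE => /orP[]->; rewrite !orbT.
have m2 y : y \in [:: v; q; q'] -> y \in a by rewrite mm !inE => /or3P[]->; rewrite !orbT.
have cq : chain [:: q; q'] by rewrite /= l3.
rewrite dets_leafA //; [|by move=> y; rewrite mm|]; last first.
  by move=> y; rewrite !inE => /orP[]/eqP->; rewrite AC_com.
rewrite dets_leafA //; [|by case/andP: u|]; last by move=> y; rewrite inE => /eqP->; rewrite AC_com.
rewrite (AC_3 rS vS l1) (AC_lbl vS qS l2) // io_ck4 mulr1.
rewrite (@dets_chain0 a [:: q; q']) //=; last by rewrite qS q'S.
rewrite (@dets_chain0 a [:: q']) //=; first by rewrite q'S.
by move=> y; rewrite inE => /eqP->; apply: m3; rewrite !inE eqxx orbT.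
Qed.

(** The expected Coxeter number and exponents, for all Coxeter words of J at once. The bound e < h
    makes an exponent readable from its eigenvalue. *)
Definition cdata (J : {set gT}) h es := [/\ forall a, uniq a -> ltr a = J ->
  char_poly (gmx AC J a) = \prod_(e <- es) ('X - (zeta h ^+ e)%:P), 1%N \in es & all (fun e => e < h)%N es].

Lemma cdata_ordh (J : {set gT}) h es : J \subset S -> J != set0 -> (0 < h)%N -> cdata J h es -> ordh J h.
Proof. by move=> JS J0 h0 [ch e1 _] a ua ea; apply: (order_type ioA JS J0 ua ea (zprim h0) e1); apply: ch. Qed.

Lemma cdata_roots Q h es : uniq Q -> (0 < h)%N -> size es = size Q -> uniq es ->
  all (fun e => e < h)%N es -> 1%N \in es ->
  (forall a e, uniq a -> ltr a = ltr Q -> e \in es -> (char_poly (gmx AC (ltr Q) a)).[zeta h ^+ e] = 0) ->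
  cdata (ltr Q) h es.
Proof.
move=> uQ h0 sz ue lt e1 rt; split=> // a ua ea; apply: (char_poly_roots (zprim h0)) => //.
  by rewrite sz cardsE; apply/esym/card_uniqP.
by move=> e ee; apply: rt.
Qed.

Lemma cdataA P : all [in S] P -> chain P -> P != [::] -> cdata (ltr P) (size P).+1 (iota 1 (size P)).
Proof.
move=> PS cP P0; apply: cdata_roots; rewrite ?size_iota ?iota_uniq ?(chain_uniq X) //.
- by apply/allP=> e; rewrite mem_iota add1n => /andP[].
- by case: (P) P0.
move=> a e ua ea; rewrite mem_iota add1n => /andP[e0 el]; rewrite char_typA //; have zp := zprim (ltn0Sn (size P)).
apply: phi_root; last by apply: (prim_neq1 zp); rewrite e0.
by rewrite exprAC (prim_expr_order zp) expr1n.
Qed.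

Lemma Xsub1_neq0 : 'X - 1 != 0 :> {poly algC}.
Proof. by rewrite -polyC1 polyXsubC_eq0. Qed.

Lemma phi_eq (p p' : {poly algC}) : ('X - 1) * p = ('X - 1) * p' -> p = p'.
Proof. exact: (mulfI Xsub1_neq0). Qed.

(** The characteristic polynomial is X^n + 1 for n = size P + 1, as seen after multiplication by X -
    1; its roots are the odd powers of a primitive 2n-th root of unity. *)
Lemma cdataB q P : all [in S] (q :: P) -> typL 4 q P ->
  cdata (ltr (q :: P)) (2 * (size P).+1) [seq i.*2.+1 | i <- iota 0 (size P).+1].
Proof.
move=> QS tL; split=> [a ua ea||].
- rewrite (char_typL _ QS tL ua ea) // io_ck4 -(Xn1_prod (K := algC)) ?zprim ?muln_gt0 //.
  case/and3P: tL => _ + _; case: (P) => // v T _ /=; apply: phi_eq.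
  have h1 := phi_mul algC (size T); have h2 := phi_mul algC (size T).+1.
  have -> : ('X - 1) * (('X + 1) * phi (size T).+1 - 'X * 2%:P * phi (size T)) =
    ('X + 1) * (('X - 1) * phi (size T).+1) - 'X * 2%:P * (('X - 1) * phi (size T)) by ring.
  by rewrite h1 h2 !exprS polyC_natr; ring.
- by apply/mapP; exists 0%N.
apply/allP=> e /mapP[i]; rewrite mem_iota add0n => /andP[_ il] ->; lia.
Qed.

(** The polynomial is (X^(n-1) + 1) (X + 1) for n = size T + 3; the additional exponent n - 1
    accounts for the root -1. *)
Lemma cdataD v x L T : all [in S] (x :: rev L ++ v :: T) -> uniq (x :: rev L ++ v :: T) ->
  typT v x L T -> size L = 1%N ->
  cdata (ltr (x :: rev L ++ v :: T)) (2 * (size T).+2) ((size T).+2 :: [seq i.*2.+1 | i <- iota 0 (size T).+2]).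
Proof.
move=> QS u tT sL; split=> [a ua ea||].
- have zp : (2 * (size T).+2).-primitive_root (zeta (2 * (size T).+2)) by apply: zprim; rewrite muln_gt0.
  rewrite (char_typT QS u tT ua ea) sL big_cons -(Xn1_prod (K := algC)) // (prim_half _ zp) //.
  rewrite add1n polyCN opprK polyC1; apply: phi_eq.
  have h1 := phi_mul algC (size T); have h2 := phi_mul algC (size T).+2.
  have -> : ('X - 1) * (('X + 1) * phi (size T).+2 - 'X * (phi 1 * phi (size T))) =
    ('X + 1) * (('X - 1) * phi (size T).+2) - 'X * phi 1 * (('X - 1) * phi (size T)) by ring.
  by rewrite h1 h2 !exprS /=; ring.
- by rewrite inE; apply/orP; right; apply/mapP; exists 0%N.
apply/allP=> e; rewrite in_cons => /predU1P[->|/mapP[i]]; first by lia.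
rewrite mem_iota add0n => /andP[_ il] ->; lia.
Qed.

Lemma zcop h e : (0 < h)%N -> coprime e h -> h.-primitive_root (zeta h ^+ e).
Proof. by move=> h0 c; rewrite (prim_root_exp_coprime _ (zprim h0)). Qed.

Lemma hphi2 (x : algC) : (phi 2).[x] = x ^+ 2 + x + 1.
Proof. by rewrite /= !hornerE; ring. Qed.

Lemma hphi (n : nat) (x : algC) : (phi n).[x] = \sum_(i < n.+1) x ^+ i.
Proof. by rewrite phiE horner_sum; apply: eq_bigr => i _; rewrite hornerXn. Qed.

Lemma hornerT (p p1 p2 : {poly algC}) (x : algC) :
  (('X + 1) * p - 'X * (p1 * p2)).[x] = (x + 1) * p.[x] - x * (p1.[x] * p2.[x]).
Proof. by rewrite !hornerE. Qed.

(** The polynomial is the product of the third and twelfth cyclotomic polynomials; 4 and 8 belong to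
    the third. *)
Lemma cdataE6 v x L T : all [in S] (x :: rev L ++ v :: T) -> uniq (x :: rev L ++ v :: T) ->
  typT v x L T -> size L = 2 -> size T = 2 ->
  cdata (ltr (x :: rev L ++ v :: T)) 12 [:: 1; 4; 5; 7; 8; 11].
Proof.
move=> QS u tT sL sT; apply: cdata_roots => //; first by rewrite /= size_cat size_rev /= sL sT.
move=> a e ua ea ee; rewrite (char_typT QS u tT ua ea) sL sT.
have E (y : algC) : (('X + 1) * phi 5 - 'X * (phi 2 * phi 2)).[y] = (y ^+ 2 + y + 1) * (y ^+ 4 - y ^+ 2 + 1).
  by rewrite hornerT !hphi !big_ord_recr !big_ord0 /=; ring.
move: ee; apply: (fun F ee => etrans (E _) (F ee)); rewrite !inE.
have z3 k : 3.-primitive_root (zeta 12 ^+ k) -> (zeta 12 ^+ k) ^+ 2 + zeta 12 ^+ k + 1 = 0.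
  by move=> pk; have := @phi_root _ 2 _ (prim_expr_order pk) (prim_neq1 (k := 1) pk isT); rewrite hphi2.
have p4 : 3.-primitive_root (zeta 12 ^+ 4) by rewrite (zetaM (k := 4) (m := 3)) // zprim.
have p8 : 3.-primitive_root (zeta 12 ^+ 8).
  by rewrite (_ : 8 = 4 * 2)%N // exprM (prim_root_exp_coprime _ p4).
case/or3P=> [/eqP->|/eqP->|]; [|by rewrite (z3 4) ?mul0r|case/or4P=> [/eqP->|/eqP->|/eqP->|/eqP->]; try by rewrite (z3 8) ?mul0r];
  by rewrite prim12 ?mulr0 // zcop.
Qed.

Lemma cdataE7 v x L T : all [in S] (x :: rev L ++ v :: T) -> uniq (x :: rev L ++ v :: T) ->
  typT v x L T -> size L = 2 -> size T = 3 ->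
  cdata (ltr (x :: rev L ++ v :: T)) 18 [:: 1; 5; 7; 9; 11; 13; 17].
Proof.
move=> QS u tT sL sT; apply: cdata_roots => //; first by rewrite /= size_cat size_rev /= sL sT.
move=> a e ua ea ee; rewrite (char_typT QS u tT ua ea) sL sT.
have E (y : algC) : (('X + 1) * phi 6 - 'X * (phi 2 * phi 3)).[y] = (y + 1) * (y ^+ 6 - y ^+ 3 + 1).
  by rewrite hornerT !hphi !big_ord_recr !big_ord0 /=; ring.
apply: etrans (E _) _; have [->|e9] := eqVneq e 9.
  by rewrite (@prim_half _ 9 _ isT (zprim _)) // addNr mul0r.
rewrite prim18 ?mulr0 // zcop //; move: ee e9; rewrite !inE.
by do ![case/orP; first by move/eqP->]; move/eqP->.
Qed.

Lemma cdataE8 v x L T : all [in S] (x :: rev L ++ v :: T) -> uniq (x :: rev L ++ v :: T) ->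
  typT v x L T -> size L = 2 -> size T = 4 ->
  cdata (ltr (x :: rev L ++ v :: T)) 30 [:: 1; 7; 11; 13; 17; 19; 23; 29].
Proof.
move=> QS u tT sL sT; apply: cdata_roots => //; first by rewrite /= size_cat size_rev /= sL sT.
move=> a e ua ea ee; rewrite (char_typT QS u tT ua ea) sL sT.
have E (y : algC) : (('X + 1) * phi 7 - 'X * (phi 2 * phi 4)).[y] =
    y ^+ 8 + y ^+ 7 - y ^+ 5 - y ^+ 4 - y ^+ 3 + y + 1.
  by rewrite hornerT !hphi !big_ord_recr !big_ord0 /=; ring.
apply: etrans (E _) _; rewrite prim30 // zcop //; move: ee; rewrite !inE.
by do ![case/orP; first by move/eqP->]; move/eqP->.
Qed.

Lemma cdataF r v q q' : all [in S] [:: r; v; q; q'] -> uniq [:: r; v; q; q'] ->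
  typF r v q q' -> cdata (ltr [:: r; v; q; q']) 12 [:: 1; 5; 7; 11].
Proof.
move=> QS u tF; apply: cdata_roots => // a e ua ea ee; rewrite (char_typF QS u tF ua ea).
have E (y : algC) : (('X + 1) * (('X + 1) * phi 2 - 'X * 2%:P * phi 1) - 'X * phi 2).[y] =
    y ^+ 4 - y ^+ 2 + 1.
  by rewrite /= !hornerE; ring.
apply: etrans (E _) _; rewrite prim12 // zcop //; move: ee; rewrite !inE.
by do ![case/orP; first by move/eqP->]; move/eqP->.
Qed.

Lemma zetaV m k : (0 < m)%N -> (k <= m)%N -> zeta m ^+ (m - k) = (zeta m ^+ k)^-1.
Proof.
move=> m0 km; have zp := zprim m0; apply: (mulIf (x := zeta m ^+ k)).
  by rewrite expf_neq0 // (prim_root_eq0 zp) -lt0n.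
rewrite -exprD subnK // (prim_expr_order zp) mulVf //.
by rewrite expf_neq0 // (prim_root_eq0 zp) -lt0n.
Qed.

Lemma cdataI m q v : (2 < m)%N -> all [in S] [:: q; v] -> typL m q [:: v] ->
  cdata (ltr [:: q; v]) m [:: 1; m.-1].
Proof.
move=> m2 QS tL; have m1 := ltnW m2; have m0 := ltnW m1; have u := typL_uniq X m1 QS tL.
apply: cdata_roots => //=; rewrite ?inE.
- by rewrite andbT; apply/eqP; lia.
- by rewrite m1 andbT; lia.
move=> a e ua ea ee; rewrite (char_typL m1 QS tL ua ea) ck2 //=.
have z0 : zeta m != 0 by rewrite (prim_root_eq0 (zprim m0)) -lt0n.
rewrite !hornerE; move: ee; rewrite !inE => /orP[]/eqP->.
  by rewrite expr1; field.
by rewrite -subn1 zetaV // expr1; field.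
Qed.

Lemma cdataH3 q P : all [in S] (q :: P) -> typL 5 q P -> size P = 2 ->
  cdata (ltr (q :: P)) 10 [:: 1; 5; 9].
Proof.
move=> QS tL sP; have u := typL_uniq X (m := 5) isT QS tL.
apply: cdata_roots => //=; first by rewrite sP.
have ck25 : io (ck X 5) ^+ 2 = 2 + (zeta 5 + (zeta 5)^-1) by rewrite ck2 // addrA.
move=> a e ua ea ee; rewrite (char_typL _ QS tL ua ea) // ck25 sP /=.
have [->|e5] := eqVneq e 5.
  by rewrite (@prim_half _ 5 _ isT (zprim _)) // !hornerE; ring.
have pe : 10.-primitive_root (zeta 10 ^+ e).
  by apply: zcop => //; move: ee e5; rewrite !inE => /or3P[]/eqP->.
have e0 : zeta 10 ^+ e != 0 by rewrite (prim_root_eq0 pe).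
have hb : zeta 5 + (zeta 5)^-1 = (zeta 10 ^+ e) ^+ 2 + ((zeta 10 ^+ e) ^+ 2)^-1.
  rewrite -(zetaM (k := 2) (m := 5)) //; move: ee e5; rewrite !inE => /or3P[]/eqP-> // _.
  by rewrite (@zetaV 10 1) // exprVn invrK addrC.
move: (zeta 5 + _) hb => b; move: (zeta 10 ^+ e) pe e0 => y /prim10 pe e0 hb; rewrite !hornerE.
transitivity ((y + 1) * (y ^+ 2 - y + 1 - y * b)); first by ring.
rewrite hb (_ : _ - _ = - (y ^+ 4 - y ^+ 3 + y ^+ 2 - y + 1) / y); last by field.
by rewrite pe oppr0 mul0r mulr0.
Qed.

Lemma cdataH4 q P : all [in S] (q :: P) -> typL 5 q P -> size P = 3 ->
  cdata (ltr (q :: P)) 30 [:: 1; 11; 19; 29].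
Proof.
move=> QS tL sP; have u := typL_uniq X (m := 5) isT QS tL.
apply: cdata_roots => //=; first by rewrite sP.
have ck25 : io (ck X 5) ^+ 2 = 2 + (zeta 5 + (zeta 5)^-1) by rewrite ck2 // addrA.
move=> a e ua ea ee; rewrite (char_typL _ QS tL ua ea) // ck25 sP /=.
have pe : 30.-primitive_root (zeta 30 ^+ e).
  by apply: zcop => //; move: ee; rewrite !inE => /or4P[]/eqP->.
have e0 : zeta 30 ^+ e != 0 by rewrite (prim_root_eq0 pe).
have p30 := prim_expr_order (zprim (isT : 0 < 30)%N).
have m30 k : zeta 30 ^+ (30 + k) = zeta 30 ^+ k by rewrite exprD p30 mul1r.
(* Each exponent is 1 or -1 modulo 5, so this sixth power is zeta 5 or its inverse. *)
have hb : zeta 5 + (zeta 5)^-1 = (zeta 30 ^+ e) ^+ 6 + ((zeta 30 ^+ e) ^+ 6)^-1.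
  rewrite -(zetaM (k := 6) (m := 5)) // -[(zeta 30 ^+ e) ^+ 6]exprM.
  move: ee; rewrite !inE => /or4P[]/eqP-> //.
  - by rewrite (_ : 11 * 6 = 30 + (30 + 6))%N // !m30.
  - by rewrite (_ : 19 * 6 = 30 + (30 + (30 + (30 - 6))))%N // !m30 zetaV // invrK addrC.
  - by rewrite (_ : 29 * 6 = 30 + (30 + (30 + (30 + (30 + (30 - 6))))))%N // !m30 zetaV // invrK addrC.
move: (zeta 5 + _) hb => b; move: (zeta 30 ^+ e) pe e0 => y /prim30 pe e0 hb; rewrite !hornerE.
transitivity (y ^+ 4 + 1 - b * (y ^+ 3 + y ^+ 2 + y)); first by ring.
(* Once b is expressed through y, the quartic is a multiple of the thirtieth cyclotomic
   polynomial. *)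
rewrite hb (_ : _ - _ = - (y ^+ 8 + y ^+ 7 - y ^+ 5 - y ^+ 4 - y ^+ 3 + y + 1) *
  (y ^+ 7 + y ^+ 5 + y ^+ 3 + y) / y ^+ 6); last by field.
by rewrite pe oppr0 !mul0r.
Qed.

End TypeData.

(** * Roots of -1 and existence of the representation *)

Section ChebRoots.
Local Open Scope ring_scope.

(* Christoffel-Darboux: [D k := p_(k+1) y * p_k x - p_(k+1) x * p_k y] satisfies
   [D (k+1) = (y - x) * p_(k+1) y * p_(k+1) x + D k]. *)
Lemma cheb_gt (R : realFieldType) (x y : R) n : x < y ->
  (forall k, (0 < k < n)%N -> 0 < cheb x k) -> 0 <= cheb x n ->
  forall k, (0 < k <= n)%N -> 0 < cheb y k.
Proof.
move=> xy px pn; have px' k : (0 < k <= n)%N -> 0 <= cheb x k.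
  by case/andP=> k0; rewrite leq_eqVlt => /orP[/eqP->|kn] //; rewrite ltW // px // k0.
suff h k : (k < n)%N -> 0 < cheb y k.+1 /\ 0 <= cheb y k.+1 * cheb x k - cheb x k.+1 * cheb y k.
  by case=> // k /andP[_ kn]; case: (h k kn).
elim: k => [|k IH] kn; first by rewrite !cheb1 !cheb0 !mulr0 subrr.
have [p1 D] := IH (ltnW kn); have q1 : 0 < cheb x k.+1 by apply: px; rewrite kn.
have q2 : 0 <= cheb x k.+2 by apply: px'; rewrite kn.
have e : cheb y k.+2 * cheb x k.+1 - cheb x k.+2 * cheb y k.+1 =
    (y - x) * (cheb y k.+1 * cheb x k.+1) + (cheb y k.+1 * cheb x k - cheb x k.+1 * cheb y k).
  by rewrite !chebSS; ring.
have d0 : 0 < (y - x) * (cheb y k.+1 * cheb x k.+1).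
  by rewrite mulr_gt0 ?subr_gt0 // mulr_gt0.
have D' : 0 < cheb y k.+2 * cheb x k.+1 - cheb x k.+2 * cheb y k.+1 by rewrite e; apply: ltr_pwDl.
split; last exact: ltW.
rewrite -(pmulr_lgt0 _ q1); apply: lt_le_trans D' _; rewrite gerBl; apply: mulr_ge0 => //; exact: ltW.
Qed.

Lemma cheb_root_uniq (R : realFieldType) (x y : R) n : (0 < n)%N -> cheb x n = 0 -> cheb y n = 0 ->
  (forall k, (0 < k < n)%N -> 0 < cheb x k) -> (forall k, (0 < k < n)%N -> 0 < cheb y k) -> x = y.
Proof.
move=> n0 x0 y0 px py; have nn : (0 < n <= n)%N by rewrite n0 leqnn.
case: (ltgtP x y) => // xy.
  by have := cheb_gt xy px _ nn; rewrite x0 y0 lexx ltxx => /(_ isT).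
by have := cheb_gt xy py _ nn; rewrite x0 y0 lexx ltxx => /(_ isT).
Qed.

Lemma cheb_poly (R : realFieldType) n : exists p : {poly R}, forall x, p.[x] = cheb x n.
Proof.
suff [p [q [h _]]] : exists p q : {poly R}, (forall x, p.[x] = cheb x n) /\ (forall x, q.[x] = cheb x n.+1).
  by exists p.
elim: n => [|n [p [q [hp hq]]]].
  by exists 0, 1; split=> x; rewrite ?cheb0 ?cheb1 hornerE.
by exists q, ('X * q - p); split=> // x; rewrite !hornerE hp hq chebSS.
Qed.

Lemma cheb_at2 (R : realFieldType) n : cheb (2 : R) n = n%:R.
Proof.
suff [] : cheb (2 : R) n = n%:R /\ cheb (2 : R) n.+1 = n.+1%:R by [].
elim: n => [|n [h1 h2]]; first by rewrite cheb0 cheb1.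
by split=> //; rewrite chebSS h1 h2 -!natr1; ring.
Qed.

(** At the root x of one polynomial the next one equals minus the previous one, so it is negative,
    while its value at 2 is positive. The intermediate root y exceeds x, and [cheb_gt] keeps the
    lower polynomials positive at y. *)
Lemma cheb_root_exists (R : rcfType) n : exists x : R,
  [/\ 0 <= x, x < 2, cheb x n.+2 = 0 & forall k, (0 < k < n.+2)%N -> 0 < cheb x k].
Proof.
elim: n => [|n [x [x0 x2 rt px]]].
  exists 0; split=> //; first by rewrite chebSS cheb0 cheb1; ring.
  by case=> [|[]] //; rewrite cheb1 ltr01.
have [p hp] := cheb_poly R n.+3.
have xn : cheb x n.+3 < 0 by rewrite chebSS rt mulr0 sub0r oppr_lt0 px // ltnSn.
have [] := @poly_ivt _ p x 2 (ltW x2); first by rewrite !hp cheb_at2 (ltW xn) ler0n.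
move=> y /andP[xy y2] /rootP; rewrite hp => ry.
have {}xy : x < y by rewrite lt_neqAle xy andbT; apply: contraTneq xn => ->; rewrite ry ltxx.
exists y; split=> //; first by apply: le_trans (ltW xy).
  by rewrite lt_neqAle y2 andbT; apply: contra_eq_neq ry => ->; rewrite cheb_at2 pnatr_eq0.
by apply: (cheb_gt xy px); rewrite rt.
Qed.

End ChebRoots.

Section RootNeg1.
Local Open Scope ring_scope.
Implicit Types (u z : algC) (x : algR).

(** At exp (i pi / m) this is 2 cos (pi / m). *)
Definition reR (z : algC) : algR := in_algR (Creal_Re z) *+ 2.

Lemma reRE z : algRval (reR z) = z + z^*.
Proof.
rewrite rmorphMn /= ReE -mulr_natr divfK ?pnatr_eq0 //.
Qed.

(** The powers of u satisfy the Chebyshev recursion because u and its conjugate have product 1. *)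
Lemma Im_exp u k : u * u^* = 1 -> 'Im (u ^+ k) = algRval (cheb (reR u) k) * 'Im u.
Proof.
move=> u1; suff [] : 'Im (u ^+ k) = algRval (cheb (reR u) k) * 'Im u /\
    'Im (u ^+ k.+1) = algRval (cheb (reR u) k.+1) * 'Im u by [].
elim: k => [|k [h1 h2]].
  rewrite cheb0 cheb1 rmorph0 rmorph1 mul0r mul1r expr1 expr0; split=> //.
  by apply/Creal_ImP; rewrite real1.
split=> //; have -> : u ^+ k.+2 = algRval (reR u) * u ^+ k.+1 - u ^+ k.
  have e : u^* * u ^+ k.+1 = u ^+ k by rewrite exprS mulrA [u^* * u]mulrC u1 mul1r.
  by rewrite reRE mulrDl e -exprS addrK.
have -> : 'Im (algRval (reR u) * u ^+ k.+1 - u ^+ k) = 'Im (algRval (reR u) * u ^+ k.+1) - 'Im (u ^+ k).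
  by rewrite raddfB.
by rewrite (@ImMl _ (algRval (reR u)) (algRvalP _)) h1 h2 chebSS rmorphB rmorphM; ring.
Qed.

(** Singles out exp (i pi / m) algebraically: its powers before the m-th stay in the open upper half
    plane. *)
Definition good m u := [/\ u ^+ m = -1, u * u^* = 1 & forall k, (0 < k < m)%N -> 0 < 'Im (u ^+ k)].

Lemma good_cheb m u : (1 < m)%N -> good m u ->
  [/\ 0 < 'Im u, cheb (reR u) m = 0 & forall k, (0 < k < m)%N -> 0 < cheb (reR u) k].
Proof.
move=> m1 [um u1 Im]; have I0 : 0 < 'Im u by have := Im 1%N m1; rewrite expr1.
split=> // [|k km].
  apply/eqP; rewrite -(inj_eq val_inj) /=; have := Im_exp m u1; rewrite um.
  have -> : 'Im (-1 : algC) = 0 by apply/Creal_ImP; rewrite rpredN real1.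
  by move/esym/eqP; rewrite mulf_eq0 (gt_eqF I0) orbF.
by have := Im k km; rewrite Im_exp // pmulr_lgt0.
Qed.

Lemma eq_ReIm u z : u * u^* = 1 -> z * z^* = 1 -> 0 <= 'Im u -> 0 <= 'Im z -> 'Re u = 'Re z -> u = z.
Proof.
move=> u1 z1 iu iz e; apply/eqCP; split=> //; apply/eqP; rewrite -(eqrXn2 (n := 2)) //.
have h v : v * v^* = 1 -> 'Im v ^+ 2 = 1 - 'Re v ^+ 2.
  by rewrite -normCK normC2_Re_Im => <-; ring.
by rewrite !h // e.
Qed.

Lemma reR_inj u z : reR u = reR z -> 'Re u = 'Re z.
Proof. by move/(congr1 algRval); rewrite !reRE !ReE => ->. Qed.

Lemma good_uniq m u z : (1 < m)%N -> good m u -> good m z -> u = z.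
Proof.
move=> m1 gu gz; have [iu ru pu] := good_cheb m1 gu; have [iz rz pz] := good_cheb m1 gz.
case: gu gz => _ u1 _ [_ z1 _]; apply: eq_ReIm => //; try exact: ltW.
by apply: reR_inj; apply: (cheb_root_uniq (ltnW m1) ru rz pu pz).
Qed.

Lemma good_exists m : (1 < m)%N -> exists u, good m u.
Proof.
case: m => [|[|n]] // _; have [x [x0 x2 rt px]] := cheb_root_exists algR n.
pose a := algRval x / 2; pose b := sqrtC (1 - a ^+ 2); pose u := a + 'i * b.
have aR : a \is Num.real by rewrite rpred_div ?algRvalP ?realn.
have a0 : 0 <= a by apply: divr_ge0; [exact: x0 | exact: ler0n].
have a1 : a < 1 by rewrite ltr_pdivrMr ?ltr0n // mul1r; move: x2; rewrite -[_ < _]/(algRval x < algRval 2) rmorph_nat.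
have b0 : 0 < b by rewrite sqrtC_gt0 subr_gt0 expr_lt1.
have bR : b \is Num.real by apply: gtr0_real.
have uR : 'Re u = a by apply: Re_rect.
have uI : 'Im u = b by apply: Im_rect.
have u1 : u * u^* = 1 by rewrite -normCK normC2_Re_Im uR uI sqrtCK; ring.
have xE : reR u = x.
  apply: val_inj; rewrite -[val (reR u)]/(algRval (reR u)) reRE; by have := ReE u; rewrite uR /a => /(congr1 (fun t => t * 2)); rewrite !divfK ?pnatr_eq0 // => <-.
have Ipos k : (0 < k < n.+2)%N -> 0 < 'Im (u ^+ k).
  by move=> kn; rewrite Im_exp // xE uI pmulr_lgt0 //; apply: (px k kn).
exists u; split=> //.
have uu : u ^+ n.+2 * (u ^+ n.+2)^* = 1 by rewrite rmorphXn -exprMn u1 expr1n.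
have Im0 : 'Im (u ^+ n.+2) = 0 by rewrite Im_exp // xE rt rmorph0 mul0r.
have : u ^+ n.+2 = (u ^+ n.+2)^* by rewrite conj_Creal //; apply/Creal_ImP.
move=> e; move: uu; rewrite -e -expr2 => /eqP; rewrite sqrf_eq1 => /orP[]/eqP // un.
have := Ipos n.+1; rewrite ltnSn => /(_ isT).
have -> : u ^+ n.+1 = u^*.
  by rewrite -[LHS]mulr1 -u1 mulrA -exprSr un mul1r.
by rewrite Im_conj uI oppr_gt0 lt_gtF.
Qed.

(** [m.-root] takes the largest real part among the roots in the upper half plane, so its real part
    is at least that of a good root u. A strictly larger one would make [cheb] positive there by
    [cheb_gt], while -1 being real forces either this value or the imaginary part to vanish. *)
Lemma root_good m : (1 < m)%N -> good m (m.-root (-1)).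
Proof.
move=> m1; have m0 := ltnW m1; have [u gu] := good_exists m1; set z := m.-root (-1).
have [iu ru pu] := good_cheb m1 gu; have [um u1 _] := gu.
have zm : z ^+ m = -1 by apply: rootCK.
have z1 : z * z^* = 1.
  rewrite -normCK; have : `|z| ^+ m = 1 by rewrite -normrX zm normrN1.
  by move/eqP; rewrite pexpr_eq1 // => /eqP->; rewrite expr1n.
have iz : 0 <= 'Im z by apply: Im_rootC_ge0.
have Re : 'Re u <= 'Re z by apply: rootC_Re_max => //; apply: ltW.
suff -> : z = u by [].
apply: eq_ReIm => //; first exact: ltW.
apply/eqP; rewrite eq_le Re andbT real_leNgt ?Creal_Re //; apply/negP=> lt.
have lt' : reR u < reR z.
  rewrite -[_ < _]/(algRval (reR u) < algRval (reR z)) !reRE.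
  by move: lt; rewrite !ReE ltr_pM2r // invr_gt0 ltr0n.
have mm : (0 < m <= m)%N by rewrite m0 leqnn.
have := cheb_gt lt' pu _ mm; rewrite ru lexx => /(_ isT) pz.
have := Im_exp m z1; rewrite zm.
have -> : 'Im (-1 : algC) = 0 by apply/Creal_ImP; rewrite rpredN real1.
move/esym/eqP; rewrite mulf_eq0 => /orP[h|/eqP Im0].
  by move: pz; rewrite -[_ < _]/(0 < algRval (cheb (reR z) m)) (eqP h) ltxx.
(* A real z of modulus 1 is 1 or -1: the first is no root of -1, the second has too small a real
   part. *)
have zr : z^* = z by rewrite conj_Creal //; apply/Creal_ImP.
move: z1; rewrite zr -expr2 => /eqP; rewrite sqrf_eq1 => /orP[]/eqP ze.
  by move: zm; rewrite ze expr1n => /eqP; rewrite -subr_eq0 opprK (_ : 1 + 1 = 2%:R) ?pnatr_eq0.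
have x0 : 0 <= reR u.
  have e2 : cheb (reR u) 2 = reR u by rewrite chebSS cheb0 cheb1 mulr1 subr0.
  move: m1; rewrite leq_eqVlt => /orP[/eqP e|m2]; first by move: ru; rewrite -e e2 => ->.
  by have := pu 2; rewrite m2 e2 => /(_ isT)/ltW.
have := le_lt_trans x0 lt'; rewrite -[_ < _]/(0 < algRval (reR z)) reRE zr ze -opprD oppr_gt0.
by rewrite lt_gtF // addr_gt0.
Qed.

Lemma root_exp k m : (0 < k)%N -> (1 < m)%N -> (k * m).-root (-1) ^+ k = m.-root (-1) :> algC.
Proof.
move=> k0 m1; have km : (1 < k * m)%N by apply: leq_trans m1 _; rewrite leq_pmull.
have [zm z1 Ip] := root_good km; apply: (good_uniq m1 _ (root_good m1)); split.
- by rewrite -exprM.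
- by rewrite rmorphXn -exprMn z1 expr1n.
by move=> j /andP[j0 jm]; rewrite -exprM Ip // muln_gt0 k0 j0 ltn_pmul2l.
Qed.

Lemma zeta_prim h : (0 < h)%N -> h.-primitive_root (zeta h).
Proof.
case: h => [|[|n]] // _.
  by rewrite /zeta root1C sqrrN expr1n; apply/andP; split=> //; apply/forallP=> i; rewrite ord1 unity_rootE eqxx.
have [zm z1 Ip] := root_good (isT : 1 < n.+2)%N; rewrite /zeta; set z := _.-root _ in zm z1 Ip *.
have e1 : (z ^+ 2) ^+ n.+2 = 1 by rewrite exprAC zm sqrrN expr1n.
have [m pm md] := prim_order_exists (ltn0Sn n.+1) e1.
have m0 := prim_order_gt0 pm.
have : (m <= n.+2)%N by apply: dvdn_leq md.
rewrite leq_eqVlt => /orP[/eqP<-//|mn]; have := prim_expr_order pm; rewrite exprAC => /eqP.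
have := Ip m; rewrite m0 mn => /(_ isT) I0; rewrite sqrf_eq1 => /orP[]/eqP e; move: I0; rewrite e.
  by rewrite (Creal_ImP 1 (real1 _)) ltxx.
by rewrite (Creal_ImP (-1) _) ?ltxx // rpredN real1.
Qed.

Lemma zeta_exp k m : (0 < k)%N -> (0 < m)%N -> zeta (k * m) ^+ k = zeta m.
Proof.
move=> k0; case: m => [|[|m]] // _.
  by rewrite muln1 (prim_expr_order (zeta_prim k0)) /zeta root1C sqrrN expr1n.
by rewrite /zeta exprAC root_exp.
Qed.

Lemma reR2_zeta m : (1 < m)%N -> algRval (reR (m.-root (-1))) ^+ 2 = 2 + zeta m + (zeta m)^-1.
Proof.
move=> m1; have [_ z1 _] := root_good m1; rewrite reRE /zeta; set z := _.-root _ in z1 *.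
have z0 : z != 0 by apply: contra_eq_neq z1 => ->; rewrite mul0r eq_sym oner_eq0.
have -> : z^* = z^-1 by apply: (mulfI z0); rewrite z1 mulfV.
by field.
Qed.

End RootNeg1.

(** * Existence of the geometric representation *)

(** The bijections of V form the possibly infinite group to which the presentation of W is applied;
    carrying the inverse as data gives inversion directly. *)
Record vbij (V : Type) := Vbij {
  vb :> V -> V; vbi : V -> V; vbK : cancel vb vbi; vbKV : cancel vbi vb }.

Lemma vbij_eq V (f g : vbij V) : vb f =1 vb g -> f = g.
Proof.
case: f g => f fi fK fKV [g gi gK gKV] /= e.
have {e} e : f = g by apply/funext.
move: gK gKV; rewrite -{}e => gK gKV.
have e : fi = gi by apply/funext=> x; rewrite -{1}(gKV x) fK.
by move: gK gKV; rewrite -e => gK gKV; congr Vbij; apply: Prop_irrelevance.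
Qed.

HB.instance Definition _ V := gen_eqMixin (vbij V).
HB.instance Definition _ V := gen_choiceMixin (vbij V).

Section Vbij.
Variable V : Type.
Definition vbij1 := @Vbij V id id (fun=> erefl) (fun=> erefl).
Definition vbijV (f : vbij V) := Vbij (vbKV f) (vbK f).
Definition vbijM (f g : vbij V) := Vbij (can_comp (vbK f) (vbK g)) (can_comp (vbKV g) (vbKV f)).
Lemma vbijA : associative vbijM. Proof. by move=> f g k; apply: vbij_eq. Qed.
Lemma vbij1M : left_id vbij1 vbijM. Proof. by move=> f; apply: vbij_eq. Qed.
Lemma vbijM1 : right_id vbij1 vbijM. Proof. by move=> f; apply: vbij_eq. Qed.
Lemma vbijVM : left_inverse vbij1 vbijV vbijM.
Proof. by move=> f; apply: vbij_eq => x /=; rewrite vbK. Qed.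
Lemma vbijMV : right_inverse vbij1 vbijV vbijM.
Proof. by move=> f; apply: vbij_eq => x /=; rewrite vbKV. Qed.
HB.instance Definition _ := isGroup.Build (vbij V) vbijA vbij1M vbijM1 vbijVM vbijMV.

Lemma vb_exp (f : vbij V) k v : vb (f ^+ k) v = iter k (vb f) v.
Proof. by elim: k v => // k IH v; rewrite expgS iterS /= IH. Qed.
End Vbij.

Section Reflections.
Local Open Scope ring_scope.
Variables (gT : finGroupType) (S : {set gT}) (R : realFieldType) (ck : nat -> R).
Implicit Types (s t y : gT) (v : {ffun gT -> R}) (x : R).
Notation refl := (refl S ck).
Notation pair := (pairing S ck).
Notation A := (cartan ck).

Definition two (a b : R) s t v : {ffun gT -> R} := [ffun y => v y - a * (y == s)%:R - b * (y == t)%:R].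

Lemma pair_two a b q s t v : s \in S -> t \in S -> pair q (two a b s t v) = pair q v - a * A q s - b * A q t.
Proof.
move=> sS tS; rewrite /pairing.
have D k (u : gT) : u \in S -> \sum_(y in S) A q y * (k * (y == u)%:R) = k * A q u.
  move=> uS; rewrite (bigD1 u) //= eqxx mulr1 big1 ?addr0 1?mulrC // => y /andP[_ /negbTE->].
  by rewrite !mulr0.
rewrite -!D // -!sumrB; apply: eq_bigr => y _; rewrite ffunE; ring.
Qed.

Lemma A_ss s : A s s = 2. Proof. by rewrite /cartan eqxx. Qed.

Lemma refl_two1 a b s t v : s \in S -> t \in S ->
  refl s (two a b s t v) = two (pair s v - a - b * A s t) b s t v.
Proof.
by move=> sS tS; apply/ffunP=> y; rewrite ffunE pair_two // !ffunE A_ss; ring.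
Qed.

Lemma refl_two2 a b s t v : s \in S -> t \in S ->
  refl t (two a b s t v) = two a (pair t v - b - a * A t s) s t v.
Proof.
by move=> sS tS; apply/ffunP=> y; rewrite ffunE pair_two // !ffunE A_ss; ring.
Qed.

Lemma two0 s t v : two 0 0 s t v = v.
Proof. by apply/ffunP=> y; rewrite ffunE !mul0r !subr0. Qed.

Lemma reflK s : s \in S -> cancel (refl s) (refl s).
Proof.
move=> sS v; have -> : refl s v = two (pair s v) 0 s s v.
  by apply/ffunP=> y; rewrite !ffunE mul0r subr0.
by rewrite refl_two1 // subrr mul0r subr0 two0.
Qed.

(** The quadratic form p^2 + q^2 - x p q is invariant under the recursion of consecutive values p,
    q. *)
Lemma cheb_inv x k : cheb x k ^+ 2 = 1 - cheb x k.+1 ^+ 2 + x * cheb x k * cheb x k.+1.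
Proof.
elim: k => [|k IH]; first by rewrite cheb0 cheb1; ring.
rewrite chebSS; move: (cheb x k) (cheb x k.+1) IH => p q IH; ring: IH.
Qed.

(** Both coefficients carry the factor [cheb x k], so the k-th power is the identity where this
    vanishes: the defining relations hold. *)
Lemma dihedral s t x : s \in S -> t \in S -> s != t -> x = ck #[(s * t)%g] -> forall v k,
  iter k (refl s \o refl t) v =
  two (cheb x k * (cheb x k * pair s v + cheb x k.+1 * pair t v))
      (cheb x k * ((x * cheb x k - cheb x k.+1) * pair s v + cheb x k * pair t v)) s t v.
Proof.
move=> sS tS ne ex v; have Ast : A s t = - x by rewrite /cartan (negbTE ne) ex.
have Ats : A t s = - x.
  rewrite /cartan eq_sym (negbTE ne) ex; congr (- ck _).
  by rewrite -(orderJ (s * t)%g s) conjgE -!mulgA mulKg.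
elim=> [|k IH]; first by rewrite cheb0 !mul0r two0.
rewrite iterS IH -[(_ \o _) _]/(refl s (refl t _)) refl_two2 // refl_two1 // Ast Ats chebSS.
have := cheb_inv x k; move: (pair s v) (pair t v) => a b.
by move: (cheb x k.+1) (cheb x k) => q p inv; congr two; ring: inv.
Qed.

End Reflections.

Section Build.
Local Open Scope ring_scope.
Variables (gT : finGroupType) (S : {set gT}).
Hypothesis cox : coxeter_system S.
Implicit Types (s t y : gT) (v : {ffun gT -> algR}) (x : algR).

Definition ckR (m : nat) : algR := reR (m.-root (-1)).
Notation refl := (refl S ckR).
Notation pair := (pairing S ckR).
Notation A := (cartan ckR).

Lemma cox_inv s : s \in S -> (s * s = 1)%g.
Proof. by move=> sS; have := expg_order s; rewrite (coxeter_involution cox sS). Qed.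

Lemma cox_order s t : s \in S -> t \in S -> s != t -> (1 < #[(s * t)%g])%N.
Proof.
move=> sS tS ne; rewrite ltn_neqAle order_gt0 andbT eq_sym order_eq1; apply: contra ne => /eqP e.
by apply/eqP; apply: (mulIg t); rewrite e cox_inv.
Qed.

Lemma ckR_root m : (1 < m)%N -> cheb (ckR m) m = 0.
Proof. by move=> m1; have [_ h _] := good_cheb m1 (root_good m1). Qed.

Lemma ckR_pos m k : (0 < k < m)%N -> 0 < cheb (ckR m) k.
Proof.
move=> km; have m1 : (1 < m)%N by case/andP: km => k0 km; apply: leq_ltn_trans k0 km.
by have [_ _ h] := good_cheb m1 (root_good m1); apply: h.
Qed.

(** The match on the view supplies the proof of s \in S from which the bijection is built. *)
Definition rbij s : vbij {ffun gT -> algR} :=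
  if @eqP _ (s \in S) true is ReflectT sS then Vbij (reflK ckR sS) (reflK ckR sS) else 1%g.

Lemma rbijE s v : s \in S -> rbij s v = refl s v.
Proof. by move=> sS; rewrite /rbij; case: eqP. Qed.

(** The universal property is applied twice: to the reflections, and to the constant transposition
    of [bool], which gives the sign character. *)
Lemma coxrep_exists : exists X : coxrep S algR, ck X = ckR.
Proof.
have [phi [phiM phiE]] : exists phi : gT -> vbij {ffun gT -> algR},
    {morph phi : x y / (x * y)%g} /\ {in S, forall s, phi s = rbij s}.
  apply: (coxeter_present cox) => s t sS tS; apply: vbij_eq => v.
  have e k : iter k (vb (rbij s * rbij t)%g) v = iter k (refl s \o refl t) v.
    by apply: eq_iter => u /=; rewrite rbijE // rbijE.
  rewrite vb_exp e; have [<-|ne] := eqVneq s t.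
    by rewrite cox_inv // order1 /= reflK.
  by rewrite (dihedral sS tS ne erefl) ckR_root ?cox_order // !mul0r two0.
have [sg [sgM sgE]] : exists sg : gT -> {perm bool},
    {morph sg : x y / (x * y)%g} /\ {in S, forall s, sg s = tperm true false}.
  apply: (coxeter_present cox (f := fun=> tperm true false)) => s t sS tS.
  by rewrite -expg2 (_ : (tperm true false ^+ 2 = 1)%g) ?expg1n // expgS expg1 tperm2.
have phi1 : phi 1%g = 1%g by apply: (mulgI (phi 1%g)); rewrite -phiM !mulg1.
unshelve eexists (@CoxRep gT S algR ckR (fun y : gT => phi y) (fun y : gT => odd_perm (sg y)) _ _ _ _ _ _ _ _ _ _).
- exact: cox_inv.
- move=> s sS; apply/eqP=> e; have := coxeter_involution cox sS; by rewrite e order1.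
- exact: (coxeter_generate cox).
- exact: ckR_pos.
- exact: ckR_root.
- by move=> v /=; rewrite phi1.
- by move=> ? ? v /=; rewrite phiM.
- by move=> s sS v /=; rewrite phiE // rbijE.
- by move=> ? ? /=; rewrite sgM odd_permM.
- by move=> s sS /=; rewrite sgE // odd_tperm.
by [].
Qed.

Lemma ioA_ckR : {in S &, forall s t, algRval (A s t) = AC s t}.
Proof.
move=> s t sS tS; rewrite /AC /coxeter_form /cartan; case: eqVneq => [<-|ne].
  (* On the diagonal the order is 1 and [1.-root (-1)] is -1, so the form has the value 1. *)
  rewrite cox_inv // order1 root1C (Creal_ReP (-1) _) ?opprK ?mulr1 ?rmorph_nat //.
  by rewrite rpredN real1.
by rewrite rmorphN rmorphMn /= -mulr_natl mulrN.
Qed.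

End Build.

(** * The Catalan product *)

Section CatalanProducts.
Local Open Scope ring_scope.

Definition catprod h (es : seq nat) : rat := \prod_(e <- es) ((e + h + 1)%N%:R / (e + 1)%N%:R).

Lemma prod_iota a k n : (0 < a + k)%N -> ((\prod_(e <- iota a n) (e + k)%N) * (a + k).-1`! = (a + k + n).-1`!)%N.
Proof.
elim: n a => [|n IH] a pos; first by rewrite big_nil mul1n addn0.
rewrite /= big_cons.
have -> : ((a + k) * (\prod_(j <- iota a.+1 n) (j + k)) * (a + k).-1`! = (\prod_(j <- iota a.+1 n) (j + k)) * (a.+1 + k).-1`!)%N.
  by rewrite addSn /= -[in RHS](prednK pos) factS (prednK pos); ring.
by rewrite IH // addSn addnS.
Qed.

Lemma catalan_fact n : (catalan n * (n.+1`! * n`!) = (n.*2)`!)%N.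
Proof.
have := catalan_bin n; have := @bin_fact n.*2 n; rewrite -addnn leq_addr addnK => /(_ isT) h.
by move=> e; rewrite factS -h -e; ring.
Qed.

Lemma catprodA n : catprod n.+1 (iota 1 n) = (catalan n.+1)%:R.
Proof.
rewrite /catprod big_split /= prodfV -!natr_prod.
have h1 := @prod_iota 1 1 n isT; have h2 := @prod_iota 1 n.+2 n isT; rewrite muln1 /= in h1.
have h3 := catalan_fact n.+1.
have e : (\prod_(e <- iota 1 n) (e + n.+1 + 1) = \prod_(e <- iota 1 n) (e + n.+2))%N.
  by apply: eq_bigr => i _; rewrite -addnA addn1.
apply: (mulIf (x := (\prod_(e <- iota 1 n) (e + 1))%N%:R)).
  by rewrite h1 pnatr_eq0 -lt0n fact_gt0.
rewrite mulfVK; last by rewrite h1 pnatr_eq0 -lt0n fact_gt0.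
rewrite e -natrM; congr (_%:R); rewrite h1.
apply/eqP; rewrite -(eqn_pmul2r (fact_gt0 n.+2)); move: h2; rewrite add1n /= => ->; apply/eqP.
rewrite mulnAC -mulnA h3; congr (_`!); rewrite -addnn; lia.
Qed.

(** For exponents 2 i + 1 and h = 2 m numerators and denominators are even; halving them leaves a
    quotient of factorials. *)
Lemma catprod_odd m : (0 < m)%N ->
  catprod (2 * m) [seq i.*2.+1 | i <- iota 0 m] = (m.+1 * catalan m)%:R.
Proof.
move=> m0; rewrite /catprod big_map.
rewrite (eq_bigr (fun i => (i + m.+1)%N%:R / (i + 1)%N%:R)); last first.
  move=> i _; have -> : (i.*2.+1 + 2 * m + 1 = 2 * (i + m.+1))%N by rewrite -addnn; lia.
  have -> : (i.*2.+1 + 1 = 2 * (i + 1))%N by rewrite -addnn; lia.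
  by rewrite !natrM -mulf_div divff ?mul1r // pnatr_eq0.
rewrite big_split /= prodfV -!natr_prod.
have h1 := @prod_iota 0 1 m isT; have h2 := @prod_iota 0 m.+1 m isT; rewrite muln1 /= in h1.
have h3 := catalan_fact m.
apply: (mulIf (x := (\prod_(e <- iota 0 m) (e + 1))%N%:R)).
  by rewrite h1 pnatr_eq0 -lt0n fact_gt0.
rewrite mulfVK; last by rewrite h1 pnatr_eq0 -lt0n fact_gt0.
rewrite -natrM; congr (_%:R); rewrite h1 add0n /=.
apply/eqP; rewrite -(eqn_pmul2r (fact_gt0 m)); move: h2; rewrite add0n /= => ->; apply/eqP.
rewrite addnn -h3 factS; ring.
Qed.

Lemma catprodD j : catprod (2 * j.+2) (j.+2 :: [seq i.*2.+1 | i <- iota 0 j.+2]) =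
  ((3 * j + 7) * catalan j.+2)%:R.
Proof.
have := @catprod_odd j.+2 isT; rewrite /catprod big_cons => ->.
have -> : (j.+2 + 2 * j.+2 + 1 = 3 * j + 7)%N by lia.
by rewrite addn1 !natrM mulrA divfK ?pnatr_eq0.
Qed.

Lemma catprodI m : (2 < m)%N -> catprod m [:: 1%N; m.-1] = (m + 2)%:R.
Proof.
case: m => // m m2; rewrite /catprod !big_cons big_nil mulr1 /=.
have -> : (1 + m.+1 + 1 = m.+1 + 2)%N by lia.
have -> : (m + m.+1 + 1 = 2 * m.+1)%N by lia.
by rewrite [(m + 1)%N]addn1 natrM mulfK ?pnatr_eq0 // divfK // pnatr_eq0.
Qed.

End CatalanProducts.

(** * Comparison with the given Coxeter number and exponents *)

Section Final.
Variables (gT : finGroupType) (S : {set gT}).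
Hypothesis cox : coxeter_system S.
Hypothesis irr : coxeter_irreducible S.
Variable X : coxrep S algR.
Hypothesis ckX : ck X = ckR.
Implicit Types (s t q v x y : gT) (a b P Q L T : seq gT) (es : seq nat).

Lemma irr_adj : {in S &, forall s t, connect (fun s t => [&& s \in S, t \in S & adj s t]) s t}.
Proof. by case: irr => _. Qed.

Lemma irr_pd u : supp S u -> (bil X u u <= 0)%R -> u = 0%R.
Proof.
apply: posdef => s t sS tS; have := irr_adj sS tS; apply: connect_sub => x y /and3P[xS yS a].
by apply: connect1; rewrite xS yS (adj_ncom X).
Qed.

Lemma ioX : {in S &, forall s t, algRval (cartan (ck X) s t) = AC s t}.
Proof. by rewrite ckX; apply: ioA_ckR. Qed.

Lemma ck2X m : 1 < m -> (algRval (ck X m) ^+ 2 = 2 + zeta m + (zeta m)^-1)%R.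
Proof. by rewrite ckX; apply: reR2_zeta. Qed.

Lemma coxword_seq b c : coxeter_word S b c -> [/\ uniq b, ltr b = S & wprod b = c].
Proof.
case=> [[[_ bc] _] pb]; split=> //; first by rewrite (perm_uniq pb) enum_uniq.
by apply/setP=> y; rewrite inE (perm_mem pb) mem_enum.
Qed.

(** The given a is any reduced word of c. A reduced word b of c that permutes S has the same length,
    and its letters occur in a because c lies in the subgroup generated by the letters of a. *)
Lemma red_coxword a c : coxeter_element S c -> reduced_word S a c -> uniq a /\ ltr a = S.
Proof.
case=> b cb ra; have [ub eb bc] := coxword_seq cb; have [rb _] := cb.
have [rda ac] := (reduced_wordP X a c).1 ra; have [rdb _] := (reduced_wordP X b c).1 rb.
have aS : all [in S] a by apply: red_all rda.
have sz : size a = size b by rewrite (red_size rda) (red_size rdb) ac bc.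
have sub : {subset b <= a}.
  move=> y yb; have : wprod b \in <<ltr a>>.
    by rewrite bc -ac; apply/(gen_word _ (ltr_sub aS)); exists a => //; apply/allP=> z; rewrite inE.
  move/(red_gen (ltr_sub aS) rdb)/allP/(_ _ yb); by rewrite inE.
split; first by apply: (leq_size_uniq ub sub); rewrite sz.
apply/setP=> y; rewrite inE; apply/idP/idP=> [/(allP aS)//|yS]; apply: sub.
by move: yS; rewrite -eb inE.
Qed.

(** h and e come from Coxeter elements chosen independently of c, but [cdata] holds for every
    Coxeter word, so order and characteristic polynomial are the same. Unique factorisation then
    makes e a rearrangement of es. *)
Lemma catalan_finish (n h h0 N : nat) (e : 'I_n -> nat) es c a :
  is_coxeter_number S h -> is_exponents S h e -> coxeter_element S c -> reduced_word S a c ->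
  0 < h0 -> cdata S h0 es -> Nval X S N -> (catprod h0 es = N%:R)%R ->
  (#|sortable_set S a|%:R = W_catalan h e :> rat)%R.
Proof.
move=> [c1 [b1 cb1] oc1] [elt [c2 [b2 [cb2 ch]]]] cc ra h00 cd nv pr.
have [ua ea] := red_coxword cc ra; rewrite (sortable_count ua ea nv) -pr.
have S0 : S != set0 by case: irr.
have eh : h = h0.
  have [u1 e1 w1] := coxword_seq cb1.
  by rewrite -oc1 -w1 (cdata_ordh ioX zeta_prim (subxx S) S0 h00 cd u1 e1).
have [chE _ lt] := cd; have [u2 e2 _] := coxword_seq cb2.
have /(_ _ u2 e2) {}chE := chE.
(* The two products of reflection matrices agree by conversion. *)
have chE' : char_poly (geometric_mx S b2) = (\prod_(e <- es) ('X - (zeta h0 ^+ e)%:P))%R := chE.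
move: elt ch; rewrite eh chE' => elt ch.
have pm : perm_eq [seq (zeta h0 ^+ i)%R | i <- es] [seq (zeta h0 ^+ e i)%R | i <- index_enum 'I_n].
  by apply: prod_XsubC_eq; rewrite !big_map ch.
(* Reads the factor of an exponent off its eigenvalue, so that the permutation of eigenvalues
   transfers to the Catalan product. *)
pose G (y : algC) : rat := let i := index y [seq (zeta h0 ^+ i)%R | i <- iota 0 h0] in
  ((i + h0 + 1)%N%:R / (i + 1)%N%:R)%R.
have GE i : i < h0 -> G (zeta h0 ^+ i)%R = ((i + h0 + 1)%N%:R / (i + 1)%N%:R)%R.
  move=> il; rewrite /G; have -> // : index (zeta h0 ^+ i)%R [seq (zeta h0 ^+ i)%R | i <- iota 0 h0] = i.
  have zi : (zeta h0 ^+ i)%R = nth 0%R [seq (zeta h0 ^+ i)%R | i <- iota 0 h0] i.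
    by rewrite (nth_map 0) ?size_iota // nth_iota.
  rewrite {1}zi index_uniq ?size_map ?size_iota //.
  rewrite map_inj_in_uniq ?iota_uniq // => j k; rewrite !mem_iota !add0n => jl kl /eqP.
  by rewrite (eq_prim_root_expr (zeta_prim h00)) !modn_small // => /eqP.
have E : (\prod_(y <- [seq (zeta h0 ^+ i)%R | i <- es]) G y =
    \prod_(y <- [seq (zeta h0 ^+ e i)%R | i <- index_enum 'I_n]) G y)%R by apply: perm_big.
rewrite !big_map in E.
rewrite /catprod /W_catalan (eq_big_seq (fun i => G (zeta h0 ^+ i)%R)); last first.
  by move=> i /(allP lt) il; rewrite GE.
by rewrite E; apply: eq_bigr => i _; rewrite GE.
Qed.

Let pd := irr_pd.
Let cdA := cdataA ioX zeta_prim.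

Lemma ltr_neq0 Q : Q != [::] -> ltr Q != set0.
Proof. by case: Q => // q Q _; apply/set0Pn; exists q; rewrite inE mem_head. Qed.

Lemma oA : ordA S.
Proof.
move=> P PS cP P0; apply: (cdata_ordh ioX zeta_prim (ltr_sub PS) (ltr_neq0 P0) _ (cdA PS cP P0)) => //.
Qed.

Lemma oB N : ordL S 4 N (fun k => 2 * k.+1)%N.
Proof.
move=> q P QS tL _; apply: (cdata_ordh ioX zeta_prim (ltr_sub QS) (ltr_neq0 (isT : q :: P != [::])) _ (cdataB ioX zeta_prim QS tL)) => //.
Qed.

Lemma oI m : 2 < m -> ordL S m 1 (fun=> m).
Proof.
move=> m2 q P QS tL sP; have [_ P0 _] := and3P tL; case: P P0 sP QS tL => // v [|//] _ _ QS tL.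
apply: (cdata_ordh ioX zeta_prim (ltr_sub QS) (ltr_neq0 (isT : [:: q; v] != [::])) _ (cdataI ioX zeta_prim ck2X m2 QS tL)).
exact: ltnW (ltnW m2).
Qed.

(** At sizes 1, 2 and 3 of P these are the Coxeter numbers of I_2(5), H_3 and H_4. *)
Lemma oH : ordL S 5 3 (nth 0 [:: 0; 5; 10; 30]).
Proof.
move=> q P QS tL; have nz := ltr_neq0 (isT : q :: P != [::]); have QS' := ltr_sub QS.
case: P QS tL nz QS' => [|v [|t [|r [|]]]] // QS tL nz QS' _.
- exact: (cdata_ordh ioX zeta_prim QS' nz _ (cdataI ioX zeta_prim ck2X _ QS tL)).
- exact: (cdata_ordh ioX zeta_prim QS' nz _ (cdataH3 ioX zeta_prim zeta_exp ck2X QS tL _)).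
- exact: (cdata_ordh ioX zeta_prim QS' nz _ (cdataH4 ioX zeta_prim zeta_exp ck2X QS tL _)).
Qed.

(* Row 1 of these tables is D_(j+3); row 2 is A_5, D_5, E_6, E_7, E_8. *)
Definition domT i j := (i <= 1) || ((i <= 2) && (j <= 4)).
Definition hvT i j := if i == 1%N then (2 * j.+2)%N else nth 0 [:: 0; 8; 12; 18; 30] j.
Definition tvT i j := match i with
  | 0 => catalan j.+3 | 1 => ((3 * j + 7) * catalan j.+2)%N
  | 2 => nth 0 [:: 42; 182; 833; 416 * 10; 2508 * 10]%N j | _ => catalan i.+3 end.

Lemma domT_down i j i' j' : i' <= i -> j' <= j -> domT i j -> domT i' j'.
Proof. rewrite /domT; lia. Qed.

Lemma typT_sym v x L T : all [in S] (x :: rev L ++ v :: T) -> typT v x L T -> typT v x T L.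
Proof.
move=> /andP[_ PS] /and3P[cP l c]; rewrite /typT l -ctr_rev (chain_rev X) // cP.
by move: c; rewrite !all_cat andbC.
Qed.

Lemma oT : ordT S domT hvT.
Proof.
move=> v x L T QS u tT L0 T0 d; have QS' := ltr_sub QS.
have nz : ltr (x :: rev L ++ v :: T) != set0 by apply: ltr_neq0.
have [sL|sL] := eqVneq (size L) 1%N.
  rewrite sL /hvT /=; apply: (cdata_ordh ioX zeta_prim QS' nz _ (cdataD ioX zeta_prim QS u tT sL)) => //.
have {sL}sL : size L = 2.
  by move: d sL L0; rewrite /domT -size_eq0; case: (size L) => [|[|[|]]].
have sT : 0 < size T <= 4 by move: d T0; rewrite sL /domT /= lt0n size_eq0 => -> ->.
rewrite sL /hvT /=; case/andP: sT; case eT: (size T) => [|[|[|[|[|]]]]] // _ _.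
(* Arms of lengths 2 and 1 form D_5 with the roles of L and T exchanged. *)
- have pm : perm_eq (x :: rev L ++ v :: T) (x :: rev T ++ v :: L).
    by apply/seq.permP=> z; rewrite /= !count_cat !count_rev /=; clear; lia.
  rewrite (ltr_perm pm) in nz QS' *; have u' : uniq (x :: rev T ++ v :: L) by rewrite -(perm_uniq pm).
  have QS2 : all [in S] (x :: rev T ++ v :: L) by rewrite -(perm_all _ pm).
  have := cdataD ioX zeta_prim QS2 u' (typT_sym QS tT) eT; rewrite sL => cd.
  exact: (cdata_ordh ioX zeta_prim QS' nz _ cd).
- exact: (cdata_ordh ioX zeta_prim QS' nz _ (cdataE6 ioX zeta_prim zeta_exp QS u tT sL eT)).
- exact: (cdata_ordh ioX zeta_prim QS' nz _ (cdataE7 ioX zeta_prim QS u tT sL eT)).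
- exact: (cdata_ordh ioX zeta_prim QS' nz _ (cdataE8 ioX zeta_prim QS u tT sL eT)).
Qed.

Lemma catE : (catalan 1 = 1%N) * (catalan 2 = 2) * (catalan 3 = 5) * (catalan 4 = 14) *
  (catalan 5 = 42) * (catalan 6 = 132) * (catalan 7 = 429) * (catalan 8 = 1430).
Proof.
have c1 : catalan 1 = 1%N by []; have := catalanS 1; have := catalanS 2; have := catalanS 3.
have := catalanS 4; have := catalanS 5; have := catalanS 6; have := catalanS 7; rewrite c1.
move: (catalan 2) (catalan 3) (catalan 4) (catalan 5) (catalan 6) (catalan 7) (catalan 8) => a b c d e f g *.
have ea : a = 2 by lia. have eb : b = 5 by lia. have ec : c = 14 by lia. have ed : d = 42 by lia.
have ee : e = 132 by lia. have ef : f = 429 by lia. have eg : g = 1430 by lia.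
by rewrite ea eb ec ed ee ef eg.
Qed.

Lemma NvalT v x L T : all [in S] (x :: rev L ++ v :: T) -> uniq (x :: rev L ++ v :: T) ->
  typT v x L T -> domT (size L) (size T) ->
  Nval X (ltr (x :: rev L ++ v :: T)) (tvT (size L) (size T)).
Proof.
apply: (Nval_T pd oA oT domT_down); [by case=> [|[|[|i]]] | by [] |].
case=> [|[|i]] j; rewrite /domT //; last first.
  by case: j => [|[|[|[|]]]] // _; rewrite !big_ord_recr !big_ord0 /tvT /hvT /= !subSS ?subn0 !catE; lia.
(* The row of type D: h + 2 cancels against twice the rank, leaving [catalanD]. *)
move=> _; rewrite big_ord1 subn0 add0n.
have -> : (hvT 1 j.+1 + 2 = 2 * j.+4)%N by rewrite /hvT /=; lia.
congr (_ * _)%N; apply: etrans (catalanD j.+1) _; rewrite !catE muln1 mulnA.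
by congr (_ + _ + _ + _)%N.
Qed.

Theorem finite_type : exists h0 es N, [/\ 0 < h0, cdata S h0 es, Nval X S N & (catprod h0 es = N%:R)%R].
Proof.
have [S0 _] := irr; have inS Q : ltr Q = S -> all [in S] Q by move=> eQ; apply/allP=> y; rewrite -eQ inE.
have comp h es (N : nat) : (\prod_(e <- es) (e + h + 1) = N * \prod_(e <- es) (e + 1))%N ->
    (catprod h es = N%:R)%R.
  move=> e; rewrite /catprod big_split /= prodfV -!natr_prod e natrM mulfK // pnatr_eq0 -lt0n.
  by apply: prodn_gt0 => i; rewrite addn1.
have key Q : ltr Q = S -> (exists h0 es N, [/\ 0 < h0, cdata (ltr Q) h0 es, Nval X (ltr Q) N &
    (catprod h0 es = N%:R)%R]) -> exists h0 es N, [/\ 0 < h0, cdata S h0 es, Nval X S N & (catprod h0 es = N%:R)%R].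
  by move=> ->.
have [[P [cP u eP]]|[m [q [P [tL u eP hm]]]]|[v [x [L [T [tT u eP LT hLT]]]]]|[r [v [q [q' [tF u eP]]]]]] :=
  classify pd S0 irr_adj; have QS := inS _ eP; apply: (key _ eP).
- have P0 : P != [::] by apply: contraNneq S0 => e; rewrite -eP e ltr_nil.
  exists (size P).+1, (iota 1 (size P)), (catalan (size P).+1); split=> //.
  + exact: cdA.
  + exact: (Nval_chain pd oA).
  + exact: catprodA.
- have P0 : P != [::] by case/and3P: tL.
  case: hm => [em|[[em sP]|[m5 sP]]].
  + rewrite em in tL; exists (2 * (size P).+1)%N, [seq i.*2.+1 | i <- iota 0 (size P).+1],
      ((size P).+2 * catalan (size P).+1)%N; split=> //.
    * exact: (cdataB ioX zeta_prim).
    * apply: (@Nval_L _ _ _ _ pd 4 (size P) (fun k => 2 * k.+1)%N (fun k => k.+2 * catalan k.+1)%N q P oA (oB (N := size P))) => //.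
      by move=> k _; apply: catalanB.
    * exact: catprod_odd.
  + rewrite em in tL.
    (* The values of A_1, I_2(5), H_3 and H_4. *)
    have nv : Nval X (ltr (q :: P)) (nth 0 [:: 2; 7; 32; 280] (size P)).
      apply: (@Nval_L _ _ _ _ pd 5 3 _ (nth 0 [:: 2; 7; 32; 280]) q P oA oH) => //.
      by case=> [|[|[|[|k]]]] // _; rewrite !big_ord_recr !big_ord0.
    case: P P0 sP tL QS nv {u eP} => [|v [|t [|w [|]]]] // _ _ tL QS nv.
    * exists 5, [:: 1%N; 4], 7; split; [by []| |exact: nv|by apply: comp; rewrite !big_cons !big_nil; lia].
      exact: (cdataI ioX zeta_prim ck2X _ QS tL).
    * exists 10, [:: 1%N; 5; 9], 32; split; [by []| |exact: nv|by apply: comp; rewrite !big_cons !big_nil; lia].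
      exact: (cdataH3 ioX zeta_prim zeta_exp ck2X QS tL).
    * exists 30, [:: 1%N; 11; 19; 29], 280; split; [by []| |exact: nv|by apply: comp; rewrite !big_cons !big_nil; lia].
      exact: (cdataH4 ioX zeta_prim zeta_exp ck2X QS tL).
  have m2 : 2 < m by apply: leq_trans m5.
  case: P P0 sP tL QS {u eP} => [|v [|]] // _ _ tL QS.
  exists m, [:: 1%N; m.-1], (m + 2)%N; split=> //; first exact: leq_trans m2.
  + exact: (cdataI ioX zeta_prim ck2X m2 QS tL).
  + apply: (@Nval_L _ _ _ _ pd m 1 (fun=> m) (fun k => if k is 0 then 2 else m + 2)%N q [:: v] oA (oI m2)) => //.
    by case=> [|[|k]] // _; rewrite big_ord1 /= subn0 !catE; lia.
  + exact: catprodI.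
- have d : domT (size L) (size T) by rewrite /domT; case: hLT => [->|[-> ->]].
  have nv := NvalT QS u tT d; case: hLT => [sL|[sL sT]].
    rewrite sL /= in nv; exists (2 * (size T).+2)%N, ((size T).+2 :: [seq i.*2.+1 | i <- iota 0 (size T).+2]),
      ((3 * size T + 7) * catalan (size T).+2)%N; split=> //.
    + exact: (cdataD ioX zeta_prim).
    + exact: catprodD.
  have sT2 : 1 < size T by rewrite sL in LT.
  move: sT sT2 nv; case eT: (size T) => [|[|[|[|[|]]]]] // _ _; rewrite sL /= => nv.
  + exists 12, [:: 1%N; 4; 5; 7; 8; 11], 833; split; [by []| |exact: nv|by apply: comp; rewrite !big_cons !big_nil; lia].
    exact: (cdataE6 ioX zeta_prim zeta_exp QS u tT sL eT).
  + exists 18, [:: 1%N; 5; 7; 9; 11; 13; 17], (416 * 10)%N; split; [by []| |exact: nv|by apply: comp; rewrite !big_cons !big_nil; lia].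
    exact: (cdataE7 ioX zeta_prim QS u tT sL eT).
  + exists 30, [:: 1%N; 7; 11; 13; 17; 19; 23; 29], (2508 * 10)%N; split; [by []| |exact: nv|by apply: comp; rewrite !big_cons !big_nil; lia].
    exact: (cdataE8 ioX zeta_prim QS u tT sL eT).
- exists 12, [:: 1%N; 5; 7; 11], 105; split; first by [].
  + exact: (cdataF ioX zeta_prim QS u tF).
  + apply: (Nval_F pd oA (oB (N := 2)) (erefl 12)) => //.
    exact: (cdata_ordh ioX zeta_prim (ltr_sub QS) (ltr_neq0 (isT : [:: r; v; q; q'] != [::])) _ (cdataF ioX zeta_prim QS u tF)).
  + by apply: comp; rewrite !big_cons !big_nil; lia.
Qed.

End Final.

Theorem theorem9p1 (gT : finGroupType) (S : {set gT}) (n h : nat)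
    (e : 'I_n -> nat) (c : gT) (a : seq gT)
    (W_cox : coxeter_system S)
    (W_irr : coxeter_irreducible S)
    (rank_n : #|S| = n)
    (h_cox : is_coxeter_number S h)
    (e_exp : is_exponents S h e)
    (c_cox : coxeter_element S c)
    (a_red : reduced_word S a c) :
  (#|sortable_set S a|%:R = W_catalan h e :> rat)%R.
Proof.
have [X ckX] := coxrep_exists W_cox.
have [h0 [es [N [h00 cd nv pr]]]] := finite_type W_cox W_irr ckX.
exact: (catalan_finish W_cox W_irr ckX h_cox e_exp c_cox a_red h00 cd nv pr).
Qed.
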